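(* Let $m\in\mathbb{N}$ have prime factorization $m=p_1^{r_1}p_2^{r_2}\cdots p_k^{r_k}$ where $p_1=2$ and $r_1\neq 1$ (so $r_1=0$ or $r_1\ge 2$), and $p_2,\dots,p_k$ are distinct odd primes. Let $K_1=\mathbb{Q}(\zeta_{2^{r_1}})$, and for each $2\le i\le k$ let $K_i$ be either $\mathbb{Q}(\zeta_{p_i^{r_i}})$ or $\mathbb{Q}(\zeta_{p_i^{r_i}})^+$. Let $K$ be the compositum of $K_1,\dots,K_k$. Then $K$ is a Leopoldt field: for every finite extension $L/K$ with $L/\mathbb{Q}$ abelian, $\mathcal{O}_L$ is a free $\mathcal{A}_{L/K}$-module.
   Context: $\zeta_n$ denotes a primitive $n$-th root of unity, $\mathbb{Q}(\zeta_n)$ the $n$-th cyclotomic field and $\mathbb{Q}(\zeta_n)^+$ its maximal real subfield. For a finite Galois extension of number fields $L/K$ with group $G$, the associated order is $\mathcal{A}_{L/K}=\{x\in K[G] : x(\mathcal{O}_L)\subseteq \mathcal{O}_L\}$. An abelian number field $K$ is called Leopoldt if every finite extension $L/K$ with $L/\mathbb{Q}$ abelian has $\mathcal{O}_L$ free over $\mathcal{A}_{L/K}$. *)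

(* Defs.v *)
From HB Require Import structures.
From mathcomp Require Import all_boot all_order all_fingroup all_algebra all_field.
From mathcomp Require Import boolp.

Set Implicit Arguments.
Unset Strict Implicit.
Unset Printing Implicit Defensive.

Import GRing.Theory.
Local Open Scope ring_scope.

(* A number field is a splittingFieldType rat (a finite normal extension of   *)
(* the rationals) or one of its subfields; the base field is 1%VS.            *)

Section RingOfIntegers.
Variable L : fieldExtType rat.

Definition algint_pred : {pred L} :=
  fun a => `[< integralOver (intr : int -> L) a >].

Lemma algint_subring : subring_closed algint_pred.
Proof.
split=> [|a b|a b].
- exact/asboolP/integral1.
- by move=> /asboolP inta /asboolP intb; apply/asboolP/integral_sub.
- by move=> /asboolP inta /asboolP intb; apply/asboolP/integral_mul.
Qed.

HB.instance Definition _ := GRing.isSubringClosed.Build L algint_pred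
  algint_subring.

(* The ring of integers of L does not depend on K; the phantom parameter lets *)
(* its module structure over the associated order of L / K be inferred.       *)
Definition ringint (K : {subfield L}) := {a : L | algint_pred a}.
HB.instance Definition _ K := SubChoice.on (ringint K).
HB.instance Definition _ K := [SubChoice_isSubZmodule of ringint K by <:].

End RingOfIntegers.

Section GroupAlgebra.
Variables (L : splittingFieldType rat) (K : {subfield L}).

Definition galois_galg := {ffun [subg 'Gal({:L} / K)] -> subvs_of K}.

HB.instance Definition _ := GRing.Zmodule.on galois_galg.

Implicit Types x y z : galois_galg.

Definition galg_one : galois_galg := [ffun g => (g == 1%g)%:R].

(* In MathComp the product of Galois automorphisms is composition in          *)
(* diagrammatic order, (s * t) a = t (s a). The product of K[G] uses the      *)
(* usual order, s after t, which is (t * s)%g; hence the position of g / h.   *)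
Definition galg_mul x y : galois_galg :=
  [ffun g => \sum_h x h * y (g * h^-1)%g].

Definition galg_act x (a : L) : L := \sum_g vsval (x g) * sgval g a.

Fact galg_mulA : associative galg_mul.
Proof.
move=> x y z; apply/ffunP=> g; rewrite !ffunE.
under eq_bigr => h _ do rewrite ffunE mulr_sumr.
under [RHS]eq_bigr => h _ do rewrite ffunE mulr_suml.
rewrite [RHS]exchange_big /=; apply: eq_bigr => h _.
rewrite [RHS](reindex_inj (mulIg h)) /=; apply: eq_bigr => k _.
by rewrite mulgK invMg mulgA mulrA.
Qed.

Fact galg_mul1 : left_id galg_one galg_mul.
Proof.
move=> x; apply/ffunP=> g; rewrite ffunE (bigD1 1%g) //= ffunE eqxx mul1r.
rewrite invg1 mulg1 big1 ?addr0 // => h /negPf h1.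
by rewrite ffunE h1 mul0r.
Qed.

Fact galg_mulr1 : right_id galg_one galg_mul.
Proof.
move=> x; apply/ffunP=> g; rewrite ffunE (bigD1 g) //= ffunE mulgV eqxx mulr1.
rewrite big1 ?addr0 // => h /negPf hg.
by rewrite ffunE -eq_mulgV1 eq_sym hg mulr0.
Qed.

Fact galg_mulDl : left_distributive galg_mul +%R.
Proof.
move=> x y z; apply/ffunP=> g; rewrite !ffunE -big_split /=.
by apply: eq_bigr => h _; rewrite ffunE mulrDl.
Qed.

Fact galg_mulDr : right_distributive galg_mul +%R.
Proof.
move=> x y z; apply/ffunP=> g; rewrite !ffunE -big_split /=.
by apply: eq_bigr => h _; rewrite ffunE mulrDr.
Qed.

Fact galg_one_neq0 : galg_one != 0.
Proof.
apply/eqP => /ffunP/(_ 1%g); rewrite !ffunE eqxx; exact/eqP/oner_neq0.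
Qed.

HB.instance Definition _ := GRing.Zmodule_isNzRing.Build galois_galg
  galg_mulA galg_mul1 galg_mulr1 galg_mulDl galg_mulDr galg_one_neq0.

Lemma galg_act1 a : galg_act 1 a = a.
Proof.
rewrite /galg_act (bigD1 1%g) //= ffunE eqxx rmorph1 mul1r gal_id.
rewrite big1 ?addr0 // => h /negPf h1.
by rewrite ffunE h1 raddf0 mul0r.
Qed.

Lemma galg_actDl x y a : galg_act (x + y) a = galg_act x a + galg_act y a.
Proof.
rewrite /galg_act -big_split /=; apply: eq_bigr => g _.
by rewrite ffunE raddfD mulrDl.
Qed.

Lemma galg_actNl x a : galg_act (- x) a = - galg_act x a.
Proof.
rewrite /galg_act -sumrN /=; apply: eq_bigr => g _.
by rewrite ffunE raddfN mulNr.
Qed.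

Lemma galg_actDr x a b : galg_act x (a + b) = galg_act x a + galg_act x b.
Proof.
rewrite /galg_act -big_split /=; apply: eq_bigr => g _.
by rewrite raddfD mulrDr.
Qed.

Lemma galg_actM x y a : galg_act (x * y) a = galg_act x (galg_act y a).
Proof.
rewrite -[x * y]/(galg_mul x y) /galg_act.
under [RHS]eq_bigr => h _ do rewrite raddf_sum mulr_sumr.
under [LHS]eq_bigr => g _ do rewrite ffunE raddf_sum mulr_suml.
rewrite exchange_big /=; apply: eq_bigr => h _.
rewrite (reindex_inj (mulIg h)) /=; apply: eq_bigr => k _.
rewrite mulgK galM ?memvf // rmorphM /=.
by rewrite (fixed_gal (subvf K) (subgP h) (subvsP (y k))) mulrA.
Qed.

Definition assoc_order_pred : {pred galois_galg} :=
  fun x => `[< forall a : L, a \in @algint_pred L ->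
                 galg_act x a \in @algint_pred L >].

Lemma assoc_order_subring : subring_closed assoc_order_pred.
Proof.
split=> [|x y|x y].
- by apply/asboolP => a; rewrite galg_act1.
- move=> /asboolP Ax /asboolP Ay; apply/asboolP => a inta.
  by rewrite galg_actDl galg_actNl rpredB ?Ax ?Ay.
- move=> /asboolP Ax /asboolP Ay; apply/asboolP => a inta.
  by rewrite galg_actM Ax ?Ay.
Qed.

HB.instance Definition _ := GRing.isSubringClosed.Build galois_galg
  assoc_order_pred assoc_order_subring.

Definition assoc_order := {x : galois_galg | assoc_order_pred x}.
HB.instance Definition _ := SubChoice.on assoc_order.
HB.instance Definition _ :=
  [SubChoice_isSubNzRing of assoc_order by <:].

Fact ringint_scale_subproof (x : assoc_order) (a : ringint K) :
  algint_pred (galg_act (val x) (val a)).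
Proof. by case: x => x /= /asboolP Ax; apply: Ax; apply: (valP a). Qed.

Definition ringint_scale (x : assoc_order) (a : ringint K) : ringint K :=
  Sub (galg_act (val x) (val a)) (ringint_scale_subproof x a).

Fact ringint_scaleA (x y : assoc_order) (a : ringint K) :
  ringint_scale x (ringint_scale y a) = ringint_scale (x * y) a.
Proof. by apply: val_inj; rewrite /= galg_actM. Qed.

Fact ringint_scale1 : left_id 1 ringint_scale.
Proof. by move=> a; apply: val_inj; rewrite /= galg_act1. Qed.

Fact ringint_scaleDr : right_distributive ringint_scale +%R.
Proof. by move=> x a b; apply: val_inj; rewrite /= galg_actDr. Qed.

Fact ringint_scaleDl (a : ringint K) : {morph ringint_scale^~ a : x y / x + y}.
Proof. by move=> x y; apply: val_inj; rewrite /= galg_actDl. Qed.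

HB.instance Definition _ := GRing.Zmodule_isLmodule.Build assoc_order (ringint K)
  ringint_scaleA ringint_scale1 ringint_scaleDr ringint_scaleDl.

End GroupAlgebra.

Definition free_module (R : nzRingType) (M : lmodType R) : Prop :=
  exists (n : nat) (b : 'I_n -> M),
    forall v : M, exists! c : {ffun 'I_n -> R}, v = \sum_i c i *: b i.

Definition ringint_is_free (L : splittingFieldType rat) (K : {subfield L}) :
  Prop := free_module (ringint K).

Definition abelian_number_field (E : splittingFieldType rat)
    (K : {subfield E}) : Prop :=
  galois 1 K /\ abelian 'Gal(K / 1).

(* Extensions of K are arbitrary embeddings of the abstract field K into a    *)
(* field L, not only those inside the ambient field E.                        *)
Definition Leopoldt (E : splittingFieldType rat) (K : {subfield E}) : Prop :=
  abelian_number_field K /\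
  forall (L : splittingFieldType rat) (f : 'AHom(subvs_of K, L)),
    abelian_number_field {:L}%AS ->
    ringint_is_free (aimg_aspace f {: subvs_of K}%AS).

Definition is_cyclotomic_field (E : fieldExtType rat) (n : nat)
    (F : {subfield E}) : Prop :=
  exists2 z : E, n.-primitive_root z & F = <<1; z>>%AS.

Section RealSubfields.
Variables (E : fieldExtType rat) (iota : {rmorphism E -> algC}).

Definition real_subfield (F : {subfield E}) : Prop :=
  forall a : E, a \in F -> iota a \is Num.real.

Definition is_max_real_subfield (C F : {subfield E}) : Prop :=
  [/\ (F <= C)%VS, real_subfield F &
      forall F' : {subfield E},
        (F' <= C)%VS -> real_subfield F' -> (F' <= F)%VS].

Definition is_real_cyclotomic_field (n : nat) (F : {subfield E}) : Prop :=
  exists2 C : {subfield E}, is_cyclotomic_field n C & is_max_real_subfield C F.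

End RealSubfields.

Definition compositum (E : fieldExtType rat) (I : finType)
    (K_ : I -> {subfield E}) : {subfield E} :=
  <<\sum_i K_ i>>%AS.

(* Main.v *)
(* Embed the abelian field L into the algebraic numbers.  By the Kronecker-Weber
   theorem it lies in Q(zeta_n); take n minimal among the n such that Q(zeta_n)
   contains L and K.  Kronecker-Weber itself is proved by induction on the degree:
   Lagrange resolvents reduce it to Kummer extensions of prime degree l, Kummer
   characters of tame inertia groups are divided out until only primes with trivial
   inertia remain, and a Stickelberger element then writes a power of the radicand
   as a product of Gauss sums times a number which is a unit everywhere and of
   absolute value 1, hence a root of unity.

   On Z[zeta_n] = (x)_p Z[zeta_(p^a)] the generator is a tensor product of local
   ones.  In the p-part the powers of zeta fall into classes according to their
   conductor, and the averaging operators projecting onto these classes preserve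
   the lattice and commute with the Galois action, so that the sum of one monomial
   per class generates; when K contains only the real subfield at p, the same
   argument is run over Z[zeta + zeta^-1].  Since n is minimal, every
   element of Gal(Q(zeta_n)/L) fixing zeta_(n0), n0 the odd radical of n, is trivial
   or an involution acting on the 2-part only; in the second case one works in its
   fixed ring.  The rest of that Galois group acts faithfully on Q(zeta_(n0)),
   which yields an integer theta with trace 1 to L; multiplication by theta followed
   by the trace carries the generator for Q(zeta_n) to one for O_L.  The associated
   order is free of rank one on a generator because K[G] acts faithfully on L. *)
From HB Require Import structures.
Require Import Defs.
From mathcomp Require Import all_boot all_order all_fingroup all_algebra all_field.
From mathcomp Require Import boolp.
From mathcomp Require classical_sets.
From mathcomp Require Import cyclic commutator zify ring lra.

Set Implicit Arguments.
Unset Strict Implicit.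
Unset Printing Implicit Defensive.

Import Order.TTheory GRing.Theory Num.Theory.
Local Open Scope ring_scope.

(** What shapes every generator is that the operators have to come from K[G]. Averaging over xi ->
    xi^(1 + p^s u) is trivial on Q(zeta_(p^r)) only if s >= r, and the weights that isolate the
    exponents near c lie in that field only if s + v_p(c) >= a - r; these are the two terms of
    [cexp]. Over the real subfield the weights must in addition be symmetric, so classes are met in
    pairs c, -c, and the class of 0 needs a generator of its own. The descent is delicate at 2. If
    r_1 >= 2, which is where r_1 <> 1 enters, every automorphism over K is 1 modulo 4 on the 2-part,
    and this rules the exceptional involution out; if r_1 = 0, K imposes no condition at 2, and the
    fixed ring can be treated like the full one. The odd radical is used for the trace because the
    primitive roots of unity of squarefree order sum to a sign. Fields are represented inside [algC]
    by the automorphisms fixing a generator, and elements of K[G] by maps on [algC], so that no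
    tower of field types occurs before the last part. *)

Notation Aut := {rmorphism algC -> algC}.
Notation pZC := (map_poly (intr : int -> algC)).
Notation pQC := (map_poly (ratr : rat -> algC)).

(** * Number fields inside the algebraic numbers *)

Lemma normal_number_field (s : seq algC) :
  exists (L : splittingFieldType rat) (iota : {rmorphism L -> algC})
    (t : seq L), map iota t = s.
Proof.
have Qroots (x : algC) : exists p : {poly rat}, pQC p = minCpoly x.
  by have [p [-> _] _] := minCpolyP x; exists p.
pose pq x := projT1 (cid (Qroots x)).
have Epq x : pQC (pq x) = minCpoly x by rewrite /pq; case: cid.
pose P := \prod_(x <- s) pq x.
have P0 : pQC P != 0.
  rewrite rmorph_prod prodf_seq_neq0; apply/allP=> x _.
  by rewrite /= Epq minCpoly_eq0.
have [rs Drs] := closed_field_poly_normal (pQC P).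
have [L [iota [rs1 Ers1 genL]]] := num_field_exists rs.
have mapCP : map_poly iota (map_poly (in_alg L) P) = pQC P.
  rewrite -map_poly_comp; apply: eq_map_poly => a /=.
  by rewrite rmorphZ_num rmorph1 mulr1.
have axL : SplittingField.axiom L.
  exists (map_poly (in_alg L) P); first exact: alg_polyOver.
  exists rs1 => //.
  rewrite -(eqp_map iota) mapCP map_prod_XsubC.
  rewrite -(big_map iota predT (fun z => 'X - z%:P)) Ers1 {1}Drs.
  by rewrite eqp_scale // lead_coef_eq0.
have inrs x : x \in s -> exists y, iota y = x.
  move=> xs; have : root (pQC P) x.
    by rewrite /P rmorph_prod /= (big_rem x) //= rootM Epq root_minCpoly.
  rewrite Drs rootZ ?lead_coef_eq0 // root_prod_XsubC -Ers1.
  by case/mapP=> y _ ->; exists y.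
have [t Et] : exists t, map iota t = s.
  elim: s inrs {P P0 Drs mapCP axL} => [|x s IH] inrs; first by exists [::].
  have [t <-] := IH (fun y ys => inrs y (mem_behead (s := x :: s) ys)).
  by have [y <-] := inrs x (mem_head x s); exists (y :: t).
exists (HB.pack_for (splittingFieldType rat) L
  (FieldExt_isSplittingField.Build rat L axL)), iota.
by exists t.
Qed.

Lemma separable_number_field (L : fieldExtType rat) (K E : {subfield L}) :
  separable K E.
Proof.
apply/separableP => x _; apply: pcharf0_separable.
exact: ftrans (pchar_lalg L) (pchar_num _).
Qed.

(** L is generated by one element u, so evaluation at an algebraic number c that is a root of the
    minimal polynomial of u is an embedding: polynomials with equal value at u differ by a multiple
    of that polynomial, hence agree at c. *)
Lemma number_field_embedding (L : fieldExtType rat) :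
  exists iota : {rmorphism L -> algC}, True.
Proof.
pose u := separable_generator 1 {:L}.
have genu : <<1; u>>%VS = fullv.
  by rewrite -eq_adjoin_separable_generator ?sub1v ?separable_number_field.
pose inL := in_alg L.
have /polyOver1P[q Dq] := minPolyOver 1 u.
have q0 : size q != 1.
  by rewrite -(size_map_poly inL) -Dq size_minPoly.
have [c qc] : exists c, root (pQC q) c.
  by apply/closed_rootP; rewrite size_map_poly.
have evalL x : exists f : {poly rat}, x = (map_poly inL f).[u].
  have /Fadjoin1_polyP[f ->] : x \in <<1; u>>%VS by rewrite genu memvf.
  by exists f.
pose pol x := projT1 (cid (evalL x)).
have polE x : (map_poly inL (pol x)).[u] = x by rewrite /pol; case: cid.
have eval_eq (f g : {poly rat}) : (map_poly inL f).[u] = (map_poly inL g).[u] ->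
  (pQC f).[c] = (pQC g).[c].
  move=> Efg; apply/eqP; rewrite -subr_eq0 -hornerN -hornerD -rmorphB.
  have : root (map_poly inL (f - g)) u.
    by rewrite rootE rmorphB hornerD hornerN Efg subrr.
  move/(minPoly_dvdp (K := 1%AS) (alg_polyOver 1%AS _)); rewrite Dq dvdp_map => /dvdpP[h ->].
  by rewrite rmorphM hornerM (rootP qc) mulr0.
pose iota x := (pQC (pol x)).[c].
have iotaB : zmod_morphism iota.
  move=> x y; rewrite /iota -hornerN -hornerD -rmorphB; apply: eval_eq.
  by rewrite rmorphB hornerD hornerN !polE.
have iotaM : monoid_morphism iota.
  split=> [|x y].
    rewrite /iota -[RHS](hornerC _ c) -[1%:P](rmorph1 pQC); apply: eval_eq.
    by rewrite polE rmorph1 hornerC.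
  rewrite /iota -hornerM -rmorphM; apply: eval_eq.
  by rewrite rmorphM hornerM !polE.
pose ia := GRing.isZmodMorphism.Build _ _ iota iotaB.
pose im := GRing.isMonoidMorphism.Build _ _ iota iotaM.
by exists (HB.pack_for {rmorphism L -> algC} iota ia im).
Qed.

(* [adj z x]: [x] lies in the field generated by [z] over the rationals. *)
Definition adj (z x : algC) : Prop := forall h : Aut, h z = z -> h x = x.

(** The Galois correspondence in a normal number field containing z and x: its automorphisms over
    Q(z) extend to [algC], so they fix x, and x lies in the field generated by z. *)
Lemma adj_poly z x : adj z x -> exists f : {poly rat}, x = (pQC f).[z].
Proof.
move=> adjx; have [L [iota [[|z1 [|x1 []]] //= [Ez Ex]]]] :=
  normal_number_field [:: z; x].
have x1z1 : x1 \in <<1; z1>>%VS.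
  have gal : galois <<1; z1>>%AS {:L}%AS.
    by rewrite /galois subvf normalFieldf separable_number_field.
  move/galois_fixedField: (gal) => <-; apply/fixedFieldP; first exact: memvf.
  move=> g gG; have [nu Dnu] := extend_algC_subfield_aut iota g.
  apply: (fmorph_inj iota); rewrite Dnu Ex; apply: adjx.
  rewrite -Ez -Dnu /= (fixed_gal _ gG) ?subvf ?memv_adjoin //.
case/Fadjoin_polyP: x1z1 => p /polyOver1P[f Df] Ex1.
exists f; rewrite -Ex Ex1 -horner_map Df -Ez; congr (_.[_]).
rewrite -map_poly_comp; apply: eq_map_poly => a /=.
by rewrite rmorphZ_num rmorph1 mulr1.
Qed.

(** * Fields and rings generated by a root of unity *)

Lemma adj_root (z : algC) : adj z z. Proof. by []. Qed.

Lemma adjB z x y : adj z x -> adj z y -> adj z (x - y).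
Proof. by move=> zx zy h hz; rewrite rmorphB zx ?zy. Qed.

Lemma adjD z x y : adj z x -> adj z y -> adj z (x + y).
Proof. by move=> zx zy h hz; rewrite rmorphD zx ?zy. Qed.

Lemma adjM z x y : adj z x -> adj z y -> adj z (x * y).
Proof. by move=> zx zy h hz; rewrite rmorphM zx ?zy. Qed.

Lemma adjV z x : adj z x -> adj z x^-1.
Proof. by move=> zx h hz; rewrite fmorphV zx. Qed.

Lemma adjX z x k : adj z x -> adj z (x ^+ k).
Proof. by move=> zx h hz; rewrite rmorphXn /= zx. Qed.

Lemma adj_rat z (a : rat) : adj z (ratr a).
Proof. by move=> h _; rewrite fmorph_rat. Qed.

Lemma adj_int z (a : int) : adj z a%:~R.
Proof. by move=> h _; rewrite rmorph_int. Qed.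

Lemma adj0 z : adj z 0. Proof. by move=> h _; rewrite rmorph0. Qed.

Lemma adj1 z : adj z 1. Proof. by move=> h _; rewrite rmorph1. Qed.

Lemma adj_sum z I (r : seq I) (P : pred I) F :
  (forall i, P i -> adj z (F i)) -> adj z (\sum_(i <- r | P i) F i).
Proof.
by move=> zF; apply: big_ind => //; [apply: adj0 | apply: adjD].
Qed.

Lemma adj_prod z I (r : seq I) (P : pred I) F :
  (forall i, P i -> adj z (F i)) -> adj z (\prod_(i <- r | P i) F i).
Proof.
by move=> zF; apply: big_ind => //; [apply: adj1 | apply: adjM].
Qed.

Lemma adj_trans y z x : adj z y -> adj y x -> adj z x.
Proof. by move=> zy yx h hz; apply: yx; apply: zy. Qed.

Lemma adj_exp z k x : adj (z ^+ k) x -> adj z x.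
Proof. by apply: adj_trans; apply: adjX. Qed.

Lemma aut_prim_root n z (g : Aut) : n.-primitive_root z ->
  exists2 k, coprime k n & g z = z ^+ k.
Proof.
move=> zn; have gzn : n.-primitive_root (g z) by rewrite fmorph_primitive_root.
have [k gk] := prim_rootP zn (prim_expr_order gzn).
by exists k => //; rewrite -(prim_root_exp_coprime _ zn) -gk.
Qed.

Lemma aut_exp n k : coprime k n ->
  exists g : Aut, forall z, z ^+ n = 1 -> g z = z ^+ k.
Proof. by case/Qn_aut_exists => g; exists g. Qed.

Lemma aut_inv (g : Aut) :
  exists h : Aut, (forall x, h (g x) = x) /\ (forall x, g (h x) = x).
Proof.
by exists (algC_invaut g); split; [apply: algC_autK | apply: algC_invautK].
Qed.

Lemma aut_iter (g : Aut) k : exists h : Aut, forall x, h x = iter k g x.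
Proof.
elim: k => [|k [h hE]]; first by exists idfun.
by exists (g \o h) => x; rewrite /= hE.
Qed.

Lemma aut_iter_exp (g : Aut) z t k : g z = z ^+ t -> iter k g z = z ^+ (t ^ k).
Proof.
move=> gz; elim: k => [|k IH] /=; first by rewrite expn0 expr1.
by rewrite IH rmorphXn /= gz -exprM expnS.
Qed.

Lemma adj_aut n z x (g : Aut) : n.-primitive_root z -> adj z x -> adj z (g x).
Proof.
move=> zn /adj_poly[f ->] h hz; have [k _ gz] := aut_prim_root g zn.
have mapg (u : Aut) : map_poly u (pQC f) = pQC f.
  by rewrite -map_poly_comp; apply: eq_map_poly => a /=; rewrite fmorph_rat.
by rewrite -!horner_map !mapg gz rmorphXn hz.
Qed.

Lemma adj_aut_eq n z x (g h : Aut) : n.-primitive_root z -> adj z x ->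
  g z = h z -> g x = h x.
Proof.
move=> zn zx; have [h' [hK Kh]] := aut_inv h => ghz.
by rewrite -[LHS]Kh; congr (h _); apply: (zx (h' \o g)); rewrite /= ghz hK.
Qed.

(** Encodes that the normal closure of Q(x) has an abelian Galois group, without naming a field:
    commuting on x implies commuting on all conjugates of x ([abelianC_aut]). *)
Definition abelianC (x : algC) : Prop := forall g h : Aut, g (h x) = h (g x).

Lemma abelianC_adj n z x : n.-primitive_root z -> adj z x -> abelianC x.
Proof.
move=> zn zx g h; apply: (@adj_aut_eq n z x (g \o h) (h \o g)) => //=.
have [k _ gz] := aut_prim_root g zn; have [l _ hz] := aut_prim_root h zn.
by rewrite gz hz !rmorphXn /= gz hz -!exprM mulnC.
Qed.

Lemma abelianC_aut (g : Aut) x : abelianC x -> abelianC (g x).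
Proof.
move=> abx h k.
have /= <- := abx g (h \o k); have /= <- := abx g (k \o h).
by rewrite abx.
Qed.

Lemma abelianCM x y : abelianC x -> abelianC y -> abelianC (x * y).
Proof. by move=> abx aby g h; rewrite !rmorphM abx aby. Qed.

Lemma abelianCD x y : abelianC x -> abelianC y -> abelianC (x + y).
Proof. by move=> abx aby g h; rewrite !rmorphD abx aby. Qed.

Definition cyclotomicC (x : algC) : Prop :=
  exists n z, n.-primitive_root z /\ adj z x.

Lemma cyclotomicC2 x y : cyclotomicC x -> cyclotomicC y ->
  exists n z, [/\ n.-primitive_root z, adj z x & adj z y].
Proof.
case=> n [z [zn zx]] [m [w [wm wy]]].
have nm_gt0 : (0 < n * m)%N.
  by rewrite muln_gt0 (prim_order_gt0 zn) (prim_order_gt0 wm).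
have [u unm] := C_prim_root_exists nm_gt0; exists (n * m)%N, u.
have znm : z ^+ (n * m) = 1 by rewrite exprM (prim_expr_order zn) expr1n.
have wnm : w ^+ (n * m) = 1 by rewrite mulnC exprM (prim_expr_order wm) expr1n.
have [k Ez] := prim_rootP unm znm; have [l Ew] := prim_rootP unm wnm.
by split=> //; [apply: (@adj_exp _ k) | apply: (@adj_exp _ l)]; rewrite -?Ez -?Ew.
Qed.

Lemma cyclotomicCM x y : cyclotomicC x -> cyclotomicC y -> cyclotomicC (x * y).
Proof.
move=> cx cy; have [n [z [zn zx zy]]] := cyclotomicC2 cx cy.
by exists n, z; split=> //; apply: adjM.
Qed.

Lemma cyclotomicCB x y : cyclotomicC x -> cyclotomicC y -> cyclotomicC (x - y).
Proof.
move=> cx cy; have [n [z [zn zx zy]]] := cyclotomicC2 cx cy.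
by exists n, z; split=> //; apply: adjB.
Qed.

Lemma cyclotomicCV x : cyclotomicC x -> cyclotomicC x^-1.
Proof. by case=> n [z [zn zx]]; exists n, z; split=> //; apply: adjV. Qed.

Lemma cyclotomicCX x k : cyclotomicC x -> cyclotomicC (x ^+ k).
Proof. by case=> n [z [zn zx]]; exists n, z; split=> //; apply: adjX. Qed.

Lemma prim_root_1 (F : fieldType) : 1.-primitive_root (1 : F).
Proof. by apply/andP; split=> //; apply/forallP => i; rewrite ord1 unity_rootE expr1 eqxx. Qed.

Lemma cyclotomicC_rat (a : rat) : cyclotomicC (ratr a).
Proof. by exists 1, 1; split; [apply: prim_root_1 | apply: adj_rat]. Qed.

Lemma cyclotomicC_aut (g : Aut) x : cyclotomicC x -> cyclotomicC (g x).
Proof. by case=> n [z [zn zx]]; exists n, z; split; last exact: adj_aut zn zx. Qed.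

Lemma cyclotomicC_sum I (r : seq I) (P : pred I) F :
  (forall i, P i -> cyclotomicC (F i)) -> cyclotomicC (\sum_(i <- r | P i) F i).
Proof.
move=> cF; have c0 : cyclotomicC 0 by rewrite -(rmorph0 ratr); apply: cyclotomicC_rat.
apply: big_ind => // x y cx cy; rewrite -[y]opprK -(sub0r y).
by apply: (cyclotomicCB cx); apply: cyclotomicCB.
Qed.

Lemma cyclotomicC_prod I (r : seq I) (P : pred I) F :
  (forall i, P i -> cyclotomicC (F i)) -> cyclotomicC (\prod_(i <- r | P i) F i).
Proof.
move=> cF; apply: big_ind => //; last exact: cyclotomicCM.
by rewrite -(rmorph1 ratr); apply: cyclotomicC_rat.
Qed.

Lemma cyclotomicC_unity n z : (0 < n)%N -> z ^+ n = 1 -> cyclotomicC z.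
Proof.
by move=> n0 /(prim_order_exists n0)[m zm _]; exists m, z; split.
Qed.

(* [Zadj z x]: [x] lies in the ring generated by [z] over the integers. *)
Definition Zadj (z x : algC) : Prop := exists f : {poly int}, x = (pZC f).[z].

Section Zadj.
Variable z : algC.

Lemma ZadjB x y : Zadj z x -> Zadj z y -> Zadj z (x - y).
Proof. by case=> f -> [g ->]; exists (f - g); rewrite rmorphB hornerD hornerN. Qed.

Lemma ZadjD x y : Zadj z x -> Zadj z y -> Zadj z (x + y).
Proof. by case=> f -> [g ->]; exists (f + g); rewrite rmorphD hornerD. Qed.

Lemma ZadjM x y : Zadj z x -> Zadj z y -> Zadj z (x * y).
Proof. by case=> f -> [g ->]; exists (f * g); rewrite rmorphM hornerM. Qed.

Lemma Zadj_int (a : int) : Zadj z a%:~R.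
Proof. by exists a%:P; rewrite map_polyC hornerC. Qed.

Lemma Zadj_nat k : Zadj z k%:R. Proof. exact: (Zadj_int k). Qed.

Lemma Zadj0 : Zadj z 0. Proof. by exists 0; rewrite rmorph0 horner0. Qed.

Lemma Zadj1 : Zadj z 1. Proof. by exists 1; rewrite rmorph1 hornerC. Qed.

Lemma Zadj_root : Zadj z z. Proof. by exists 'X; rewrite map_polyX hornerX. Qed.

Lemma ZadjN x : Zadj z x -> Zadj z (- x).
Proof. by move=> zx; rewrite -sub0r; apply: ZadjB => //; apply: Zadj0. Qed.

Lemma Zadj_sum I (r : seq I) (P : pred I) F :
  (forall i, P i -> Zadj z (F i)) -> Zadj z (\sum_(i <- r | P i) F i).
Proof.
by move=> zF; apply: big_ind => //; [apply: Zadj0 | apply: ZadjD].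
Qed.

Lemma Zadj_prod I (r : seq I) (P : pred I) F :
  (forall i, P i -> Zadj z (F i)) -> Zadj z (\prod_(i <- r | P i) F i).
Proof. by move=> zF; apply: big_ind => //; [apply: Zadj1 | apply: ZadjM]. Qed.

Lemma ZadjX x k : Zadj z x -> Zadj z (x ^+ k).
Proof.
by move=> zx; elim: k => [|k IH]; rewrite ?expr0 ?exprS; [apply: Zadj1 | apply: ZadjM].
Qed.

Lemma Zadj_horner x (f : {poly int}) : Zadj z x -> Zadj z (pZC f).[x].
Proof.
move=> zx; rewrite horner_coef; apply: Zadj_sum => i _; apply: ZadjM.
  by rewrite coef_map; apply: Zadj_int.
exact: ZadjX.
Qed.

End Zadj.

Lemma Zadj_adj z x : Zadj z x -> adj z x.
Proof.
case=> f ->; rewrite horner_coef; apply: adj_sum => i _; apply: adjM.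
  by rewrite coef_map; apply: adj_int.
exact: adjX.
Qed.

Lemma Zadj_Aint n z x : n.-primitive_root z -> Zadj z x -> x \in Aint.
Proof.
move=> zn [f ->]; rewrite horner_coef; apply: rpred_sum => i _; apply: rpredM.
  by rewrite coef_map; apply: Aint_int.
by apply: rpredX; apply: Aint_prim_root zn.
Qed.

Lemma Zadj_aut n z x (g : Aut) : n.-primitive_root z -> Zadj z x -> Zadj z (g x).
Proof.
move=> zn [f ->]; have [k _ gz] := aut_prim_root g zn.
rewrite -horner_map gz /=.
have -> : map_poly g (pZC f) = pZC f.
  by rewrite -map_poly_comp; apply: eq_map_poly => a /=; rewrite rmorph_int.
by apply: Zadj_horner; apply/ZadjX/Zadj_root.
Qed.

Lemma adj_Zadj z x : adj z x ->
  exists2 d : nat, (0 < d)%N & Zadj z (d%:R * x).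
Proof.
case/adj_poly=> f ->; have [q [a a0 ->]] := rat_poly_scale f.
exists `|a|%N; first by rewrite absz_gt0.
have -> : `|a|%N%:R = (sgz a)%:~R * a%:~R :> algC.
  by rewrite -intrM -abszEsg pmulrn.
rewrite -mulrA; apply: ZadjM; first exact: Zadj_int.
exists q; rewrite map_polyZ hornerZ fmorphV rmorph_int mulrA mulfV ?intr_eq0 // mul1r.
by rewrite -map_poly_comp; congr (_.[z]); apply: eq_map_poly => b /=; rewrite rmorph_int.
Qed.

Lemma prim_root_neq0 (F : fieldType) n (z : F) : n.-primitive_root z -> z != 0.
Proof.
by move=> zn; rewrite (prim_root_eq0 zn) -lt0n (prim_order_gt0 zn).
Qed.

Definition Zunit (z u : algC) : Prop := [/\ Zadj z u, Zadj z u^-1 & u != 0].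

Definition Zcong (z d x y : algC) : Prop := exists2 r, Zadj z r & x - y = d * r.

Lemma ZunitM z u v : Zunit z u -> Zunit z v -> Zunit z (u * v).
Proof.
move=> [zu zu' u0] [zv zv' v0]; split; first exact: ZadjM.
  by rewrite invfM; apply: ZadjM.
by rewrite mulf_neq0.
Qed.

Lemma Zunit1 z : Zunit z 1.
Proof. by split; rewrite ?invr1 ?oner_eq0 //; apply: Zadj1. Qed.

Lemma Zunit_prod z I (r : seq I) (P : pred I) F :
  (forall i, P i -> Zunit z (F i)) -> Zunit z (\prod_(i <- r | P i) F i).
Proof. by move=> zF; apply: big_ind => //; [apply: Zunit1 | apply: ZunitM]. Qed.

Lemma ZunitN z u : Zunit z u -> Zunit z (- u).
Proof. by case=> zu zu' u0; split; rewrite ?invrN ?oppr_eq0 //; apply: ZadjN. Qed.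

Lemma Zunit_root n z k : n.-primitive_root z -> Zunit z (z ^+ k).
Proof.
move=> zn; split; first exact/ZadjX/Zadj_root.
  rewrite -exprVn; apply: ZadjX.
  have -> : z^-1 = z ^+ n.-1.
    apply: (mulfI (prim_root_neq0 zn)).
    rewrite -exprS prednK ?(prim_order_gt0 zn) // mulfV ?(prim_root_neq0 zn) //.
    by rewrite prim_expr_order.
  exact/ZadjX/Zadj_root.
by rewrite expf_neq0 ?(prim_root_neq0 zn).
Qed.

Section Zcong.
Variables z d : algC.
Local Notation "x ~~ y" := (Zcong z d x y) (at level 70).

Lemma Zcong_refl x : x ~~ x.
Proof. by exists 0; [apply: Zadj0 | rewrite subrr mulr0]. Qed.

Lemma Zcong_sym x y : x ~~ y -> y ~~ x.
Proof. by case=> r zr E; exists (- r); [apply: ZadjN | rewrite mulrN -E opprB]. Qed.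

Lemma Zcong_trans y x w : x ~~ y -> y ~~ w -> x ~~ w.
Proof.
case=> r zr E [s zs F]; exists (r + s); first exact: ZadjD.
by rewrite mulrDr -E -F addrA subrK.
Qed.

Lemma ZcongD x y v w : x ~~ y -> v ~~ w -> x + v ~~ y + w.
Proof.
case=> r zr E [s zs F]; exists (r + s); first exact: ZadjD.
by rewrite mulrDr -E -F; ring.
Qed.

Lemma ZcongM x y v w : Zadj z y -> Zadj z v -> x ~~ y -> v ~~ w -> x * v ~~ y * w.
Proof.
move=> zy zv [r zr E] [s zs F]; exists (r * v + y * s).
  by apply: ZadjD; apply: ZadjM.
by rewrite mulrDr mulrA -E mulrCA -F; ring.
Qed.

Lemma Zcong_sum I (r : seq I) (P : pred I) F G :
  (forall i, P i -> F i ~~ G i) ->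
  \sum_(i <- r | P i) F i ~~ \sum_(i <- r | P i) G i.
Proof.
move=> FG; apply: (big_ind2 (fun x y => x ~~ y)) => //; first exact: Zcong_refl.
by move=> x y v w; apply: ZcongD.
Qed.

Lemma ZcongX x y k : Zadj z x -> Zadj z y -> x ~~ y -> x ^+ k ~~ y ^+ k.
Proof.
move=> zx zy xy; elim: k => [|k IH]; first exact: Zcong_refl.
by rewrite !exprS; apply: ZcongM => //; apply: ZadjX.
Qed.

Lemma Zcong_horner (f : {poly int}) x y : Zadj z x -> Zadj z y ->
  x ~~ y -> (pZC f).[x] ~~ (pZC f).[y].
Proof.
move=> zx zy xy; rewrite !horner_coef; apply: Zcong_sum => i _.
apply: ZcongM; try exact: Zcong_refl; last exact: ZcongX.
  by rewrite coef_map; apply: Zadj_int.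
exact: ZadjX.
Qed.

End Zcong.

Lemma Zcong_dvd z d e x y : Zadj z e -> Zcong z (d * e) x y -> Zcong z d x y.
Proof.
by move=> ze [r zr E]; exists (e * r); [apply: ZadjM | rewrite mulrA].
Qed.

(** * Frobenius congruences and the ring of integers of a cyclotomic field *)

Section Frobenius.
Variables (z : algC) (p : nat).
Hypothesis p_prime : prime p.
Local Notation "x ~~ y" := (Zcong z p%:R x y) (at level 70).

Lemma Frobenius_add x y : Zadj z x -> Zadj z y ->
  (x + y) ^+ p ~~ x ^+ p + y ^+ p.
Proof.
move=> zx zy; rewrite exprDn; case: p p_prime => // q q1_prime.
rewrite big_ord_recr big_ord_recl /= subnn bin0 binn subn0 !mulr1n.
rewrite !expr0 mulr1 mul1r -addrA addrCA.
rewrite -[X in Zcong _ _ _ X]add0r; apply: ZcongD; last exact: Zcong_refl.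
exists (\sum_(i < q) x ^+ (q.+1 - bump 0 i) * y ^+ bump 0 i *+
   ('C(q.+1, bump 0 i) %/ q.+1)).
  apply: Zadj_sum => i _; rewrite -mulr_natr; apply: ZadjM; last exact: Zadj_nat.
  by apply: ZadjM; apply: ZadjX.
rewrite subr0 mulr_sumr; apply: eq_bigr => i _.
rewrite mulrnAr mulr_natl -mulrnA mulnC divnK //.
by apply: prime_dvd_bin => //; rewrite /bump /= add1n ltnS ltn_ord.
Qed.

Lemma Frobenius_horner (f : {poly int}) x : Zadj z x ->
  (pZC f).[x] ^+ p ~~ (pZC f).[x ^+ p].
Proof.
move=> zx; have zxp : Zadj z (x ^+ p) by apply: ZadjX.
elim/poly_ind: f => [|f c IH].
  by rewrite rmorph0 !horner0 expr0n gtn_eqF ?prime_gt0 //; apply: Zcong_refl.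
rewrite rmorphD rmorphM /= map_polyX map_polyC /= !hornerMXaddC.
apply: Zcong_trans (Frobenius_add _ _) _; [|exact: Zadj_int|].
  by apply: ZadjM => //; apply: Zadj_horner.
apply: ZcongD.
  rewrite exprMn; apply: ZcongM => //; [|exact: Zcong_refl].
  exact: Zadj_horner.
(* Fermat's little theorem for the constant coefficient. *)
have [k Ek] : exists k : int, c ^+ p = c + p%:Z * k.
  have [k Ek] : exists k, c ^+ p - c = k * p%:Z.
    apply/dvdzP; rewrite (dvdz_pcharf (pchar_Fp p_prime)) // rmorphB rmorphXn /=.
    by rewrite -(pFrobenius_autE (pchar_Fp p_prime)) pFrobenius_aut_int subrr.
  by exists k; rewrite mulrC -Ek addrC subrK.
exists k%:~R; first exact: Zadj_int.
by rewrite -rmorphXn /= Ek rmorphD rmorphM addrAC subrr add0r.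
Qed.

Lemma Frobenius_iter (f : {poly int}) x k : Zadj z x ->
  (pZC f).[x] ^+ (p ^ k) ~~ (pZC f).[x ^+ (p ^ k)].
Proof.
move=> zx; elim: k => [|k IH]; first by rewrite expn0 !expr1; apply: Zcong_refl.
rewrite expnSr !exprM; apply: Zcong_trans (ZcongX _ _ _ IH) _.
- by apply/ZadjX/Zadj_horner.
- by apply/Zadj_horner/ZadjX.
- by apply/Frobenius_horner/ZadjX.
Qed.

End Frobenius.

Lemma Aint_root x : x \in Aint ->
  exists q : {poly int}, q \is monic /\ root (pZC q) x.
Proof.
rewrite unfold_in => /floorpP[q Dq]; exists q; rewrite -Dq root_minCpoly; split=> //.
have := minCpoly_monic x; rewrite Dq !monicE lead_coef_map_inj //; last exact: intr_inj.
by rewrite -(rmorph1 (intr : int -> algC)) (inj_eq intr_inj).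
Qed.

(* With [n = p ^ a * m], [unif] is a prime element lying over [p] in the ring
   generated by an [n]-th root of unity [z] (up to the splitting of [p] in the
   prime-to-[p] part). *)
Definition unif (p a m : nat) (z : algC) : algC :=
  if a == 0%N then p%:R else 1 - z ^+ m.

Section Uniformizer.
Variables (p a m : nat) (z : algC).
Hypotheses (p_prime : prime p) (pm : coprime p m).
Hypothesis zn : (p ^ a * m).-primitive_root z.
Local Notation pi := (unif p a m z).

Let n_gt0 : (0 < p ^ a * m)%N := prim_order_gt0 zn.
Let m_gt0 : (0 < m)%N. Proof. by move: n_gt0; rewrite muln_gt0 => /andP[]. Qed.

Lemma prim_root_ppart : (p ^ a).-primitive_root (z ^+ m).
Proof. by have := dvdn_prim_root zn (dvdn_mulr m (dvdnn (p ^ a))); rewrite mulKn ?expn_gt0 ?prime_gt0. Qed.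

Lemma Zadj_unif : Zadj z pi.
Proof.
rewrite /unif; case: ifP => _; first exact: Zadj_nat.
by apply: ZadjB; [apply: Zadj1 | apply/ZadjX/Zadj_root].
Qed.

Lemma unif_neq0 : pi != 0.
Proof.
rewrite /unif; case: (a =P 0%N) => [_|/eqP a0]; first by rewrite pnatr_eq0 -lt0n prime_gt0.
rewrite subr_eq0 eq_sym -(prim_order_dvd zn).
apply/negP => /(dvdn_leq m_gt0); rewrite leqNgt -{1}[m]mul1n ltn_pmul2r //.
by rewrite -(expn0 p) ltn_exp2l ?prime_gt1 // lt0n a0.
Qed.

(** The two powers differ by a factor (z^m)^k, and 1 - (z^m)^k is a multiple of 1 - z^m; for a = 0
    they are equal. *)
Lemma Zcong_exp_unif i j : i = j %[mod m] -> Zcong z pi (z ^+ i) (z ^+ j).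
Proof.
wlog le_ij : i j / (i <= j)%N.
  move=> IH ij; case: (leqP i j) => [|/ltnW] /IH H; first exact: H.
  by apply: Zcong_sym; apply: H.
move/esym/eqP; rewrite eqn_mod_dvd // => /dvdnP[k Ek].
exists (if a == 0%N then 0 else z ^+ i * \sum_(l < k) (z ^+ m) ^+ l).
  case: ifP => _; first exact: Zadj0.
  apply: ZadjM; first exact/ZadjX/Zadj_root.
  by apply: Zadj_sum => l _; apply/ZadjX/ZadjX/Zadj_root.
rewrite -(subnK le_ij) Ek /unif exprD mulnC exprM.
case: (a =P 0%N) zn => [->|_ _]; last first.
  have := subrX1 (z ^+ m) k; rewrite -(opprB 1) => /(canRL (@opprK _)) E.
  by rewrite -{1}[z ^+ i]mul1r -mulrBl -(opprB _ 1) subrX1; ring.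
rewrite expn0 mul1n => zm.
by rewrite (prim_expr_order zm) expr1n mul1r subrr mulr0.
Qed.

(** With w = z^m, the quotient (1 - w^e)/(1 - w) is a cyclotomic unit: if e e' = 1 modulo p^a, its
    inverse is the geometric sum (1 - w^(e e'))/(1 - w^e). *)
Lemma Zunit_geom e : coprime e (p ^ a) -> (0 < a)%N ->
  exists2 u, Zunit z u & 1 - (z ^+ m) ^+ e = pi * u.
Proof.
move=> ea a_gt0; rewrite /unif gtn_eqF //; set w := z ^+ m.
have wp : (p ^ a).-primitive_root w := prim_root_ppart.
have pa_gt1 : (1 < p ^ a)%N by rewrite -(expn0 p) ltn_exp2l ?prime_gt1.
have w1 : 1 - w != 0.
  by have := unif_neq0; rewrite /unif gtn_eqF.
have we1 : 1 - w ^+ e != 0.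
  rewrite subr_eq0 eq_sym -(prim_order_dvd wp); apply/negP => dve.
  by move: ea; rewrite coprime_sym /coprime (gcdn_idPl dve) gtn_eqF.
have [e' ee'] : exists e', w ^+ (e * e') = w.
  have [e' _ /eqP ee'] : exists2 e', true & (e * e' == 1 %[mod p ^ a])%N.
    have e_gt0 : (0 < e)%N.
      by rewrite lt0n; apply: contraTneq ea => ->; rewrite /coprime gcd0n gtn_eqF.
    have [e' k Ee _] := egcdnP (p ^ a) e_gt0; exists e' => //.
    by rewrite mulnC Ee (eqP ea) modnMDl.
  by exists e'; rewrite -(prim_expr_mod wp) ee' (prim_expr_mod wp).
have geom x k : 1 - x ^+ k = (1 - x) * \sum_(i < k) x ^+ i :> algC.
  by rewrite -(opprB _ 1) subrX1 -mulNr opprB.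
have Zgeom x k : Zadj z x -> Zadj z (\sum_(i < k) x ^+ i).
  by move=> zx; apply: Zadj_sum => i _; apply: ZadjX.
have Zw : Zadj z w by apply/ZadjX/Zadj_root.
exists (\sum_(i < e) w ^+ i); last exact: geom.
split; first exact: Zgeom.
  suff -> : (\sum_(i < e) w ^+ i)^-1 = \sum_(i < e') (w ^+ e) ^+ i.
    exact/Zgeom/ZadjX.
  apply: (mulfI we1); rewrite -(geom (w ^+ e)) -(exprM w) ee' (geom w) mulfK //.
  by apply: contraNneq we1 => E; rewrite geom E mulr0.
by apply: contraNneq we1 => E; rewrite geom E mulr0.
Qed.

(** p is the product of the 1 - om^i, 0 < i < p, where om = w^N has order p and N = p^(a-1).
    Evaluating the factorization of X^N - 1 into the X - w^(p j) at w^i splits each of these into N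
    terms w^i - w^(p j), all unit multiples of the uniformizer because i - p j is prime to p. *)
Lemma unif_pow_pos : (0 < a)%N ->
  exists2 u, Zunit z u & p%:R = pi ^+ (p ^ a.-1 * p.-1) * u.
Proof.
move=> a_gt0.
have wp := prim_root_ppart; set w := z ^+ m in wp *.
have ap : a = a.-1.+1 by rewrite prednK.
pose N := (p ^ a.-1)%N.
have pN : (p ^ a = N * p)%N by rewrite /N {1}ap expnSr.
have N_gt0 : (0 < N)%N by rewrite expn_gt0 prime_gt0.
have p_gt0 := prime_gt0 p_prime.
have omp : p.-primitive_root (w ^+ N).
  have := dvdn_prim_root (m := p) wp; rewrite pN mulnK //; apply.
  exact: dvdn_mull.
have etaN : N.-primitive_root (w ^+ p).
  have := dvdn_prim_root (m := N) wp; rewrite pN mulKn //; apply.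
  exact: dvdn_mulr.
have Ep : p%:R = \prod_(1 <= i < p) (1 - (w ^+ N) ^+ i) :> algC.
  have := factor_Xn_sub_1 omp.
  rewrite big_ltn // expr0 subrX1 polyC1.
  have X1 : 'X - 1 != 0 :> {poly algC} by rewrite -polyC1 polyXsubC_eq0.
  move/(mulfI X1)/(congr1 (horner^~ 1)); rewrite horner_prod horner_sum.
  under eq_bigr do rewrite !hornerE.
  move=> ->; rewrite (eq_bigr (fun=> 1)) => [|i _]; last by rewrite hornerXn expr1n.
  by rewrite sumr_const card_ord.
have Ew i : (0 < i < p)%N -> exists2 u, Zunit z u & 1 - (w ^+ N) ^+ i = pi ^+ N * u.
  move=> /andP[i_gt0 i_lt].
  have ew j : (j < N)%N -> exists2 u, Zunit z u & w ^+ i - (w ^+ p) ^+ j = pi * u.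
    move=> jN; have [|//|u Zu Eu] := @Zunit_geom (i + p * (N - j)).
      rewrite coprimeXr // coprime_sym prime_coprime // dvdn_addl ?dvdn_mulr //.
      by apply: contraTN i_lt => /(dvdn_leq i_gt0); rewrite -leqNgt.
    exists (- u * (z ^+ (m * p * j))); first exact/ZunitM/(Zunit_root _ zn)/ZunitN.
    rewrite -mulnA (exprM z) -/w mulrA mulrN -Eu mulNr mulrBl mul1r opprB.
    congr (_ - _); last by rewrite exprM.
    rewrite -exprD -addnA -mulnDr subnK ?(ltnW jN) // exprD mulnC -pN.
    by rewrite (prim_expr_order wp) mulr1.
  pose u_ j := if (j < N)%N =P true is ReflectT h then s2val (cid2 (ew j h)) else 1.
  have uP j : (j < N)%N -> Zunit z (u_ j) /\ w ^+ i - (w ^+ p) ^+ j = pi * u_ j.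
    by rewrite /u_; case: eqP => // h _; case: (cid2 _).
  have := factor_Xn_sub_1 etaN; move/(congr1 (horner^~ (w ^+ i))).
  rewrite horner_prod !hornerE => E.
  exists (- \prod_(0 <= j < N) u_ j).
    apply: ZunitN; rewrite big_nat_cond; apply: Zunit_prod => j /andP[/andP[_ /uP[]]] //.
  rewrite mulrN -exprM mulnC exprM -(opprB _ 1) -E; congr (- _).
  have -> : pi ^+ N = \prod_(0 <= j < N) pi by rewrite prodr_const_nat subn0.
  rewrite -big_split /=.
  by apply: eq_big_nat => j /andP[_ /uP[_ <-]]; rewrite !hornerE.
pose u_ i := if (0 < i < p)%N =P true is ReflectT h then s2val (cid2 (Ew i h)) else 1.
have uP i : (0 < i < p)%N -> Zunit z (u_ i) /\ 1 - (w ^+ N) ^+ i = pi ^+ N * u_ i.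
  by rewrite /u_; case: eqP => // h _; case: (cid2 _).
exists (\prod_(1 <= i < p) u_ i).
  by rewrite big_nat_cond; apply: Zunit_prod => i /andP[/uP[]].
rewrite -/N.
have -> : pi ^+ (N * p.-1) = \prod_(1 <= j < p) (pi ^+ N).
  by rewrite prodr_const_nat exprM subn1.
rewrite Ep -big_split /=.
by apply: eq_big_nat => i /uP[_ ->].
Qed.

Lemma unif_pow : exists c u, [/\ (0 < c)%N, Zunit z u & p%:R = pi ^+ c * u].
Proof.
have [a0|a_gt0] := posnP a.
  by exists 1, 1; split=> //; [apply: Zunit1 | rewrite /unif a0 expr1 mulr1].
have [u uu Eu] := unif_pow_pos a_gt0; exists (p ^ a.-1 * p.-1)%N, u; split=> //.
by rewrite muln_gt0 expn_gt0 prime_gt0 // -ltnS prednK ?prime_gt0 ?prime_gt1.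
Qed.
End Uniformizer.

Section IntegralClosure.
Variables (p a m : nat) (z : algC).
Hypotheses (p_prime : prime p) (pm : coprime p m).
Hypothesis zn : (p ^ a * m).-primitive_root z.
Local Notation pi := (unif p a m z).

Lemma Zcong_unif_p x y : Zcong z p%:R x y -> Zcong z pi x y.
Proof.
have [[|c] [u [// _ [zu _ _] ->]]] := unif_pow p_prime zn.
rewrite exprS -mulrA; apply: Zcong_dvd; apply: ZadjM => //.
exact/ZadjX/Zadj_unif.
Qed.

(** For x = f(z) the power is congruent to f(z^Q), Q = p^(totient m * k); since Q = 1 modulo m by
    Euler, z^Q is congruent to z. *)
Lemma Zcong_Frobenius x k : Zadj z x ->
  Zcong z pi (x ^+ (p ^ (totient m * k))) x.
Proof.
move=> [f ->]; apply: Zcong_trans.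
  exact/Zcong_unif_p/(Frobenius_iter p_prime)/Zadj_root.
apply: Zcong_horner; [exact/ZadjX/Zadj_root | exact: Zadj_root|].
rewrite -[X in Zcong _ _ _ X]expr1; apply: (Zcong_exp_unif zn).
by rewrite expnM -modnXm Euler_exp_totient // modnXm exp1n.
Qed.

(** Multiplying a monic equation of degree d for y/pi by pi^d shows that pi divides y^d. As y is
    congruent to y^Q for arbitrarily large powers Q of p, pi divides y itself. *)
Lemma unif_dvd_integral y : Zadj z y -> y / pi \in Aint -> Zcong z pi y 0.
Proof.
move=> zy /Aint_root[q [q_monic]].
have pi0 : pi != 0 := unif_neq0 p_prime zn.
have Zpi : Zadj z pi := Zadj_unif p a m z.
case Eq: (size q) => [|d].
  by move: q_monic; rewrite monicE lead_coefE Eq nth_default ?Eq // eq_sym oner_eq0.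
have qd : q`_d = 1 by move: q_monic; rewrite monicE lead_coefE Eq => /eqP.
rewrite rootE horner_coef size_map_inj_poly ?rmorph0 //; last exact: intr_inj.
rewrite Eq big_ord_recr coef_map /= qd mul1r addrC addr_eq0 => /eqP Ed.
have yd : Zcong z pi (y ^+ d) 0.
  exists (- \sum_(i < d) (q`_i)%:~R * pi ^+ (d - i).-1 * y ^+ i).
    apply/ZadjN/Zadj_sum => i _; apply: ZadjM; last exact: ZadjX.
    by apply: ZadjM; [apply: Zadj_int | apply: ZadjX].
  set w := y / pi in Ed; have Ey : y = w * pi by rewrite divfK.
  rewrite subr0 Ey exprMn Ed mulNr mulrN mulr_suml mulr_sumr.
  congr (- _); apply: eq_bigr => i _; rewrite coef_map /= (exprMn _ w).
  have -> : pi ^+ d = pi ^+ i * (pi * pi ^+ (d - i).-1).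
    by rewrite -exprS prednK ?subn_gt0 // -exprD subnKC // ltnW.
  have acE (A B C D E : algC) : A * B * (C * (D * E)) = D * (A * E * (B * C)).
    by ring.
  exact: acE.
have [e ed] : exists e, (d <= p ^ (totient m * e))%N.
  exists d; apply: leq_trans (ltnW (ltn_expl d (prime_gt1 p_prime))) _.
  rewrite leq_exp2l ?prime_gt1 // leq_pmull // totient_gt0.
  by have := prim_order_gt0 zn; rewrite muln_gt0 => /andP[].
apply: Zcong_trans (Zcong_sym (Zcong_Frobenius e zy)) _.
rewrite -(subnK ed) exprD -(mulr0 (y ^+ (p ^ (totient m * e) - d))).
apply: ZcongM yd; [exact: ZadjX | exact: ZadjX | exact: Zcong_refl].
Qed.

(** p is a unit times pi^c, so the division by p is done as c divisions by pi; the intermediate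
    quotients y / pi^k are integral because they are integral multiples of y / p. *)
Lemma Zadj_div_prime y : Zadj z y -> y / p%:R \in Aint -> Zadj z (y / p%:R).
Proof.
have pi0 : pi != 0 := unif_neq0 p_prime zn.
have [c [u [_ [zu zv u0] Ep]]] := unif_pow p_prime zn.
have intu := Zadj_Aint zn zu; have intpi := Zadj_Aint zn (Zadj_unif p a m z).
move=> zy; rewrite Ep invfM mulrA => inty.
have intk k : (k <= c)%N -> y / pi ^+ k \in Aint.
  move=> kc; have -> : y / pi ^+ k = y / pi ^+ c * u^-1 * (u * pi ^+ (c - k)).
    rewrite mulrA mulfVK // -{1}(subnK kc) exprD invfM -!mulrA; congr (_ * _).
    by rewrite mulrCA mulVf ?mulr1 // expf_neq0.
  by rewrite rpredM // rpredM // rpredX.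
suff H k : (k <= c)%N -> Zadj z (y / pi ^+ k) by apply: ZadjM => //; apply: H.
elim: k => [|k IH] kc; first by rewrite expr0 divr1.
have [|r zr] := unif_dvd_integral (IH (ltnW kc)).
  by rewrite -mulrA -invfM -exprSr; apply: intk.
rewrite subr0 => Er; by rewrite exprSr invfM mulrA Er mulrC mulKf.
Qed.

End IntegralClosure.

(** A denominator d of x is removed prime by prime: for p dividing d, the quotient d x / p is an
    integral multiple of x, so [Zadj_div_prime] puts it in Z[z]. *)
Theorem Zadj_integral n z x : n.-primitive_root z -> adj z x -> x \in Aint ->
  Zadj z x.
Proof.
move=> zn /adj_Zadj[d]; elim/ltn_ind: d x => d IH x d_gt0 zdx intx.
have [d1|d_gt1] := leqP d 1.
  by case: d d_gt0 d1 zdx {IH} => [|[|d]] // _ _; rewrite mul1r.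
have p_prime := pdiv_prime d_gt1; set p := pdiv d in p_prime.
have Ed : d = (d %/ p * p)%N by rewrite divnK ?pdiv_dvd.
have n_gt0 := prim_order_gt0 zn.
have zn' : (p ^ logn p n * n`_p^').-primitive_root z by rewrite -p_part partnC.
have pm : coprime p n`_p^' by rewrite coprime_sym; apply: (pnat_coprime (part_pnat _ _)); rewrite pnatNK pnat_id.
have p0 : p%:R != 0 :> algC by rewrite pnatr_eq0 -lt0n prime_gt0.
apply: (IH (d %/ p)%N) => //; first by rewrite ltn_Pdiv ?prime_gt1.
  by rewrite divn_gt0 ?prime_gt0 // dvdn_leq ?pdiv_dvd.
have -> : (d %/ p)%:R * x = d%:R * x / p%:R.
  by rewrite {2}Ed natrM mulrAC mulfK.
apply: (Zadj_div_prime p_prime pm zn') => //.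
rewrite {1}Ed natrM mulrAC mulfK //; apply: rpredM => //.
by rewrite rpred_nat.
Qed.

(** A prime ideal of the ring of all algebraic integers instead of the integers of one field: a
    single choice serves every number field, and congruences in different fields can be compared. *)
Record prime_over (p : nat) (P : algC -> Prop) : Prop := PrimeOver {
  prime_over_Aint : forall x, P x -> x \in Aint;
  prime_over_p : P p%:R;
  prime_overD : forall x y, P x -> P y -> P (x + y);
  prime_overM : forall a x, a \in Aint -> P x -> P (a * x);
  prime_over1 : ~ P 1;
  prime_over_prime : forall x y, x \in Aint -> y \in Aint -> P (x * y) -> P x \/ P y
}.

Lemma prime_over_exists p : prime p -> exists P, prime_over p P.
Proof.
move=> p_prime.
pose ideal (I : algC -> Prop) := [/\ forall x, I x -> x \in Aint, I p%:R,
  forall x y, I x -> I y -> I (x + y), forall a x, a \in Aint -> I x -> I (a * x)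
  & ~ I 1].
have [|A [A_ok Amax]] :=
    @classical_sets.Zorn_bigcup algC (fun I => ideal I \/ forall x, ~ I x).
  move=> F FP Ftot.
  have [[X [FX [x0 Xx0]]]|F0] := pselect (exists X, F X /\ exists x, X x); last first.
    by right=> x [X FX Xx]; apply: F0; exists X; split=> //; exists x.
  have Fid Y y : F Y -> Y y -> ideal Y by move=> /FP[//|Y0] /Y0.
  have [_ Xp _ _ _] := Fid _ _ FX Xx0.
  left; split=> [x [Y FY Yx] | | x y [Y FY Yx] [Z FZ Zy] | b x b_int [Y FY Yx] | [Y FY Y1]].
  - by have [Yint _ _ _ _] := Fid _ _ FY Yx; apply: Yint.
  - by exists X.
  - have [sub|sub] := Ftot _ _ FY FZ.
      exists Z => //; have [_ _ ZD _ _] := Fid _ _ FZ Zy.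
      by apply: ZD => //; apply: sub.
    exists Y => //; have [_ _ YD _ _] := Fid _ _ FY Yx.
    by apply: YD => //; apply: sub.
  - by exists Y => //; have [_ _ _ YM _] := Fid _ _ FY Yx; apply: YM.
  - by have [_ _ _ _ []] := Fid _ _ FY Y1.
have A_ideal : ideal A.
  case: A_ok => // A0; pose B x := exists2 a, a \in Aint & x = a * p%:R.
  case: (Amax B); first split.
    by move=> x /A0.
  - move=> BA; apply: (A0 p%:R); apply: BA; exists 1; rewrite ?mul1r //.
  left; split=> [x [a aint ->]||x y [a aint ->] [b bint ->]|b x bint [a aint ->]|[a aint]].
  - by apply: rpredM => //; apply: rpred_nat.
  - by exists 1; rewrite ?mul1r.
  - by exists (a + b); rewrite ?mulrDl // rpredD.
  - by exists (b * a); rewrite ?mulrA // rpredM.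
  - have p0 : p%:R != 0 :> algC by rewrite pnatr_eq0 -lt0n prime_gt0.
    move=> Eap; have : (p%:R : algC)^-1 \in Num.int.
      apply: Cint_rat_Aint; first by rewrite rpredV rpred_nat.
      suff -> : p%:R^-1 = a by [].
      by apply: (mulIf p0); rewrite mulVf.
    case/intrP=> k Ek; have : `|k|%N * p = 1 :> nat.
      have /(congr1 absz) : k * p%:Z = 1 :> int.
        by apply: (intr_inj (R := algC)); rewrite rmorphM /= -Ek mulVf.
      by rewrite abszM.
    by case/eqP; rewrite muln_eq1 => /andP[_ /eqP p1]; move: p_prime; rewrite p1.
have [Aint_A Ap AD AM A1] := A_ideal.
exists A; split=> // x y xint yint Axy.
have [Ax|Ax] := pselect (A x); first by left.
have [Ay|Ay] := pselect (A y); first by right.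
exfalso.
pose B w := exists a b, [/\ A b, a \in Aint & w = b + a * x].
case: (Amax B); first split.
- by move=> w Aw; exists 0, w; rewrite mul0r addr0.
- move=> BA; apply: Ax; apply: BA; exists 1, 0; rewrite add0r mul1r; split=> //.
  by rewrite -(mul0r p%:R); apply: AM.
left; split=> [w [a [b [Ab aint ->]]]| |w v [a [b [Ab aint ->]]] [c [d [Ad cint ->]]]
  |c w cint [a [b [Ab aint ->]]]|[a [b [Ab aint E1]]]].
- by apply: rpredD; [apply: Aint_A | apply: rpredM].
- by exists 0, p%:R; rewrite mul0r addr0.
- exists (a + c), (b + d); split; [exact: AD | exact: rpredD | by ring].
- exists (c * a), (c * b); split; [exact: AM | exact: rpredM | by ring].
- apply: Ay; rewrite -(mul1r y) E1 mulrDl -mulrA; apply: AD; last exact: AM.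
  by rewrite mulrC; apply: AM.
Qed.

(** * Localization and valuation at a prime *)

Section LocalRing.
Variables (p : nat) (P : algC -> Prop).
Hypotheses (p_prime : prime p) (P_p : prime_over p P).

Let P_int := prime_over_Aint P_p.
Let Pp := prime_over_p P_p.
Let PD := prime_overD P_p.
Let PM := prime_overM P_p.
Let P1 := prime_over1 P_p.
Let Pprime := prime_over_prime P_p.

(* The valuation ring of the algebraic numbers at [P] and its maximal ideal. *)
Definition loc (x : algC) : Prop :=
  exists u w, [/\ u \in Aint, w \in Aint, ~ P w & x = u / w].
Definition mloc (x : algC) : Prop :=
  exists u w, [/\ P u, w \in Aint, ~ P w & x = u / w].
Definition uloc (x : algC) : Prop := loc x /\ ~ mloc x.

Lemma P0 : P 0.
Proof. by rewrite -(mul0r p%:R); apply: PM => //; apply: Pp. Qed.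

Lemma notP_neq0 w : ~ P w -> w != 0.
Proof. by apply: contra_notN => /eqP->; apply: P0. Qed.

Lemma notPM x y : x \in Aint -> y \in Aint -> ~ P x -> ~ P y -> ~ P (x * y).
Proof. by move=> xi yi Px Py /(Pprime xi yi)[]. Qed.

Lemma loc_Aint x : x \in Aint -> loc x.
Proof. by move=> xi; exists x, 1; split; rewrite ?divr1. Qed.

Lemma locD x y : loc x -> loc y -> loc (x + y).
Proof.
move=> [u [w [ui wi Pw ->]]] [v [t [vi ti Pt ->]]].
exists (u * t + v * w), (w * t); split; rewrite ?rpredD ?rpredM //.
  exact: notPM.
by rewrite addf_div ?notP_neq0.
Qed.

Lemma locM x y : loc x -> loc y -> loc (x * y).
Proof.
move=> [u [w [ui wi Pw ->]]] [v [t [vi ti Pt ->]]].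
by exists (u * v), (w * t); split; rewrite ?rpredM ?mulf_div //; apply: notPM.
Qed.

Lemma locN x : loc x -> loc (- x).
Proof. by rewrite -mulN1r; apply: locM; apply: loc_Aint; rewrite rpredN. Qed.

Lemma mloc_loc x : mloc x -> loc x.
Proof. by move=> [u [w [/P_int ui wi Pw ->]]]; exists u, w. Qed.

Lemma mlocD x y : mloc x -> mloc y -> mloc (x + y).
Proof.
move=> [u [w [ui wi Pw ->]]] [v [t [vi ti Pt ->]]].
exists (u * t + v * w), (w * t); split; rewrite ?rpredM //.
- by apply: PD; rewrite mulrC; apply: PM.
- exact: notPM.
by rewrite addf_div ?notP_neq0.
Qed.

Lemma mlocM x y : loc x -> mloc y -> mloc (x * y).
Proof.
move=> [u [w [ui wi Pw ->]]] [v [t [vi ti Pt ->]]].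
exists (u * v), (w * t); split; rewrite ?rpredM ?mulf_div //; first exact: PM.
exact: notPM.
Qed.

Lemma mlocMr x y : mloc x -> loc y -> mloc (x * y).
Proof. by rewrite mulrC => mx ly; apply: mlocM. Qed.

Lemma mlocN x : mloc x -> mloc (- x).
Proof.
by move=> mx; rewrite -mulN1r; apply: mlocM mx; apply: loc_Aint; rewrite rpredN.
Qed.

Lemma mloc0 : mloc 0.
Proof. by exists 0, 1; split; rewrite ?mul0r //; apply: P0. Qed.

Lemma P_mloc x : P x -> mloc x.
Proof. by move=> Px; exists x, 1; split; rewrite ?divr1. Qed.

Lemma mloc_P x : x \in Aint -> mloc x -> P x.
Proof.
move=> xi [u [w [Pu wi Pw Ex]]]; have w0 := notP_neq0 Pw.
have Pxw : P (x * w) by rewrite Ex divfK.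
by case: (Pprime xi wi Pxw).
Qed.

Lemma mloc_p : mloc p%:R. Proof. exact/P_mloc/Pp. Qed.

Lemma mloc1 : ~ mloc 1. Proof. by move=> /mloc_P -/(_ Aint1). Qed.

Lemma mloc_prime x y : loc x -> loc y -> mloc (x * y) -> mloc x \/ mloc y.
Proof.
move=> [u [w [ui wi Pw ->]]] [v [t [vi ti Pt ->]]] mxy.
have uvi : u * v \in Aint by rewrite rpredM.
have /(mloc_P uvi) : mloc (u * v).
  have -> : u * v = w * t * (u / w * (v / t)).
    by rewrite mulf_div [RHS]mulrC divfK // mulf_neq0 ?notP_neq0.
  by apply: mlocM mxy; apply: loc_Aint; rewrite rpredM.
by move/(Pprime ui vi) => [Pu|Pv]; [left; exists u, w | right; exists v, t].
Qed.

Lemma uloc_neq0 x : uloc x -> x != 0.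
Proof. by case=> _; apply: contra_notN => /eqP->; apply: mloc0. Qed.

Lemma ulocM x y : uloc x -> uloc y -> uloc (x * y).
Proof.
move=> [lx mx] [ly my]; split; first exact: locM.
by move/(mloc_prime lx ly) => [].
Qed.

Lemma uloc_Aint x : x \in Aint -> ~ P x -> uloc x.
Proof. by move=> xi Px; split; [apply: loc_Aint | move/(mloc_P xi)]. Qed.

Lemma uloc1 : uloc 1. Proof. exact: uloc_Aint. Qed.

Lemma ulocV x : uloc x -> uloc x^-1.
Proof.
move=> [lx mx]; have [u [w [ui wi Pw Ex]]] := lx.
have Pu : ~ P u by move=> Pu; apply: mx; exists u, w.
rewrite Ex invf_div; split; first by exists w, u.
move=> [u' [w' [Pu' wi' Pw' E]]]; apply: (notPM wi wi' Pw Pw').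
have -> : w * w' = u * u'.
  by rewrite -(divfK (notP_neq0 Pu) w) E mulrAC divfK ?notP_neq0 // mulrC.
exact: PM.
Qed.

Lemma ulocX x k : uloc x -> uloc (x ^+ k).
Proof.
by move=> ux; elim: k => [|k IH]; rewrite ?exprS; [apply: uloc1 | apply: ulocM].
Qed.

Lemma ulocXz x (k : int) : uloc x -> uloc (x ^ k).
Proof.
case: k => k ux; first exact: ulocX.
by rewrite NegzE -exprnN; apply/ulocV/ulocX.
Qed.

Lemma uloc_factor x y : loc x -> loc y -> uloc (x * y) -> uloc x.
Proof. by move=> lx ly [_ mxy]; split=> // mx; apply: mxy; apply: mlocMr. Qed.

Lemma P_int_dvd (a : int) : P a%:~R -> (p %| a)%Z.
Proof.
move=> Pa; apply/negPn/negP => pa; apply: P1.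
have : coprimez p a.
  by rewrite coprimezE prime_coprime //; move: pa; rewrite dvdzE.
rewrite /coprimez => /eqP g1; have [u [v E]] := Bezoutz p a.
rewrite -(rmorph1 (intr : int -> algC)) -g1 -E rmorphD !rmorphM /=.
by apply: PD; apply: PM; rewrite ?Aint_int //; apply: Pp.
Qed.

Lemma mloc_int_dvd (a : int) : mloc a%:~R -> (p %| a)%Z.
Proof. by move/(mloc_P (Aint_int a))/P_int_dvd. Qed.

Lemma loc_rat (a : rat) : loc (ratr a) -> ~~ (p %| denq a)%Z.
Proof.
move=> la; apply/negP => pd; have pd0 := pd.
have : mloc (numq a)%:~R.
  have -> : (numq a)%:~R = ratr a * (denq a)%:~R :> algC.
    by rewrite /ratr divfK // intr_eq0 denq_eq0.
  apply: mlocM => //; apply: P_mloc; case/dvdzP: pd => k ->.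
  rewrite rmorphM /=; apply: PM; [exact: Aint_int | exact: Pp].
move/mloc_int_dvd => pn; have := coprime_num_den a.
rewrite /coprime => /eqP E; have := dvdn_gcd p `|numq a| `|denq a|.
move: pn pd0; rewrite !dvdzE E dvdn1 => -> -> /eqP p1.
by move: p_prime; rewrite p1.
Qed.

Definition lcong x y := mloc (x - y).

Lemma lcong_refl x : lcong x x. Proof. by rewrite /lcong subrr; apply: mloc0. Qed.

Lemma lcong_sym x y : lcong x y -> lcong y x.
Proof. by move/mlocN; rewrite opprB. Qed.

Lemma lcong_trans y x z : lcong x y -> lcong y z -> lcong x z.
Proof. by move=> xy yz; have := mlocD xy yz; rewrite addrA subrK. Qed.

Lemma lcongM x y v w : loc y -> loc v -> lcong x y -> lcong v w ->
  lcong (x * v) (y * w).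
Proof.
move=> ly lv xy vw; rewrite /lcong.
have -> : x * v - y * w = (x - y) * v + y * (v - w) by ring.
by apply: mlocD; [apply: mlocMr | apply: mlocM].
Qed.

Lemma lcongX x y k : loc x -> loc y -> lcong x y -> lcong (x ^+ k) (y ^+ k).
Proof.
move=> lx ly xy; elim: k => [|k IH]; first exact: lcong_refl.
rewrite !exprS; apply: lcongM => //; elim: k {IH} => [|k]; first exact: loc_Aint.
by rewrite exprS; apply: locM.
Qed.

Lemma lcongV x y : uloc x -> uloc y -> lcong x y -> lcong x^-1 y^-1.
Proof.
move=> ux uy xy; rewrite /lcong.
have -> : x^-1 - y^-1 = - (x^-1 * y^-1) * (x - y).
  have := uloc_neq0 ux; have := uloc_neq0 uy; move=> y0 x0.
  by field; rewrite x0 y0.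
by apply: mlocM => //; apply/locN/locM; [case: (ulocV ux) | case: (ulocV uy)].
Qed.

Lemma lcongXz x y (k : int) : uloc x -> uloc y -> lcong x y -> lcong (x ^ k) (y ^ k).
Proof.
move=> ux uy xy; case: k => k; first by apply: lcongX; [case: ux | case: uy|].
rewrite !NegzE -!exprnN; apply: lcongV; [exact: ulocX | exact: ulocX|].
by apply: lcongX => //; [case: ux | case: uy].
Qed.

Lemma lcong_uloc x y : lcong x y -> uloc y -> uloc x.
Proof.
move=> xy [ly my]; split.
  by rewrite -(subrK y x); apply: locD => //; apply: mloc_loc.
by move=> mx; apply: my; rewrite -(subKr x y); apply/mlocD/mlocN.
Qed.

Lemma lcong_nat i j : lcong i%:R j%:R -> (i = j %[mod p])%N.
Proof.
rewrite /lcong -[i%:R]/(i%:~R) -[j%:R]/(j%:~R) -rmorphB => /mloc_int_dvd pij.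
by apply/eqP; rewrite -eqz_nat -eqz_mod_dvd in pij *; rewrite -!modz_nat.
Qed.

End LocalRing.

Section Valuation.
Variables (p a m : nat) (z : algC) (P : algC -> Prop).
Hypotheses (p_prime : prime p) (pm : coprime p m) (P_p : prime_over p P).
Hypothesis zn : (p ^ a * m).-primitive_root z.
Local Notation pi := (unif p a m z).

Let pi0 : pi != 0 := unif_neq0 p_prime zn.
Let Zpi : Zadj z pi := Zadj_unif p a m z.
Let Zint x : Zadj z x -> x \in Aint := @Zadj_Aint _ z x zn.

Lemma Zunit_uloc u : Zunit z u -> uloc P u.
Proof.
move=> [zu zv u0]; apply: (uloc_Aint P_p (Zint zu)) => Pu.
apply: (prime_over1 P_p); rewrite -(mulVf u0); apply: (prime_overM P_p) => //.
exact: Zint.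
Qed.

Lemma P_unif : P pi.
Proof.
have [[|c] [u [// _ uu Ep]]] := unif_pow p_prime zn.
have [zu _ _] := uu; have [_ nPu] := Zunit_uloc uu.
have : mloc P (pi ^+ c.+1 * u) by rewrite -Ep; apply: (mloc_p P_p).
have lpi k : loc P (pi ^+ k) by apply/(loc_Aint P_p)/Zint/ZadjX.
have lu : loc P u by apply/(loc_Aint P_p)/Zint.
case/(mloc_prime P_p (lpi _) lu) => // mpi.
apply: (mloc_P P_p (Zint Zpi)).
elim: c.+1 mpi => [|k IH]; first by move/(mloc1 P_p).
by rewrite exprS; case/(mloc_prime P_p (lpi 1%N) (lpi k)).
Qed.

Lemma Zcong_lcong x y : Zcong z pi x y -> lcong P x y.
Proof.
case=> r zr Exy; rewrite /lcong Exy mulrC; apply: (mlocM P_p).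
  exact/(loc_Aint P_p)/Zint.
exact/(P_mloc P_p)/P_unif.
Qed.

(** The units at P inside Q(z). Unlike in [uloc], numerator and denominator are polynomials in z, so
    the effect of an automorphism modulo P can be computed. *)
Definition zunit (u : algC) : Prop :=
  exists y w, [/\ Zadj z y, Zadj z w, ~ P y, ~ P w & u = y / w].

Lemma zunit_uloc u : zunit u -> uloc P u.
Proof.
move=> [y [w [zy zw Py Pw ->]]]; apply: (ulocM P_p).
  exact: (uloc_Aint P_p (Zint zy) Py).
apply: (ulocV P_p); exact: (uloc_Aint P_p (Zint zw) Pw).
Qed.

Lemma zunitM u v : zunit u -> zunit v -> zunit (u * v).
Proof.
move=> [y [w [zy zw Py Pw ->]]] [y' [w' [zy' zw' Py' Pw' ->]]].
exists (y * y'), (w * w'); split; try exact: ZadjM.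
- exact: (notPM P_p (Zint zy) (Zint zy') Py Py').
- exact: (notPM P_p (Zint zw) (Zint zw') Pw Pw').
by rewrite mulf_div.
Qed.

Lemma zunitV u : zunit u -> zunit u^-1.
Proof.
by move=> [y [w [zy zw Py Pw ->]]]; exists w, y; split; rewrite ?invf_div.
Qed.

Lemma zunit_notP y : Zadj z y -> ~ P y -> zunit y.
Proof.
move=> zy Py; exists y, 1; split; rewrite ?divr1 //; first exact: Zadj1.
exact: (prime_over1 P_p).
Qed.

Definition hasval (v : int) (x : algC) : Prop :=
  exists2 u, zunit u & x = pi ^ v * u.

Lemma hasvalM v w x y : hasval v x -> hasval w y -> hasval (v + w) (x * y).
Proof.
move=> [u uu ->] [t ut ->]; exists (u * t); first exact: zunitM.
by rewrite expfzDr // mulrACA.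
Qed.

Lemma hasvalV v x : hasval v x -> hasval (- v) x^-1.
Proof.
by move=> [u uu ->]; exists u^-1; [apply: zunitV | rewrite invfM invr_expz].
Qed.

Lemma hasval_zunit u : zunit u -> hasval 0 u.
Proof. by move=> uu; exists u; rewrite ?expr0z ?mul1r. Qed.

Lemma hasval1 : hasval 0 1.
Proof. exact/hasval_zunit/zunit_notP/(prime_over1 P_p)/Zadj1. Qed.

Lemma hasvalX v x k : hasval v x -> hasval (v * k%:Z) (x ^+ k).
Proof.
move=> vx; elim: k => [|k IH]; first by rewrite mulr0; apply: hasval1.
by rewrite exprS intS mulrDr mulr1; apply: hasvalM.
Qed.

Lemma hasval_prod I (r : seq I) (Q : pred I) v F :
  (forall i, Q i -> hasval (v i) (F i)) ->
  hasval (\sum_(i <- r | Q i) v i) (\prod_(i <- r | Q i) F i).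
Proof.
move=> vF; apply: (big_ind2 hasval) => //; first exact: hasval1.
by move=> *; apply: hasvalM.
Qed.

Lemma hasval_uloc v x : hasval v x -> uloc P x -> v = 0.
Proof.
move=> [u /zunit_uloc uu ->] ux.
have upi : uloc P (pi ^ v).
  have -> : pi ^ v = pi ^ v * u * u^-1 by rewrite mulfK ?(uloc_neq0 P_p).
  by apply: (ulocM P_p) => //; apply: (ulocV P_p).
have mpi k : ~ uloc P (pi ^+ k.+1).
  case=> _ []; rewrite exprSr; apply: (mlocM P_p); last exact/(P_mloc P_p)/P_unif.
  exact/(loc_Aint P_p)/Zint/ZadjX.
case: v upi {ux} => [[|k] upi|k] //; first by case: (mpi k).
rewrite NegzE -exprnN => /(ulocV P_p); rewrite invrK => /mpi[].
Qed.

Lemma hasval_inj v w x : hasval v x -> hasval w x -> v = w.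
Proof.
move=> vx wx; have x0 : x != 0.
  have [u /zunit_uloc/(uloc_neq0 P_p) u0 ->] := vx.
  by rewrite mulf_neq0 ?expfz_neq0.
apply/eqP; rewrite -subr_eq0; apply/eqP.
apply: (@hasval_uloc _ (x / x)); first exact/hasvalM/hasvalV.
by rewrite mulfV //; apply: (uloc1 P_p).
Qed.

Lemma hasval_uloc_zunit x : hasval 0 x -> zunit x.
Proof. by case=> u uu ->; rewrite expr0z mul1r. Qed.

Lemma hasval_loc v x : hasval v x -> loc P x -> 0 <= v.
Proof.
move=> vx lx; case: v vx => // k [u uu Ex]; exfalso.
have uu' := zunit_uloc uu.
apply: (mloc1 P_p); have -> : 1 = x * (pi ^+ k.+1 * u^-1).
  rewrite Ex NegzE -exprnN mulrACA mulVf ?mul1r ?mulfV ?expf_neq0 //.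
  exact: (uloc_neq0 P_p uu').
apply: (mlocM P_p) => //; apply: (mlocMr P_p); last by case: (ulocV P_p uu').
rewrite exprSr; apply: (mlocM P_p); last exact/(P_mloc P_p)/P_unif.
exact/(loc_Aint P_p)/Zint/ZadjX.
Qed.

(* If [y] is in [P], some [e] outside [P] makes [e * y] divisible by the
   uniformizer, because [y ^+ Q] is congruent to [y] for a power [Q] of [p];
   the norm of [y] bounds the number of times this can be repeated. *)
Lemma hasval_Zadj_bounded k y y' u : Zadj z y -> Zadj z y' -> uloc P u ->
  y * y' = pi ^+ k * u -> exists v, hasval v y.
Proof.
elim: k y u => [|k IH] y u zy zy' uu Eyy'.
  exists 0; apply: hasval_zunit; apply: zunit_notP => // Py.
  case: uu => _ []; rewrite -[u]mul1r -(expr0 pi) -Eyy'.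
  by apply: (mlocMr P_p); [apply: (P_mloc P_p) | apply/(loc_Aint P_p)/Zint].
have [Py|Py] := pselect (P y); last first.
  by exists 0; apply/hasval_zunit/zunit_notP.
have m_gt0 : (0 < m)%N.
  by have := prim_order_gt0 zn; rewrite muln_gt0 => /andP[].
pose Q := (p ^ (totient m * 1))%N.
have Q_gt1 : (1 < Q)%N.
  by rewrite /Q muln1 -(expn0 p) ltn_exp2l ?prime_gt1 ?totient_gt0.
pose e := 1 - y ^+ Q.-1.
have ze : Zadj z e by apply: ZadjB; [apply: Zadj1 | apply: ZadjX].
have Pe : ~ P e.
  move=> Pe; apply: (prime_over1 P_p); rewrite -(subrK (y ^+ Q.-1) 1).
  apply: (prime_overD P_p) => //; case: Q Q_gt1 {e ze Pe} => [|[|q]] // _ /=.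
  by rewrite exprSr; apply: (prime_overM P_p) => //; apply/Zint/ZadjX.
have [r zr Er] := Zcong_sym (Zcong_Frobenius p_prime pm zn 1 zy).
have Eye : y * e = pi * r.
  by rewrite -Er mulrBr mulr1 -exprS prednK // ltnW.
have ue : uloc P e by apply: (uloc_Aint P_p) => //; apply: Zint.
have [|v vr] := IH r (u * e) zr zy' (ulocM P_p uu ue).
  by apply: (mulfI pi0); rewrite [LHS]mulrA -Eye mulrAC Eyy' exprS !mulrA.
exists (v + 1); rewrite -(mulfK (uloc_neq0 P_p ue) y) Eye (mulrC pi).
rewrite -[v + 1]addr0; apply: hasvalM.
  apply: hasvalM vr _; exists 1; last by rewrite expr1z mulr1.
  exact/zunit_notP/(prime_over1 P_p)/Zadj1.
exact/hasval_zunit/zunitV/zunit_notP.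
Qed.

Lemma Zunit_zunit u : Zunit z u -> zunit u.
Proof.
move=> uu; have [zu _ _] := uu; apply: zunit_notP => // Pu.
by have [_ []] := Zunit_uloc uu; apply: (P_mloc P_p).
Qed.

Lemma zunitX u k : zunit u -> zunit (u ^+ k).
Proof.
move=> uu; elim: k => [|k IH]; rewrite ?exprS; last exact: zunitM.
exact/zunit_notP/(prime_over1 P_p)/Zadj1.
Qed.

Lemma hasval_nat d : (0 < d)%N -> exists v, hasval v d%:R.
Proof.
move=> d_gt0; have [c [u [c_gt0 uu Ep]]] := unif_pow p_prime zn.
pose e := (d`_p^')%N; pose l := logn p d.
have Ed : (d%:R : algC) = p%:R ^+ l * e%:R.
  by rewrite -natrX -p_part -natrM partnC.
exists (c%:Z * l%:Z); exists (u ^+ l * e%:R); last first.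
  by rewrite Ed {1}Ep exprMn -mulrA exprnP -exprz_exp.
have pe : ~ P e%:R.
  move/(@P_int_dvd p P p_prime P_p e); apply/negP.
  rewrite dvdzE /= -prime_coprime //.
  rewrite coprime_sym; apply: (pnat_coprime (part_pnat _ _)).
  by rewrite pnatNK pnat_id.
apply: zunitM; last exact/zunit_notP/pe/Zadj_nat.
exact/zunitX/Zunit_zunit.
Qed.

(** Clearing the denominators of x and then of 1/y, y = d x, gives y y' = d' with y and y' in Z[z]
    and d' a positive integer, whose valuation bounds that of y. *)
Lemma hasval_adj x : adj z x -> x != 0 -> exists v, hasval v x.
Proof.
move=> zx x0; have [d d_gt0 zdx] := adj_Zadj zx.
have d0 : d%:R != 0 :> algC by rewrite pnatr_eq0 -lt0n.
set y := d%:R * x in zdx; have y0 : y != 0 by rewrite mulf_neq0.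
have [d' d'_gt0 zy'] : exists2 d', (0 < d')%N & Zadj z (d'%:R * y^-1).
  exact/adj_Zadj/adjV/Zadj_adj.
have [w vd'] := hasval_nat d'_gt0.
have w_ge0 : 0 <= w.
  by apply: hasval_loc vd' _; apply: (loc_Aint P_p); rewrite rpred_nat.
case: w w_ge0 vd' => // w _ [u uu Ed'].
have [|v vy] := hasval_Zadj_bounded zdx zy' (zunit_uloc uu) (k := w).
  by rewrite -Ed' mulrCA mulfV ?mulr1.
have [v' vd] := hasval_nat d_gt0; exists (v - v').
by have := hasvalM vy (hasvalV vd); rewrite /y mulrAC mulfV ?mul1r.
Qed.

Section Automorphism.
Variables (g : Aut) (t : nat).
Hypothesis gz : g z = z ^+ t.

Lemma aut_horner (f : {poly int}) : g (pZC f).[z] = (pZC f).[z ^+ t].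
Proof.
rewrite -horner_map gz; congr (_.[_]).
by rewrite -map_poly_comp; apply: eq_map_poly => b /=; rewrite rmorph_int.
Qed.

Section Inertia.
Hypotheses (a_gt0 : (0 < a)%N) (tm : (t = 1 %[mod m])%N) (tp : coprime t p).

Lemma inertia_Zadj y : Zadj z y -> lcong P (g y) y.
Proof.
move=> [f ->]; rewrite aut_horner; apply: Zcong_lcong.
apply: Zcong_horner; [exact/ZadjX/Zadj_root | exact: Zadj_root|].
by rewrite -[X in Zcong _ _ _ X]expr1; apply: (Zcong_exp_unif zn).
Qed.

Lemma inertia_zunit u : zunit u -> lcong P (g u / u) 1.
Proof.
move=> uu; have ul := zunit_uloc uu; have [y [w [zy zw Py Pw Eu]]] := uu.
have yl := uloc_Aint P_p (Zint zy) Py; have wl := uloc_Aint P_p (Zint zw) Pw.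
have gwl := lcong_uloc P_p (inertia_Zadj zw) wl.
have gu : lcong P (g u) u.
  rewrite Eu fmorph_div; apply: (lcongM P_p).
  - by case: yl.
  - by case: (ulocV P_p gwl).
  - exact: inertia_Zadj.
  - by apply: (lcongV P_p) => //; apply: inertia_Zadj.
rewrite -[1](mulfV (uloc_neq0 P_p ul)); apply: (lcongM P_p) => //.
- by case: ul.
- by case: (ulocV P_p ul).
- exact: lcong_refl P_p _.
Qed.

Lemma inertia_unif : lcong P (g pi / pi) t%:R.
Proof.
have -> : g pi = pi * \sum_(i < t) (z ^+ m) ^+ i.
  rewrite {1}/unif gtn_eqF // rmorphB rmorph1 rmorphXn /= gz -exprM mulnC exprM.
  by rewrite -(opprB _ 1) subrX1 -mulNr opprB /unif gtn_eqF.
rewrite mulrAC mulfV // mul1r.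
have -> : t%:R = \sum_(i < t) 1 :> algC by rewrite sumr_const card_ord.
apply: Zcong_lcong; apply: Zcong_sum => i _.
rewrite -exprM -(expr0 z); apply: (Zcong_exp_unif zn).
by rewrite modnMr mod0n.
Qed.

Lemma uloc_nat : uloc P t%:R.
Proof.
apply: (uloc_Aint P_p); first by rewrite rpred_nat.
move/(@P_int_dvd p P p_prime P_p t); apply/negP.
by rewrite dvdzE /= -prime_coprime // coprime_sym.
Qed.

(** The tame character of inertia: g multiplies the uniformizer by 1 + w + ... + w^(t-1), w = z^m,
    which is congruent to t, and multiplies a unit at P by a factor congruent to 1. *)
Lemma inertia_lcong v x : hasval v x -> lcong P (g x / x) (t%:R ^ v).
Proof.
move=> [u uu ->]; have ul := uloc_nat; have uz := zunit_uloc uu.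
have -> : g (pi ^ v * u) / (pi ^ v * u) = (g pi / pi) ^ v * (g u / u).
  by rewrite rmorphM fmorphXz invfM mulrACA expfzMl expfV.
rewrite -[t%:R ^ v]mulr1; apply: (lcongM P_p).
- by case: (ulocXz P_p v ul).
- by case: (lcong_uloc P_p (inertia_zunit uu) (uloc1 P_p)).
- apply: (lcongXz P_p) => //; last exact: inertia_unif.
  exact: (lcong_uloc P_p inertia_unif ul).
- exact: inertia_zunit.
Qed.

End Inertia.

Section Frobenius.
Hypotheses (tp : (t = p %[mod m])%N) (ta : (t = 1 %[mod p ^ a])%N).

Lemma Frobenius_unif : g pi = pi.
Proof.
rewrite /unif; case: ifP => _; first by rewrite rmorph_nat.
rewrite rmorphB rmorph1 rmorphXn /= gz -exprM; congr (1 - _).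
apply/eqP; rewrite (eq_prim_root_expr zn); apply/eqP.
by have /= := congr1 (muln^~ m) ta; rewrite !muln_modl mul1n.
Qed.

Lemma Frobenius_Zadj y : Zadj z y -> lcong P (g y) (y ^+ p).
Proof.
move=> [f ->]; rewrite aut_horner; apply: Zcong_lcong.
apply: Zcong_trans (Zcong_sym _); last first.
  exact/(Zcong_unif_p p_prime zn)/(Frobenius_horner p_prime)/Zadj_root.
apply: Zcong_horner; [exact/ZadjX/Zadj_root | exact/ZadjX/Zadj_root |].
exact: (Zcong_exp_unif zn).
Qed.

Lemma Frobenius_notP y : Zadj z y -> ~ P y -> ~ P (g y).
Proof.
move=> zy Py Pgy; have yl := uloc_Aint P_p (Zint zy) Py.
have := lcong_uloc P_p (Frobenius_Zadj zy) (ulocX P_p p yl).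
by case=> _ []; apply: (P_mloc P_p).
Qed.

Lemma Frobenius_zunit u : zunit u -> zunit (g u) /\ lcong P (g u) (u ^+ p).
Proof.
move=> [y [w [zy zw Py Pw ->]]]; split.
  exists (g y), (g w); rewrite fmorph_div; split=> //; try exact: Zadj_aut zn _.
    exact: Frobenius_notP.
  exact: Frobenius_notP.
have yl := uloc_Aint P_p (Zint zy) Py; have wl := uloc_Aint P_p (Zint zw) Pw.
have wlp := ulocX P_p p wl.
have gwl := lcong_uloc P_p (Frobenius_Zadj zw) wlp.
rewrite fmorph_div expr_div_n; apply: (lcongM P_p).
- by case: (ulocX P_p p yl).
- by case: (ulocV P_p gwl).
- exact: Frobenius_Zadj.
- by apply: (lcongV P_p) => //; apply: Frobenius_Zadj.
Qed.

(** g is trivial on the roots of unity of p-power order, hence fixes the uniformizer; it is a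
    Frobenius modulo P, hence preserves the units at P. *)
Lemma Frobenius_hasval v x : hasval v x -> hasval v (g x).
Proof.
move=> [u uu ->]; exists (g u); first by case: (Frobenius_zunit uu).
by rewrite rmorphM fmorphXz /= Frobenius_unif.
Qed.

End Frobenius.
End Automorphism.
End Valuation.

(** * Inertia in Kummer extensions and tame descent *)

Lemma primitive_root_mod p : prime p ->
  exists w : nat, coprime w p /\
    forall k, (w ^ k = 1 %[mod p])%N -> (p.-1 %| k)%N.
Proof.
move=> p_prime; pose rs := [seq x : 'F_p <- enum 'F_p | x != 0].
have size_rs : size rs = p.-1.
  have := cardC1 (0 : 'F_p); rewrite card_Fp // cardE /enum_mem -enumT => <-.
  congr size; apply: eq_filter => x; exact: erefl.
have /hasP[x xrs xprim] : has p.-1.-primitive_root rs.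
  apply: has_prim_root.
  - by rewrite -ltnS prednK ?prime_gt0 ?prime_gt1.
  - apply/allP => x; rewrite mem_filter => /andP[x0 _]; rewrite unity_rootE.
    rewrite -(inj_eq (mulfI x0)) mulr1 -exprS prednK ?prime_gt0 //.
    by have := expf_card x; rewrite card_Fp // => ->.
  - by rewrite filter_uniq ?enum_uniq.
  - by rewrite size_rs.
exists x; split.
  rewrite coprime_sym prime_coprime //; apply/negP => px.
  have : (x : nat)%:R = 0 :> 'F_p by apply/eqP; rewrite -(dvdn_pcharf (pchar_Fp p_prime)).
  rewrite natr_Zp => x0; move: xrs; rewrite x0 mem_filter eqxx //.
move=> k xk; rewrite (prim_order_dvd xprim) -[x in x ^+ k]natr_Zp -natrX.
by rewrite -(Fp_nat_mod p_prime) xk (Fp_nat_mod p_prime).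
Qed.

Lemma lcong_exp_dvd p (P : algC -> Prop) t (v : int) : prime p ->
  prime_over p P -> coprime t p -> lcong P (t%:R ^ v) 1 ->
  (forall k, (t ^ k = 1 %[mod p])%N -> (p.-1 %| k)%N) -> (p.-1%:Z %| v)%Z.
Proof.
move=> p_prime P_p tp tv tprim; have ut := uloc_nat p_prime P_p tp.
have pos k : lcong P (t%:R ^+ k) 1 -> (p.-1 %| k)%N.
  move=> tk; apply: tprim; apply: (lcong_nat p_prime P_p).
  by rewrite natrX.
case: v tv => k tk; first by rewrite dvdzE /=; apply: pos.
rewrite dvdzE NegzE abszN /=; apply: pos.
have := lcongV P_p (ulocV P_p (ulocX P_p k.+1 ut)) (uloc1 P_p).
by rewrite invrK invr1; apply; move: tk; rewrite NegzE -exprnN.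
Qed.

Section Kummer.
Variables (n l : nat) (z alpha : algC).
Hypotheses (zn : n.-primitive_root z) (l_prime : prime l) (ln : (l %| n)%N).
Hypotheses (alpha0 : alpha != 0) (ab_alpha : abelianC alpha).
Hypothesis alphal : adj z (alpha ^+ l).
Local Notation zl := (z ^+ (n %/ l)).

Lemma kummer_prim : l.-primitive_root zl.
Proof. exact: dvdn_prim_root. Qed.

Lemma kummer_aut (g : Aut) t e : g z = z ^+ t -> (t = e %[mod l])%N ->
  g zl = zl ^+ e.
Proof.
move=> gz te; rewrite rmorphXn /= gz [LHS]exprAC.
by rewrite -(prim_expr_mod kummer_prim) te (prim_expr_mod kummer_prim).
Qed.

Lemma kummer_root (h : Aut) : h (alpha ^+ l) = alpha ^+ l ->
  exists j, h alpha = zl ^+ j * alpha.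
Proof.
move=> ha; have : (h alpha / alpha) ^+ l = 1.
  by rewrite expr_div_n -rmorphXn /= ha mulfV // expf_neq0.
by case/(prim_rootP kummer_prim) => j Ej; exists j; rewrite -Ej divfK.
Qed.

Lemma kummer_fix (h : Aut) : h z = z -> exists j, h alpha = zl ^+ j * alpha.
Proof. by move=> hz; apply/kummer_root/alphal. Qed.

(** An automorphism h over Q(z) multiplies alpha by some zl^j. Since g and h commute on alpha, it
    multiplies g(alpha) by g(zl^j) = zl^(e j), which is also its factor on alpha^e. *)
Lemma kummer_quot (g : Aut) e : g zl = zl ^+ e -> adj z (g alpha / alpha ^+ e).
Proof.
move=> gzl h hz; have [j hj] := kummer_fix hz.
rewrite fmorph_div rmorphXn /= ab_alpha hj rmorphM rmorphXn /= gzl.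
rewrite exprMn (exprAC zl e j) -mulf_div mulfV ?mul1r //.
by rewrite !expf_neq0 // (prim_root_neq0 zn).
Qed.

Lemma kummer_iter (g : Aut) : g zl = zl -> g (alpha ^+ l) = alpha ^+ l ->
  iter l g alpha = alpha.
Proof.
move=> gzl /kummer_root[j gj].
have E k : iter k g alpha = zl ^+ (j * k) * alpha.
  elim: k => [|k IH] /=; first by rewrite muln0 expr0 mul1r.
  by rewrite IH rmorphM rmorphXn /= gzl gj mulrA -exprD mulnS addnC.
by rewrite E mulnC exprM (prim_expr_order kummer_prim) expr1n mul1r.
Qed.

End Kummer.

(** If y were not 1, the sum 1 + y + ... + y^(l-1) would vanish, whereas it is congruent to l, which
    is not in P. *)
Lemma prime_over_unity_root p l (P : algC -> Prop) y : prime p -> prime l ->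
  p != l -> prime_over p P -> y \in Aint -> y ^+ l = 1 -> lcong P y 1 -> y = 1.
Proof.
move=> p_prime l_prime pl P_p yint yl y1; apply/eqP/negPn/negP => ny1.
have sum0 : \sum_(i < l) y ^+ i = 0.
  apply: (mulfI (_ : y - 1 != 0)); first by rewrite subr_eq0.
  by rewrite mulr0 -subrX1 yl subrr.
have lc : lcong P (\sum_(i < l) y ^+ i) (\sum_(i < l) 1).
  rewrite /lcong -sumrB; apply: big_ind; [exact: mloc0 P_p| exact: mlocD P_p|].
  move=> i _; rewrite -[X in _ - X](expr1n _ i); apply: (lcongX P_p) => //.
    exact: loc_Aint P_p _ _.
  by case: (uloc1 P_p).
move: lc; rewrite sum0 sumr_const card_ord => lc.
have := lcong_nat p_prime P_p (i := 0) (j := l) lc.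
by rewrite mod0n => /esym/eqP; rewrite -/(dvdn _ _) dvdn_prime2 // (negPf pl).
Qed.

Lemma iter_quot_prod (g : Aut) (x b : algC) k : g x = b * x ->
  iter k g x = \prod_(i < k) iter i g b * x.
Proof.
move=> gx; elim: k => [|k IH] /=; first by rewrite big_ord0 mul1r.
rewrite IH rmorphM gx mulrA big_ord_recl /= (mulrC b) rmorph_prod.
by congr (_ * _ * _).
Qed.

(* Let [v] be the valuation of [alpha ^+ l] above [p].  Commutation of an inertia
   element with a Frobenius shows that the inertia acts trivially to first order
   on an element of valuation [v * (1 - p) / l], so that [l] divides [v]. *)
Lemma tame_iter p a m l z (alpha : algC) (g : Aut) t :
  prime p -> coprime p m -> (p ^ a * m).-primitive_root z ->
  prime l -> l != p -> (l %| m)%N ->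
  alpha != 0 -> abelianC alpha -> adj z (alpha ^+ l) ->
  g z = z ^+ t -> (t = 1 %[mod m])%N -> (t ^ l = 1 %[mod p ^ a * m])%N ->
  iter l g alpha = alpha.
Proof.
move=> p_prime pm zn l_prime lp lm alpha0 ab_alpha alphal gz tm tl.
set n := (p ^ a * m)%N in zn tl.
have ln : (l %| n)%N by rewrite dvdn_mull.
set zl := z ^+ (n %/ l).
have zl_prim : l.-primitive_root zl := dvdn_prim_root zn ln.
have modl i j : (i = j %[mod m])%N -> (i = j %[mod l])%N.
  by move=> ij; rewrite -(modn_dvdm i lm) ij modn_dvdm.
have gzl : g zl = zl.
  by rewrite /zl (kummer_aut zn ln gz (modl _ _ tm)) expr1.
have [a0|a_gt0] := posnP a.
  apply: (kummer_iter zn ln) => //; apply: alphal; rewrite gz.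
  by move: zn; rewrite /n a0 expn0 mul1n => zn; rewrite -(prim_expr_mod zn) tm (prim_expr_mod zn) expr1.
have [P P_p] := prime_over_exists p_prime.
have tp : coprime t p.
  have := fmorph_primitive_root g n z; rewrite zn gz (prim_root_exp_coprime _ zn).
  by rewrite /n coprimeMr coprime_pexpr // => /andP[].
pose A := alpha ^+ l; have A0 : A != 0 by rewrite expf_neq0.
have [v vA] := hasval_adj p_prime pm P_p zn alphal A0.
have ppa : coprime (p ^ a) m by rewrite coprimeXl.
have [w [wp wprim]] := primitive_root_mod p_prime.
(* [t1] is the exponent of a Frobenius lift that is trivial on the p-part; [t0] below is that of an
   inertia element, a primitive root modulo p and trivial on the prime-to-p part. *)
have [t1 [t1m t1a]] : exists t1, (t1 = p %[mod m])%N /\ (t1 = 1 %[mod p ^ a])%N.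
  by exists (chinese (p ^ a) m 1 p); rewrite chinese_modl // chinese_modr.
have [t0 [t0m t0a]] : exists t0, (t0 = 1 %[mod m])%N /\ (t0 = w %[mod p ^ a])%N.
  by exists (chinese (p ^ a) m w 1); rewrite chinese_modl // chinese_modr.
have pdva : (p %| p ^ a)%N by rewrite dvdn_exp.
have t0p : (t0 = w %[mod p])%N by rewrite -(modn_dvdm t0 pdva) t0a modn_dvdm.
have t0cp : coprime t0 p by rewrite -coprime_modl t0p coprime_modl.
have co_n i : coprime i p -> coprime i m -> coprime i n.
  by move=> ip im; rewrite /n coprimeMr coprimeXr.
have [phi phiE] : exists phi : Aut, forall x, x ^+ n = 1 -> phi x = x ^+ t1.
  apply: aut_exp; apply: co_n; last by rewrite -coprime_modl t1m coprime_modl.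
  by rewrite -coprime_modl -(modn_dvdm t1 pdva) t1a modn_dvdm // coprime_modl coprime1n.
have [g0 g0E] : exists g0 : Aut, forall x, x ^+ n = 1 -> g0 x = x ^+ t0.
  by apply: aut_exp; apply: co_n => //; rewrite -coprime_modl t0m coprime_modl coprime1n.
have phiz : phi z = z ^+ t1 by apply/phiE/prim_expr_order.
have g0z : g0 z = z ^+ t0 by apply/g0E/prim_expr_order.
have phizl : phi zl = zl ^+ p by apply: (kummer_aut zn ln phiz); apply: modl.
have g0zl : g0 zl = zl ^+ 1 by apply: (kummer_aut zn ln g0z); apply: modl.
pose c := phi alpha / alpha ^+ p; pose b0 := g0 alpha / alpha.
have zc : adj z c by apply: (kummer_quot zn ln).
have zb0 : adj z b0 by rewrite /b0 -[X in _ / X]expr1; apply: (kummer_quot zn ln).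
have Ephi : phi alpha = c * alpha ^+ p by rewrite divfK // expf_neq0.
have Eg0 : g0 alpha = b0 * alpha by rewrite divfK.
have c0 : c != 0 by rewrite mulf_neq0 ?invr_neq0 ?expf_neq0 ?fmorph_eq0.
have b00 : b0 != 0 by rewrite mulf_neq0 ?invr_neq0 ?fmorph_eq0.
clearbody c b0.
have [vc vcc] := hasval_adj p_prime pm P_p zn zc c0.
have [vb vbb] := hasval_adj p_prime pm P_p zn zb0 b00.
(* Valuations in phi(A) = c^l A^p, where phi preserves the valuation of A. *)
have Evc : v = vc * l%:Z + v * p%:Z.
  have vphi := Frobenius_hasval p_prime P_p zn phiz t1m t1a vA.
  apply: (hasval_inj p_prime P_p zn vphi).
  have -> : phi A = c ^+ l * A ^+ p.
    by rewrite /A rmorphXn /= Ephi exprMn exprAC.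
  by apply: (hasvalM p_prime P_p zn); apply: (hasvalX p_prime P_p zn).
have ut0 : uloc P t0%:R := uloc_nat p_prime P_p t0cp.
have ub0 : zunit z P b0.
  apply: hasval_uloc_zunit; suff <- : vb = 0 by exact: vbb.
  have := inertia_lcong p_prime P_p zn g0z a_gt0 t0m t0cp vA => /(lcong_uloc P_p).
  move/(_ (ulocXz P_p v ut0)); have -> : g0 (alpha ^+ l) / alpha ^+ l = b0 ^+ l.
    by rewrite rmorphXn /= Eg0 exprMn mulfK.
  move/(hasval_uloc p_prime P_p zn (hasvalX p_prime P_p zn l vbb))/eqP.
  by rewrite mulf_eq0 => /orP[/eqP //|]; rewrite eqz_nat gtn_eqF ?prime_gt0.
(* Commutation of g0 and phi on alpha gives g0(c)/c = phi(b0)/b0^p, which is congruent to 1 because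
   phi is a Frobenius on the unit b0. So the tame character t0^vc is congruent to 1, with t0 a
   primitive root. *)
have vcdvd : (p.-1%:Z %| vc)%Z.
  apply: (lcong_exp_dvd p_prime P_p t0cp) => [|k]; last first.
    by rewrite -modnXm t0p modnXm; apply: wprim.
  apply: (lcong_trans P_p) (lcong_sym P_p _) _.
    exact: (inertia_lcong p_prime P_p zn g0z a_gt0 t0m t0cp vcc).
  have [ub1 bp] := Frobenius_zunit p_prime P_p zn phiz t1m ub0.
  have -> : g0 c / c = phi b0 / b0 ^+ p.
    apply/eqP; rewrite eqr_div ?expf_neq0 //; apply/eqP.
    apply: (mulIf (expf_neq0 p alpha0)); rewrite -!mulrA -exprMn.
    have := ab_alpha g0 phi; rewrite Ephi Eg0 !rmorphM rmorphXn /= Eg0 Ephi => ->.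
    by [].
  have ubp := ulocX P_p p (zunit_uloc P_p zn ub0).
  have lbV := ulocV P_p ubp; rewrite -(mulfV (uloc_neq0 P_p ubp)).
  apply: (lcongM P_p) => //; [by case: ubp | |exact: lcong_refl P_p _].
  by case: (ulocV P_p ubp).
have ldvd : (l%:Z %| v)%Z.
  case/dvdzP: vcdvd => k Ek; apply/dvdzP; exists (- k).
  have p1 : p.-1%:Z != 0 by rewrite eqz_nat -lt0n -ltnS prednK ?prime_gt0 ?prime_gt1.
  apply: (mulfI p1); have Ep : p%:Z = p.-1%:Z + 1.
    by rewrite -PoszD addn1 prednK ?prime_gt0.
  rewrite Ek Ep in Evc; have {}Evc : p.-1%:Z * v = - (k * p.-1%:Z * l%:Z).
    apply/eqP; rewrite -addr_eq0; apply/eqP; apply: (addIr v).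
    by rewrite add0r [RHS]Evc; ring.
  by rewrite Evc; ring.
pose b := g alpha / alpha.
have zb : adj z b.
  have gzl1 : g zl = zl ^+ 1 by rewrite expr1.
  by have := kummer_quot zn ln alpha0 ab_alpha alphal gzl1; rewrite expr1.
have Eg : g alpha = b * alpha by rewrite divfK.
have b_neq0 : b != 0 by rewrite mulf_neq0 ?invr_neq0 ?fmorph_eq0.
have ut := uloc_nat p_prime P_p tp.
have blv : lcong P (b ^+ l) (t%:R ^ v).
  rewrite /b expr_div_n -rmorphXn /=.
  exact: (inertia_lcong p_prime P_p zn gz a_gt0 tm tp vA).
have bl1 : lcong P (b ^+ l) 1.
  apply: (lcong_trans P_p) blv _; case/dvdzP: ldvd => k ->.
  rewrite mulrC -exprz_exp.
  have := lcongXz P_p k (ulocX P_p l ut) (uloc1 P_p); rewrite exp1rz; apply.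
  rewrite -natrX.
  have tlp : (t ^ l = 1 %[mod p])%N.
    have pn : (p %| n)%N by rewrite dvdn_mulr.
    by rewrite -(modn_dvdm _ pn) tl modn_dvdm.
  have tl_gt0 : (0 < t ^ l)%N.
    rewrite expn_gt0 lt0n; apply/orP; left; apply: contraTneq tp => ->.
    by rewrite /coprime gcd0n gtn_eqF ?prime_gt1.
  move/eqP: tlp; rewrite eqn_mod_dvd // => /dvdnP[q Eq].
  rewrite /lcong -(natrB _ tl_gt0) Eq natrM.
  apply: (mlocM P_p); last exact: (mloc_p P_p).
  by apply: (loc_Aint P_p); rewrite rpred_nat.
have ub : zunit z P b.
  have [w' vb'] := hasval_adj p_prime pm P_p zn zb b_neq0.
  apply: hasval_uloc_zunit; suff <- : w' = 0 by exact: vb'.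
  have := lcong_uloc P_p bl1 (uloc1 P_p).
  move/(hasval_uloc p_prime P_p zn (hasvalX p_prime P_p zn l vb'))/eqP.
  by rewrite mulf_eq0 => /orP[/eqP //|]; rewrite eqz_nat gtn_eqF ?prime_gt0.
have bu := zunit_uloc P_p zn ub.
have gbi i : lcong P (iter i g b) b.
  have [h hE] := aut_iter g i; rewrite -hE.
  have hz : h z = z ^+ (t ^ i) by rewrite hE (aut_iter_exp i gz).
  have hm : (t ^ i = 1 %[mod m])%N by rewrite -modnXm tm modnXm exp1n.
  rewrite -[h b](divfK b_neq0) -[X in lcong _ _ X]mul1r; apply: (lcongM P_p).
  - by case: (uloc1 P_p).
  - by case: bu.
  - exact: (inertia_zunit p_prime P_p zn hz hm ub).
  - exact: (lcong_refl P_p).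
have [j Ej] : exists j, iter l g alpha = zl ^+ j * alpha.
  have [h hE] := aut_iter g l; rewrite -hE; apply: (kummer_fix zn ln) => //.
  by rewrite hE (aut_iter_exp l gz) -(prim_expr_mod zn) tl (prim_expr_mod zn) expr1.
(* zl^j is the product of the g^i(b), i < l. Each is congruent to b, and b^l is congruent to t^v,
   hence to 1, because l divides v and t^l = 1 modulo p. The root of unity zl^j is therefore
   congruent to 1. *)
suff zj1 : zl ^+ j = 1 by rewrite Ej zj1 mul1r.
have Ezj : zl ^+ j = \prod_(i < l) iter i g b.
  by apply: (mulIf alpha0); rewrite -Ej (iter_quot_prod l Eg).
rewrite eq_sym in lp.
apply: (prime_over_unity_root p_prime l_prime lp P_p).
- by apply/rpredX/(Aint_prim_root zl_prim).
- by rewrite exprAC (prim_expr_order zl_prim) expr1n.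
apply: (lcong_trans P_p) _ bl1; rewrite Ezj -[l in b ^+ l]card_ord -prodr_const.
suff [] : loc P (\prod_(i < l) iter i g b) /\
  lcong P (\prod_(i < l) iter i g b) (\prod_(i < l) b) by [].
apply: (big_ind2 (fun x y => loc P x /\ lcong P x y)) => [||i _].
- by split; [case: (uloc1 P_p) | apply: (lcong_refl P_p)].
- move=> x y x' y' [lx xy] [lx' xy']; split; first exact: (locM P_p).
  apply: (lcongM P_p) => //.
  by rewrite -(subKr x y); apply: (locD P_p) => //; apply: (locN P_p); apply: (mloc_loc P_p).
split; last exact: gbi.
by case: (lcong_uloc P_p (gbi i) bu).
Qed.

(** Modulo l^2 the power (1 + l u)^i is 1 + i l u, and the sum of the i is l (l - 1)/2, a multiple
    of l because l is odd. So the sum is l modulo l^2. *)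
Lemma geometric_sum_odd l t : prime l -> odd l -> (t = 1 %[mod l])%N ->
  exists2 s, (\sum_(i < l) t ^ i = l * s)%N & coprime s l.
Proof.
move=> l_prime l_odd tl; have l_gt1 := prime_gt1 l_prime.
have [u ->] : exists u, t = (1 + l * u)%N.
  by exists (t %/ l)%N; rewrite {1}(divn_eq t l) tl modn_small // addnC mulnC.
have powc i : exists c, ((1 + l * u) ^ i = 1 + i * (l * u) + l * l * c)%N.
  elim: i => [|i [c IH]]; first by exists 0%N; rewrite expn0; lia.
  by exists (c + i * u * u + l * u * c)%N; rewrite expnS IH; ring.
have [c cE] : exists c : nat -> nat,
    forall i, ((1 + l * u) ^ i = 1 + i * (l * u) + l * l * c i)%N.
  by exists (fun i => projT1 (cid (powc i))) => i; case: (cid (powc i)).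
have /dvdnP[q Eq] : (l %| \sum_(i < l) i)%N.
  rewrite -(big_mkord xpredT id) bin2_sum prime_dvd_bin //=.
  by rewrite ltn_neqAle l_gt1 andbT; apply: contraTneq l_odd => <-.
exists (1 + l * (u * q + \sum_(i < l) c i))%N.
  rewrite (eq_bigr (fun i : 'I_l => 1 + i * (l * u) + l * l * c i)%N) //.
  rewrite !big_split /= sum1_card card_ord -big_distrl /= -big_distrr /= Eq; ring.
by rewrite -coprime_modl addnC mulnC modnMDl coprime_modl coprime1n.
Qed.

Lemma geometric_sum_two t : (t = 1 %[mod 4])%N ->
  (\sum_(i < 2) t ^ i = 2 * (t %/ 4 * 2 + 1))%N /\ coprime (t %/ 4 * 2 + 1) 2.
Proof.
move=> t4; rewrite big_ord_recl big_ord1 coprimen2 /= /bump /= expn1 expn0.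
by rewrite {1}(divn_eq t 4) t4; lia.
Qed.

(** In t^l - 1 = (t - 1)(1 + t + ... + t^(l-1)) the second factor contains l exactly once. *)
Lemma root_of_one_mod l a t s : prime l -> (0 < t)%N ->
  (\sum_(i < l) t ^ i = l * s)%N -> coprime s l -> (t ^ l = 1 %[mod l ^ a.+1])%N ->
  (t = 1 %[mod l ^ a])%N.
Proof.
move=> l_prime t_gt0 Es sl /eqP; rewrite eqn_mod_dvd ?expn_gt0 ?t_gt0 //.
rewrite subn1 predn_exp.
rewrite Es mulnCA expnS dvdn_pmul2l ?prime_gt0 // Gauss_dvdl; last first.
  by rewrite coprimeXl // coprime_sym.
by move=> dt; apply/eqP; rewrite eqn_mod_dvd // subn1.
Qed.

Lemma iter_comp_abelian (g h : Aut) k x : abelianC x ->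
  iter k (g \o h) x = iter k g (iter k h x).
Proof.
move=> abx; elim: k => //= k ->; congr (g _).
have [gk gkE] := aut_iter g k; have [hk hkE] := aut_iter h k.
by rewrite -!gkE -!hkE; apply: abelianC_aut.
Qed.

Section PowerIter.
Variables (n l : nat) (z alpha : algC).
Hypotheses (zn : n.-primitive_root z) (l_prime : prime l) (lln : (l * l %| n)%N).
Hypotheses (alpha0 : alpha != 0) (ab_alpha : abelianC alpha).
Hypothesis alphal : adj (z ^+ l) (alpha ^+ l).
Local Notation zl := (z ^+ (n %/ l)).

Let ln : (l %| n)%N. Proof. exact: dvdn_trans (dvdn_mulr l (dvdnn l)) lln. Qed.
Let zalphal : adj z (alpha ^+ l). Proof. exact: adj_exp alphal. Qed.

Let zlE : exists j, zl = (z ^+ l) ^+ j.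
Proof.
have /dvdnP[j Ej] : (l %| n %/ l)%N by rewrite dvdn_divRL.
by exists j; rewrite -exprM mulnC -Ej.
Qed.

Lemma power_iter_fix (g : Aut) : g (z ^+ l) = z ^+ l -> iter l g alpha = alpha.
Proof.
move=> gzl; apply: (kummer_iter zn ln alpha0); last exact: alphal.
by have [j ->] := zlE; rewrite rmorphXn /= gzl.
Qed.

Lemma power_iter_eq (g h : Aut) : g z = h z ->
  iter l g alpha = alpha -> iter l h alpha = alpha.
Proof.
move=> ghz gal; have [g' [gK Kg]] := aut_inv g.
have fixl : iter l (g' \o h) alpha = alpha.
  by apply: power_iter_fix; rewrite /= !rmorphXn /= -ghz gK.
have [u uE] := aut_iter g l; have [v vE] := aut_iter (g' \o h) l.
rewrite -[RHS]gal -[in RHS]fixl -(iter_comp_abelian g (g' \o h)) //.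
by apply: eq_iter => x /=; rewrite Kg.
Qed.

Lemma eqn_mod_prime_parts k t : (0 < k)%N -> (0 < t)%N ->
  (forall p, prime p -> (t = 1 %[mod p ^ logn p k])%N) -> (t = 1 %[mod k])%N.
Proof.
move=> k_gt0 t_gt0 tp; apply/eqP; rewrite eqn_mod_dvd //.
apply/dvdn_partP => // p; rewrite mem_primes => /and3P[/tp/eqP + _ _].
by rewrite eqn_mod_dvd // p_part.
Qed.

Lemma prime_part_coprime p k : prime p -> (0 < k)%N ->
  coprime p (k %/ p ^ logn p k).
Proof.
move=> p_prime k_gt0; rewrite -p_part -{1}(partnC p k_gt0) mulKn ?part_gt0 //.
rewrite coprime_sym; apply: (pnat_coprime (part_pnat _ _)).
by rewrite pnatNK pnat_id.
Qed.

(** Induction on the list s of primes at which t may differ from 1: by the Chinese remainder theorem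
    g agrees on z with g1 o g2, where g1 is concentrated at p and g2 is trivial there. Automorphisms
    commute on alpha, so the l-th iterates can be treated separately. *)
Lemma power_iter_primes (s : seq nat) (g : Aut) t : g z = z ^+ t ->
  (forall p, prime p -> p \notin s -> (t = 1 %[mod p ^ logn p n])%N) ->
  (t ^ l = 1 %[mod n])%N -> (t = 1 %[mod l ^ (logn l n).-1])%N ->
  iter l g alpha = alpha.
Proof.
have n_gt0 := prim_order_gt0 zn.
have n_gt1 : (1 < n)%N.
  by apply: leq_trans (dvdn_leq n_gt0 ln); apply: prime_gt1.
have co_gt0 i : coprime i n -> (0 < i)%N.
  by rewrite lt0n; apply: contraTneq => ->; rewrite /coprime gcd0n gtn_eqF.
elim: s g t => [|p s IH] g t gz ts tl tll.
  have ct : coprime t n.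
    by have := fmorph_primitive_root g n z; rewrite zn gz (prim_root_exp_coprime _ zn).
  have t1 : (t = 1 %[mod n])%N.
    by apply: eqn_mod_prime_parts => [||p pp] //; [apply: co_gt0 | apply: ts].
  apply: power_iter_fix; rewrite rmorphXn /= gz.
  by rewrite -(prim_expr_mod zn t) t1 (prim_expr_mod zn) expr1.
have [p_prime|pN] := boolP (prime p); last first.
  apply: (IH g t) => // q qp qs; apply: ts => //.
  by rewrite inE negb_or qs andbT; apply: contraTneq qp => ->.
have ct : coprime t n.
  by have := fmorph_primitive_root g n z; rewrite zn gz (prim_root_exp_coprime _ zn).
have Nn := pfactor_dvdnn p n; have pm := prime_part_coprime p_prime n_gt0.
set N := (p ^ logn p n)%N in Nn pm; set m := (n %/ N)%N in pm.
have En : n = (N * m)%N by rewrite mulnC divnK.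
have Nm : coprime N m by rewrite coprimeXl.
have [tN tm] : coprime t N /\ coprime t m.
  by apply/andP; rewrite -coprimeMr -En.
pose t1 := chinese N m t 1; pose t2 := chinese N m 1 t.
have t1N : (t1 = t %[mod N])%N by rewrite chinese_modl.
have t1m : (t1 = 1 %[mod m])%N by rewrite chinese_modr.
have t2N : (t2 = 1 %[mod N])%N by rewrite chinese_modl.
have t2m : (t2 = t %[mod m])%N by rewrite chinese_modr.
have c1 : coprime t1 n.
  rewrite En coprimeMr -coprime_modl t1N coprime_modl tN /=.
  by rewrite -coprime_modl t1m coprime_modl coprime1n.
have c2 : coprime t2 n.
  rewrite En coprimeMr -[X in _ && X]coprime_modl t2m coprime_modl tm andbT.
  by rewrite -coprime_modl t2N coprime_modl coprime1n.
have [g1 g1E] := aut_exp c1; have [g2 g2E] := aut_exp c2.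
have g1z : g1 z = z ^+ t1 by apply/g1E/prim_expr_order.
have g2z : g2 z = z ^+ t2 by apply/g2E/prim_expr_order.
have modn_iff i j : (i = j %[mod N])%N -> (i = j %[mod m])%N -> (i = j %[mod n])%N.
  by move=> ijN ijm; apply/eqP; rewrite En chinese_remainder // ijN ijm !eqxx.
have t12 : (t1 * t2 = t %[mod n])%N.
  apply: modn_iff.
    by rewrite -modnMm t1N t2N modnMm muln1.
  by rewrite -modnMm t1m t2m modnMm mul1n.
have mN i j d : (d %| n)%N -> (i = j %[mod n])%N -> (i = j %[mod d])%N.
  by move=> dn ij; rewrite -(modn_dvdm _ dn) ij modn_dvdm.
have mn : (m %| n)%N by rewrite En dvdn_mull.
have t1l : (t1 ^ l = 1 %[mod n])%N.
  apply: modn_iff; last by rewrite -modnXm t1m modnXm exp1n.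
  by rewrite -modnXm t1N modnXm; apply: mN tl.
have t2l : (t2 ^ l = 1 %[mod n])%N.
  apply: modn_iff; first by rewrite -modnXm t2N modnXm exp1n.
  by rewrite -modnXm t2m modnXm; apply: mN tl.
have part_m q : prime q -> q != p -> (q ^ logn q n %| m)%N.
  move=> qp q_p; have := pfactor_dvdnn q n; rewrite {2}En Gauss_dvdr //.
  by rewrite coprimeXl // coprimeXr // prime_coprime // dvdn_prime2.
have g1a : iter l g1 alpha = alpha.
  (* For p distinct from l this is tame inertia. For p = l the exponent is 1 modulo l^((logn l n) -
     1), so g1 fixes z^l and with it alpha^l. *)
  have [p_l|p_l] := eqVneq p l; last first.
    have lm : (l %| m)%N.
      have := ln; rewrite {1}En Gauss_dvdr //.
      by rewrite coprimeXr // prime_coprime // dvdn_prime2 // eq_sym.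
    apply: (@tame_iter p (logn p n) m l z alpha g1 t1) => //; rewrite -?En //.
    by rewrite eq_sym.
  apply: power_iter_fix; rewrite rmorphXn /= g1z exprAC.
  pose Nl := (l ^ (logn l n).-1)%N.
  have EN : N = (Nl * l)%N.
    by rewrite -expnSr prednK /N ?p_l // logn_gt0 mem_primes l_prime n_gt0.
  have Enl : n = (Nl * m * l)%N by rewrite {1}En EN mulnAC.
  have Nlm_gt0 : (0 < Nl * m)%N by move: n_gt0; rewrite {1}Enl muln_gt0 => /andP[].
  have zlm : (Nl * m).-primitive_root (z ^+ l).
    have := dvdn_prim_root zn (m := (Nl * m)%N).
    rewrite {1}Enl dvdn_mulr // => /(_ isT); suff -> : (n %/ (Nl * m) = l)%N by [].
    by rewrite Enl mulKn.
  have NlN : (Nl %| N)%N by rewrite EN dvdn_mulr.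
  rewrite -(prim_expr_mod zlm); suff -> : (t1 = 1 %[mod Nl * m])%N.
    by rewrite (prim_expr_mod zlm) expr1.
  apply/eqP; rewrite chinese_remainder; last exact: coprime_dvdl NlN Nm.
  by rewrite t1m eqxx andbT -(modn_dvdm _ NlN) t1N modn_dvdm // tll.
have g2a : iter l g2 alpha = alpha.
  apply: (IH g2 t2) => // [q qp qs|].
    have [->|q_p] := eqVneq q p; first exact: t2N.
    rewrite -(modn_dvdm _ (part_m q qp q_p)) t2m modn_dvdm ?part_m //.
    by apply: ts => //; rewrite inE negb_or q_p.
  have NlN : (l ^ (logn l n).-1 %| l ^ logn l n)%N by rewrite dvdn_exp2l // leq_pred.
  have [p_l|p_l] := eqVneq l p.
    have NlN' : (l ^ (logn l n).-1 %| N)%N by rewrite /N -p_l.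
    by rewrite -(modn_dvdm _ NlN') t2N modn_dvdm.
  have Nlm := dvdn_trans NlN (part_m l l_prime p_l).
  by rewrite -(modn_dvdm _ Nlm) t2m modn_dvdm.
apply: (@power_iter_eq (g1 \o g2)).
  rewrite /= g2z rmorphXn /= g1z gz -exprM.
  by rewrite -(prim_expr_mod zn) t12 (prim_expr_mod zn).
by rewrite iter_comp_abelian // g2a.
Qed.

(** The purpose: a nontrivial automorphism of Q(z, alpha) over Q(z) is not an l-th power in the
    Galois group, so the subgroup it generates can be split off. For l = 2 and t = 3 modulo 4 the
    sum 1 + t is divisible by 4; composing with complex conjugation, an involution, leads back to t
    = 1 modulo 4. *)
Theorem power_iter (g : Aut) : (4 %| n)%N -> iter l g z = z ->
  iter l g alpha = alpha.
Proof.
move=> n4; have n_gt0 := prim_order_gt0 zn.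
have n_gt1 : (1 < n)%N by apply: leq_trans (dvdn_leq n_gt0 n4).
have suffcond (h : Aut) t : h z = z ^+ t -> iter l h z = z ->
    (l = 2 -> t = 1 %[mod 4])%N -> iter l h alpha = alpha.
  move=> hz hlz t4.
  have ct : coprime t n.
    by have := fmorph_primitive_root h n z; rewrite zn hz (prim_root_exp_coprime _ zn).
  have t_gt0 : (0 < t)%N.
    by rewrite lt0n; apply: contraTneq ct => ->; rewrite /coprime gcd0n gtn_eqF.
  have tl : (t ^ l = 1 %[mod n])%N.
    apply/eqP; rewrite -(eq_prim_root_expr zn) expr1.
    by rewrite -(aut_iter_exp l hz) hlz.
  have tp p : p \notin primes n -> (t = 1 %[mod p ^ logn p n])%N.
    by rewrite -logn_gt0 lt0n negbK => /eqP->; rewrite expn0 !modn1.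
  apply: (@power_iter_primes (primes n) h t) => // [p _ /tp //|].
  have lnlog : (0 < logn l n)%N by rewrite logn_gt0 mem_primes l_prime n_gt0.
  have tln : (t ^ l = 1 %[mod l ^ (logn l n).-1.+1])%N.
    by rewrite prednK // -(modn_dvdm _ (pfactor_dvdnn l n)) tl modn_dvdm ?pfactor_dvdnn.
  have [l_odd|l_even] := boolP (odd l).
    have tl1 : (t = 1 %[mod l])%N.
      have : (t ^ l = 1 %[mod l])%N.
        by rewrite -(modn_dvdm _ ln) tl modn_dvdm.
      have t0l : (t ^ l = t %[mod l])%N.
        by have := fermat_little t l_prime.
      by rewrite t0l.
    have [s Es sl] := geometric_sum_odd l_prime l_odd tl1.
    exact: root_of_one_mod Es sl tln.
  have l2 : l = 2%N by case: (even_prime l_prime) l_even => [//|->].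
  have := geometric_sum_two (t4 l2); set s := (t %/ 4 * 2 + 1)%N.
  by rewrite -l2 => -[Es cs]; apply: root_of_one_mod Es cs tln.
move=> glz; have [t _ gz] := aut_prim_root g zn.
have [l2|l_neq2] := eqVneq l 2%N; last first.
  by apply: (suffcond g t) => // l2; rewrite l2 in l_neq2.
have n4_2 : (2 %| n)%N by apply: dvdn_trans n4.
have t_odd : odd t.
  have := fmorph_primitive_root g n z; rewrite zn gz (prim_root_exp_coprime _ zn).
  by move/(coprime_dvdr n4_2); rewrite coprimen2.
have [t4|t4] := boolP (t == 1 %[mod 4])%N.
  by apply: (suffcond g t) => // _; apply/eqP.
have t3 : (t = 3 %[mod 4])%N.
  have : (t %% 4 < 4)%N by rewrite ltn_mod.
  have : odd (t %% 4) by rewrite odd_mod.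
  by move: t4; case: (t %% 4)%N => [|[|[|[|]]]].
pose c : Aut := Num.conj.
have cK x : iter 2 c x = x by rewrite /= conjCK.
have cz : c z = z ^+ n.-1.
  have z1 : z * z ^+ n.-1 = 1 by rewrite -exprS prednK // (prim_expr_order zn).
  have nz1 : `|z| = 1.
    by apply/eqP; rewrite -(pexpr_eq1 n_gt0) // -normrX (prim_expr_order zn) normr1.
  apply: (mulfI (prim_root_neq0 zn)); rewrite z1.
  by rewrite /c /= -normCK nz1 expr1n.
have ghz : (g \o c) z = z ^+ (t * n.-1).
  by rewrite /= [c z]cz rmorphXn /= gz -exprM.
have abz := abelianC_adj zn (@adj_root z).
have t_n4 : (t * n.-1 = 1 %[mod 4])%N.
  rewrite -modnMml t3 modnMml; case/dvdnP: n4 n_gt0 => [[|k] ->] // _.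
  have -> : (3 * (k.+1 * 4).-1 = (3 * k + 2) * 4 + 1)%N by clear; lia.
  by rewrite modnMDl.
have := suffcond (g \o c) _ ghz _ (fun _ => t_n4).
by rewrite !iter_comp_abelian // l2 !cK -{1}l2 glz => ->.
Qed.

End PowerIter.

(** * Splitting off a Kummer extension of the l-th cyclotomic field *)

Lemma gal_to_aut (L : splittingFieldType rat) (iota : {rmorphism L -> algC})
  (g : gal_of {:L}) : exists h : Aut, forall x, h (iota x) = iota (g x).
Proof.
have [h hE] := extend_algC_subfield_aut iota g; exists h => x.
by rewrite -hE.
Qed.

Lemma aut_to_gal (L : splittingFieldType rat) (iota : {rmorphism L -> algC})
  (h : Aut) : exists g : gal_of {:L}, forall x, iota (g x) = h (iota x).
Proof.
have [h0 h0E] := restrict_aut_to_normal_num_field iota h.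
have homh : kHom 1 {:L} (linfun h0).
  apply/kHomP; split=> [x y _ _|x /vlineP[k ->]].
    by rewrite !lfunE /= rmorphM.
  by rewrite lfunE /= linearZ rmorph1.
have [g _ gE] := kHom_to_gal (K := 1%AS) (E := {:L}%AS) (M := {:L}%AS)
  (introT andP (conj (sub1v _) (subvf _))) (normalFieldf _) homh.
by exists g => x; rewrite -gE ?memvf // lfunE /= h0E.
Qed.

(** G modulo l-th powers is a vector space over F_l in which x is not 0. A subgroup maximal among
    those containing all l-th powers and avoiding x is a complement of the line of x: adjoining a
    further y brings in x, and the relation can be solved for y. *)
Lemma abelian_complement (gT : finGroupType) (G : {group gT}) x l :
  abelian G -> prime l -> x \in G -> (x ^+ l = 1)%g ->
  (forall y, y \in G -> (y ^+ l)%g != x) ->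
  exists B : {group gT}, [/\ B \subset G, x \notin B &
    forall y, y \in G -> exists2 b, b \in B & exists k, y = (b * x ^+ k)%g].
Proof.
move=> abG l_prime Gx xl notpow.
have cG y1 y2 : y1 \in G -> y2 \in G -> commute y1 y2.
  by move=> G1 G2; apply: (centsP abG).
pose P := [set (y ^+ l)%g | y in G].
have P_group : group_set P.
  apply/group_setP; split.
    by apply/imsetP; exists 1%g; rewrite ?group1 ?expg1n.
  move=> _ _ /imsetP[y1 G1 ->] /imsetP[y2 G2 ->].
  by rewrite -expgMn; [apply/imsetP; exists (y1 * y2)%g; rewrite ?groupM | apply: cG].
pose ok (B : {group gT}) := [&& P \subset B, B \subset G & x \notin B].
have [B /maxgroupP[/and3P[PB BG xB] Bmax]] : {B : {group gT} | maxgroup B ok}.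
  apply: ex_maxgroup; exists (Group P_group); rewrite /ok subxx /=.
  apply/andP; split; first by apply/subsetP => _ /imsetP[y Gy ->]; apply: groupX.
  by apply/imsetP => -[y Gy xy]; move: (notpow y Gy); rewrite -xy eqxx.
exists B; split=> // y Gy.
have [By|nBy] := boolP (y \in B); first by exists y => //; exists 0%N; rewrite mulg1.
have joinE : (B <*> <[y]>)%g = (B * <[y]>)%g.
  apply: cent_joinEr; rewrite cycle_subG; apply/centP => b Bb.
  exact: cG (subsetP BG _ Bb).
have : x \in (B <*> <[y]>)%G.
  apply/negPn/negP => xBy; move: nBy; rewrite -(Bmax (B <*> <[y]>)%G).
  - by rewrite (subsetP (joing_subr _ _)) ?cycle_id.
  - rewrite /ok xBy andbT (subset_trans PB (joing_subl _ _)) /=.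
    by rewrite join_subG BG cycle_subG.
  - exact: joing_subl.
rewrite /= joinE => /mulsgP[b _ Bb /cycleP[k ->] Ex].
have Byl i : (y ^+ (l * i))%g \in B.
  by rewrite expgM groupX // (subsetP PB) //; apply/imsetP; exists y.
have [lk|lk] := boolP (l %| k)%N.
  case/dvdnP: lk => i Ek; case/negP: xB.
  by rewrite Ex groupM // Ek mulnC Byl.
have k_gt0 : (0 < k)%N by rewrite lt0n; apply: contraNneq lk => ->; rewrite dvdn0.
have [u v Euv _] := egcdnP l k_gt0.
have g1 : gcdn k l = 1%N by apply/eqP; rewrite -/(coprime k l) coprime_sym prime_coprime.
have Eyu : (y ^+ (u * k) = y * y ^+ (l * v))%g.
  by rewrite Euv g1 addnC expgS mulnC.
have Exu : (x ^+ u = b ^+ u * y ^+ (u * k))%g.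
  rewrite Ex expgMn; last by apply: cG; [apply: (subsetP BG) | apply: groupX].
  by rewrite -expgM (mulnC k).
exists (b ^+ u * y ^+ (l * v))^-1%g.
  by rewrite groupV groupM ?Byl // groupX.
exists u; rewrite Exu Eyu.
have GB i : (y ^+ i)%g \in G by rewrite groupX.
have Gb i : (b ^+ i)%g \in G by rewrite groupX ?(subsetP BG).
have -> : (y * y ^+ (l * v) = y ^+ (l * v) * y)%g by apply: cG.
by rewrite (mulgA (b ^+ u)%g) mulKg.
Qed.

Lemma inverse_mod_prime l j : prime l -> ~~ (l %| j)%N ->
  exists j', (j * j' = 1 %[mod l])%N.
Proof.
move=> l_prime lj; have j_gt0 : (0 < j)%N.
  by rewrite lt0n; apply: contraNneq lj => ->; rewrite dvdn0.
have [u v Euv _] := egcdnP l j_gt0; exists u.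
have g1 : gcdn j l = 1%N.
  by apply/eqP; rewrite -/(coprime j l) coprime_sym prime_coprime.
by rewrite mulnC Euv g1 modnMDl.
Qed.

Section Descent.
Variables (n l : nat) (z alpha : algC).
Hypotheses (zn : n.-primitive_root z) (l_prime : prime l) (lln : (l * l %| n)%N).
Hypothesis n4 : (4 %| n)%N.
Hypotheses (alpha0 : alpha != 0) (ab_alpha : abelianC alpha).
Hypothesis alphal : adj (z ^+ l) (alpha ^+ l).
Local Notation zl := (z ^+ (n %/ l)).

Let ln : (l %| n)%N. Proof. exact: dvdn_trans (dvdn_mulr l (dvdnn l)) lln. Qed.

Section InField.
Variables (L : splittingFieldType rat) (iota : {rmorphism L -> algC}) (w a : L).
Hypotheses (iw : iota w = z) (ia : iota a = alpha).
Variable s : gal_of {:L}.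
Hypotheses (sw : s w = w) (sa : s a != a).
Local Open Scope group_scope.
Local Notation wl := (w ^+ (n %/ l))%R.

Let memL (x : L) : x \in {:L}%VS := memvf x.

Lemma gal_commute (g h : gal_of {:L}) x : abelianC (iota x) -> g (h x) = h (g x).
Proof.
move=> abx; apply: (fmorph_inj iota).
have [g' g'E] := gal_to_aut iota g; have [h' h'E] := gal_to_aut iota h.
by rewrite -!(g'E, h'E) abx.
Qed.

Let gmul (g h : gal_of {:L}) x : (g * h) x = h (g x).
Proof. by rewrite galM. Qed.

Let commw (g h : gal_of {:L}) : g (h w) = h (g w).
Proof. by apply: gal_commute; rewrite iw; apply: abelianC_adj zn _. Qed.

Let comma (g h : gal_of {:L}) : g (h a) = h (g a).
Proof. by apply: gal_commute; rewrite ia. Qed.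

Let gexp (g : gal_of {:L}) k x : (g ^+ k) x = iter k g x.
Proof.
elim: k x => [|k IH] x; first by rewrite expg0 gal_id.
by rewrite expgSr gmul IH.
Qed.

Definition fixl : {group gal_of {:L}} := 'Gal({:L} / <<1; wl>>)%G.

Lemma fixlP (g : gal_of {:L}) : reflect (g wl = wl) (g \in fixl).
Proof.
apply: (iffP idP) => [gf|gwl].
  by apply: (fixed_gal (subvf _) gf); rewrite memv_adjoin.
rewrite gal_kHom ?subvf //; apply/kAHomP => x /Fadjoin1_polyP[p ->].
rewrite -horner_map /= gwl; congr (_.[_])%R; rewrite -map_poly_comp.
by apply: eq_map_poly => b /=; rewrite rmorph_alg.
Qed.

Definition fixwa_set : {set gal_of {:L}} := [set g : gal_of {:L} | (g w == w) && (g a == a)].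

Lemma fixwa_group : group_set fixwa_set.
Proof.
apply/group_setP; split; first by rewrite inE !gal_id !eqxx.
move=> g h; rewrite !inE => /andP[/eqP gw /eqP ga] /andP[/eqP hw /eqP ha].
by rewrite !gmul gw ga hw ha !eqxx.
Qed.

Definition fixwa := Group fixwa_group.

Lemma fixwaP (g h : gal_of {:L}) : reflect (g w = h w /\ g a = h a) ((g * h^-1)%g \in fixwa).
Proof.
have K x : (h^-1)%g (h x) = x by rewrite -gmul mulgV gal_id.
have K' x : h ((h^-1)%g x) = x by rewrite -gmul mulVg gal_id.
rewrite inE !gmul; apply: (iffP andP) => [[/eqP gw /eqP ga]|[-> ->]]; last first.
  by rewrite !K.
by rewrite -[g w]K' -[g a]K' gw ga.
Qed.

Lemma fixwa_normal : fixwa <| fixl /\ abelian (fixl / fixwa).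
Proof.
have sub : fixwa \subset fixl.
  apply/subsetP => g; rewrite inE => /andP[/eqP gw _].
  by apply/fixlP; rewrite rmorphXn /= gw.
have der : [~: fixl, fixl] \subset fixwa.
  rewrite gen_subG; apply/subsetP => _ /imset2P[g h _ _ ->].
  rewrite inE /commg /conjg; apply/andP.
  have K (x y : L) : x = y -> x == y by move->.
  have E x : (forall g h : gal_of {:L}, g (h x) = h (g x)) -> [~ g, h]%g x = x.
    move=> cx; apply: (fmorph_inj (gal_repr (g * h)%g)).
    have E1 : (g * h)%g x = [~ g, h]%g ((h * g)%g x) by rewrite -gmul -commgC.
    rewrite /= (cx (g * h)%g) [RHS]E1 (gmul h) (gmul g h) (cx g h) //.
  by split; apply: K; apply: E.
by split; [apply: sub_der1_normal | apply: sub_der1_abelian]; rewrite ?derg1.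
Qed.

Let iwl : iota wl = zl. Proof. by rewrite rmorphXn /= iw. Qed.

Lemma fixw_root (g : gal_of {:L}) : g w = w -> exists i, g a = (wl ^+ i * a)%R.
Proof.
move=> gw; have [h hE] := gal_to_aut iota g.
have [|i hi] := kummer_fix zn ln alpha0 (adj_exp alphal) (h := h).
  by rewrite -iw hE gw.
exists i; apply: (fmorph_inj iota).
by rewrite -hE ia hi rmorphM rmorphXn /= iwl ia.
Qed.

(** [fixl / fixwa] is the Galois group of Q(z, alpha) over Q(zl), and [power_iter] says that the
    class of s in it is not an l-th power. B is the preimage of the complement given by
    [abelian_complement]. *)
Lemma descent_complement : exists B : {group gal_of {:L}},
  [/\ B \subset fixl,
      forall h, h \in fixl -> exists2 b, b \in B & exists k,
        h w = (b * s ^+ k) w /\ h a = (b * s ^+ k) a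
    & forall b, b \in B -> b w = w -> b a = a].
Proof.
have [nC abQ] := fixwa_normal; have [sC nC'] := andP nC.
have sfix : s \in fixl by apply/fixlP; rewrite rmorphXn /= sw.
have wl_prim : l.-primitive_root wl.
  have := kummer_prim zn ln; rewrite -iwl.
  by rewrite (fmorph_primitive_root iota).
have a0 : (a != 0)%R.
  by rewrite -(fmorph_eq0 iota) ia.
have [j sj] := fixw_root sw.
have swl : s wl = wl by rewrite rmorphXn /= sw.
have iters k : iter k s a = (wl ^+ (j * k) * a)%R.
  elim: k => [|k IH]; first by rewrite muln0 expr0 mul1r.
  rewrite iterS IH rmorphM rmorphXn /= swl sj mulrA -exprD.
  by rewrite mulnS addnC.
have itersw k : iter k s w = w by elim: k => //= k ->.
have cosetE g h : g \in fixl -> h \in fixl ->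
    coset fixwa g = coset fixwa h <-> (g w = h w /\ g a = h a).
  move=> fg fh; have [Ng Nh] := (subsetP nC' _ fg, subsetP nC' _ fh).
  split=> [E|/fixwaP E].
    apply/fixwaP; apply: coset_idr; first by rewrite groupM ?groupV.
    by rewrite morphM ?groupV // morphV //= E mulgV.
  apply/eqP; rewrite eq_mulgV1 -morphV // -morphM ?groupV //.
  by apply/eqP/coset_id.
have gal1 x : (1 : gal_of {:L}) x = x by rewrite gal_id.
have [|||B [BQ sB Bgen]] := abelian_complement abQ l_prime
    (x := coset fixwa s).
- exact: mem_quotient.
- rewrite -morphX ?(subsetP nC') // -(coset_id (group1 fixwa)).
  apply/cosetE; rewrite ?groupX ?group1 // !gexp !gal1 itersw iters; split=> //.
  by rewrite mulnC exprM (prim_expr_order wl_prim) expr1n mul1r.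
- move=> y /morphimP[g Ng fg ->]; rewrite -morphX //; apply/eqP.
  move/cosetE; rewrite !gexp; case; rewrite ?groupX // => gw ga.
  have [h hE] := gal_to_aut iota g.
  have hk k x : iter k h (iota x) = iota (iter k g x).
    by elim: k => //= k ->.
  have := power_iter zn l_prime lln alpha0 ab_alpha alphal n4 (g := h).
  rewrite -ia -iw !hk gw sw ga => /(_ erefl) /(fmorph_inj iota) sa1.
  by move: sa; rewrite sa1 eqxx.
exists ((coset fixwa @*^-1 B) :&: fixl)%G; split.
- exact: subsetIr.
- move=> h fh; have [|bb Bb [k Ek]] := Bgen (coset fixwa h).
    exact: mem_quotient.
  have /morphimP[b Nb fb Eb] := subsetP BQ _ Bb.
  exists b; first by rewrite inE fb andbT mem_morphpre // -Eb.
  exists k; apply/cosetE => //; first by rewrite groupM ?groupX.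
  by rewrite morphM ?groupX ?(subsetP nC') // morphX ?(subsetP nC') // -Eb.
move=> b; rewrite inE => /andP[/morphpreP[Nb Bb] fb] bw.
have [i bi] := fixw_root bw.
have [li|li] := boolP (l %| i)%N.
  by case/dvdnP: li bi => k -> ->; rewrite mulnC exprM (prim_expr_order wl_prim) expr1n mul1r.
have lj : ~~ (l %| j)%N.
  apply: contra sa => /dvdnP[k Ek]; rewrite sj Ek mulnC exprM.
  by rewrite (prim_expr_order wl_prim) expr1n mul1r.
have [j' jj'] := inverse_mod_prime l_prime lj.
have [i' ii'] := inverse_mod_prime l_prime li.
have Esb : coset fixwa b = (coset fixwa s ^+ (j' * i))%g.
  rewrite -morphX ?(subsetP nC') //; apply/cosetE; rewrite ?groupX // !gexp itersw iters.
  split=> //; rewrite bi; congr (_ * _)%R; apply/eqP.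
  by rewrite (eq_prim_root_expr wl_prim) mulnA -modnMml jj' modnMml mul1n.
have sl1 : (coset fixwa s ^+ l = 1)%g.
  rewrite -morphX ?(subsetP nC') // -(coset_id (group1 fixwa)).
  apply/cosetE; rewrite ?groupX ?group1 // !gexp !gal1 itersw iters; split=> //.
  by rewrite mulnC exprM (prim_expr_order wl_prim) expr1n mul1r.
case/negP: sB; suff <- : (coset fixwa b ^+ (j * i') = coset fixwa s)%g by rewrite groupX.
rewrite Esb -expgM -[RHS]expg1 -(expg_mod _ sl1) -[RHS](expg_mod _ sl1).
congr (_ ^+ _)%g; rewrite mulnACA (mulnC j') -modnMm jj' ii' modnMm //.
Qed.
End InField.

(** beta is the sum of b(w^i a) over the complement B. Being fixed by B, it is a Kummer generator
    over Q(zl); automorphisms over Q(z) multiply it by the same roots of unity as alpha, so the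
    quotient lies in Q(z). *)
Lemma kummer_descent : ~ adj z alpha -> exists beta : algC,
  [/\ beta != 0, adj z (beta / alpha)
    & forall h : Aut, h zl = zl -> exists k, h beta = zl ^+ k * beta].
Proof.
move=> nza; have [s [sz sa]] : exists s : Aut, s z = z /\ s alpha != alpha.
  apply: contrapT => nex; apply: nza => h hz; apply/eqP/negPn/negP => ha.
  by apply: nex; exists h.
have [L [iota [[|w [|a [|]]] //= [iw ia]]]] := normal_number_field [:: z; alpha].
have [sg sgE] := aut_to_gal iota s.
have sgw : sg w = w by apply: (fmorph_inj iota); rewrite sgE iw.
have sga : sg a != a by rewrite -(inj_eq (fmorph_inj iota)) sgE ia.
have [B [sB genB fixB]] := descent_complement iw ia sgw sga.
pose wl := w ^+ (n %/ l).
have iwl : iota wl = zl by rewrite rmorphXn /= iw.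
have a0 : a != 0 by rewrite -(fmorph_eq0 iota) ia.
have commw (g h : gal_of {:L}) : g (h w) = h (g w).
  by apply: (gal_commute (iota := iota)); rewrite iw; apply: abelianC_adj zn _.
have comma (g h : gal_of {:L}) : g (h a) = h (g a).
  by apply: (gal_commute (iota := iota)); rewrite ia.
have [i Si] : exists i, \sum_(b in B) b w ^+ i * b a != 0.
  apply: contrapT => nex.
  have S0 i : \sum_(b in B) b w ^+ i * b a = 0.
    by apply/eqP/negPn/negP => Si; apply: nex; exists i.
  have Spoly (P : {poly L}) : \sum_(b in B) P.[b w] * b a = 0.
    under eq_bigr do rewrite horner_coef mulr_suml.
    rewrite exchange_big big1 // => k _ /=.
    under eq_bigr do rewrite -mulrA.
    by rewrite -mulr_sumr S0 mulr0.
  (* If all these sums vanish, then so does the sum of P(b w) (b a) for every polynomial P. This P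
     kills the terms with b w distinct from w; in the others b a = a, and their number times P(w) a
     is not 0. *)
  pose P := \prod_(b in B | b w != w) ('X - (b w)%:P).
  have Pw : P.[w] != 0.
    rewrite horner_prod; apply/prodf_neq0 => b /andP[_ bw].
    by rewrite hornerXsubC subr_eq0 eq_sym.
  have Pb b : b \in B -> b w != w -> P.[b w] = 0.
    move=> Bb bw; rewrite horner_prod (bigD1 b) /=; last by rewrite Bb.
    by rewrite hornerXsubC subrr mul0r.
  have := Spoly P; rewrite (bigID (fun b : gal_of {:L} => b w == w)) /= addrC.
  rewrite big1 => [|b /andP[Bb bw]]; last by rewrite Pb ?mul0r.
  rewrite add0r (eq_bigr (fun=> P.[w] * a)); last first.
    by move=> b /andP[Bb /eqP bw]; rewrite bw fixB.
  rewrite sumr_const => /eqP; rewrite -mulr_natr mulf_eq0 mulf_eq0.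
  rewrite (negPf Pw) (negPf a0) /= -(fmorph_eq0 iota) rmorph_nat pnatr_eq0.
  by move=> /eqP/card0_eq/(_ 1%g); rewrite unfold_in /= group1 gal_id eqxx.
pose be := \sum_(b in B) b w ^+ i * b a.
have fixw_be (g : gal_of {:L}) j : g w = w -> g a = wl ^+ j * a ->
    g be = wl ^+ j * be.
  move=> gw gj; rewrite rmorph_sum mulr_sumr; apply: eq_bigr => b Bb.
  have /(fixlP w) bwl := subsetP sB b Bb.
  rewrite rmorphM rmorphXn /= commw comma gw gj rmorphM rmorphXn /= bwl.
  by rewrite mulrCA.
have fix_be b : b \in B -> b be = be.
  move=> Bb; rewrite rmorph_sum /be [RHS](reindex_inj (mulIg b)) /=.
  apply: eq_big => [c|c Bc]; first by rewrite groupMr.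
  by rewrite rmorphM rmorphXn /= !galM ?memvf.
exists (iota be); split; first by rewrite fmorph_eq0.
  move=> h hz; have [g gE] := aut_to_gal iota h.
  have gw : g w = w by apply: (fmorph_inj iota); rewrite gE iw.
  have [j gj] := fixw_root iw ia gw.
  rewrite fmorph_div -gE (fixw_be g j gw gj) -ia -gE gj !rmorphM.
  rewrite -mulf_div mulfV ?mul1r // rmorphXn iwl expf_neq0 //.
  by rewrite expf_neq0 // (prim_root_neq0 zn).
move=> h hzl; have [g gE] := aut_to_gal iota h.
have gwl : g \in fixl w.
  by apply/fixlP; apply: (fmorph_inj iota); rewrite gE iwl.
have [b Bb [k [Ew Ea]]] := genB g gwl.
have skw : (sg ^+ k)%g w = w.
  elim: k {Ew Ea} => [|k IH]; first by rewrite expg0 gal_id.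
  by rewrite expgS galM ?memvf // sgw.
have [j skaj] := fixw_root iw ia skw.
have skj := fixw_be _ j skw skaj.
exists j; rewrite -gE -iwl -rmorphXn -rmorphM; congr (iota _).
rewrite -skj -[in RHS](fix_be b Bb) -galM ?memvf // !rmorph_sum.
apply: eq_bigr => c Bc.
rewrite !rmorphM !rmorphXn /=; congr (_ ^+ _ * _).
  by rewrite commw Ew [RHS]commw.
by rewrite comma Ea [RHS]comma.
Qed.
End Descent.

(** * Gauss sums and Stickelberger elements *)

Lemma adj1_rat x : adj 1 x -> exists a : rat, x = ratr a.
Proof.
case/adj_poly=> f ->; exists f.[1]; rewrite -horner_map rmorph1 //.
Qed.

Lemma cyclotomicC_coprime x k l : x != 0 -> coprime k l ->
  cyclotomicC (x ^+ k) -> cyclotomicC (x ^+ l) -> cyclotomicC x.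
Proof.
move=> x0 kl ck cl; have [k0|k_gt0] := posnP k.
  by move: kl cl; rewrite k0 /coprime gcd0n => /eqP->; rewrite expr1.
have [u v Euv _] := egcdnP l k_gt0.
have -> : x = x ^+ k ^+ u / x ^+ l ^+ v.
  rewrite -!exprM (mulnC k) Euv (eqP kl) addnC exprD expr1 (mulnC l).
  by rewrite mulfK // expf_neq0.
apply: cyclotomicCM; first exact: cyclotomicCX.
by apply/cyclotomicCV/cyclotomicCX.
Qed.

Lemma abelianCV x : abelianC x -> abelianC x^-1.
Proof. by move=> abx g h; rewrite !fmorphV abx. Qed.

Lemma abelianCX x k : abelianC x -> abelianC (x ^+ k).
Proof. by move=> abx g h; rewrite !rmorphXn /= abx. Qed.

Section Kum.
Variables (l : nat) (zeta : algC).
Hypotheses (l_prime : prime l) (zetal : l.-primitive_root zeta).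

(** Kummer generators of degree l over Q(zeta) that are abelian over Q. [Kum_fix] expresses that x^l
    lies in Q(zeta), in a form visibly stable under products, inverses and conjugation. *)
Record Kum (x : algC) : Prop := MkKum {
  Kum_neq0 : x != 0;
  Kum_abelian : abelianC x;
  Kum_fix : forall h : Aut, h zeta = zeta -> exists k, h x = zeta ^+ k * x }.

Lemma KumM x y : Kum x -> Kum y -> Kum (x * y).
Proof.
move=> [x0 abx fx] [y0 aby fy]; split; first exact: mulf_neq0.
  exact: abelianCM.
move=> h hz; have [i hi] := fx h hz; have [j hj] := fy h hz.
by exists (i + j)%N; rewrite rmorphM hi hj exprD mulrACA.
Qed.

Lemma zetaV k : exists j, (zeta ^+ k)^-1 = zeta ^+ j.
Proof.
have : ((zeta ^+ k)^-1) ^+ l = 1.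
  by rewrite exprVn exprAC (prim_expr_order zetal) expr1n invr1.
by case/(prim_rootP zetal) => j ->; exists j.
Qed.

Lemma KumV x : Kum x -> Kum x^-1.
Proof.
move=> [x0 abx fx]; split; rewrite ?invr_neq0 //; first exact: abelianCV.
move=> h hz; have [i hi] := fx h hz; have [j Ej] := zetaV i.
by exists j; rewrite fmorphV hi invfM Ej.
Qed.

Lemma Kum_adj x : adj zeta x -> x != 0 -> Kum x.
Proof.
move=> zx x0; split=> //; first exact: abelianC_adj zetal zx.
by move=> h hz; exists 0%N; rewrite mul1r zx.
Qed.

Lemma KumX x k : Kum x -> Kum (x ^+ k).
Proof.
move=> kx; elim: k => [|k IH]; last by rewrite exprS; apply: KumM.
by rewrite expr0; apply: Kum_adj; [apply: adj1 | apply: oner_neq0].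
Qed.

Lemma Kum_aut (g : Aut) x : Kum x -> Kum (g x).
Proof.
move=> [x0 abx fx]; split; rewrite ?fmorph_eq0 //; first exact: abelianC_aut.
move=> h hz; have [i hi] := fx h hz; have [j _ gz] := aut_prim_root g zetal.
by exists (j * i)%N; rewrite abx hi rmorphM rmorphXn /= gz -exprM.
Qed.

Lemma Kum_exp_adj x : Kum x -> adj zeta (x ^+ l).
Proof.
move=> kx h hz; have [k hk] := Kum_fix kx hz.
by rewrite rmorphXn /= hk exprMn exprAC (prim_expr_order zetal) expr1n mul1r.
Qed.

Lemma Kum_quot (g : Aut) t x : Kum x -> g zeta = zeta ^+ t ->
  adj zeta (g x / x ^+ t).
Proof.
move=> kx gz h hz; have [k hk] := Kum_fix kx hz.
rewrite fmorph_div rmorphXn /= (Kum_abelian kx) hk rmorphM rmorphXn /= gz.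
rewrite exprMn (exprAC zeta t k) -mulf_div mulfV ?mul1r //.
by rewrite !expf_neq0 // (prim_root_neq0 zetal).
Qed.

(** x^k is cyclotomic because it is y times an element of Q(zeta), x^l because it lies in Q(zeta),
    and k and l are coprime. *)
Lemma Kum_cyclotomic x k y : Kum x -> coprime k l -> y != 0 ->
  adj zeta (y / x ^+ k) -> cyclotomicC y -> cyclotomicC x.
Proof.
move=> kx kl y0 zyx cy; have x0 := Kum_neq0 kx.
apply: (cyclotomicC_coprime x0 kl); last first.
  by exists l, zeta; split=> //; apply: Kum_exp_adj.
have -> : x ^+ k = y / (y / x ^+ k) by rewrite invf_div mulrC divfK.
apply: (cyclotomicCM cy); apply: cyclotomicCV.
by exists l, zeta.
Qed.

(* Applying all [g_d - 1], [d <> 1], removes the prime ideals with nontrivial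
   decomposition group and raises [x] to a power prime to [l]. *)
Lemma Kum_project (s : seq nat) x : Kum x ->
  (forall d, d \in s -> (1 < d < l)%N) ->
  exists y k, [/\ Kum y, coprime k l, adj zeta (y / x ^+ k)
    & forall d (g : Aut), d \in s -> g zeta = zeta ^+ d ->
      exists c, [/\ adj zeta c, c != 0 & y ^+ l = g c / c]].
Proof.
move=> kx; elim: s => [|d s IH] ds.
  exists x, 1%N; split; rewrite ?coprime1n ?expr1 ?mulfV ?(Kum_neq0 kx) //.
  exact: adj1.
have [|y [k [ky kl zyx yc]]] := IH; first by move=> e es; apply: ds; rewrite inE es orbT.
have /andP[d_gt1 dl] := ds d (mem_head d s).
have cd : coprime d l.
  by rewrite coprime_sym prime_coprime // gtnNdvd // ltnW.
have [g gE] := aut_exp cd.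
have gz : g zeta = zeta ^+ d by apply/gE/prim_expr_order.
have y0 := Kum_neq0 ky; have x0 := Kum_neq0 kx.
exists (g y / y), (k * d.-1)%N; split.
- by apply: KumM (KumV ky); apply: Kum_aut.
- rewrite coprimeMl kl /= coprime_sym prime_coprime // gtnNdvd //.
    by rewrite -ltnS prednK // ltnW.
  by apply: leq_ltn_trans (leq_pred d) dl.
- have -> : g y / y / x ^+ (k * d.-1) = g y / y ^+ d * (y / x ^+ k) ^+ d.-1.
    have -> : y ^+ d = y * y ^+ d.-1 by rewrite -exprS prednK // ltnW.
    by rewrite expr_div_n exprM invfM !mulrA divfK // expf_neq0.
  by apply: adjM; [apply: Kum_quot | apply: adjX].
move=> e h; rewrite inE => /predU1P[->|es] hz.
  exists (y ^+ l); split; [exact: Kum_exp_adj | by rewrite expf_neq0|].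
  rewrite expr_div_n -rmorphXn; congr (_ / _).
  by apply: (adj_aut_eq zetal (Kum_exp_adj ky)); rewrite gz hz.
have [c [zc c0 Ec]] := yc e h es hz.
exists (g c / c); split; rewrite ?mulf_neq0 ?invr_neq0 ?fmorph_eq0 //.
  by apply: adjM (adjV zc); apply: adj_aut zetal zc.
have abc := abelianC_adj zetal zc.
rewrite expr_div_n -rmorphXn /= Ec !fmorph_div abc !invf_div.
by rewrite [LHS]mulf_div [RHS]mulf_div (mulrC (h c)).
Qed.
End Kum.

Section GaussSum.
Variables (l q : nat) (zeta : algC).
Hypotheses (l_prime : prime l) (q_prime : prime q) (lq : (l %| q.-1)%N).
Hypothesis zetal : l.-primitive_root zeta.

Lemma gauss_coprime : coprime q l.
Proof.
rewrite prime_coprime // dvdn_prime2 //; apply/eqP => ql.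
have : (l <= q.-1)%N.
  by apply: dvdn_leq lq; rewrite -ltnS prednK ?prime_gt0 ?prime_gt1.
by rewrite -ql leqNgt prednK ?prime_gt0 // leqnn.
Qed.

Lemma Fq_generator : exists w : 'F_q, q.-1.-primitive_root w.
Proof.
pose rs := [seq x : 'F_q <- enum 'F_q | x != 0].
have size_rs : size rs = q.-1.
  have := cardC1 (0 : 'F_q); rewrite card_Fp // cardE /enum_mem -enumT => <-.
  congr size; apply: eq_filter => x; exact: erefl.
have /hasP[x _ xprim] : has q.-1.-primitive_root rs.
  apply: has_prim_root.
  - by rewrite -ltnS prednK ?prime_gt0 ?prime_gt1.
  - apply/allP => x; rewrite mem_filter => /andP[x0 _]; rewrite unity_rootE.
    rewrite -(inj_eq (mulfI x0)) mulr1 -exprS prednK ?prime_gt0 //.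
    by have := expf_card x; rewrite card_Fp // => ->.
  - by rewrite filter_uniq ?enum_uniq.
  - by rewrite size_rs.
by exists x.
Qed.

Section Character.
Variables (w : 'F_q) (zq : algC).
Hypotheses (wprim : q.-1.-primitive_root w) (zqq : q.-primitive_root zq).

Lemma Fq_unity (x : 'F_q) : x != 0 -> x ^+ q.-1 = 1.
Proof.
move=> x0; apply: (mulfI x0); rewrite mulr1 -exprS prednK ?prime_gt0 //.
by have := expf_card x; rewrite card_Fp.
Qed.

Definition chi (x : 'F_q) : algC :=
  if (x != 0) =P true is ReflectT x0 then
    zeta ^+ sval (prim_rootP wprim (Fq_unity x0)) else 0.

Lemma chi_exp i : chi (w ^+ i) = zeta ^+ i.
Proof.
rewrite /chi; case: eqP => [x0|[]]; last first.
  by rewrite expf_neq0 // (prim_root_neq0 wprim).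
case: prim_rootP => j /= /eqP; rewrite (eq_prim_root_expr wprim) => /eqP ij.
have lij : (i = j %[mod l])%N by rewrite -(modn_dvdm _ lq) ij modn_dvdm.
by rewrite -(prim_expr_mod zetal i) lij (prim_expr_mod zetal).
Qed.

Lemma Fq_exp (x : 'F_q) : x != 0 -> exists i, x = w ^+ i.
Proof. by move/Fq_unity/(prim_rootP wprim) => [i ->]; exists i. Qed.

Lemma chiM x y : x != 0 -> y != 0 -> chi (x * y) = chi x * chi y.
Proof.
by move=> /Fq_exp[i ->] /Fq_exp[j ->]; rewrite -exprD !chi_exp exprD.
Qed.

Lemma chi1 : chi 1 = 1. Proof. by rewrite -(expr0 w) chi_exp. Qed.

Definition psi (x : 'F_q) : algC := zq ^+ (x : nat).

Lemma psi_nat i : psi i%:R = zq ^+ i.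
Proof. by rewrite /psi val_Fp_nat // (prim_expr_mod zqq). Qed.

Lemma psiD x y : psi (x + y) = psi x * psi y.
Proof. by rewrite -[x]natr_Zp -[y]natr_Zp -natrD !psi_nat exprD. Qed.

Lemma psi0 : psi 0 = 1. Proof. by rewrite -[0]/(0%:R) psi_nat. Qed.

Lemma sum_psi : \sum_x psi x = 0.
Proof.
have psi1 : psi 1 != 1.
  rewrite (psi_nat 1) expr1 -[zq]expr1 -(prim_order_dvd zqq) dvdn1.
  by rewrite gtn_eqF ?prime_gt1.
apply: (mulfI (_ : psi 1 - 1 != 0)); first by rewrite subr_eq0.
rewrite mulr0 mulrBl mul1r mulr_sumr [X in _ - X](reindex_inj (addrI 1)) /=.
by rewrite -sumrB big1 // => x _; rewrite psiD subrr.
Qed.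

Lemma sum_psi_scale a : a != 0 -> \sum_(x | x != 0) psi (a * x) = -1.
Proof.
move=> a0; have : \sum_x psi (a * x) = 0.
  by rewrite -[RHS]sum_psi [RHS](reindex_inj (mulfI a0)).
rewrite (bigD1 0) //= mulr0 psi0 => /eqP; rewrite addrC addr_eq0 => /eqP //.
Qed.

Lemma sum_chi : \sum_(x | x != 0) chi x = 0.
Proof.
have w0 := prim_root_neq0 wprim.
have chiw : chi w != 1.
  rewrite -[w]expr1 chi_exp -(prim_order_dvd zetal) dvdn1.
  by rewrite gtn_eqF ?prime_gt1.
apply: (mulfI (_ : chi w - 1 != 0)); first by rewrite subr_eq0.
rewrite mulr0 mulrBl mul1r mulr_sumr [X in _ - X](reindex_inj (mulfI w0)) /=.
rewrite [X in _ - X](eq_bigl (fun x => x != 0)) => [|x]; last first.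
  by rewrite mulf_eq0 (negPf w0).
by rewrite -sumrB big1 // => x x0; rewrite chiM // subrr.
Qed.

Definition gauss : algC := \sum_(x | x != 0) chi x * psi x.

Lemma gauss_aut (h : Aut) (t : 'F_q) : t != 0 -> h zeta = zeta ->
  h zq = zq ^+ (t : nat) -> chi t * h gauss = gauss.
Proof.
move=> t0 hzeta hzq; rewrite rmorph_sum mulr_sumr [RHS](reindex_inj (mulfI t0)) /=.
apply: eq_big => [x|x x0]; first by rewrite mulf_eq0 (negPf t0).
have [i Ei] := Fq_exp x0; rewrite rmorphM chiM // -!mulrA; congr (_ * (_ * _)).
  by rewrite Ei chi_exp rmorphXn /= hzeta.
rewrite rmorphXn /= hzq -exprM -psi_nat natrM !natr_Zp //.
Qed.

Lemma conj_unity k (x : algC) : (0 < k)%N -> x ^+ k = 1 -> x * x^* = 1.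
Proof.
move=> k0 xk; rewrite -normCK.
by have /eqP -> : `|x| == 1; rewrite ?expr1n // -(pexpr_eq1 k0) // -normrX xk normr1.
Qed.

(** Substitute x = u y in the double sum. The terms with u = 1 contribute q - 1, any other u
    contributes -chi(u), and these add up to 1 because the values of chi sum to 0. *)
Lemma gauss_conj : gauss * gauss^* = q%:R.
Proof.
have chiC x : x != 0 -> (chi x)^* = chi x^-1.
  move=> x0; have [i Ei] := Fq_exp x0.
  have cx0 : chi x != 0 by rewrite Ei chi_exp expf_neq0 // (prim_root_neq0 zetal).
  apply: (mulfI cx0); rewrite -chiM ?invr_neq0 // mulfV // chi1.
  apply: (conj_unity (prime_gt0 l_prime)).
  by rewrite Ei chi_exp exprAC (prim_expr_order zetal) expr1n.
have psiC x : (psi x)^* = psi (- x).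
  have px0 : psi x != 0 by rewrite expf_neq0 // (prim_root_neq0 zqq).
  apply: (mulfI px0); rewrite -psiD subrr psi0.
  apply: (conj_unity (prime_gt0 q_prime)).
  by rewrite exprAC (prim_expr_order zqq) expr1n.
rewrite /gauss rmorph_sum mulr_suml.
transitivity (\sum_(u | u != 0) \sum_(y | y != 0) chi u * psi ((u - 1) * y)).
  rewrite [RHS]exchange_big /=.
  under eq_bigr do rewrite mulr_sumr.
  rewrite exchange_big /=; apply: eq_bigr => y y0.
  rewrite (reindex_inj (mulIf y0)) /=; apply: eq_big => [x|x].
    by rewrite mulf_eq0 (negPf y0) orbF.
  rewrite mulf_eq0 (negPf y0) orbF => x0.
  rewrite rmorphM /= chiC // psiC mulrACA -chiM ?mulf_neq0 ?invr_neq0 //.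
  by rewrite mulfK // -psiD mulrBl mul1r.
rewrite (bigD1 1) ?oner_neq0 //=.
under eq_bigr do rewrite subrr mul0r psi0 chi1 mul1r.
rewrite sumr_const (cardC1 (0 : 'F_q)) card_Fp //.
rewrite (eq_bigr (fun u => - chi u)) => [|u /andP[u0 u1]]; last first.
  by rewrite -mulr_sumr sum_psi_scale ?subr_eq0 // mulrN1.
have := sum_chi; rewrite (bigD1 1) ?oner_neq0 //= chi1 => /eqP.
rewrite addrC addr_eq0 => /eqP S; rewrite sumrN S opprK.
by rewrite -[X in _ + X]/(1%:R) -natrD addn1 prednK ?prime_gt0.
Qed.

Lemma gauss_Aint : gauss \in Aint.
Proof.
apply: rpred_sum => x x0; apply: rpredM.
  have [i ->] := Fq_exp x0; rewrite chi_exp.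
  by apply/rpredX/(Aint_prim_root zetal).
by apply/rpredX/(Aint_prim_root zqq).
Qed.

End Character.
End GaussSum.

Lemma nat_lcong p (P : algC -> Prop) i j : prime_over p P ->
  (i = j %[mod p])%N -> lcong P i%:R j%:R.
Proof.
move=> P_p; wlog ij : i j / (j <= i)%N.
  move=> IH eij; case: (leqP j i) => [/IH|/ltnW/IH H]; first exact.
  by apply: (lcong_sym P_p); apply: H.
move/eqP; rewrite eqn_mod_dvd // => /dvdnP[k Ek].
rewrite /lcong -natrB // Ek natrM; apply: (mlocM P_p); last exact: (mloc_p P_p).
by apply: (loc_Aint P_p); rewrite rpred_nat.
Qed.

Section GaussValuation.
Variables (l q : nat) (zeta : algC) (P : algC -> Prop).
Hypotheses (l_prime : prime l) (q_prime : prime q) (lq : (l %| q.-1)%N).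
Hypotheses (zetal : l.-primitive_root zeta) (P_q : prime_over q P).

Let ql : coprime q l := gauss_coprime l_prime q_prime lq.
Let q1_gt0 : (0 < q.-1)%N.
Proof. by rewrite -ltnS prednK ?prime_gt0 ?prime_gt1. Qed.
Let l_gt0 : (0 < l)%N := prime_gt0 l_prime.

Lemma hasval_zeta z v x : (q ^ 1 * l).-primitive_root z -> adj z zeta ->
  (exists j, zeta = z ^+ j) ->
  hasval q 0 l zeta P v x -> hasval q 1 l z P (v * q.-1%:Z) x.
Proof.
move=> zn _ [j Ej] [u [y [w [zy zw Py Pw ->]]] ->].
have Zz t : Zadj zeta t -> Zadj z t.
  by move=> [f ->]; apply: Zadj_horner; rewrite Ej; apply/ZadjX/Zadj_root.
have vq : hasval q 1 l z P q.-1%:Z q%:R.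
  have [u0 uu Eq] := unif_pow_pos q_prime zn (ltn0Sn 0).
  exists u0; first exact: (Zunit_zunit P_q zn uu).
  by rewrite Eq expn0 mul1n.
rewrite -[v * _]addr0; apply: (hasvalM q_prime P_q zn); last first.
  by apply: hasval_zunit; exists y, w; split=> //; apply: Zz.
rewrite mulrC /unif eqxx; case: v => k; first exact: hasvalX.
rewrite NegzE -exprnN mulrN; exact/hasvalV/hasvalX.
Qed.

(** Stickelberger's theorem for l-th powers of Gauss sums. A generator of the inertia at q
    multiplies the Gauss sum by zeta^-1, and also, up to congruence, by the tame character t0^V;
    this determines V modulo q - 1. As the Gauss sum times its complex conjugate is q, V lies
    between 0 and q - 1. Conjugation by [h'] normalises the valuation of G^l at P to 1. *)
Theorem gauss_sum_exists : exists G : algC,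
  [/\ cyclotomicC G, Kum zeta G, G * G^* = q%:R, G \in Aint
    & forall s (h : Aut), (0 < s < l)%N -> h zeta = zeta ^+ s ->
        hasval q 0 l zeta P s%:Z (h (G ^+ l))].
Proof.
have [w wprim] := Fq_generator q_prime.
have [z zn] : exists z : algC, (q ^ 1 * l).-primitive_root z.
  have n_gt0 : (0 < q ^ 1 * l)%N by rewrite muln_gt0 expn1 prime_gt0.
  by have [z zn] := C_prim_root_exists n_gt0; exists z.
have n_gt0 := prim_order_gt0 zn.
pose zq := z ^+ l.
have zqq : q.-primitive_root zq by have := prim_root_ppart q_prime zn; rewrite expn1.
have [jz Ezeta] : exists j, zeta = z ^+ j.
  have zln : zeta ^+ (q ^ 1 * l) = 1.
    by rewrite mulnC exprM (prim_expr_order zetal) expr1n.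
  by have [j ->] := prim_rootP zn zln; exists j.
have zzeta : adj z zeta by rewrite Ezeta; apply: adjX; apply: adj_root.
pose G0 := gauss zeta q_prime zq wprim.
have GG0 : G0 * G0^* = q%:R by exact: (gauss_conj l_prime q_prime lq zetal wprim zqq).
have intG0 : G0 \in Aint by exact: (gauss_Aint q_prime lq zetal wprim zqq).
have G00 : G0 != 0.
  by apply/eqP => G0E; move/eqP: GG0; rewrite G0E mul0r eq_sym pnatr_eq0 gtn_eqF ?prime_gt0.
have zG0 : adj z G0.
  move=> h hz; rewrite /G0 -[in RHS](gauss_aut q_prime lq zetal wprim zqq (h := h) (t := 1)) //.
  - by rewrite (chi1 q_prime lq zetal wprim) mul1r.
  - by rewrite Ezeta rmorphXn /= hz.
  by rewrite rmorphXn /= hz expr1.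
have abG0 := abelianC_adj zn zG0.
have q_gt0 := prime_gt0 q_prime.
have zeta_n x : x = zeta \/ x = zq -> x ^+ (q ^ 1 * l) = 1.
  case=> ->; first by rewrite mulnC exprM (prim_expr_order zetal) expr1n.
  by rewrite expn1 exprM (prim_expr_order zqq) expr1n.
have auts s t : coprime s l -> coprime t q -> exists (h : Aut) (e : nat),
    [/\ h z = z ^+ e, h zeta = zeta ^+ s, h zq = zq ^+ t, (e = s %[mod l])%N
      & (e = t %[mod q])%N].
  move=> sl tq; pose e := chinese q l t s.
  have eq_ : (e = t %[mod q])%N by rewrite chinese_modl.
  have el : (e = s %[mod l])%N by rewrite chinese_modr.
  have ce : coprime e (q ^ 1 * l).
    rewrite expn1 coprimeMr -coprime_modl eq_ coprime_modl tq /=.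
    by rewrite -coprime_modl el coprime_modl.
  have [h hE] := aut_exp ce; exists h, e; split=> //.
  - exact/hE/prim_expr_order.
  - rewrite hE; last by apply: zeta_n; left.
    by rewrite -(prim_expr_mod zetal) el (prim_expr_mod zetal).
  - rewrite hE; last by apply: zeta_n; right.
    by rewrite -(prim_expr_mod zqq) eq_ (prim_expr_mod zqq).
have chi_root t : t != 0 -> exists i, chi zeta q_prime wprim t = zeta ^+ i.
  by move/(Fq_exp q_prime wprim) => [i ->]; exists i; apply: (chi_exp q_prime lq zetal wprim).
have zq_aut (h : Aut) : exists2 t : 'F_q, t != 0 & h zq = zq ^+ (t : nat).
  have [t ct ht] := aut_prim_root h zqq; exists (t%:R : 'F_q).
    by rewrite -(dvdn_pcharf (pchar_Fp q_prime)) -prime_coprime // coprime_sym.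
  by rewrite ht; apply: (esym (psi_nat q_prime zqq t)).
have kumG0 : Kum zeta G0.
  split=> // h hzeta; have [t t0 ht] := zq_aut h; have [i Ei] := chi_root t t0.
  have := gauss_aut q_prime lq zetal wprim zqq t0 hzeta ht; rewrite -/G0 Ei => EG.
  have [j Ej] := zetaV zetal i; exists j; rewrite -Ej -{2}EG mulKf //.
  by rewrite expf_neq0 // (prim_root_neq0 zetal).
have w_nat : (w : nat)%:R = w :> 'F_q by rewrite natr_Zp.
have w0 := prim_root_neq0 wprim.
have wq : coprime (w : nat) q.
  by rewrite coprime_sym prime_coprime // (dvdn_pcharf (pchar_Fp q_prime)) w_nat.
have [g [t0 [gz gzeta gzq t0l t0q]]] := auts 1%N w (coprime1n l) wq.
rewrite expr1 in gzeta.
have gG0 : g G0 = zeta^-1 * G0.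
  have := gauss_aut q_prime lq zetal wprim zqq w0 gzeta gzq.
  rewrite -[w in chi _ _ _ w]expr1 (chi_exp q_prime lq zetal wprim) expr1 -/G0 => EG.
  by rewrite -{2}EG mulKf // (prim_root_neq0 zetal).
have t0q' : coprime t0 q by rewrite -coprime_modl t0q coprime_modl.
have t0w : t0%:R = w :> 'F_q.
  by rewrite -(Fp_nat_mod q_prime) t0q (Fp_nat_mod q_prime).
have t0prim k : (t0 ^ k = 1 %[mod q])%N -> (q.-1 %| k)%N.
  move=> t0k; rewrite (prim_order_dvd wprim) -t0w -natrX.
  by rewrite -(Fp_nat_mod q_prime) t0k (Fp_nat_mod q_prime).
have ut0 : uloc P t0%:R := uloc_nat q_prime P_q t0q'.
have t0fermat : lcong P (t0%:R ^+ q.-1) 1.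
  rewrite -natrX; apply: (nat_lcong P_q (j := 1%N)).
  have E : (t0 ^ q.-1)%:R = 1%:R :> 'F_q.
    by rewrite natrX t0w (prim_expr_order wprim).
  by have := congr1 (@nat_of_ord _) E; rewrite !(val_Fp_nat q_prime).
have vG s (h : Aut) : h zeta = zeta ^+ s -> exists V : int,
    [/\ hasval q 1 l z P V (h G0), 0 <= V, V <= q.-1%:Z &
        lcong P (t0%:R ^ V) ((zeta ^+ s)^-1)].
  move=> hs; have zhG : adj z (h G0) := adj_aut h zn zG0.
  have hG0 : h G0 != 0 by rewrite fmorph_eq0.
  have [V vV] := hasval_adj q_prime ql P_q zn zhG hG0; exists V.
  have intV : h G0 \in Aint by rewrite Aint_aut.
  split=> //.
  - exact: (hasval_loc q_prime P_q zn vV (loc_Aint P_q intV)).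
  - have zhGc : adj z (h G0^*) by apply: (adj_aut h zn); apply: (adj_aut Num.conj zn).
    have hGc0 : h G0^* != 0 by rewrite !fmorph_eq0.
    have [V' vV'] := hasval_adj q_prime ql P_q zn zhGc hGc0.
    have V'_ge0 : 0 <= V'.
      apply: (hasval_loc q_prime P_q zn vV' (loc_Aint P_q _)).
      by rewrite Aint_aut; rewrite (Aint_aut Num.conj).
    have Vq : V + V' = q.-1%:Z.
      apply: (hasval_inj q_prime P_q zn (x := q%:R)).
        have := hasvalM q_prime P_q zn vV vV'; rewrite -rmorphM GG0 rmorph_nat; exact.
      have [u0 uu Eq] := unif_pow_pos q_prime zn (ltn0Sn 0).
      exists u0; first exact: (Zunit_zunit P_q zn uu).
      by rewrite Eq expn0 mul1n.
    by rewrite -Vq lerDl.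
  apply: (lcong_sym P_q); have <- : g (h G0) / h G0 = (zeta ^+ s)^-1.
    rewrite (abelianC_adj zn zG0) gG0 rmorphM fmorphV /= hs mulfK //.
  by apply: (inertia_lcong q_prime P_q zn gz _ t0l t0q' vV).
have [V1 [_ V1_ge0 _ V1z]] := vG 1%N idfun (esym (expr1 zeta)).
rewrite expr1 in V1z.
pose f := (q.-1 %/ l)%N; have Ef : q.-1 = (f * l)%N by rewrite divnK.
have f_gt0 : (0 < f)%N by move: q1_gt0; rewrite Ef muln_gt0 => /andP[].
have zetau : uloc P zeta^-1.
  apply: (ulocV P_q).
  have zl0 : zeta ^+ l = 1 := prim_expr_order zetal.
  apply: (uloc_factor P_q (y := zeta ^+ l.-1)).
  - exact: (loc_Aint P_q (Aint_prim_root zetal)).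
  - exact: (loc_Aint P_q (rpredX _ (Aint_prim_root zetal))).
  by rewrite -exprS prednK // zl0; apply: (uloc1 P_q).
have V1l : (q.-1%:Z %| V1 * l%:Z)%Z.
  apply: (lcong_exp_dvd q_prime P_q t0q') => //.
  rewrite -exprz_exp -exprnP.
  have := lcongX P_q l _ _ V1z; rewrite exprVn (prim_expr_order zetal) invr1; apply.
    by case: (ulocXz P_q V1 ut0).
  by case: zetau.
(* V1 l is a multiple of q - 1 = f l because zeta has order l. The factor [k0] is prime to l, since
   otherwise zeta^-1 would be congruent to 1 modulo P. *)
have [k0 Ek0] : exists k0 : nat, V1 = (f * k0)%N%:Z.
  case: V1 V1l V1_ge0 {V1z} => // V1 + _.
  rewrite dvdzE abszM /= Ef dvdn_pmul2r // => /dvdnP[k ->].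
  by exists k; rewrite mulnC.
have k0l : ~~ (l %| k0)%N.
  apply/negP => /dvdnP[k Ek]; have : zeta^-1 = 1.
    apply: (prime_over_unity_root q_prime l_prime _ P_q).
    - by apply: contraTneq ql => ->; rewrite /coprime gcdnn gtn_eqF ?prime_gt1.
    - have [j Ej] := zetaV zetal 1; rewrite -[zeta]expr1 Ej.
      by apply/rpredX/(Aint_prim_root zetal).
    - by rewrite exprVn (prim_expr_order zetal) invr1.
    apply: (lcong_trans P_q) (lcong_sym P_q V1z) _.
    rewrite Ek0 Ek mulnCA -Ef mulnC -exprnP exprM.
    have := lcongX P_q k _ _ t0fermat; rewrite expr1n; apply.
      by case: (ulocX P_q q.-1 ut0).
    by case: (uloc1 P_q).
  move/(congr1 (@GRing.inv _)); rewrite invrK invr1 => z1.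
  have := prim_order_dvd zetal 1; rewrite expr1 z1 eqxx dvdn1.
  by rewrite gtn_eqF ?prime_gt1.
have [k' kk'] := inverse_mod_prime l_prime k0l.
have k'l : coprime k' l.
  have : coprime (k0 * k') l by rewrite -coprime_modl kk' coprime_modl coprime1n.
  by rewrite coprimeMl => /andP[].
have [h' [e' [_ h'zeta _ _ _]]] := auts k' 1%N k'l (coprime1n q).
have kumG : Kum zeta (h' G0) by apply: (Kum_aut zetal).
exists (h' G0); split=> //.
- by exists (q ^ 1 * l)%N, z; split=> //; apply: adj_aut zn zG0.
- by rewrite -[(h' G0)^*](abelianC_adj zn zG0 h' Num.conj) -rmorphM GG0 rmorph_nat.
- by rewrite Aint_aut.
move=> s h /andP[s_gt0 sl] hs.
have [V [vV V_ge0 V_le Vz]] : exists V : int, [/\ hasval q 1 l z P V (h (h' G0)),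
    0 <= V, V <= q.-1%:Z & lcong P (t0%:R ^ V) ((zeta ^+ (k' * s))^-1)].
  apply: (vG (k' * s)%N (h \o h')); rewrite /= h'zeta rmorphXn /= hs -exprM.
  by rewrite mulnC.
have Vdvd : (q.-1%:Z %| V - (k' * s * (f * k0))%N%:Z)%Z.
  apply: (lcong_exp_dvd q_prime P_q t0q') => //.
  have t00 : t0%:R != 0 :> algC := uloc_neq0 P_q ut0.
  rewrite expfzDr // -[X in lcong P _ X](mulVf (expf_neq0 (k' * s) (prim_root_neq0 zetal))).
  apply: (lcongM P_q) => //.
  - by rewrite -exprVn; case: (ulocX P_q (k' * s) zetau).
  - by case: (ulocXz P_q (- (k' * s * (f * k0))%N%:Z) ut0).
  - have -> : zeta ^+ (k' * s) = (zeta^-1 ^+ (k' * s))^-1 by rewrite exprVn invrK.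
    rewrite -exprnN (mulnC (k' * s)%N) exprM; apply: (lcongV P_q).
    + exact/(ulocX P_q)/(ulocX P_q).
    + exact: (ulocX P_q).
    apply: (lcongX P_q); first by case: (ulocX P_q (f * k0) ut0).
      by case: zetau.
    by move: V1z; rewrite Ek0 -exprnP.
have [j Ej] : exists j : nat, V = (f * j)%N%:Z.
  case: V V_ge0 Vdvd {vV V_le Vz} => // V _.
  case/dvdzP=> x; rewrite Ef => Ex; have : (f%:Z %| V%:Z)%Z.
    apply/dvdzP; exists (x * l%:Z + (k' * s * k0)%N%:Z).
    move/eqP: Ex; rewrite subr_eq => /eqP ->; rewrite !PoszM; ring.
  by rewrite dvdzE /= => /dvdnP[y ->]; exists y; rewrite mulnC.
(* j and s agree modulo l and 0 <= j <= l; the ends j = 0 and j = l are excluded by 0 < s < l. *)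
have js : j = s.
  move: Vdvd V_le; rewrite Ej Ef lez_nat leq_pmul2l // => Vdvd jl.
  have : (l%:Z %| j%:Z - (k' * s * k0)%N%:Z)%Z.
    case/dvdzP: Vdvd => x Ex; apply/dvdzP; exists x.
    have f0 : f%:Z != 0 by rewrite eqz_nat -lt0n.
    apply: (mulfI f0); move: Ex; rewrite !PoszM => Ex.
    by apply: etrans (_ : x * (f%:Z * l%:Z) = _); [rewrite -Ex; ring | ring].
  rewrite -eqz_mod_dvd !modz_nat eqz_nat (mulnC k') -mulnA (mulnC k') mulnC.
  rewrite -modnMml kk' modnMml mul1n (modn_small sl) => /eqP jms.
  move: jl; rewrite leq_eqVlt => /orP[/eqP jl|jl]; last by rewrite -jms modn_small.
  by move: s_gt0; rewrite -jms jl modnn.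
have zGl : adj zeta (h (h' G0 ^+ l)) by apply: (adj_aut h zetal); apply: (Kum_exp_adj zetal).
have Gl0 : h (h' G0 ^+ l) != 0 by rewrite fmorph_eq0 expf_neq0 ?fmorph_eq0.
have zn0 : (q ^ 0 * l).-primitive_root zeta by rewrite expn0 mul1n.
have [v vv] := hasval_adj q_prime ql P_q zn0 zGl Gl0.
have -> // : s%:Z = v.
have q10 : q.-1%:Z != 0 by rewrite eqz_nat -lt0n.
apply: (mulIf q10).
have := hasval_zeta zn zzeta (ex_intro _ jz Ezeta) vv => vz.
apply: (hasval_inj q_prime P_q zn _ vz).
rewrite rmorphXn /=; have := hasvalX q_prime P_q zn l vV.
rewrite Ej js; have -> : (f * s)%N%:Z * l%:Z = s%:Z * q.-1%:Z by rewrite Ef !PoszM; ring.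
exact.
Qed.

End GaussValuation.

Lemma inord_shift_inj (M : nat) (a b : int) : (`|a| <= M)%N -> (`|b| <= M)%N ->
  inord `|(a + M%:Z)%R|%N = inord `|(b + M%:Z)%R|%N :> 'I_(M + M).+1 -> a = b.
Proof.
move=> ha hb /(congr1 (@nat_of_ord _)).
have la : (`|(a + M%:Z)%R| < (M + M).+1)%N by lia.
have lb : (`|(b + M%:Z)%R| < (M + M).+1)%N by lia.
by rewrite /= !inordK //; lia.
Qed.

(** * Integers all of whose conjugates have absolute value one *)

Section ConjugatePoly.
Variables (l : nat) (zeta : algC).
Hypotheses (l_prime : prime l) (zetal : l.-primitive_root zeta).

Lemma prim_exp_FpM (s t : 'F_l) : zeta ^+ (s * t : 'F_l)%R = zeta ^+ (s * t)%N.
Proof.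
have -> : s * t = (s * t)%N%:R by rewrite natrM !natr_Zp.
by rewrite val_Fp_nat // (prim_expr_mod zetal).
Qed.

Lemma aut_Fp (h : Aut) : exists2 s : 'F_l, s != 0 & h zeta = zeta ^+ (s : nat).
Proof.
have [t ct ht] := aut_prim_root h zetal; exists (t%:R : 'F_l).
  by rewrite -(dvdn_pcharf (pchar_Fp l_prime)) -prime_coprime // coprime_sym.
by rewrite ht val_Fp_nat // (prim_expr_mod zetal).
Qed.

Lemma Fp_aut : exists sigma : 'F_l -> Aut,
  forall t : 'F_l, t != 0 -> sigma t zeta = zeta ^+ (t : nat).
Proof.
have H (t : 'F_l) : exists g : Aut, t != 0 -> g zeta = zeta ^+ (t : nat).
  have [->|t0] := eqVneq t 0; first by exists idfun.
  have ct : coprime (t : nat) l.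
    by rewrite coprime_sym prime_coprime // (dvdn_pcharf (pchar_Fp l_prime)) natr_Zp.
  by have [g gE] := aut_exp ct; exists g => _; apply/gE/(prim_expr_order zetal).
by have [sigma sE] := choice H; exists sigma.
Qed.

Variable sigma : 'F_l -> Aut.
Hypothesis sigmaE : forall t : 'F_l, t != 0 -> sigma t zeta = zeta ^+ (t : nat).

Lemma sigma_comp (h : Aut) (s t : 'F_l) x : t != 0 -> s != 0 ->
  h zeta = zeta ^+ (s : nat) -> adj zeta x -> h (sigma t x) = sigma (s * t) x.
Proof.
move=> t0 s0 hs zx; apply: (@adj_aut_eq l zeta x (h \o sigma t)) => //=.
by rewrite !sigmaE ?mulf_neq0 // rmorphXn /= hs -exprM -prim_exp_FpM.
Qed.

Lemma sigma1 x : adj zeta x -> sigma 1 x = x.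
Proof. by apply; rewrite sigmaE ?oner_eq0 // val_Fp_nat // (prim_expr_mod zetal). Qed.

Definition conjpoly x := \prod_(t : 'F_l | t != 0) ('X - (sigma t x)%:P).

Lemma root_conjpoly x t : t != 0 -> root (conjpoly x) (sigma t x).
Proof.
move=> t0; rewrite /conjpoly (bigD1 t) //= rootE hornerM.
by rewrite hornerXsubC subrr mul0r.
Qed.

Lemma root_conjpolyP x y : root (conjpoly x) y -> exists2 t, t != 0 & y = sigma t x.
Proof.
rewrite rootE horner_prod => /prodf_eq0[t t0]; rewrite hornerXsubC subr_eq0.
by move/eqP; exists t.
Qed.

Lemma conjpoly_rat x i : adj zeta x -> exists a : rat, (conjpoly x)`_i = ratr a.
Proof.
move=> zx; apply: adj1_rat => h _; have [s s0 hs] := aut_Fp h.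
rewrite -coef_map; suff -> : map_poly h (conjpoly x) = conjpoly x by [].
rewrite /conjpoly rmorph_prod /=.
rewrite [RHS](reindex_inj (mulfI s0)) /=.
apply: eq_big => [t|t t0]; first by rewrite mulf_eq0 (negPf s0).
by rewrite rmorphB /= map_polyX map_polyC /= (sigma_comp t0 s0 hs).
Qed.

Lemma conjpoly_monic x : conjpoly x \is monic.
Proof. by apply: monic_prod => t _; apply: monicXsubC. Qed.

Lemma size_conjpoly x : (size (conjpoly x) <= l)%N.
Proof.
rewrite /conjpoly size_prod => [|t _]; last by rewrite polyXsubC_eq0.
under eq_bigr => t _ do rewrite size_XsubC.
rewrite sum_nat_const muln2 -addnn -addnS addKn.
rewrite (_ : #|_| = l.-1); last first.
  by rewrite -[RHS](congr1 predn (card_Fp l_prime)) -(cardC1 (0 : 'F_l)); apply: eq_card.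
by rewrite prednK ?prime_gt0.
Qed.

Lemma coef_prod_XsubC_bound I (r : seq I) (P : pred I) (a : I -> algC) i :
  (forall j, P j -> `|a j| <= 1) ->
  `|(\prod_(j <- r | P j) ('X - (a j)%:P))`_i| <= 2%:R ^+ size r.
Proof.
move=> a1; elim: r i => [|j r IH] i.
  by rewrite big_nil coef1; case: (i == 0)%N; rewrite ?normr1 ?normr0 ?ler01.
rewrite big_cons /=; have [Pj|_] := boolP (P j); last first.
  by apply: le_trans (IH i) _; rewrite exprS ler_peMl ?exprn_ge0 ?ler0n ?ler1n.
rewrite exprS mulrBl coefB coefXM coefCM mulr_natl mulr2n.
apply: le_trans (ler_normB _ _) _; apply: lerD; last first.
  by rewrite normrM; apply: le_trans (ler_wpM2r _ (a1 j Pj)) _; rewrite ?mul1r ?IH.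
case: (i == 0)%N; last exact: IH.
by rewrite normr0 exprn_ge0 ?ler0n.
Qed.

(* The conjugate polynomials of the powers of x have bounded rational integer *)
(* coefficients, hence x^i is conjugate to x^j for some i < j.                *)
Theorem unity_of_norm1 x : adj zeta x -> x \in Aint ->
  (forall h : Aut, `|h x| = 1) -> exists2 k, (0 < k)%N & x ^+ k = 1.
Proof.
move=> zx ix x1;
pose M := (2 ^ size (index_enum 'F_l))%N.
have cint k i : exists c : int, (conjpoly (x ^+ k))`_i = c%:~R /\ (`|c| <= M)%N.
  have [a Ea] := conjpoly_rat i (adjX k zx).
  have inta : (conjpoly (x ^+ k))`_i \is a Num.int.
    apply: Cint_rat_Aint; first by rewrite Ea Crat_rat.
    have : conjpoly (x ^+ k) \is a polyOver Aint.
      apply: rpred_prod => t _; rewrite rpredB ?polyOverX ?polyOverC //.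
      by rewrite Aint_aut rpredX.
    by move/polyOverP/(_ i).
  case/intrP: inta => c Ec; exists c; split=> //.
  have := @coef_prod_XsubC_bound _ (index_enum 'F_l) (fun t => t != 0)
    (fun t => sigma t (x ^+ k)) i.
  rewrite -/(conjpoly _) Ec -natrX -/M => H.
  have {}H : `|c%:~R| <= M%:R :> algC.
    by apply: H => t _; rewrite rmorphXn normrX /= x1 expr1n.
  by rewrite -intr_norm -[M%:R]/(M%:Z%:~R) ler_int in H; lia.
have [c' cE'] := choice (fun ki => cint ki.1 ki.2).
pose c k i := c' (k, i); have cE k i := cE' (k, i).
(* The coefficients lie between -M and M; a shift by M encodes the polynomial in a finite type, for
   the pigeonhole principle. *)
pose code k : {ffun 'I_l -> 'I_(M + M).+1} := [ffun i : 'I_l => inord `|(c k i + M%:Z)%R|%N].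
pose T := {ffun 'I_l -> 'I_(M + M).+1}.
have /injectivePn[i [j ij Eij]] : ~~ injectiveb (fun k : 'I_#|T|.+1 => code k).
  apply/negP => /injectiveP inj; have := leq_card _ inj.
  by rewrite card_ord ltnn.
have Epoly : conjpoly (x ^+ i) = conjpoly (x ^+ j).
  apply/polyP => e; have [le|le] := ltnP e l; last first.
    by rewrite !nth_default // (leq_trans (size_conjpoly _)).
  have [-> ci] := cE i e; have [-> cj] := cE j e.
  move/ffunP/(_ (Ordinal le)): Eij; rewrite !ffunE /= => /(inord_shift_inj ci cj).
  by rewrite /c => ->.
have [g0 [t t0 Ex]] : 1 != 0 :> 'F_l /\ exists2 t, t != 0 & x ^+ i = sigma t (x ^+ j).
  split; first exact: oner_neq0.
  apply: root_conjpolyP; rewrite -Epoly -[X in root _ X](sigma1 (adjX i zx)).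
  by apply: root_conjpoly; apply: oner_neq0.
set g := sigma t in Ex.
(* Iteration of x^i = g(x^j). Once g^e fixes x, two powers of x with the distinct exponents i^e and
   j^e coincide. *)
have iterE e : x ^+ (i ^ e) = iter e g x ^+ (j ^ e).
  elim: e => [|e IH]; first by rewrite !expn0 !expr1.
  have [ge geE] := aut_iter g e.
  rewrite expnS mulnC exprM IH exprAC iterSr -!geE.
  apply: etrans (_ : ge (x ^+ i) ^+ (j ^ e) = _); first by rewrite rmorphXn.
  by rewrite Ex (rmorphXn g) (rmorphXn ge) /= -exprM -expnS.
have gord : exists2 e, (0 < e)%N & iter e g x = x.
  exists l.-1; first by rewrite -ltnS prednK ?prime_gt0 ?prime_gt1.
  have [ge geE] := aut_iter g l.-1; rewrite -geE; apply: zx.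
  rewrite geE (aut_iter_exp _ (sigmaE t0)).
  rewrite -[RHS]expr1; apply/eqP; rewrite (eq_prim_root_expr zetal).
  rewrite -!val_Fp_nat // natrX natr_Zp (Fq_unity l_prime t0).
  exact: eqxx.
have [e e0 ge] := gord.
have := iterE e; rewrite ge => E.
have ije : (i ^ e != j ^ e)%N by rewrite eqn_exp2r.
have x0 : x != 0 by rewrite -normr_gt0 (x1 idfun) ltr01.
wlog : i j {ij Eij Epoly Ex iterE} E ije / (i ^ e <= j ^ e)%N.
  move=> H; case: (leqP (i ^ e) (j ^ e)) => [|/ltnW] le; first exact: (H i j).
  by apply: (H j i); rewrite // eq_sym.
move=> le; exists (j ^ e - i ^ e)%N; first by rewrite subn_gt0 ltn_neqAle ije.
by apply: (mulfI (expf_neq0 (i ^ e) x0)); rewrite -exprD subnKC // mulr1.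
Qed.

End ConjugatePoly.

Lemma hasvalXz p a m z P (k v : int) x : prime p -> prime_over p P ->
  (p ^ a * m).-primitive_root z -> hasval p a m z P v x ->
  hasval p a m z P (v * k) (x ^ k).
Proof.
move=> p_prime P_p zn vx; case: k => k; first exact: (hasvalX p_prime P_p zn).
by rewrite NegzE -exprnN mulrN; apply/hasvalV/(hasvalX p_prime P_p zn).
Qed.

Lemma uloc_prod p P I (r : seq I) (Q : pred I) F : prime_over p P ->
  (forall i, Q i -> uloc P (F i)) -> uloc P (\prod_(i <- r | Q i) F i).
Proof.
move=> P_p uF; apply: (big_ind (uloc P)) => //; first exact: (uloc1 P_p).
by move=> x y ux uy; apply: (ulocM P_p).
Qed.

Section LocalEverywhere.
Variable P : nat -> algC -> Prop.
Hypothesis PP : forall p, prime p -> prime_over p (P p).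

Lemma loc_everywhere_int (a : rat) :
  (forall p, prime p -> loc (P p) (ratr a)) -> denq a = 1.
Proof.
move=> la; apply/eqP; rewrite -absz_denq eqz_nat; apply/negPn/negP => d1.
have [p p_prime pd] : exists2 p, prime p & (p %| `|denq a|)%N.
  exists (pdiv `|denq a|); last exact: pdiv_dvd.
  by apply: pdiv_prime; rewrite ltn_neqAle eq_sym d1 absz_gt0 denq_eq0.
by move/negP: (loc_rat p_prime (PP p_prime) (la p p_prime)); rewrite dvdzE.
Qed.

Lemma loc_everywhere_rat_Aint (a : rat) :
  (forall p, prime p -> loc (P p) (ratr a)) -> (ratr a : algC) \is a Num.int.
Proof.
by move/loc_everywhere_int => a1; rewrite /ratr a1 divr1; apply: intr_int.
Qed.

Lemma uloc_everywhere_rat (a : rat) : 0 < a ->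
  (forall p, prime p -> uloc (P p) (ratr a)) -> a = 1.
Proof.
move=> a0 ua; have d1 : denq a = 1.
  by apply: loc_everywhere_int => p pp; case: (ua p pp).
have d2 : denq a^-1 = 1.
  apply: loc_everywhere_int => p pp; rewrite fmorphV.
  by case: (ulocV (PP pp) (ua p pp)).
have E1 : a = (numq a)%:~R by rewrite -[LHS]divq_num_den d1 divr1.
have E2 : a^-1 = (numq a^-1)%:~R by rewrite -[LHS]divq_num_den d2 divr1.
have n1 : 0 < numq a by rewrite numq_gt0.
have n2 : 0 < numq a^-1 by rewrite numq_gt0 invr_gt0.
have : (numq a * numq a^-1)%:~R = 1%:~R :> rat.
  by rewrite intrM -E1 -E2 mulfV // gt_eqF.
move/intr_inj => n12; rewrite E1; have -> // : numq a = 1.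
by move: n1 n2 n12; move: (numq a) (numq a^-1) => x y; nia.
Qed.

Lemma conjpoly_loc_Aint l zeta (sigma : 'F_l -> Aut) x : prime l -> l.-primitive_root zeta ->
  (forall t : 'F_l, t != 0 -> sigma t zeta = zeta ^+ (t : nat)) -> adj zeta x ->
  (forall p (h : Aut), prime p -> loc (P p) (h x)) -> x \in Aint.
Proof.
move=> l_prime zetal sE zx lx.
have cint : conjpoly sigma x \is a polyOver Num.int.
  apply/polyOverP => i; have [a Ea] := conjpoly_rat l_prime zetal sE i zx.
  rewrite Ea; apply: loc_everywhere_rat_Aint => p pp; rewrite -Ea.
  have : forall i, loc (P p) (conjpoly sigma x)`_i.
    rewrite /conjpoly; apply: (big_ind (fun f : {poly algC} => forall i, loc (P p) f`_i)).
    - by move=> j; rewrite coef1; apply: (loc_Aint (PP pp)); case: (j == 0)%N.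
    - move=> f g lf lg j; rewrite coefM.
      apply: (big_ind (loc (P p))); first exact/(loc_Aint (PP pp))/Aint0.
        exact: (locD (PP pp)).
      by move=> k _; apply: (locM (PP pp)).
    - move=> t _ j; rewrite coefB coefX coefC; apply: (locD (PP pp)).
        by apply: (loc_Aint (PP pp)); case: (j == 1)%N.
      apply: (locN (PP pp)); case: (j == 0)%N; first exact: lx.
      exact/(loc_Aint (PP pp))/Aint0.
  exact.
apply: (root_monic_Aint _ _ cint); last exact: conjpoly_monic.
rewrite -[X in root _ X](sigma1 sE zx).
by apply: root_conjpoly; apply: oner_neq0.
Qed.

End LocalEverywhere.

Section GaussQuotient.
Variables (l : nat) (zeta : algC) (sigma : 'F_l -> Aut).
Hypotheses (l_prime : prime l) (zetal : l.-primitive_root zeta).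
Hypothesis sigmaE : forall t : 'F_l, t != 0 -> sigma t zeta = zeta ^+ (t : nat).

Lemma Fp_val_bounds (t : 'F_l) : t != 0 -> (0 < (t : nat) < l)%N.
Proof.
move=> t0; apply/andP; split.
  by rewrite lt0n; apply: contraNneq t0 => t0; apply/eqP/val_inj.
by have := ltn_ord t; rewrite [X in (_ < X)%N](Fp_cast l_prime).
Qed.

Lemma Kum_uloc_aut x y p P (h : Aut) : x \in Aint -> x * x^* = y%:R ->
  abelianC x -> prime p -> coprime y p -> prime_over p P -> uloc P (h x).
Proof.
move=> ix xx abx pp yp P_p.
apply: (uloc_factor P_p (y := h x^*)).
- by apply: (loc_Aint P_p); rewrite Aint_aut.
- by apply: (loc_Aint P_p); rewrite Aint_aut (Aint_aut Num.conj).
by rewrite -rmorphM xx rmorph_nat; apply: (uloc_nat pp P_p).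
Qed.

(* B = \prod_t (sigma_(1/t) a)^t has, at the prime P and all its conjugates,  *)
(* the valuation of a product of l-th powers of Gauss sums.                   *)
Lemma gauss_quotient q P a : prime q -> (l %| q.-1)%N -> prime_over q P ->
  adj zeta a -> a != 0 -> exists Q, [/\ cyclotomicC Q, adj zeta (Q ^+ l),
    exists k : int, Q * Q^* = q%:R ^ k,
    forall p P' (h : Aut), prime p -> p != q -> prime_over p P' -> uloc P' (h Q)
  & forall h : Aut, uloc P (h
      (\prod_(t : 'F_l | t != 0) sigma t^-1 a ^+ (t : nat) / Q ^+ l))].
Proof.
move=> qp lq P_q za a0.
have ql := gauss_coprime l_prime qp lq.
have zn : (q ^ 0 * l).-primitive_root zeta by rewrite expn0 mul1n.
have [G [cG kG GG iG vG]] := gauss_sum_exists l_prime qp lq zetal P_q.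
have [V vV] : exists V : 'F_l -> int, forall u, hasval q 0 l zeta P (V u) (sigma u a).
  have H u : exists v, hasval q 0 l zeta P v (sigma u a).
    apply: (hasval_adj qp ql P_q zn); first exact: adj_aut zetal za.
    by rewrite fmorph_eq0.
  by have [V vV] := choice H; exists V.
have abG := Kum_abelian kG; have G0 := Kum_neq0 kG.
(* [V u] is the valuation of sigma_u(a) at P; with these exponents h(Q^l) has the same valuation as
   h(B) for every h. *)
pose Q := \prod_(u : 'F_l | u != 0) sigma u^-1 G ^ (V u).
have Ql : Q ^+ l = \prod_(u : 'F_l | u != 0) sigma u^-1 (G ^+ l) ^ (V u).
  rewrite -prodrXl; apply: eq_bigr => u _.
  by rewrite rmorphXn /= !exprnP exprzAC.
have zGl : adj zeta (G ^+ l) := Kum_exp_adj zetal kG.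
have adjXz x (k : int) : adj zeta x -> adj zeta (x ^ k).
  by move=> zx; case: k => k; [apply: adjX | apply/adjV/adjX].
exists Q; split.
- apply: cyclotomicC_prod => u _; have := cyclotomicC_aut (sigma u^-1) cG.
  move: (sigma _ G) => x cx; case: (V u) => k; first exact: cyclotomicCX.
  exact/cyclotomicCV/cyclotomicCX.
- by rewrite Ql; apply: adj_prod => u _; apply/adjXz/(adj_aut _ zetal).
- exists (\sum_(u : 'F_l | u != 0) V u).
  rewrite /Q rmorph_prod -big_split /=.
  have q0 : q%:R != 0 :> algC by rewrite pnatr_eq0 -lt0n prime_gt0.
  apply: (big_ind2 (fun (x : algC) k => x = q%:R ^ k)); first by rewrite expr0z.
    by move=> x k y k' -> ->; rewrite expfzDr.
  move=> u _; rewrite fmorphXz /= -expfzMl; congr (_ ^ _).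
  by rewrite -[(sigma _ _)^*](abG (sigma u^-1) Num.conj) -rmorphM GG rmorph_nat.
- move=> p P' h pp pq P'_p; rewrite rmorph_prod; apply: (uloc_prod _ P'_p) => u _.
  rewrite /= fmorphXz; apply: (ulocXz P'_p).
  apply: (Kum_uloc_aut (h \o sigma u^-1) iG GG abG pp _ P'_p).
  by rewrite prime_coprime // dvdn_prime2 // eq_sym.
move=> h; have [s s0 hs] := aut_Fp l_prime zetal h.
apply: (zunit_uloc P_q zn); apply: hasval_uloc_zunit.
rewrite fmorph_div Ql !rmorph_prod /=.
(* The common valuation of h(B) and h(Q^l); the substitution t = s/u turns one sum into the
   other. *)
pose v := \sum_(u : 'F_l | u != 0) ((s * u^-1 : 'F_l)%R : nat)%:Z * V u.
rewrite -(subrr v); apply: (hasvalM qp P_q zn); last apply: hasvalV.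
  have -> : v = \sum_(t : 'F_l | t != 0) V (s * t^-1) * (t : nat)%:Z.
    have sK (t : 'F_l) : s * (s * t^-1)^-1 = t by rewrite invfM invrK mulVKf.
    rewrite [RHS](reindex_onto (fun u => s * u^-1) (fun u => s * u^-1)) //=.
    apply: eq_big => [t|t _]; last by rewrite sK mulrC.
    by rewrite sK eqxx andbT mulf_eq0 invr_eq0 (negPf s0).
  apply: (hasval_prod qp P_q zn) => t t0; rewrite rmorphXn /=.
  apply: (hasvalX qp P_q zn).
  by rewrite (sigma_comp l_prime zetal sigmaE _ s0 hs za) ?invr_eq0.
apply: (hasval_prod qp P_q zn) => u u0; rewrite fmorphXz.
apply: (hasvalXz _ qp P_q zn); apply: (vG _ (h \o sigma u^-1)).
  by apply: Fp_val_bounds; rewrite mulf_neq0 ?invr_eq0.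
rewrite /= sigmaE ?invr_eq0 // rmorphXn /= hs -exprM.
by rewrite (prim_exp_FpM l_prime zetal).
Qed.

End GaussQuotient.

Section BaseUnit.
Variables (l : nat) (zeta : algC).
Hypotheses (l_prime : prime l) (zetal : l.-primitive_root zeta).

Lemma adj_uloc_bound a : adj zeta a -> a != 0 -> exists2 D : nat, (0 < D)%N
  & forall p P (h : Aut), prime p -> ~~ (p %| D)%N -> prime_over p P -> uloc P (h a).
Proof.
move=> za a0; have [d d0 zd] := adj_Zadj za; have [e e0 ze] := adj_Zadj (adjV za).
exists (d * e)%N; rewrite ?muln_gt0 ?d0 // => p P h pp pde P_p.
have ude : uloc P (d * e)%:R.
  by apply: (uloc_nat pp P_p); rewrite coprime_sym prime_coprime.
have int b : Zadj zeta b -> loc P (h b).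
  by move=> zb; apply: (loc_Aint P_p); rewrite Aint_aut; apply: (Zadj_Aint zetal).
have ud : uloc P (h (d%:R * a)).
  apply: (uloc_factor P_p (y := h (e%:R * a^-1))); [exact: int | exact: int |].
  by rewrite -rmorphM mulrACA mulfV // mulr1 -natrM rmorph_nat.
have -> : h a = h (d%:R * a) * d%:R^-1.
  have d1 : d%:R != 0 :> algC by rewrite pnatr_eq0 -lt0n.
  by rewrite rmorphM rmorph_nat mulrAC mulfV // mul1r.
apply: (ulocM P_p) => //; apply: (ulocV P_p); apply: (uloc_nat pp P_p).
rewrite coprime_sym prime_coprime //; apply: contra pde; exact: dvdn_mulr.
Qed.

(* With a = alpha^l, the l-th power B of the Stickelberger element applied to *)
(* alpha is a product of l-th powers of Gauss sums times a number eps, which  *)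
(* is a unit everywhere and has absolute value 1 under every embedding.       *)
Lemma Kum_cyclotomic_unit alpha : Kum zeta alpha ->
  (forall p P (h : Aut), prime p -> ~~ (l %| p.-1)%N -> prime_over p P ->
     uloc P (h (alpha ^+ l))) ->
  cyclotomicC alpha.
Proof.
move=> kal ual; have alpha0 := Kum_neq0 kal.
have [sigma sE] := Fp_aut l_prime zetal.
pose a := alpha ^+ l; have za : adj zeta a := Kum_exp_adj zetal kal.
have a0 : a != 0 by rewrite expf_neq0.
pose A := \prod_(t : 'F_l | t != 0) sigma t^-1 alpha ^+ (t : nat).
pose B := \prod_(t : 'F_l | t != 0) sigma t^-1 a ^+ (t : nat).
have AB : A ^+ l = B.
  rewrite -prodrXl; apply: eq_bigr => t _.
  by rewrite rmorphXn /= exprAC.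
have A0 : A != 0 by apply/prodf_neq0 => t _; rewrite expf_neq0 ?fmorph_eq0.
suff cA : cyclotomicC A.
  (* Up to factors in Q(zeta), sigma_(1/t) raises alpha to the power 1/t, so A is alpha^M. Each of
     the l - 1 summands of M is 1 modulo l, hence M = -1 modulo l. *)
  pose M := (\sum_(t : 'F_l | t != 0%R) (t^-1)%R * t)%N.
  apply: (Kum_cyclotomic zetal kal _ A0 _ cA (k := M)).
    have : (M%:R : 'F_l) = -1.
      rewrite natr_sum (eq_bigr (fun _ => 1)) => [|t t0]; last first.
        by rewrite natrM !natr_Zp mulVf.
      rewrite sumr_const.
      have -> : #|(fun t : 'F_l => t != 0%R)| = l.-1.
        by rewrite -[RHS](congr1 predn (card_Fp l_prime)) -(cardC1 (0 : 'F_l)); apply: eq_card.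
      apply/eqP; rewrite -addr_eq0 -mulrSr prednK ?prime_gt0 //.
      by rewrite pchar_Fp_0.
    move=> ME; rewrite coprime_sym prime_coprime // (dvdn_pcharf (pchar_Fp l_prime)).
    by rewrite ME oppr_eq0 oner_eq0.
  rewrite /M expr_sum -prodf_div; apply: adj_prod => t t0.
  rewrite exprM -expr_div_n; apply: adjX.
  by apply: (Kum_quot zetal kal); rewrite sE ?invr_eq0.
have [D D0 uD] := adj_uloc_bound za a0.
have [P PP] : exists P : nat -> algC -> Prop, forall p, prime p -> prime_over p (P p).
  have H p : exists Pp : algC -> Prop, prime p -> prime_over p Pp.
    case: (boolP (prime p)) => [pp|_]; last by exists xpredT.
    by have [Pp PpE] := prime_over_exists pp; exists Pp.
  by have [P PP] := choice H; exists P.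
have [Q QE] : exists Q : nat -> algC, forall q, prime q -> (l %| q.-1)%N ->
   [/\ cyclotomicC (Q q), adj zeta (Q q ^+ l),
    exists k : int, Q q * (Q q)^* = q%:R ^ k,
    forall p P' (h : Aut), prime p -> p != q -> prime_over p P' -> uloc P' (h (Q q))
  & forall h : Aut, uloc (P q) (h (B / Q q ^+ l))].
  have H q : exists Qq, prime q -> (l %| q.-1)%N ->
   [/\ cyclotomicC Qq, adj zeta (Qq ^+ l),
    exists k : int, Qq * Qq^* = q%:R ^ k,
    forall p P' (h : Aut), prime p -> p != q -> prime_over p P' -> uloc P' (h Qq)
  & forall h : Aut, uloc (P q) (h (B / Qq ^+ l))].
    case: (boolP (prime q && (l %| q.-1)%N)) => [/andP[qp lq]|H]; last first.
      by exists 0 => qp lq; rewrite qp lq in H.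
    have [Qq QqE] := gauss_quotient l_prime zetal sE qp lq (PP q qp) za a0.
    by exists Qq.
  by have [Q QE] := choice H; exists Q.
(* The conjugates of a are units at primes not dividing D, and the hypothesis on alpha covers the q
   with l not dividing q - 1; Gauss sums are needed only at the remaining q. *)
pose S := [seq q <- primes D | (l %| q.-1)%N].
have SE q : q \in S -> prime q /\ (l %| q.-1)%N.
  by rewrite mem_filter mem_primes => /and3P[lq qp _].
pose QS := \prod_(q <- S) Q q.
have cQS : cyclotomicC QS.
  by rewrite /QS big_seq; apply: cyclotomicC_prod => q /SE[qp lq]; case: (QE q qp lq).
pose eps := B / QS ^+ l.
have zeps : adj zeta eps.
  apply: adjM; first by apply: adj_prod => t _; apply/adjX/(adj_aut _ zetal).
  apply: adjV; rewrite /QS -prodrXl big_seq; apply: adj_prod => q /SE[qp lq].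
  by case: (QE q qp lq).
have uQ p q (h : Aut) : prime p -> q \in S -> p != q -> uloc (P p) (h (Q q)).
  by move=> pp /SE[qp lq] pq; case: (QE q qp lq) => _ _ _ H _; apply: (H p) => //; apply: PP.
have ueps p (h : Aut) : prime p -> uloc (P p) (h eps).
  move=> pp; have uB : p \notin S -> uloc (P p) (h B).
    move=> pS; rewrite rmorph_prod; apply: (uloc_prod _ (PP p pp)) => t _.
    rewrite rmorphXn /=; apply: (ulocX (PP p pp)).
    have [lp|lp] := boolP (l %| p.-1)%N; last exact: (ual p _ (h \o sigma t^-1) pp lp (PP p pp)).
    apply: (uD p _ (h \o sigma t^-1) pp _ (PP p pp)); apply: contra pS => pD.
    by rewrite mem_filter lp mem_primes pp D0.
  have [pS|pS] := boolP (p \in S); last first.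
    rewrite fmorph_div; apply: (ulocM (PP p pp)); first exact: uB.
    apply: (ulocV (PP p pp)); rewrite rmorphXn /=; apply: (ulocX (PP p pp)).
    rewrite rmorph_prod /= big_seq; apply: (uloc_prod _ (PP p pp)) => q qS.
    by apply: uQ => //; apply: contraNneq pS => ->.
  rewrite /eps /QS (big_rem p) //= exprMn invfM mulrA rmorphM.
  have [pp' lp] := SE p pS; case: (QE p pp' lp) => _ _ _ _ H.
  apply: (ulocM (PP p pp)); first exact: H.
  rewrite fmorphV; apply: (ulocV (PP p pp)); rewrite rmorphXn /=; apply: (ulocX (PP p pp)).
  rewrite rmorph_prod /= big_seq; apply: (uloc_prod _ (PP p pp)) => q.
  rewrite (mem_rem_uniq _ (filter_uniq _ (primes_uniq D))) !inE => /andP[qp qS].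
  by apply: uQ; rewrite // eq_sym.
have ieps : eps \in Aint.
  apply: (conjpoly_loc_Aint PP l_prime zetal sE zeps) => p h pp.
  by case: (ueps p h pp).
have Neps : exists r : rat, eps * eps^* = ratr r.
  have NQ : exists r : rat, QS * QS^* = ratr r.
    rewrite /QS rmorph_prod -big_split /= big_seq.
    apply: (big_ind (fun x : algC => exists r : rat, x = ratr r)).
    - by exists 1; rewrite rmorph1.
    - by move=> x y [r ->] [s ->]; exists (r * s); rewrite rmorphM.
    move=> q /SE[qp lq]; case: (QE q qp lq) => _ _ [k ->] _ _.
    by exists (q%:R ^ k); rewrite fmorphXz /= rmorph_nat.
  (* Complex conjugation takes the conjugate of a at -t to the one at t, and the representatives of
     t and -t add up to l. So the product is the l-th power of the norm of a. *)
  have NB : B * B^* = (\prod_(t : 'F_l | t != 0) sigma t^-1 a) ^+ l.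
    have conjz : zeta^* = zeta ^+ ((-1 : 'F_l)%R : nat).
      have := conj_unity (prime_gt0 l_prime) (prim_expr_order zetal) => E.
      apply: (mulfI (prim_root_neq0 zetal)); rewrite E -exprS.
      apply: esym; apply/eqP; rewrite -(prim_order_dvd zetal).
      rewrite (dvdn_pcharf (pchar_Fp l_prime)) mulrSr natr_Zp.
      by rewrite addrC subrr.
    have m1 : -1 != 0 :> 'F_l by rewrite oppr_eq0 oner_eq0.
    rewrite /B [in X in _ * X](reindex_inj (@oppr_inj 'F_l)) rmorph_prod /=.
    rewrite [X in _ * X](eq_bigl (fun t : 'F_l => t != 0)); last by move=> t; rewrite oppr_eq0.
    rewrite -big_split -prodrXl /=; apply: eq_bigr => t t0.
    have Ec : (sigma (- t)^-1 a)^* = sigma t^-1 a.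
      have := sigma_comp l_prime zetal sE (h := Num.conj) (t := (- t)^-1) _ m1 conjz za.
      by rewrite invrN mulN1r opprK /= => -> //; rewrite oppr_eq0 invr_eq0.
    rewrite (rmorphXn Num.conj) /= Ec -exprD; congr (_ ^+ _).
    rewrite -[RHS](Fp_cast l_prime) /=; case/andP: (Fp_val_bounds l_prime t0) => t_gt0 _.
    rewrite modn_small ?subnKC ?(ltnW (ltn_ord t)) //.
    by rewrite ltn_subrL t_gt0.
  have [r1 E1] := NQ.
  have [r2 E2] : exists r2 : rat, B * B^* = ratr r2.
    rewrite NB; have [r2 ->] : exists r : rat, \prod_(t : 'F_l | t != 0) sigma t^-1 a = ratr r; last first.
      by exists (r2 ^+ l); rewrite rmorphXn.
    apply: adj1_rat => h _; have [s s0 hs] := aut_Fp l_prime zetal h.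
    rewrite rmorph_prod [RHS](reindex_inj (mulfI (invr_neq0 s0))) /=.
    apply: eq_big => [t|t t0]; first by rewrite mulf_eq0 invr_eq0 (negPf s0).
    by rewrite (sigma_comp l_prime zetal sE _ s0 hs za) ?invr_eq0 // invfM invrK.
  exists (r2 / r1 ^+ l).
  have -> : ratr (r2 / r1 ^+ l) = ratr r2 / ratr r1 ^+ l :> algC.
    by rewrite fmorph_div rmorphXn.
  rewrite -E1 -E2 /eps.
  by rewrite fmorph_div (rmorphXn Num.conj) /= exprMn invfM mulrACA.
have N1 : eps * eps^* = 1.
  have [r Er] := Neps; rewrite Er.
  have B0 : B != 0 by rewrite -AB expf_neq0.
  have eps0 : eps != 0.
    by apply: (uloc_neq0 (PP 2%N isT)); apply: (ueps 2%N idfun isT).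
  have -> : r = 1; last by rewrite rmorph1.
  apply: (uloc_everywhere_rat PP) => [|p pp].
    by rewrite -(@ltr0q algC) -Er -normCK exprn_gt0 // normr_gt0.
  rewrite -Er; apply: (ulocM (PP p pp)); first exact: (ueps p idfun).
  exact: (ueps p Num.conj).
have abeps : abelianC eps := abelianC_adj zetal zeps.
have norm1 (h : Aut) : `|h eps| = 1.
  apply/eqP; rewrite -(pexpr_eq1 (n := 2)) // normCK.
  by rewrite -[(h eps)^*](abeps h Num.conj) -rmorphM N1 rmorph1.
have [k k0 epsk] := unity_of_norm1 l_prime zetal sE zeps ieps norm1.
have -> : A = A / QS * QS.
  rewrite divfK //; apply/negP => /eqP Q0.
  have := ueps 2%N idfun isT; rewrite /eps Q0 expr0n gtn_eqF ?prime_gt0 // invr0 mulr0.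
  by move/(uloc_neq0 (PP 2%N isT)); rewrite eqxx.
apply: cyclotomicCM => //; apply: (@cyclotomicC_unity (l * k)).
  by rewrite muln_gt0 prime_gt0.
by rewrite exprM expr_div_n AB.
Qed.

End BaseUnit.

(** [Kum_project] for all d with 1 < d < l passes to y such that y^l has the form g(c)/c for every
    nontrivial g. At a prime p distinct from l with p not 1 modulo l take for g the Frobenius, which
    preserves the valuation of c; at p = l take zeta -> zeta^2, an inertia element, for which g(c)/c
    is congruent to a power of 2. In both cases y^l is a unit, as [Kum_cyclotomic_unit] requires. *)
Lemma Kum_cyclotomic_odd l zeta alpha : prime l -> l != 2%N ->
  l.-primitive_root zeta -> Kum zeta alpha -> cyclotomicC alpha.
Proof.
move=> l_prime l2 zetal kal; have l_gt2 : (2 < l)%N.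
  by rewrite ltn_neqAle eq_sym l2 prime_gt1.
have sP d : d \in iota 2 (l - 2) -> (1 < d < l)%N.
  by rewrite mem_iota subnKC // ltnW.
have [y [k [ky kl zy yP]]] := Kum_project l_prime zetal kal sP.
apply: (Kum_cyclotomic zetal kal kl (Kum_neq0 ky) zy).
apply: (Kum_cyclotomic_unit l_prime zetal ky) => p P h pp lp P_p.
have inS d : (1 < d < l)%N -> d \in iota 2 (l - 2).
  by rewrite mem_iota subnKC // ltnW.
have hgc (g : Aut) c : adj zeta c -> h (g c / c) = g (h c) / h c.
  by move=> zc; rewrite fmorph_div (abelianC_adj zetal zc).
have [pl|pl] := eqVneq p l; last first.
  have pcl : coprime p l by rewrite prime_coprime // dvdn_prime2.
  have [g gE] := aut_exp pcl; have gz := gE _ (prim_expr_order zetal).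
  have gz' : g zeta = zeta ^+ (p %% l) by rewrite (prim_expr_mod zetal).
  have /inS dS : (1 < p %% l < l)%N.
    rewrite ltn_mod prime_gt0 // andbT ltn_neqAle eq_sym andbC lt0n.
    rewrite -[(p %% l)%N == 0%N]/(l %| p)%N dvdn_prime2 // eq_sym pl /=.
    apply: contra lp => /eqP p1.
    by rewrite -subn1 -(eqn_mod_dvd _ (prime_gt0 pp)) p1 modn_small // ltnW.
  have [c [zc c0 ->]] := yP _ g dS gz'; have hc0 : h c != 0 by rewrite fmorph_eq0.
  have zn : (p ^ 0 * l).-primitive_root zeta by rewrite expn0 mul1n.
  have [v vc] := hasval_adj pp pcl P_p zn (adj_aut h zetal zc) hc0.
  rewrite hgc //; apply: (zunit_uloc P_p zn); apply: hasval_uloc_zunit.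
  rewrite -(subrr v); apply: (hasvalM pp P_p zn); last exact: hasvalV.
  by apply: (Frobenius_hasval pp P_p zn gz) => //; rewrite expn0 !modn1.
have [g gE] : exists g : Aut, forall z, z ^+ l = 1 -> g z = z ^+ 2.
  by apply: aut_exp; rewrite prime_coprime // dvdn_prime2 // eq_sym.
have gz := gE _ (prim_expr_order zetal).
have [c [zc c0 ->]] := yP _ g (inS 2%N l_gt2) gz.
have hc0 : h c != 0 by rewrite fmorph_eq0.
rewrite -pl in l_prime l2 zetal *.
have zn : (p ^ 1 * 1).-primitive_root zeta by rewrite muln1.
have [v vc] := hasval_adj pp (coprimen1 p) P_p zn (adj_aut h zetal zc) hc0.
have c2p : coprime 2 p by rewrite prime_coprime // dvdn_prime2 // eq_sym.
rewrite hgc //; apply: (lcong_uloc P_p (inertia_lcong pp P_p zn gz _ _ c2p vc)) => //.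
by apply: (ulocXz P_p); apply: (uloc_nat pp P_p).
Qed.

Lemma sqrt2_exists : exists2 s : algC, s ^+ 2 = 2%:R & cyclotomicC s.
Proof.
have [z z8] := C_prim_root_exists (isT : (0 < 8)%N).
have z0 := prim_root_neq0 z8; exists (z + z^-1); last first.
  by exists 8, z; split=> //; apply: adjD; [|apply: adjV].
have z4 : z ^+ 4 = -1.
  have : (z ^+ 4) ^+ 2 == 1 by rewrite -exprM (prim_expr_order z8).
  rewrite sqrf_eq1 => /orP[/eqP z4|/eqP //].
  by have := prim_order_dvd z8 4; rewrite z4 eqxx.
have z2 : z^-1 ^+ 2 = - z ^+ 2.
  by apply: (mulfI (expf_neq0 2 z0)); rewrite -exprMn mulfV // expr1n mulrN -exprD z4 opprK.
by rewrite sqrrD mulfV // z2 addrAC subrr add0r.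
Qed.

(** For l = 2 the base field is Q, and 2 is the only prime p with p - 1 odd. Dividing alpha by a
    power of the cyclotomic number sqrt 2 makes its square a unit at 2. *)
Lemma Kum_cyclotomic_two zeta alpha :
  2.-primitive_root zeta -> Kum zeta alpha -> cyclotomicC alpha.
Proof.
move=> zeta2 kal; have alpha0 := Kum_neq0 kal.
have zetaE : zeta = -1.
  have : zeta ^+ 2 == 1 by rewrite (prim_expr_order zeta2).
  rewrite sqrf_eq1 => /orP[/eqP z1|/eqP //].
  by have := prim_order_dvd zeta2 1; rewrite expr1 z1 eqxx.
have [P P_2] := prime_over_exists (isT : prime 2).
have zn : (2 ^ 1 * 1).-primitive_root zeta by rewrite muln1.
have [v [u [y [w [zy zw Py Pw ->]]]]] :=
  hasval_adj (isT : prime 2) (coprimen1 2) P_2 zn (Kum_exp_adj zeta2 kal) (expf_neq0 2 alpha0).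
have -> : unif 2 1 1 zeta = 2%:R by rewrite /unif /= expr1 zetaE opprK.
move=> Ea; have [s s2 cs] := sqrt2_exists.
have s0 : s != 0 by apply/eqP => s0; move/eqP: s2; rewrite s0 expr0n eq_sym pnatr_eq0.
have ks : Kum zeta s.
  split=> //; first by case: cs => n [z [zn' zs]]; apply: abelianC_adj zn' zs.
  move=> h _; have : h s ^+ 2 == s ^+ 2 by rewrite -rmorphXn /= s2 rmorph_nat.
  rewrite eqf_sqr => /orP[] /eqP ->; first by exists 0%N; rewrite mul1r.
  by exists 1%N; rewrite zetaE expr1 mulN1r.
pose b := alpha * (s ^ v)^-1.
have csv (k : int) : cyclotomicC (s ^ k).
  by case: k => k; [apply: cyclotomicCX | apply/cyclotomicCV/cyclotomicCX].
have ksv (k : int) : Kum zeta (s ^ k).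
  by case: k => k; [apply: (KumX zeta2) | apply/(KumV zeta2)/(KumX zeta2)].
have -> : alpha = b * s ^ v by rewrite /b divfK // expfz_neq0.
apply: cyclotomicCM (csv v); apply: (Kum_cyclotomic_unit (isT : prime 2) zeta2).
  by apply: KumM => //; apply: (KumV zeta2).
have Zint x : Zadj zeta x -> exists i : int, x = i%:~R.
  case=> f ->; rewrite zetaE; exists f.[-1].
  by rewrite -horner_map /= rmorphN rmorph1.
have [i Ei] := Zint y zy; have [j Ej] := Zint w zw.
have odd_int (k : int) : ~ P k%:~R -> ~~ (2 %| `|k|)%N.
  move=> Pk; apply/negP => /dvdnP[e Ek]; apply: Pk.
  have -> : k = (sgz k * e%:Z) * 2%:Z by rewrite {1}[k]intEsg Ek PoszM mulrA.
  by rewrite intrM; apply: (prime_overM P_2) (prime_over_p P_2); apply: Aint_int.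
have Eb : b ^+ 2 = y / w.
  have -> : b ^+ 2 = alpha ^+ 2 / 2%:R ^ v by rewrite expr_div_n (exprnP (s ^ v) 2) exprzAC -exprnP s2.
  by rewrite Ea mulrAC mulfV ?mul1r // expfz_neq0 // pnatr_eq0.
move=> p P' h pp; case: (even_prime pp) => [-> _ P'_2|]; last first.
  by move=> po; rewrite dvdn2 -subn1 oddB ?prime_gt0 // po.
rewrite Eb Ei Ej fmorph_div !rmorph_int.
have ui (k : int) : ~ P k%:~R -> uloc P' k%:~R.
  move=> /odd_int k2; apply: (uloc_Aint P'_2 (Aint_int k)).
  by move/(P_int_dvd (isT : prime 2) P'_2); rewrite dvdzE; apply/negP.
by apply: (ulocM P'_2); [|apply: (ulocV P'_2)]; apply: ui; rewrite -?Ei -?Ej.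
Qed.

Theorem Kum_cyclotomicC l zeta alpha : prime l -> l.-primitive_root zeta ->
  Kum zeta alpha -> cyclotomicC alpha.
Proof.
move=> l_prime; have [-> zeta2|l2 zetal] := eqVneq l 2%N.
  exact: (Kum_cyclotomic_two zeta2).
exact: (Kum_cyclotomic_odd l_prime l2 zetal).
Qed.

(** * The Kronecker--Weber theorem *)

(** If x is not in Q(z), [kummer_descent] replaces it, up to a factor in Q(z), by a Kummer generator
    over the l-th cyclotomic field, where the Gauss sum argument applies. *)
Lemma cyclotomicC_exp l x : prime l -> abelianC x -> cyclotomicC (x ^+ l) ->
  cyclotomicC x.
Proof.
move=> l_prime abx [n1 [z1 [z1n zx]]].
have [->|x0] := eqVneq x 0; first by rewrite -(rmorph0 ratr); apply: cyclotomicC_rat.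
have n1_gt0 := prim_order_gt0 z1n; have l_gt0 := prime_gt0 l_prime.
(* z will have order N l, so that z^l already generates a field containing x^l; the factor 4 l makes
   l^2 and 4 divide the order of z. *)
pose N := (n1 * (4 * l))%N; have Nl_gt0 : (0 < N * l)%N by rewrite !muln_gt0 n1_gt0 l_gt0.
have [z zn] := C_prim_root_exists Nl_gt0.
have [k Ez1] : exists k, z1 = (z ^+ l) ^+ k.
  have zlN : N.-primitive_root (z ^+ l).
    by have := dvdn_prim_root zn (dvdn_mulr l (dvdnn N)); rewrite mulKn // muln_gt0 n1_gt0 muln_gt0.
  have z1N : z1 ^+ N = 1 by rewrite exprM (prim_expr_order z1n) expr1n.
  by have [i ->] := prim_rootP zlN z1N; exists i.
have zxl : adj (z ^+ l) (x ^+ l).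
  by apply: adj_trans zx; rewrite Ez1; apply/adjX/adj_root.
have lln : (l * l %| N * l)%N by rewrite dvdn_pmul2r // /N !dvdn_mull.
have n4 : (4 %| N * l)%N by rewrite /N -!mulnA dvdn_mull // dvdn_mulr.
have [zadj|zadj] := pselect (adj z x); first by exists (N * l)%N, z.
have [beta [beta0 zbeta betafix]] := kummer_descent zn l_prime lln n4 x0 abx zxl zadj.
have cyq : cyclotomicC (beta / x) by exists (N * l)%N, z.
have kb : Kum (z ^+ (N * l %/ l)) beta.
  split=> //; rewrite -[beta](divfK x0); apply: abelianCM => //.
  exact: abelianC_adj zn zbeta.
have zl : l.-primitive_root (z ^+ (N * l %/ l)).
  by apply: (dvdn_prim_root zn); apply: dvdn_mull.
have cb := Kum_cyclotomicC l_prime zl kb.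
have -> : x = beta * (beta / x)^-1 by rewrite invf_div mulrC divfK.
exact/cyclotomicCM/cyclotomicCV.
Qed.

(** Fourier inversion over the powers of h: the mean of the l resolvents keeps only the term i = 0,
    which is x. *)
Lemma cyclotomicC_resolvent l zl (h : Aut) x : prime l -> l.-primitive_root zl ->
  h zl = zl -> iter l h x = x ->
  (forall j, let y := \sum_(i < l) zl ^- (i * j) * iter i h x in
     cyclotomicC y) ->
  cyclotomicC x.
Proof.
move=> l_prime zln hzl hlx cy; have l_gt0 := prime_gt0 l_prime.
have -> : x = ratr l%:R^-1 *
    \sum_(j < l) \sum_(i < l) zl ^- (i * j) * iter i h x.
  rewrite fmorphV rmorph_nat exchange_big /= (bigD1 (Ordinal l_gt0)) //=.
  rewrite [X in _ + X]big1 => [|i i0]; last first.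
    rewrite -mulr_suml; have -> : \sum_(j < l) zl ^- (i * j) = 0.
      have zi1 : zl ^- i != 1.
        rewrite invr_eq1 -(prim_order_dvd zln) gtnNdvd // lt0n.
        by apply: contraNneq i0 => i0; apply/eqP/val_inj.
      apply: (mulfI (_ : zl ^- i - 1 != 0)); first by rewrite subr_eq0.
      rewrite mulr0; under eq_bigr => j _ do rewrite exprM -exprVn.
      by rewrite -subrX1 exprVn exprAC (prim_expr_order zln) expr1n invr1 subrr.
    by rewrite mul0r.
  under eq_bigr => j _ do rewrite mul0n expr0 invr1 mul1r.
  rewrite sumr_const card_ord addr0 -[x *+ l]mulr_natl mulKf //.
  by rewrite pnatr_eq0 -lt0n.
by apply: cyclotomicCM (cyclotomicC_rat _) _; apply: cyclotomicC_sum.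
Qed.

Lemma iter_fix_order (s : seq algC) (h : Aut) x : (forall i, iter i h x \in s) ->
  exists2 e, (0 < e <= size s)%N & iter e h x = x.
Proof.
move=> hs; pose f (i : 'I_(size s).+1) := index (iter i h x) s.
have fs i : (f i < size s)%N by rewrite index_mem.
have /injectivePn[i [j ij Eij]] : ~~ injectiveb (fun i => Ordinal (fs i)).
  by apply/negP => /injectiveP/leq_card; rewrite !card_ord ltnn.
have {}Eij : iter i h x = iter j h x.
  have := congr1 (fun k : 'I_(size s) => nth 0 s k) Eij.
  by rewrite /= !nth_index.
wlog lt : i j ij Eij / (i < j)%N.
  move=> H; case: (ltngtP i j) => [lt|lt|E]; [exact: (H i j) | |].
    by apply: (H j i); rewrite // eq_sym.
  by case/eqP: ij; apply: val_inj.
exists (j - i)%N; first by rewrite subn_gt0 lt (leq_trans (leq_subr _ _)) // -ltnS.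
have [hi hiE] := aut_iter h i; apply: (fmorph_inj hi); rewrite !hiE.
by rewrite -iterD subnKC ?Eij // ltnW.
Qed.

(* Induction on the number of conjugates of x over Q(z): Lagrange resolvents  *)
(* for an automorphism of prime order l write x in terms of l-th roots of     *)
(* numbers with fewer conjugates.                                             *)
Lemma abelian_cyclotomic_bounded n d z k x : n.-primitive_root z ->
  (forall l, prime l -> (l <= d)%N -> (l %| n)%N) -> abelianC x ->
  (k <= d)%N ->
  (exists2 s : seq algC, (size s <= k)%N & forall h : Aut, h z = z -> h x \in s) ->
  cyclotomicC x.
Proof.
move=> zn nd; elim: k x => [|k IH] x abx kd [s sk sx].
  by have := sx idfun erefl; move: sk; rewrite leqn0 => /nilP ->.
have [zx|] := pselect (adj z x); first by exists n, z.
move=> nzx; have [h [hz hx]] : exists h : Aut, h z = z /\ h x <> x.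
  apply: contrapT => H; apply: nzx => h hz; apply: contrapT => hx.
  by apply: H; exists h.
have iterz i : iter i h z = z by elim: i => //= i ->.
have [e0 /andP[e0_gt0 e0s] he0] : exists2 e, (0 < e <= size s)%N & iter e h x = x.
  apply: iter_fix_order => i; have [hi hiE] := aut_iter h i.
  by rewrite -hiE; apply: sx; rewrite hiE.
have exe : exists e, (0 < e)%N && (iter e h x == x) by exists e0; rewrite e0_gt0 he0 eqxx.
case: (ex_minnP exe) => e /andP[e_gt0 /eqP hex] emin.
have ed : (e <= d)%N.
  apply: leq_trans (leq_trans e0s (leq_trans sk kd)).
  by apply: emin; rewrite e0_gt0 he0 eqxx.
have e1 : e != 1%N by apply/eqP => e1; apply: hx; rewrite -[RHS]hex e1.
pose l := pdiv e.
have l_prime : prime l by apply: pdiv_prime; rewrite ltn_neqAle eq_sym e1.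
have le : (l %| e)%N := pdiv_dvd e.
have ln : (l %| n)%N by apply: nd => //; apply: leq_trans ed; apply: dvdn_leq.
have [h' h'E] := aut_iter h (e %/ l).
have h'z : h' z = z by rewrite h'E.
have h'x : h' x != x.
  apply/eqP; rewrite h'E => E; have := emin (e %/ l)%N.
  rewrite E eqxx divn_gt0 ?prime_gt0 // dvdn_leq // => /(_ isT).
  by rewrite leqNgt ltn_Pdiv ?prime_gt1.
have h'lx : iter l h' x = x.
  have -> : iter l h' x = iter l (iter (e %/ l) h) x by apply: eq_iter.
  by rewrite -iterM mulnC divnK.
have zl := dvdn_prim_root zn ln; set zeta := z ^+ _ in zl.
have h'zeta : h' zeta = zeta by rewrite rmorphXn /= h'z.
apply: (cyclotomicC_resolvent l_prime zl h'zeta h'lx) => j /=.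
set y := \sum_(i < l) _.
have aby : abelianC y.
  apply: (big_ind abelianC); first by move=> g1 g2; rewrite !rmorph0.
    exact: abelianCD.
  move=> i _; apply: abelianCM.
    by apply/abelianCV/abelianCX; apply: (abelianC_adj zl).
  by have [hi hiE] := aut_iter h' i; rewrite -hiE; apply: abelianC_aut.
have h'y : h' y = zeta ^+ j * y.
  have zeta0 := prim_root_neq0 zl.
  pose F i := zeta ^- (i * j) * iter i h' x.
  have F1 i : h' (F i) = zeta ^+ j * F i.+1.
    rewrite /F; have -> : zeta ^- (i.+1 * j) = zeta ^- j * zeta ^- (i * j) by rewrite mulSn exprD invfM.
    rewrite mulrA (mulVKf (expf_neq0 j zeta0)).
    by rewrite rmorphM fmorphV rmorphXn /= h'zeta.
  have F0 : F l = F 0%N.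
    by rewrite /F mul0n exprM (prim_expr_order zl) expr1n expr0 h'lx.
  rewrite rmorph_sum (eq_bigr (fun i : 'I_l => zeta ^+ j * F i.+1)) => [|i _]; last exact: F1.
  rewrite -mulr_sumr; congr (_ * _); rewrite /y -/F.
  rewrite -(big_mkord xpredT (fun i => F i.+1)) -(big_mkord xpredT F).
  by apply: (addrI (F 0%N)); rewrite -big_nat_recl // big_nat_recr //= F0 addrC.
apply: (cyclotomicC_exp l_prime aby); apply: (IH (y ^+ l)).
- exact: abelianCX.
- exact: ltnW.
have h'yl : h' (y ^+ l) = y ^+ l.
  by rewrite rmorphXn /= h'y exprMn exprAC (prim_expr_order zl) expr1n mul1r.
(* Automorphisms commute on x, so g(y^l) depends only on g(x). *)
have [f fE] : exists f : algC -> algC, forall g : Aut, g z = z -> f (g x) = g (y ^+ l).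
  have H v : exists b, forall g : Aut, g z = z -> g x = v -> g (y ^+ l) = b.
    have [[g [gz gx]]|nex] := pselect (exists g : Aut, g z = z /\ g x = v); last first.
      by exists 0 => g gz gx; case: nex; exists g.
    exists (g (y ^+ l)) => g' g'z g'x; rewrite !rmorphXn; congr (_ ^+ l).
    rewrite !rmorph_sum; apply: eq_bigr => i _; rewrite !rmorphM !fmorphV !rmorphXn /=.
    rewrite g'z gz; congr (_ * _); have [hi hiE] := aut_iter h' i.
    by rewrite -!hiE (abx g' hi) (abx g hi) g'x gx.
  by have [f fE] := choice H; exists f => g gz; rewrite (fE (g x) g).
(* h' fixes y^l, so x and h'(x) yield the same conjugate of y^l; dropping h'(x) makes the list
   shorter. *)
exists [seq f v | v <- s & v != h' x].
  rewrite size_map size_filter -ltnS (leq_trans _ sk) //.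
  rewrite -(count_predC (pred1 (h' x)) s) -[X in (X < _)%N]add0n ltn_add2r.
  by rewrite -has_count has_pred1 sx.
move=> g gz; have [Eg|ng] := eqVneq (g x) (h' x); last first.
  by rewrite -fE //; apply: map_f; rewrite mem_filter ng sx.
rewrite -fE // Eg fE // h'yl -[y ^+ l]/(idfun (y ^+ l)) -(fE idfun) //.
by apply: map_f; rewrite mem_filter eq_sym h'x (sx idfun).
Qed.

Theorem abelian_cyclotomic x : abelianC x -> cyclotomicC x.
Proof.
move=> abx; have [p [pE pm] _] := minCpolyP x.
have [s ps] := closed_field_poly_normal (minCpoly x : {poly algC}).
(* The order has to be divisible by every prime up to the number of conjugates, so that the
   resolvents have their roots of unity in Q(z). *)
have n_gt0 : (0 < 4 * (size s)`!)%N by rewrite muln_gt0 fact_gt0.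
have [z zn] := C_prim_root_exists n_gt0.
apply: (abelian_cyclotomic_bounded zn _ abx (leqnn (size s))).
  by move=> l pl ls; rewrite dvdn_mull // dvdn_fact // prime_gt0.
exists s => // h _; rewrite -root_prod_XsubC.
have : root (minCpoly x) (h x).
  have -> : minCpoly x = map_poly h (minCpoly x).
    by rewrite pE -map_poly_comp; apply: eq_map_poly => a /=; rewrite fmorph_rat.
  by rewrite fmorph_root root_minCpoly.
by rewrite ps rootZ // lead_coef_eq0 -size_poly_eq0 gtn_eqF // (ltn_trans _ (size_minCpoly x)).
Qed.

Theorem abelian_field_cyclotomic (L : splittingFieldType rat) (iota : {rmorphism L -> algC}) :
  abelian 'Gal({:L} / 1) ->
  exists2 n, (0 < n)%N & forall z, n.-primitive_root z -> forall x, adj z (iota x).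
Proof.
move=> abL; have abx x : abelianC (iota x).
  move=> g h; have [g' g'E] := aut_to_gal iota g; have [h' h'E] := aut_to_gal iota h.
  rewrite -h'E -!g'E -h'E -!galM ?memvf //.
  have in1 (k : gal_of {:L}) : k \in 'Gal({:L} / 1)%g.
    by rewrite gal_kHom ?sub1v // k1HomE ahomWin.
  by rewrite (centsP abL).
pose u := separable_generator 1 {:L}.
have genu : <<1; u>>%VS = fullv.
  by rewrite -eq_adjoin_separable_generator ?sub1v ?separable_number_field.
have [n [w [wn wu]]] := abelian_cyclotomic (abx u).
exists n => [|z zn x]; first exact: prim_order_gt0 wn.
have /Fadjoin1_polyP[f ->] : x \in <<1; u>>%VS by rewrite genu memvf.
have [k Ew] := prim_rootP zn (prim_expr_order wn).
have zu : adj z (iota u) by apply: adj_trans wu; rewrite Ew; apply/adjX/adj_root.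
rewrite -horner_map -map_poly_comp horner_coef; apply: adj_sum => i _.
apply: adjM (adjX _ zu); rewrite coef_map.
by rewrite [X in adj _ X](fmorph_eq_rat (iota \o in_alg L) f`_i); apply: adj_rat.
Qed.

(** * Leopoldt generators for prime power conductor *)

Section Operators.
Variables (H : Aut -> Prop) (S : algC -> Prop).

(** The action of K[G] on [algC], for H the automorphisms over K and S a supply of scalars of K.
    Closure under sums and compositions avoids bases and group algebras until [isop_galg] recovers
    an element of K[G]. *)
Inductive isop : (algC -> algC) -> Prop :=
| isop_aut (h : Aut) : H h -> isop h
| isop_scale k : S k -> isop (fun x => k * x)
| isop_add T U : isop T -> isop U -> isop (fun x => T x + U x)
| isop_comp T U : isop T -> isop U -> isop (fun x => T (U x)).

Lemma isop_ext T U : T =1 U -> isop T -> isop U.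
Proof.
by move=> /funext ->.
Qed.

Lemma isopB T : isop T -> {morph T : x y / x - y}.
Proof.
elim=> [h _|k _|U V _ IU _ IV|U V _ IU _ IV] x y; first exact: rmorphB.
- exact: mulrBr.
- by rewrite IU IV opprD addrACA.
- by rewrite IV IU.
Qed.

Lemma isop_linear c T : (forall h, H h -> h c = c) -> isop T ->
  forall x, T (c * x) = c * T x.
Proof.
move=> Hc; elim=> [h Hh|k _|U V _ IU _ IV|U V _ IU _ IV] x.
- by rewrite rmorphM Hc.
- by rewrite mulrCA.
- by rewrite IU IV mulrDr.
- by rewrite IV IU.
Qed.

Hypothesis SQ : forall a : rat, S (ratr a).

Lemma isop_id : isop (fun x => x).
Proof.
by apply: isop_ext (isop_scale (SQ 1)) => x; rewrite rmorph1 mul1r.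
Qed.

Lemma isop_int (a : int) : isop (fun x => a%:~R * x).
Proof.
by apply: isop_ext (isop_scale (SQ a%:~R)) => x; rewrite ratr_int.
Qed.

Lemma isop_sub T U : isop T -> isop U -> isop (fun x => T x - U x).
Proof.
move=> oT oU; apply: isop_ext (isop_add oT (isop_comp (isop_int (-1)) oU)) => x.
by rewrite mulN1r.
Qed.

Lemma isop_sum I (r : seq I) (Q : pred I) (T : I -> algC -> algC) :
  (forall i, Q i -> isop (T i)) -> isop (fun x => \sum_(i <- r | Q i) T i x).
Proof.
move=> oT; elim: r => [|i r IH].
  by apply: isop_ext (isop_int 0) => x; rewrite big_nil mul0r.
have [Qi|Qi] := boolP (Q i).
  by apply: isop_ext (isop_add (oT i Qi) IH) => x; rewrite big_cons Qi.
by apply: isop_ext IH => x; rewrite big_cons (negPf Qi).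
Qed.

End Operators.

Lemma isop0 H S T : isop H S T -> T 0 = 0.
Proof.
by move=> oT; have := isopB oT 0 0; rewrite !subrr.
Qed.

Lemma isopD H S T : isop H S T -> {morph T : x y / x + y}.
Proof.
move=> oT x y; rewrite -{1}[y]opprK (isopB oT) -[- y]sub0r (isopB oT).
by rewrite (isop0 oT) sub0r opprK.
Qed.

Lemma isop_raddf_sum H S T I (r : seq I) (Q : pred I) F : isop H S T ->
  T (\sum_(i <- r | Q i) F i) = \sum_(i <- r | Q i) T (F i).
Proof.
move=> oT; apply: (big_morph T); [exact: (isopD oT) | exact: (isop0 oT)].
Qed.

Lemma isop_sub_ops (H1 H2 : Aut -> Prop) (S1 S2 : algC -> Prop) T :
  (forall h, H1 h -> H2 h) -> (forall k, S1 k -> S2 k) -> isop H1 S1 T ->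
  isop H2 S2 T.
Proof.
move=> H12 S12; elim=> [h /H12|k /S12|U V _ IU _ IV|U V _ IU _ IV].
- exact: isop_aut.
- exact: isop_scale.
- exact: isop_add.
- exact: isop_comp.
Qed.

Inductive Zspan (G : algC -> Prop) : algC -> Prop :=
| Zspan_gen x : G x -> Zspan G x
| Zspan0 : Zspan G 0
| ZspanB x y : Zspan G x -> Zspan G y -> Zspan G (x - y).

Section Zspan.
Variable G : algC -> Prop.

Lemma ZspanN x : Zspan G x -> Zspan G (- x).
Proof.
by move=> Gx; rewrite -sub0r; apply: ZspanB => //; apply: Zspan0.
Qed.

Lemma ZspanD x y : Zspan G x -> Zspan G y -> Zspan G (x + y).
Proof.
by move=> Gx Gy; rewrite -[y]opprK; apply/ZspanB/ZspanN.
Qed.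

Lemma Zspan_int (a : int) x : Zspan G x -> Zspan G (a%:~R * x).
Proof.
move=> Gx; have nat k : Zspan G (k%:R * x).
  elim: k => [|k IH]; first by rewrite mul0r; apply: Zspan0.
  by rewrite -natr1 mulrDl mul1r; apply: ZspanD.
by case: a => k; [apply: nat | rewrite NegzE rmorphN mulNr; apply/ZspanN/nat].
Qed.

Lemma Zspan_sum I (r : seq I) (Q : pred I) F :
  (forall i, Q i -> Zspan G (F i)) -> Zspan G (\sum_(i <- r | Q i) F i).
Proof.
by move=> GF; apply: big_ind => //; [apply: Zspan0 | apply: ZspanD].
Qed.

Lemma Zspan_stable H S T : isop H S T -> (forall x, G x -> Zspan G (T x)) ->
  forall x, Zspan G x -> Zspan G (T x).
Proof.
move=> oT GT x; elim=> [y /GT //||y w _ Ty _ Tw].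
  by rewrite (isop0 oT); apply: Zspan0.
by rewrite (isopB oT); apply: ZspanB.
Qed.

End Zspan.

Definition monom (z x : algC) : Prop := exists m : nat, x = z ^+ m.

Lemma Zadj_Zspan z x : Zadj z x -> Zspan (monom z) x.
Proof.
case=> f ->; rewrite horner_coef; apply: Zspan_sum => i _.
by rewrite coef_map; apply/Zspan_int/Zspan_gen; exists i.
Qed.

Lemma Zspan_Zadj z x : Zspan (monom z) x -> Zadj z x.
Proof.
elim=> [y [m ->]||y w _ zy _ zw]; [exact/ZadjX/Zadj_root | exact: Zadj0 | exact: ZadjB].
Qed.

(* [Zspan G] is generated by one element over the operators preserving it. *)
Definition op_cyclic (H : Aut -> Prop) (S G : algC -> Prop) : Prop :=
  exists2 alpha, Zspan G alpha & forall y, G y -> exists T,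
    [/\ isop H S T, forall x, Zspan G x -> Zspan G (T x) & T alpha = y].

(** * Classes of exponents and the projections onto them *)

Section ExponentClasses.
Variables (p a r : nat).
Hypotheses (p_prime : prime p) (r_gt0 : (0 < r)%N) (ra : (r <= a)%N).

(* [m] and [c] have comparable monomials when they agree modulo [p ^ cexp c]. *)
Definition cexp m := minn (a - r) (logn p m + r).

Lemma cexp_eq m c : (0 < m)%N -> (0 < c)%N -> (m = c %[mod p ^ cexp c])%N ->
  cexp m = cexp c.
Proof.
move=> m0 c0 mc; have dvd k : (k <= cexp c)%N -> (p ^ k %| m)%N = (p ^ k %| c)%N.
  move=> kc; rewrite /dvdn -(modn_dvdm m (dvdn_exp2l p kc)) mc modn_dvdm //.
  exact: dvdn_exp2l.
have vdvd k : (k <= cexp c)%N -> (k <= logn p m)%N = (k <= logn p c)%N.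
  by move=> kc; rewrite -!pfactor_dvdn // dvd.
have := vdvd (logn p c); have := vdvd (logn p c).+1; have := vdvd (cexp c) (leqnn _).
rewrite /cexp; lia.
Qed.

Lemma inverse_modX c b : coprime c p -> exists i, (c * i = 1 %[mod p ^ b])%N.
Proof.
move=> cp; have pb : coprime c (p ^ b) by rewrite coprimeXr.
have c0 : (0 < c)%N.
  by case: c cp {pb} => //; rewrite /coprime gcd0n; move: p_prime; case: p => [|[|]].
have /(coprimeP _ c0)[[u v] /= uv] := pb; exists u.
have -> : (c * u = 1 + v * p ^ b)%N by lia.
by rewrite addnC modnMDl.
Qed.

(** Inside a class K[G] can move c to m in two ways: by a power of xi^(p^(a-r)), a scalar, or by an
    automorphism with t = 1 modulo p^r. Which one is available depends on the term that attains the
    minimum in [cexp]. *)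
Lemma cexp_move m c : (0 < c)%N -> (m = c %[mod p ^ cexp c])%N ->
  (exists k, m = c + p ^ (a - r) * k %[mod p ^ a])%N \/
  (exists2 t, t = 1 %[mod p ^ r] & t * c = m %[mod p ^ a])%N.
Proof.
move=> c0 mc; have cM : (c <= m + p ^ a * c)%N.
  by rewrite (leq_trans (leq_pmull c (_ : 0 < p ^ a)%N)) ?leq_addl // expn_gt0 prime_gt0.
have pe : (p ^ cexp c %| m + p ^ a * c - c)%N.
  rewrite -eqn_mod_dvd //; apply/eqP.
  have /dvdnP[k Ek] : (p ^ cexp c %| p ^ a)%N by apply: dvdn_exp2l; rewrite /cexp; lia.
  by rewrite {1}Ek mulnAC addnC modnMDl.
have EM : (m + p ^ a * c = m %[mod p ^ a])%N by rewrite addnC mulnC modnMDl.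
move: pe; rewrite /cexp; case: leqP => _ /dvdnP[q Eq].
  by left; exists q; rewrite -EM -(subnKC cM) Eq (mulnC q).
right; have [c' pc' Ec] := pfactor_coprime p_prime c0.
have [i ci] := inverse_modX (c := c') a (etrans (coprime_sym _ _) pc').
exists (1 + p ^ r * (i * q))%N; first by rewrite addnC mulnC modnMDl.
rewrite -EM -(subnKC cM) Eq mulnDl mul1n; apply/eqP; rewrite eqn_modDl; apply/eqP.
rewrite {1}Ec.
have -> : (p ^ r * (i * q) * (c' * p ^ logn p c) = c' * i * (q * p ^ (logn p c + r)))%N.
  by rewrite expnD; ring.
by rewrite -modnMml ci modnMml mul1n.
Qed.

End ExponentClasses.

Section Averages.
Variables (p a : nat) (xi : algC) (sg : nat -> Aut).
Hypotheses (p_prime : prime p) (xia : (p ^ a).-primitive_root xi).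
Hypothesis sgE : forall t, coprime t p -> sg t xi = xi ^+ t.

Definition avg s (f : nat -> algC) x :=
  (p ^ (a - s))%:R^-1 * \sum_(u < p ^ (a - s)) f u * sg (1 + p ^ s * u) x.

(** The Fourier projection for the group of exponents 1 modulo p^s, onto the monomials with exponent
    c modulo p^(a-s). *)
Definition proj s c := avg s (fun u => xi ^- (p ^ s * c * u)).

Lemma coprime1pXM s u : (0 < s)%N -> coprime (1 + p ^ s * u) p.
Proof.
move=> s_gt0; rewrite coprime_sym -(prednK s_gt0) expnS -mulnA addnC mulnC.
by rewrite /coprime gcdnMDl gcdn1.
Qed.

Lemma isop_avg (H : Aut -> Prop) (S : algC -> Prop) s f : (forall b : rat, S (ratr b)) ->
  (forall u, H (sg (1 + p ^ s * u))) -> (forall u, S (f u)) -> isop H S (avg s f).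
Proof.
move=> SQ Hsg Sf.
have o1 : isop H S (fun x => \sum_(u < p ^ (a - s)) f u * sg (1 + p ^ s * u) x).
  apply: isop_sum => // u _; apply: (isop_comp (isop_scale _ (Sf u)) (isop_aut _ _)).
  exact: Hsg.
apply: isop_ext (isop_comp (isop_scale _ (SQ (p ^ (a - s))%:R^-1)) o1) => x.
by rewrite fmorphV rmorph_nat.
Qed.

(** On xi^m the operator is multiplication by the mean of the powers of om^(m-c), where om has order
    p^(a-s): this is 1 or 0. The denominator of the average disappears, so the lattice is
    preserved. *)
Lemma proj_monom s c m : (0 < s <= a)%N ->
  proj s c (xi ^+ m) = if m == c %[mod p ^ (a - s)] then xi ^+ m else 0.
Proof.
move=> /andP[s_gt0 sa]; have xi0 := prim_root_neq0 xia.
pose M := (p ^ (a - s))%N; pose om := xi ^+ (p ^ s).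
have M0 : M%:R != 0 :> algC by rewrite pnatr_eq0 -lt0n expn_gt0 prime_gt0.
have omM : M.-primitive_root om.
  have := dvdn_prim_root xia (dvdn_exp2l p (leq_subr s a)).
  by rewrite -expnB ?prime_gt0 ?leq_subr // subKn.
pose q := om ^+ m / om ^+ c.
have -> : proj s c (xi ^+ m) = M%:R^-1 * (xi ^+ m * \sum_(u < M) q ^+ u).
  rewrite /proj /avg -/M; congr (_ * _); rewrite mulr_sumr; apply: eq_bigr => u _.
  rewrite rmorphXn /= sgE ?coprime1pXM // -exprM mulnDl mul1n exprD mulrCA.
  congr (_ * _); rewrite /q expr_div_n /om -!exprM mulrC; congr (xi ^+ _ / _).
  by rewrite -!mulnA (mulnC m).
have qM : q ^+ M = 1.
  by rewrite expr_div_n -!exprM !(mulnC _ M) !exprM (prim_expr_order omM) !expr1n divr1.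
have q1 : (q == 1) = (m == c %[mod M]).
  rewrite -(eq_prim_root_expr omM) /q -subr_eq0.
  have omc0 : om ^+ c != 0 by rewrite !expf_neq0.
  by rewrite -[1](mulfV omc0) -mulrBl mulf_eq0 invr_eq0 (negPf omc0) orbF subr_eq0.
rewrite -/M -q1; case: eqVneq => [->|q_neq1].
  under eq_bigr => u _ do rewrite expr1n.
  by rewrite sumr_const card_ord mulrCA mulVf ?mulr1.
suff -> : \sum_(u < M) q ^+ u = 0 by rewrite !mulr0.
apply: (mulfI (_ : q - 1 != 0)); first by rewrite subr_eq0.
by rewrite mulr0 -subrX1 qM subrr.
Qed.

Lemma monom_mod m k : (m = k %[mod p ^ a])%N -> xi ^+ m = xi ^+ k.
Proof.
by move=> mk; apply/eqP; rewrite (eq_prim_root_expr xia); apply/eqP.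
Qed.

Lemma monom_pos x : monom xi x -> exists2 m, (0 < m)%N & x = xi ^+ m.
Proof.
case=> m ->; exists (m + p ^ a)%N; last by apply: monom_mod; rewrite modnDr.
by rewrite addn_gt0 expn_gt0 (prime_gt0 p_prime) orbT.
Qed.

End Averages.

Section Representatives.
Variables (p a r : nat).
Hypotheses (p_prime : prime p) (r_gt0 : (0 < r)%N) (ra : (r <= a)%N).
Local Notation e := (cexp p a r).

Lemma cexp_lt m : (e m < a)%N.
Proof.
rewrite /cexp; lia.
Qed.

(** Representatives run from 1 to p^e instead of from 0: since [logn p 0] is 0, the exponent 0 would
    be put in the wrong class. *)
Lemma cexp_rep m : (0 < m)%N -> exists c,
  [/\ (0 < c <= p ^ e c)%N, e c = e m & (m = c %[mod p ^ e c])%N].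
Proof.
move=> m0; pose c := (m.-1 %% p ^ e m).+1.
have mc : (c = m %[mod p ^ e m])%N.
  by rewrite /c -addn1 modnDml addn1 prednK.
have ec : e c = e m by apply: cexp_eq.
exists c; rewrite ec mc; split=> //.
by rewrite /c /= ltn_mod expn_gt0 prime_gt0.
Qed.

Lemma cexp_rep_uniq c d : (0 < c <= p ^ e c)%N -> (0 < d <= p ^ e d)%N ->
  (d = c %[mod p ^ e c])%N -> d = c.
Proof.
move=> /andP[c0 cp] /andP[d0 dp] dc.
have ed : e d = e c by apply: cexp_eq.
rewrite ed in dp; move: dc; move: (p ^ e c)%N cp dp => N cN dN dc.
have [E1|cN'] := eqVneq c N; have [E|dN'] := eqVneq d N; first by rewrite E.
- by move: dc; rewrite E1 modnn modn_small; lia.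
- by move: dc; rewrite E modnn modn_small; lia.
by move: dc; rewrite !modn_small; lia.
Qed.

(** Makes the weights of [proj s c] powers of xi^(p^(a-r)), that is, scalars of K; the term
    [logn p m + r] of [cexp] is there for this. *)
Lemma cexp_dvd c s : (s = a - e c)%N -> (p ^ (a - r) %| p ^ s * c)%N.
Proof.
move=> ->; have [->|c0] := posnP c; first by rewrite muln0 dvdn0.
have v : (p ^ logn p c %| c)%N by apply: pfactor_dvdnn.
apply: (dvdn_trans _ (dvdn_mul (dvdnn _) v)); rewrite -expnD; apply: dvdn_exp2l.
rewrite /cexp; lia.
Qed.

End Representatives.

Section LocalCommon.
Variables (p a : nat) (xi : algC) (sg : nat -> Aut) (H : Aut -> Prop) (S : algC -> Prop).
Hypotheses (p_prime : prime p) (xia : (p ^ a).-primitive_root xi).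
Hypothesis sgE : forall t, coprime t p -> sg t xi = xi ^+ t.
Hypothesis SQ : forall b : rat, S (ratr b).
Local Notation R := (Zspan (monom xi)).
Local Notation proj := (proj p a xi sg).

Lemma R_monom m : R (xi ^+ m).
Proof.
by apply: Zspan_gen; exists m.
Qed.

Lemma stable_sg t : coprime t p -> H (sg t) -> forall x, R x -> R (sg t x).
Proof.
move=> tp Ht; apply: (Zspan_stable (isop_aut S Ht)) => _ [m ->].
by rewrite rmorphXn /= sgE // -exprM; apply: R_monom.
Qed.

Lemma stable_proj s c : (0 < s <= a)%N -> isop H S (proj s c) ->
  forall x, R x -> R (proj s c x).
Proof.
move=> sa oP; apply: (Zspan_stable oP) => _ [m ->].
by rewrite (proj_monom p_prime xia sgE) //; case: ifP => _; [apply: R_monom | apply: Zspan0].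
Qed.

Section Cyclotomic.
Variable r : nat.
Hypotheses (r_gt0 : (0 < r)%N) (ra : (r <= a)%N).
Local Notation om := (xi ^+ (p ^ (a - r))).
Hypothesis Hsg : forall t, (t = 1 %[mod p ^ r])%N -> H (sg t).
Hypotheses (Som : forall k, S (om ^+ k)) (SomV : forall k, S (om ^- k)).
Local Notation e := (cexp p a r).

Lemma coprime_1mod t : (t = 1 %[mod p ^ r])%N -> coprime t p.
Proof.
move=> t1; have : coprime t (p ^ r) by rewrite -coprime_modl t1 coprime_modl coprime1n.
by rewrite coprime_pexpr.
Qed.

(** Different representatives lie in different classes, so E c picks xi^c out of the sum, and
    [cexp_move] carries xi^c to every monomial of its class. *)
Lemma op_cyclic_cyclotomic : op_cyclic H S (monom xi).
Proof.
have sa c : (0 < a - e c <= a)%N by have := cexp_lt p_prime r_gt0 ra c; lia.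
have kc c : (a - (a - e c) = e c)%N by have := cexp_lt p_prime r_gt0 ra c; lia.
pose E c := proj (a - e c) c.
have oE c : isop H S (E c).
  apply: isop_avg => // u.
    apply: Hsg; rewrite addnC.
    have /dvdnP[k ->] : (p ^ r %| p ^ (a - e c))%N by apply: dvdn_exp2l; rewrite /cexp; lia.
    by rewrite mulnAC modnMDl.
  have /dvdnP[d ->] := cexp_dvd p_prime r_gt0 ra (c := c) erefl.
  by rewrite -mulnA mulnCA exprM; apply: SomV.
have sE c := stable_proj (sa c) (oE c).
exists (\sum_(c < (p ^ a).+1 | (0 < c <= p ^ e c)%N) xi ^+ c).
  by apply: Zspan_sum => c _; apply: R_monom.
set alpha := \sum_(c < _ | _) _.
have Ealpha c : (0 < c <= p ^ e c)%N -> E c alpha = xi ^+ c.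
  move=> cP; have ca : (c < (p ^ a).+1)%N.
    rewrite ltnS; case/andP: cP => _ /leq_trans; apply; rewrite leq_exp2l ?prime_gt1 //.
    exact/ltnW/cexp_lt.
  rewrite /alpha (isop_raddf_sum _ _ _ (oE c)) (bigD1 (Ordinal ca)) //=.
  rewrite /E (proj_monom p_prime xia sgE) // eqxx big1 ?addr0 // => d /andP[dP dc].
  rewrite (proj_monom p_prime xia sgE) // kc; case: eqP => // Edc.
  by case/eqP: dc; apply: val_inj; apply: (cexp_rep_uniq p_prime r_gt0 ra).
move=> _ /(monom_pos p_prime xia)[m m0 ->].
have [c [cP ec mc]] := cexp_rep p_prime r_gt0 ra m0.
have c0 : (0 < c)%N by case/andP: cP.
case: (cexp_move p_prime r_gt0 ra c0 mc) => [[k Ek]|[t t1 Et]].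
  exists (fun x => om ^+ k * E c x); split.
  - exact: (isop_comp (isop_scale _ (Som k)) (oE c)).
  - move=> x /(sE c) Rx; apply: Zadj_Zspan; apply: ZadjM; last exact: Zspan_Zadj.
    by do 2!apply: ZadjX; apply: Zadj_root.
  - by rewrite Ealpha // -exprM -exprD (monom_mod xia Ek) addnC.
have tp := coprime_1mod t1.
exists (fun x => sg t (E c x)); split.
- by apply: (isop_comp _ (oE c)); apply/isop_aut/Hsg.
- by move=> x /(sE c) Rx; apply: stable_sg => //; apply: Hsg.
- by rewrite Ealpha // rmorphXn /= sgE // -exprM (monom_mod xia Et).
Qed.

End Cyclotomic.

Section Rational.
Hypothesis Hsg : forall t, coprime t p -> H (sg t).

Lemma isop_proj0 s : (0 < s)%N -> isop H S (proj s 0).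
Proof.
move=> s_gt0; apply: isop_avg => // u; first exact/Hsg/coprime1pXM.
by have := SQ 1; rewrite rmorph1 muln0 mul0n expr0 invr1.
Qed.

(** Keeps the monomials whose exponent has p-adic valuation exactly e. For e = a - 1 nothing is
    subtracted, so the monomial 1 is kept as well. *)
Definition valproj e x := proj (a - e) 0 x - (if (e.+1 < a)%N then proj (a - e.+1) 0 x else 0).

Lemma isop_valproj e : (e < a)%N -> isop H S (valproj e).
Proof.
move=> ea; have oP i : (i < a)%N -> isop H S (proj (a - i) 0).
  by move=> ia; apply: isop_proj0; rewrite subn_gt0.
have [e1a|e1a] := boolP (e.+1 < a)%N.
  by apply: isop_ext (isop_sub SQ (oP e ea) (oP e.+1 e1a)) => x; rewrite /valproj e1a.
by apply: isop_ext (oP e ea) => x; rewrite /valproj (negPf e1a) subr0.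
Qed.

Lemma valproj_monom e m : (e < a)%N -> valproj e (xi ^+ m) =
  if (p ^ e %| m)%N && ~~ ((e.+1 < a)%N && (p ^ e.+1 %| m)%N) then xi ^+ m else 0.
Proof.
move=> ea; rewrite /valproj.
have P i : (i < a)%N -> proj (a - i) 0 (xi ^+ m) = if (p ^ i %| m)%N then xi ^+ m else 0.
  move=> ia; rewrite (proj_monom p_prime xia sgE); last by rewrite subn_gt0 ia leq_subr.
  by rewrite subKn ?(ltnW ia) // mod0n.
rewrite P //; have [e1a|_] := ltnP e.+1 a; last by rewrite subr0 andbT.
rewrite P //; have [d|nd] := boolP (p ^ e.+1 %| m)%N.
  by rewrite (dvdn_trans (dvdn_exp2l p (leqnSn e)) d) subrr.
by rewrite andbT subr0.
Qed.

Lemma stable_valproj e : (e < a)%N -> forall x, R x -> R (valproj e x).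
Proof.
move=> ea; apply: (Zspan_stable (isop_valproj ea)) => _ [m ->].
by rewrite valproj_monom //; case: ifP => _; [apply: R_monom | apply: Zspan0].
Qed.

Lemma dvdn_Xp e i : (p ^ e %| p ^ i)%N = (e <= i)%N.
Proof.
exact: dvdn_Pexp2l (prime_gt1 p_prime).
Qed.

(** All automorphisms at p are available here, so monomials with exponents of the same valuation are
    conjugate, and one for each valuation below a is enough. *)
Lemma op_cyclic_rational : op_cyclic H S (monom xi).
Proof.
have [a0|a_gt0] := posnP a.
  exists 1; first by apply: Zspan_gen; exists 0%N.
  move=> _ [m ->]; exists (fun x => x); split=> //; first exact: isop_id.
  by have := prim_expr_order xia; rewrite a0 expn0 expr1 => ->; rewrite expr1n.
exists (\sum_(e < a) xi ^+ (p ^ e)); first by apply: Zspan_sum => e _; apply: R_monom.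
set alpha := \sum_(e < a) _.
have Qalpha e : (e < a)%N -> valproj e alpha = xi ^+ (p ^ e).
  move=> ea; rewrite /alpha (isop_raddf_sum _ _ _ (isop_valproj ea)).
  rewrite (bigD1 (Ordinal ea)) //= valproj_monom // !dvdn_Xp leqnn ltnn andbF /=.
  rewrite big1 ?addr0 // => i ie; rewrite valproj_monom // !dvdn_Xp.
  have {}ie : (i : nat) != e by [].
  by have ia := ltn_ord i; rewrite ifF //; lia.
move=> _ /(monom_pos p_prime xia)[m m0 ->].
have [va|va] := ltnP (logn p m) a.
  have [t tp Em] := pfactor_coprime p_prime m0; rewrite coprime_sym in tp.
  exists (fun x => sg t (valproj (logn p m) x)); split.
  - by apply: (isop_comp _ (isop_valproj va)); apply/isop_aut/Hsg.
  - by move=> x Rx; apply: stable_sg => //; [apply: Hsg | apply: stable_valproj].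
  - by rewrite Qalpha // rmorphXn /= sgE // -exprM -Em.
have a1 : (a.-1 < a)%N by rewrite prednK.
have om_prim : p.-primitive_root (xi ^+ (p ^ a.-1)).
  have := dvdn_prim_root xia (dvdn_exp a_gt0 (dvdnn p)).
  by rewrite -{1}(prednK a_gt0) expnS mulKn ?prime_gt0.
(* The p-th roots of unity sum to 0, so 1 is minus the sum of the conjugates of xi^(p^(a-1)). *)
exists (fun x => (-1)%:~R * \sum_(1 <= t < p) sg t (valproj a.-1 x)); split.
- apply: (isop_comp (isop_int H SQ (-1))).
  rewrite (_ : (fun x => _) = fun x => \sum_(1 <= t < p | (0 < t < p)%N) sg t (valproj a.-1 x)).
    apply: isop_sum => // t /andP[t0 tp]; apply: (isop_comp _ (isop_valproj a1)).
    by apply/isop_aut/Hsg; rewrite coprime_sym prime_coprime // gtnNdvd.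
  by apply: funext => x; rewrite big_nat_cond [RHS]big_nat_cond; apply: eq_bigl => t; rewrite andbT; lia.
- move=> x Rx; apply: Zspan_int; rewrite big_nat; apply: Zspan_sum => t /andP[t0 tp].
  have ctp : coprime t p by rewrite coprime_sym prime_coprime // gtnNdvd.
  by apply: stable_sg => //; [apply: Hsg | apply: stable_valproj].
rewrite Qalpha //; set om := xi ^+ _ in om_prim *.
have -> : xi ^+ m = 1.
  have /dvdnP[k ->] : (p ^ a %| m)%N by rewrite pfactor_dvdn.
  by rewrite mulnC exprM (prim_expr_order xia) expr1n.
have Esum : \sum_(0 <= t < p) om ^+ t = 0.
  have om1 : om - 1 != 0.
    rewrite subr_eq0 -[om]expr1 -(prim_order_dvd om_prim) gtnNdvd ?prime_gt1 //.
  by apply: (mulfI om1); rewrite mulr0 big_mkord -subrX1 (prim_expr_order om_prim) subrr.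
move: Esum; rewrite big_ltn ?prime_gt0 // expr0 => /eqP; rewrite addrC addr_eq0 => /eqP E.
rewrite rmorphN rmorph1 mulN1r -[RHS]opprK -E; congr (- _); apply: eq_big_nat => t /andP[t0 tp].
have ctp : coprime t p by rewrite coprime_sym prime_coprime // gtnNdvd.
by rewrite /om rmorphXn /= sgE // -!exprM mulnC.
Qed.

End Rational.
End LocalCommon.

Lemma add_multiple_eq c d N k : (0 < c < N)%N -> (0 < d <= N)%N ->
  (c + d = k * N)%N -> (c + d = N)%N.
Proof.
case: k => [|[|k]]; rewrite ?mulSn; lia.
Qed.

Lemma half_complement c d N : odd N -> (c + d = N)%N -> (N <= 2 * c)%N -> (2 * d < N)%N.
Proof.
lia.
Qed.

Lemma half_lt c N : (2 * c < N)%N -> (c < N)%N.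
Proof.
lia.
Qed.

Lemma half_add_lt c d N : (2 * c < N)%N -> (2 * d < N)%N -> (c + d < N)%N.
Proof.
lia.
Qed.

Section RealCyclotomic.
Variables (p a r : nat) (xi : algC) (sg : nat -> Aut) (H : Aut -> Prop) (S : algC -> Prop).
Hypotheses (p_prime : prime p) (p_odd : odd p) (xia : (p ^ a).-primitive_root xi).
Hypotheses (r_gt0 : (0 < r)%N) (ra : (r <= a)%N).
Hypothesis sgE : forall t, coprime t p -> sg t xi = xi ^+ t.
Hypothesis SQ : forall b : rat, S (ratr b).
Local Notation om := (xi ^+ (p ^ (a - r))).
Hypothesis Hsg : forall t, (t = 1 %[mod p ^ r])%N -> H (sg t).
Hypothesis HsgN : H (sg (p ^ a).-1).
Hypothesis Sw : forall k, S (om ^+ k + om ^- k).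
Local Notation e := (cexp p a r).
Local Notation R := (Zspan (monom xi)).
Local Notation proj := (proj p a xi sg).
Local Notation neg m := ((p ^ a).-1 * m)%N.

Let pa_gt0 : (0 < p ^ a)%N.
Proof.
by rewrite expn_gt0 prime_gt0.
Qed.

Lemma xi_neg m : xi ^+ neg m = xi ^- m.
Proof.
apply: (mulIf (expf_neq0 m (prim_root_neq0 xia))).
rewrite mulVf ?expf_neq0 ?(prim_root_neq0 xia) // -exprD -mulSnr prednK //.
by rewrite exprM (prim_expr_order xia) expr1n.
Qed.

Let pN : coprime (p ^ a).-1 p.
Proof.
rewrite -(coprime_pexpr _ _ (leq_trans r_gt0 ra)) coprime_sym -{1}(prednK pa_gt0).
exact: coprimeSn.
Qed.

Lemma cexp_neg m : e (neg m) = e m.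
Proof.
have [->|m0] := posnP m; first by rewrite muln0.
have N0 : (0 < (p ^ a).-1)%N.
  by case: (p ^ a).-1 pN => //; rewrite /coprime gcd0n; case: p p_prime => [|[|]].
rewrite /cexp lognM // (_ : logn p (p ^ a).-1 = 0)%N //.
by apply: logn_coprime; rewrite coprime_sym.
Qed.

Lemma om_prim : (p ^ r).-primitive_root om.
Proof.
have := dvdn_prim_root xia (dvdn_exp2l p ra).
by rewrite -expnB ?prime_gt0.
Qed.

Let om1 : om != 1.
Proof.
rewrite -[om]expr1 -(prim_order_dvd om_prim) gtnNdvd //.
by rewrite -(expn0 p) ltn_exp2l ?prime_gt1.
Qed.

(** The inverse of 1 + om: for the odd number N = p^r one has (1 - om^2) u = 1 - om^(N+1) = 1 - om.
    It is chosen because inversion of xi multiplies it by om ([sgN_u]), so that u and its conjugate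
    suffice to span Z[om] over the real subring. *)
Definition half_unit := \sum_(i < (p ^ r).+1./2) (om ^+ 2) ^+ i.
Local Notation u := half_unit.

Lemma half_unitE : (1 + om) * u = 1.
Proof.
have om1' : 1 - om != 0 by rewrite subr_eq0 eq_sym.
have EN : ((p ^ r).+1./2 * 2 = p ^ r + 1)%N.
  have : odd (p ^ r) by rewrite oddX p_odd orbT.
  by move: (p ^ r)%N => N; lia.
have := prim_expr_order om_prim; rewrite /half_unit.
move: (om) om1' => o o1 oN; apply: (mulfI o1); rewrite mulr1 mulrA.
have -> : (1 - o) * (1 + o) = 1 - o ^+ 2 by ring.
rewrite -[LHS]opprK -mulNr opprB -subrX1 -exprM opprB; congr (1 - _).
by rewrite mulnC EN exprD oN mul1r expr1.
Qed.

Let u0 : u != 0.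
Proof.
by apply/eqP => u0; have := half_unitE; rewrite u0 mulr0 => /eqP; rewrite eq_sym oner_eq0.
Qed.

Lemma sgN_om : sg (p ^ a).-1 om = om^-1.
Proof.
by rewrite rmorphXn /= sgE // -exprM xi_neg.
Qed.

Lemma sgN_u : sg (p ^ a).-1 u = om * u.
Proof.
have om0 : om != 0 := prim_root_neq0 om_prim.
have E : 1 + om^-1 != 0.
  rewrite -sgN_om -(rmorph1 (sg (p ^ a).-1)) -rmorphD fmorph_eq0.
  by apply/eqP => E; have := half_unitE; rewrite E mul0r => /eqP; rewrite eq_sym oner_eq0.
apply: (mulfI E); rewrite -{1}sgN_om -{1}(rmorph1 (sg (p ^ a).-1)) -rmorphD -rmorphM.
rewrite half_unitE rmorph1 mulrA mulrDl mul1r mulVf // addrC half_unitE //.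
Qed.

(* Z[om] is generated by u and its conjugate om * u over Z[om + om^-1].       *)
Lemma half_unit_span j : exists A B,
  [/\ isop H S (fun x => A * x), isop H S (fun x => B * x), Zadj om A, Zadj om B
    & om ^+ j = A * u + B * (om * u)].
Proof.
have om0 : om != 0 := prim_root_neq0 om_prim.
have zomV : Zadj om om^-1.
  have <- : om ^+ (p ^ r).-1 = om^-1.
    apply: (mulfI om0); rewrite mulfV // -exprS prednK ?expn_gt0 ?prime_gt0 //.
    exact: prim_expr_order om_prim.
  exact/ZadjX/Zadj_root.
pose ok A := isop H S (fun x => A * x) /\ Zadj om A.
have okw : ok (om + om^-1).
  split; first by have := Sw 1; rewrite !expr1; apply: isop_scale.
  by apply: ZadjD => //; apply: Zadj_root.
have okB A B : ok A -> ok B -> ok (A - B).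
  move=> [oA zA] [oB zB]; split; last exact: ZadjB.
  by apply: isop_ext (isop_sub SQ oA oB) => x; rewrite mulrBl.
have okM A B : ok A -> ok B -> ok (A * B).
  move=> [oA zA] [oB zB]; split; last exact: ZadjM.
  by apply: isop_ext (isop_comp oA oB) => x; rewrite mulrA.
have ok1 : ok 1.
  by split; [have := isop_int H SQ 1; rewrite rmorph1 | apply: Zadj1].
have ok0 : ok 0 by rewrite -(subrr 1); apply: okB.
have okD A B : ok A -> ok B -> ok (A + B).
  move=> okA okB'; have -> : A + B = A - (0 - B) by rewrite sub0r opprK.
  exact/okB/okB.
have [A [B [okA okB' Ej]]] : exists A B, [/\ ok A, ok B & om ^+ j = A + B * om].
  elim: j => [|j [A [B [okA okB' Ej]]]].
    by exists 1, 0; split=> //; rewrite mul0r addr0.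
  exists (0 - B), (A + B * (om + om^-1)); split; [exact: okB | exact/okD/okM |].
  by rewrite exprSr Ej sub0r; field.
have [oA' zA'] := okB A B okA okB'.
have [oB' zB'] := okD _ _ (okD A B okA okB') (okM B _ okB' okw).
exists (A - B), (A + B + B * (om + om^-1)); split=> //.
rewrite -[LHS]mulr1 -half_unitE {}Ej; move: u (om) om0 => v o o0.
by field.
Qed.

(** [proj] at c and at -c with conjugate weights, whose sums om^j + om^-j lie in the real subfield;
    the price is that monomials in the class of -c survive as well. *)
Definition sproj c k := avg p a sg (a - e c)
  (fun v => om ^+ k * xi ^- (p ^ (a - e c) * c * v) + om ^- k * xi ^- (p ^ (a - e c) * neg c * v)).

Let sa c : (0 < a - e c <= a)%N.
Proof.
by have := cexp_lt p_prime r_gt0 ra c; lia.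
Qed.

Let kc c : (a - (a - e c) = e c)%N.
Proof.
by have := cexp_lt p_prime r_gt0 ra c; lia.
Qed.

Lemma sprojE c k x : sproj c k x = om ^+ k * proj (a - e c) c x + om ^- k * proj (a - e c) (neg c) x.
Proof.
rewrite /sproj /proj /avg !(mulrCA (om ^+ _)) !(mulrCA (om ^- _)) -mulrDr; congr (_ * _).
rewrite !mulr_sumr -big_split /=; apply: eq_bigr => v _; ring.
Qed.

Lemma sproj_monom c k m : sproj c k (xi ^+ m) =
  (if m == c %[mod p ^ e c] then om ^+ k * xi ^+ m else 0) +
  (if m == neg c %[mod p ^ e c] then om ^- k * xi ^+ m else 0).
Proof.
rewrite sprojE !(proj_monom p_prime xia sgE) // kc.
by congr (_ + _); case: ifP => _; rewrite ?mulr0.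
Qed.

Lemma isop_sproj c k : isop H S (sproj c k).
Proof.
apply: isop_avg => // v.
  apply: Hsg; rewrite addnC.
  have /dvdnP[d ->] : (p ^ r %| p ^ (a - e c))%N by apply: dvdn_exp2l; rewrite /cexp; lia.
  by rewrite mulnAC modnMDl.
have /dvdnP[d Ed] := cexp_dvd p_prime r_gt0 ra (c := c) erefl.
have E1 : xi ^- (p ^ (a - e c) * c * v) = om ^- (d * v).
  by rewrite Ed -exprM; congr (xi ^- _); ring.
have E2 : xi ^- (p ^ (a - e c) * neg c * v) = om ^+ (d * v).
  rewrite (_ : (_ * v)%N = neg (p ^ (a - e c) * c * v)); last by ring.
  by rewrite xi_neg invrK Ed -exprM; congr (xi ^+ _); ring.
have om0 : om != 0 := prim_root_neq0 om_prim.
rewrite E1 E2; have [j Ej] : exists j, om ^+ k * om ^- (d * v) = om ^+ j.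
  have : (om ^+ k * om ^- (d * v)) ^+ (p ^ r) = 1.
    have omN q : (om ^+ q) ^+ (p ^ r) = 1.
      by have := prim_expr_order om_prim; move: (om) => o oN; rewrite exprAC oN expr1n.
    by rewrite exprMn exprVn !omN invr1 mulr1.
  by case/(prim_rootP om_prim) => j ->; exists j.
rewrite Ej; have -> : om ^- k * om ^+ (d * v) = om ^- j by rewrite -Ej invfM invrK.
exact: Sw.
Qed.

Lemma stable_sproj c k x : R x -> R (sproj c k x).
Proof.
apply: (Zspan_stable (isop_sproj c k)) => _ [m ->]; rewrite sproj_monom.
apply: ZspanD; case: ifP => _; try exact: Zspan0.
  by rewrite -exprM -exprD; apply: R_monom.
by rewrite -exprM -xi_neg -exprD; apply: R_monom.
Qed.

Lemma neg_neg m : (neg (neg m) = m %[mod p ^ a])%N.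
Proof.
apply/eqP; rewrite -(eq_prim_root_expr xia) xi_neg; apply/eqP.
by apply: invr_inj; rewrite invrK xi_neg.
Qed.

Lemma neg_sum m : (p ^ a %| m + neg m)%N.
Proof.
by rewrite -mulSn prednK // dvdn_mulr.
Qed.

Let pe_pa m : (p ^ e m %| p ^ a)%N.
Proof.
by apply: dvdn_exp2l; apply/ltnW/cexp_lt.
Qed.

Lemma cexp_top m : (e m <= logn p m)%N -> e m = (a - r)%N.
Proof.
rewrite /cexp; lia.
Qed.

(** The representatives of m and -m add up to p^e, which is odd, so one of them is below half. The
    multiples of p^(a-r), excluded here, form a class equal to its negative, whose monomials are the
    powers of om. *)
Lemma real_rep m : (0 < m)%N -> ~~ (p ^ (a - r) %| m)%N -> exists2 c,
  (0 < c)%N && (2 * c < p ^ e c)%N & (m = c %[mod p ^ e c])%N \/ (neg m = c %[mod p ^ e c])%N.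
Proof.
move=> m0 pm; have nm0 : (0 < neg m)%N.
  rewrite muln_gt0 m0 andbT; case: (p ^ a).-1 pN => //; rewrite /coprime gcd0n.
  by case: p p_prime => [|[|]].
have [c [/andP[c0 cp] ec mc]] := cexp_rep p_prime r_gt0 ra m0.
have [d [/andP[d0 dp] ed md]] := cexp_rep p_prime r_gt0 ra nm0.
rewrite cexp_neg in ed; have edc : e d = e c by rewrite ed ec.
have nd : ~~ (p ^ e c %| m)%N.
  apply: contra pm => pm; have v : (e c <= logn p m)%N by rewrite -pfactor_dvdn.
  by move: pm; rewrite ec (cexp_top (m := m)) // -ec.
have cN : c != (p ^ e c)%N.
  by apply: contraNneq nd => Ec; rewrite /dvdn mc {1}Ec modnn.
have Ecd : (c + d = p ^ e c)%N.
  have : (p ^ e c %| c + d)%N.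
    rewrite /dvdn -modnDml -mc modnDml -modnDmr -edc -md modnDmr -/(dvdn _ _).
    by rewrite edc; apply: dvdn_trans (pe_pa c) (neg_sum m).
  have cl : (c < p ^ e c)%N by rewrite ltn_neqAle cN.
  rewrite edc in dp => /dvdnP[k Ek].
  by apply: (add_multiple_eq (k := k)); rewrite ?c0 ?d0.
have po : odd (p ^ e c) by rewrite oddX p_odd orbT.
have [c2|c2] := ltnP (2 * c) (p ^ e c); first by exists c; [rewrite c0 | left].
exists d; last by right.
by rewrite edc d0 /=; apply: half_complement po Ecd c2.
Qed.

(** [u] takes care of Z[om], and [rest] has one monomial for each pair of opposite classes. Since -c
    is not represented, [sproj c k] isolates om^k xi^c; inversion of xi then reaches the class of
    -c. *)
Theorem op_cyclic_real : op_cyclic H S (monom xi).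
Proof.
pose good c := (0 < c)%N && (2 * c < p ^ e c)%N.
pose rest := \sum_(c < p ^ a | good c) xi ^+ c.
have oP : isop H S (proj r 0).
  apply: isop_avg => // v; first by apply: Hsg; rewrite addnC mulnC modnMDl.
  by have := SQ 1; rewrite rmorph1 muln0 mul0n expr0 invr1.
have ra' : (0 < r <= a)%N by rewrite r_gt0.
have PE m : proj r 0 (xi ^+ m) = if (p ^ (a - r) %| m)%N then xi ^+ m else 0.
  by rewrite (proj_monom p_prime xia sgE) // mod0n.
have zom x : Zadj om x -> Zadj xi x.
  by case=> f ->; apply: Zadj_horner; apply/ZadjX/Zadj_root.
have zu : Zadj om u by apply: Zadj_sum => i _; do 2!apply: ZadjX; apply: Zadj_root.
have goodN c m : good c -> (p ^ (a - r) %| m)%N ->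
    (m == c %[mod p ^ e c]) = false /\ (m == neg c %[mod p ^ e c]) = false.
  move=> /andP[c0 c2] pm.
  have pem : (p ^ e c %| m)%N by apply: dvdn_trans pm; apply: dvdn_exp2l; apply: geq_minl.
  have nc : ~~ (p ^ e c %| c)%N by rewrite gtnNdvd // half_lt.
  rewrite (eqP (pem : _ == 0)%N) !(eq_sym 0%N); split; apply/negbTE => //.
  by rewrite -/(dvdn _ _) Gauss_dvdr // coprimeXl // coprime_sym.
have Fom c k j : good c -> sproj c k (om ^+ j) = 0.
  move=> gc; rewrite -exprM sproj_monom.
  by have [-> ->] := goodN c (p ^ (a - r) * j)%N gc (dvdn_mulr _ (dvdnn _)); rewrite addr0.
have Fu c k : good c -> sproj c k u = 0.
  move=> gc; rewrite /u (isop_raddf_sum _ _ _ (isop_sproj c k)) big1 // => i _.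
  by rewrite -exprM Fom.
have Pom j : proj r 0 (om ^+ j) = om ^+ j by rewrite -exprM PE dvdn_mulr.
have Pu : proj r 0 u = u.
  by rewrite {1}/u (isop_raddf_sum _ _ _ oP); apply: eq_bigr => i _; rewrite -exprM Pom exprM.
have Palpha : proj r 0 (u + rest) = u.
  rewrite (isopD oP) Pu /rest (isop_raddf_sum _ _ _ oP) big1 ?addr0 // => c /andP[c0 c2].
  rewrite PE ifF //; apply: gtnNdvd => //; apply: (leq_trans (half_lt c2)).
  by rewrite leq_exp2l ?prime_gt1 // geq_minl.
have Falpha c k : good c -> sproj c k (u + rest) = om ^+ k * xi ^+ c.
  move=> gc; have /andP[c0 c2] := gc.
  have ca : (c < p ^ a)%N.
    by apply: leq_trans (dvdn_leq pa_gt0 (pe_pa c)); apply: half_lt.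
  rewrite (isopD (isop_sproj c k)) Fu // add0r /rest (isop_raddf_sum _ _ _ (isop_sproj c k)).
  have nc0 : (0 < neg c)%N.
    rewrite muln_gt0 c0 andbT; case: (p ^ a).-1 pN => //; rewrite /coprime gcd0n.
    by case: p p_prime => [|[|]].
  have noneg d : (0 < d)%N -> (2 * d < p ^ e d)%N -> (d == neg c %[mod p ^ e c]) = false.
    move=> d0 d2; apply/negP => /eqP dc.
    have ed : e d = e c.
      by rewrite -(cexp_neg c); apply: cexp_eq => //; rewrite cexp_neg.
    have : (p ^ e c %| c + d)%N.
      rewrite /dvdn -modnDmr dc modnDmr -/(dvdn _ _).
      by apply: dvdn_trans (pe_pa c) (neg_sum c).
    by rewrite gtnNdvd ?addn_gt0 ?c0 //; apply: half_add_lt => //; rewrite -ed.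
  rewrite (bigD1 (Ordinal ca)) //= sproj_monom eqxx noneg // addr0.
  rewrite big1 ?addr0 // => d /andP[/andP[d0 d2] dc]; rewrite sproj_monom noneg // addr0.
  case: eqP => // Edc; case/eqP: dc; apply: val_inj.
  have le b : (0 < b)%N -> (2 * b < p ^ e b)%N -> (0 < b <= p ^ e b)%N.
    by move=> -> b2; rewrite (leq_trans _ (ltnW b2)) // leq_pmull.
  by apply: (cexp_rep_uniq p_prime r_gt0 ra) => //; apply: le.
have sgo : isop H S (sg (p ^ a).-1) by apply: isop_aut.
have sgR := stable_sg S sgE pN HsgN.
exists (u + rest).
  apply: ZspanD; first by apply/Zadj_Zspan/zom.
  by apply: Zspan_sum => c _; apply: R_monom.
have reach c m : good c -> (m = c %[mod p ^ e c])%N -> exists T,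
    [/\ isop H S T, forall x, R x -> R (T x) & T (u + rest) = xi ^+ m].
  move=> gc mc; have /andP[c0 c2] := gc.
  case: (cexp_move p_prime r_gt0 ra c0 mc) => [[k Ek]|[t t1 Et]].
    exists (sproj c k); split; [exact: isop_sproj | exact: stable_sproj |].
    by rewrite Falpha // -exprM -exprD (monom_mod xia Ek) addnC.
  have tp : coprime t p by apply: coprime_1mod t1.
  exists (fun x => sg t (sproj c 0 x)); split.
  - by apply: (isop_comp _ (isop_sproj c 0)); apply/isop_aut/Hsg.
  - by move=> x Rx; apply: (stable_sg S sgE tp (Hsg t1)); apply: stable_sproj.
  - by rewrite Falpha // expr0 mul1r rmorphXn /= sgE // -exprM (monom_mod xia Et).
move=> _ /(monom_pos p_prime xia)[m m0 ->].
have [/dvdnP[j Em]|pm] := boolP (p ^ (a - r) %| m)%N.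
  have [A [B [oA oB zA zB EAB]]] := half_unit_span j.
  exists (fun x => A * proj r 0 x + B * sg (p ^ a).-1 (proj r 0 x)); split.
  - apply: isop_add; first exact: (isop_comp oA oP).
    exact: (isop_comp oB (isop_comp sgo oP)).
  - move=> x /(stable_proj p_prime xia sgE ra' oP) Rx; apply: ZspanD.
      by apply/Zadj_Zspan/ZadjM; [apply: zom | apply: Zspan_Zadj].
    by apply/Zadj_Zspan/ZadjM; [apply: zom | apply/Zspan_Zadj/sgR].
  - by rewrite Palpha sgN_u -EAB Em mulnC exprM.
have [c gc [mc|mc]] := real_rep m0 pm; first exact: reach gc mc.
have [T [oT TR TE]] := reach c (neg m) gc mc.
exists (fun x => sg (p ^ a).-1 (T x)); split; first exact: (isop_comp sgo oT).
  by move=> x Rx; apply/sgR/TR.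
rewrite TE rmorphXn /= sgE // -exprM; apply: (monom_mod xia).
exact: neg_neg.
Qed.

End RealCyclotomic.

Section TwistedTwo.
Variables (a tau : nat) (xi : algC) (sg : nat -> Aut) (H : Aut -> Prop) (S : algC -> Prop).
Hypotheses (a3 : (3 <= a)%N) (xia : (2 ^ a).-primitive_root xi).
Hypothesis tau3 : (tau = 3 %[mod 4])%N.
Hypothesis sgE : forall t, coprime t 2 -> sg t xi = xi ^+ t.
Hypothesis SQ : forall b : rat, S (ratr b).
Hypothesis Hsg : forall t, coprime t 2 -> H (sg t).
Local Notation w m := (xi ^+ m + xi ^+ (tau * m)).

(** Generators of the invariants of an involution xi -> xi^tau: the traces w m, and 1, which is only
    half of the trace w 0. *)
Definition twisted (x : algC) : Prop := x = 1 \/ exists m, x = w m.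
Local Notation R := (Zspan twisted).

Let prime2 : prime 2 := isT.

Let tau_odd : coprime 2 tau.
Proof.
rewrite prime_coprime // dvdn2 negbK; lia.
Qed.

Lemma proj0_w e m : (e < a)%N ->
  proj 2 a xi sg (a - e) 0 (w m) = if (2 ^ e %| m)%N then w m else 0.
Proof.
move=> ea; have oP : isop H S (proj 2 a xi sg (a - e) 0).
  by apply: isop_proj0; rewrite ?subn_gt0.
have ae : (0 < a - e <= a)%N by rewrite subn_gt0 ea leq_subr.
rewrite (isopD oP) !(proj_monom prime2 xia sgE) // subKn ?(ltnW ea) // mod0n.
rewrite -!/(dvdn _ _) Gauss_dvdr ?coprimeXl //.
by case: ifP; rewrite ?addr0.
Qed.

Lemma proj0_1 e : (e < a)%N -> proj 2 a xi sg (a - e) 0 1 = 1.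
Proof.
move=> ea; have ae : (0 < a - e <= a)%N by rewrite subn_gt0 ea leq_subr.
by have := proj_monom prime2 xia sgE 0 0 ae; rewrite eqxx expr0.
Qed.

Lemma R_w m : R (w m).
Proof.
by apply: Zspan_gen; right; exists m.
Qed.

Lemma stable_proj0 e x : (e < a)%N -> R x -> R (proj 2 a xi sg (a - e) 0 x).
Proof.
move=> ea; have oP : isop H S (proj 2 a xi sg (a - e) 0).
  by apply: isop_proj0; rewrite ?subn_gt0.
apply: (Zspan_stable oP) => _ [->|[m ->]].
  by rewrite proj0_1 //; apply: Zspan_gen; left.
by rewrite proj0_w //; case: ifP => _; [apply: R_w | apply: Zspan0].
Qed.

Lemma stable_twisted_sg t x : coprime t 2 -> R x -> R (sg t x).
Proof.
move=> t2; apply: (Zspan_stable (isop_aut S (Hsg t2))) => _ [->|[m ->]].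
  by rewrite rmorph1; apply: Zspan_gen; left.
rewrite rmorphD !rmorphXn /= sgE // -!exprM mulnCA; exact: R_w.
Qed.

(** xi^m is a primitive fourth root of unity, which tau = 3 modulo 4 inverts, so the two terms
    cancel. This is why the sum in the generator stops at a - 2. *)
Lemma w_eq0 m : (2 ^ (a - 2) %| m)%N -> ~~ (2 ^ (a - 1) %| m)%N -> w m = 0.
Proof.
move=> /dvdnP[k Ek] nd; have ko : odd k.
  apply: contraR nd => /negbTE ke; have -> : (a - 1 = (a - 2).+1)%N by lia.
  rewrite expnS Ek dvdn_pmul2r ?expn_gt0 // dvdn2 ke //.
have a2 : (2 <= a)%N by lia.
pose i := xi ^+ (2 ^ (a - 2)); have i4 : 4.-primitive_root i.
  by have := dvdn_prim_root xia (dvdn_exp2l 2 a2); rewrite -expnB.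
have i2 : i ^+ 2 = -1.
  have : (i ^+ 2) ^+ 2 == 1 by rewrite -exprM (prim_expr_order i4).
  rewrite sqrf_eq1 => /orP[/eqP i2|/eqP //].
  by have := prim_order_dvd i4 2; rewrite i2 eqxx.
have -> : xi ^+ m = i ^+ k by rewrite Ek mulnC exprM.
have -> : xi ^+ (tau * m) = i ^+ (3 * k).
  rewrite Ek (_ : tau * _ = 2 ^ (a - 2) * (tau * k))%N; last by ring.
  rewrite exprM -/i; apply/eqP; rewrite (eq_prim_root_expr i4).
  by rewrite -modnMml tau3 modnMml.
have -> : (3 * k = 2 * k + k)%N by ring.
by rewrite exprD exprM i2 -signr_odd ko expr1 mulN1r subrr.
Qed.

Lemma w_top m : (2 ^ (a - 1) %| m)%N -> exists b : int, w m = b%:~R.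
Proof.
move=> /dvdnP[k Ek]; have m2 : (xi ^+ m) ^+ 2 == 1.
  rewrite -exprM Ek -mulnA -expnSr (_ : (a - 1).+1 = a)%N; last by lia.
  by rewrite mulnC exprM (prim_expr_order xia) expr1n.
have Et : xi ^+ (tau * m) = (xi ^+ m) ^+ (tau %/ 4 * 4 + 3).
  by rewrite mulnC exprM; congr (_ ^+ _); rewrite {1}(divn_eq tau 4) tau3.
rewrite Et; move: m2; rewrite sqrf_eq1 => /orP[]/eqP->.
  by exists 2; rewrite expr1n.
exists (-2); rewrite -signr_odd oddD oddM andbF /= expr1.
by rewrite -opprD -[(-2)%:~R]/(- 2%:R).
Qed.

(** One trace for each valuation below a - 2, isolated by the difference of consecutive averages;
    the summand 1 accounts for exponents divisible by 2^(a-1), where the trace is an integer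
    ([w_top]). *)
Theorem op_cyclic_twisted : op_cyclic H S twisted.
Proof.
pose alpha := 1 + \sum_(e < a - 2) w (2 ^ e).
have dvd2 i j : (2 ^ i %| 2 ^ j)%N = (i <= j)%N by exact: dvdn_Pexp2l.
have oP e : (e < a)%N -> isop H S (proj 2 a xi sg (a - e) 0).
  by move=> ea; apply: isop_proj0; rewrite ?subn_gt0.
have a1 : (a - 1 < a)%N by lia.
have Palpha e : (e < a)%N -> proj 2 a xi sg (a - e) 0 alpha =
    1 + \sum_(i < a - 2 | (e <= i)%N) w (2 ^ i).
  move=> ea; rewrite /alpha (isopD (oP e ea)) proj0_1 //; congr (_ + _).
  rewrite (isop_raddf_sum _ _ _ (oP e ea)) [RHS]big_mkcond /=.
  by apply: eq_bigr => i _; rewrite proj0_w // dvd2.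
pose Q e x := proj 2 a xi sg (a - e) 0 x - proj 2 a xi sg (a - e.+1) 0 x.
have Qalpha e : (e < a - 2)%N -> Q e alpha = w (2 ^ e).
  move=> ea; have e1 : (e < a)%N by lia. have e2 : (e.+1 < a)%N by lia.
  rewrite /Q !Palpha // opprD addrACA subrr add0r (bigD1 (Ordinal ea)) //=.
  rewrite [X in _ + X - _](eq_bigl (fun i : 'I_(a - 2) => (e < i)%N)); last first.
    by move=> i; rewrite -val_eqE /= ltn_neqAle andbC eq_sym.
  by rewrite addrK.
exists alpha.
  apply: ZspanD; first by apply: Zspan_gen; left.
  by apply: Zspan_sum => e _; apply: R_w.
have P1 : proj 2 a xi sg (a - (a - 1)) 0 alpha = 1.
  rewrite Palpha // big1 ?addr0 // => i; have := ltn_ord i; lia.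
move=> _ [->|[m0 ->]].
  exists (proj 2 a xi sg (a - (a - 1)) 0); split=> //; first exact: oP.
  by move=> x; apply: stable_proj0.
have [m m_gt0 Em] : exists2 m, (0 < m)%N & w m0 = w m.
  exists (m0 + 2 ^ a)%N; first by rewrite addn_gt0 expn_gt0 orbT.
  by congr (_ + _); apply: (monom_mod xia); rewrite ?mulnDr ?modnDr // addnC modnMDl.
rewrite {}Em; have [va|va] := ltnP (logn 2 m) (a - 2).
  have [t t2 Em] := pfactor_coprime prime2 m_gt0; rewrite coprime_sym in t2.
  have e1 : (logn 2 m < a)%N by lia. have e2 : ((logn 2 m).+1 < a)%N by lia.
  exists (fun x => sg t (Q (logn 2 m) x)); split.
  - apply: (isop_comp (isop_aut _ (Hsg t2))); apply: isop_sub => //; exact: oP.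
  - by move=> x Rx; apply: stable_twisted_sg => //; apply: ZspanB; apply: stable_proj0.
  - rewrite Qalpha // rmorphD !rmorphXn /= sgE // -!exprM -Em; congr (_ + xi ^+ _).
    by rewrite [in RHS]Em; ring.
have [d|nd] := boolP (2 ^ (a - 1) %| m)%N; last first.
  rewrite w_eq0 // ?pfactor_dvdn //; exists (fun x => 0%:~R * x); split.
  - exact: isop_int.
  - by move=> x _; rewrite mul0r; apply: Zspan0.
  - by rewrite mul0r.
have [b ->] := w_top d.
exists (fun x => b%:~R * proj 2 a xi sg (a - (a - 1)) 0 x); split.
- exact: (isop_comp (isop_int H SQ b) (oP _ a1)).
- by move=> x Rx; apply/Zspan_int/stable_proj0.
- by rewrite P1 mulr1.
Qed.

End TwistedTwo.

(** * Tensor products over the primes dividing the conductor *)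

Section Tensor.
Variables (n : nat) (z : algC) (H : Aut -> Prop) (S : algC -> Prop).
Hypothesis zn : n.-primitive_root z.
Let n_gt0 : (0 < n)%N := prim_order_gt0 zn.

(** [pz p] and [cz p] generate the p-part and the prime-to-p part of the n-th roots of unity; an
    automorphism fixing [cz p] acts on the p-part only. *)
Definition pz p := z ^+ (n %/ p ^ logn p n).
Definition cz p := z ^+ (p ^ logn p n).

Lemma pz_prim p : (p ^ logn p n).-primitive_root (pz p).
Proof.
exact: (dvdn_prim_root zn (pfactor_dvdnn p n)).
Qed.

Lemma part_dvd_cofactor p q : p \in primes n -> q \in primes n -> p != q ->
  (q ^ logn q n %| n %/ p ^ logn p n)%N.
Proof.
rewrite !mem_primes => /and3P[pp _ _] /and3P[qp _ _] pq.
have : (q ^ logn q n * p ^ logn p n %| n)%N.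
  rewrite Gauss_dvd ?pfactor_dvdnn //; apply/coprimeXl/coprimeXr.
  by rewrite prime_coprime // dvdn_prime2 // eq_sym.
by rewrite dvdn_divRL ?pfactor_dvdnn.
Qed.

Lemma pz_cz p q : p \in primes n -> q \in primes n -> p != q ->
  exists k, pz p = cz q ^+ k.
Proof.
move=> pn qn pq; case/dvdnP: (part_dvd_cofactor pn qn pq) => k Ek.
by exists k; rewrite /pz /cz Ek mulnC exprM.
Qed.

(* Idempotents of Z/n: e p is 1 modulo the p-part of n and 0 modulo the rest. *)
Lemma z_prod_pz : exists k : nat -> nat, forall j,
  z ^+ j = \prod_(p <- primes n) pz p ^+ (k p * j).
Proof.
pose c p := (n %/ p ^ logn p n)%N.
have cop p : p \in primes n -> coprime (p ^ logn p n) (c p).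
  rewrite mem_primes => /and3P[pp _ _].
  have [c' pc' Ec] := pfactor_coprime pp n_gt0.
  have -> : c p = c' by rewrite /c {1}Ec mulnK // expn_gt0 prime_gt0.
  exact: coprimeXl.
pose e p := chinese (p ^ logn p n) (c p) 1 0.
have e1 p : p \in primes n -> (e p = 1 %[mod p ^ logn p n])%N.
  by move=> pn; rewrite /e chinese_modl ?cop.
have ec p : p \in primes n -> (c p %| e p)%N.
  by move=> pn; rewrite /dvdn /e chinese_modr ?cop // mod0n.
have dvd : (n %| \sum_(p <- primes n) e p + n.-1)%N.
  apply/dvdn_partP => // p pn; rewrite p_part.
  have {}pn : p \in primes n by [].
  have pa1 : (p ^ logn p n %| e p + n.-1)%N.
    by rewrite /dvdn -modnDml e1 // modnDml add1n prednK // -/(dvdn _ _) pfactor_dvdnn.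
  rewrite (big_rem p) //= addnAC dvdn_addr // big_seq; apply: dvdn_sum => q.
  rewrite (mem_rem_uniq _ (primes_uniq n)) inE => /andP[qp qn].
  exact: dvdn_trans (part_dvd_cofactor qn pn qp) (ec q qn).
have Ez : z = \prod_(p <- primes n) z ^+ e p.
  have z0 : z ^+ n.-1 != 0 by rewrite expf_neq0 ?(prim_root_neq0 zn).
  apply: (mulIf z0); rewrite -exprS prednK // -expr_sum -exprD (prim_expr_order zn).
  by case/dvdnP: dvd => k ->; rewrite mulnC exprM (prim_expr_order zn) expr1n.
exists (fun p => e p %/ c p)%N => j; rewrite {1}Ez -prodrXl big_seq [RHS]big_seq.
apply: eq_bigr => p pn; rewrite /pz -!exprM -/(c p); congr (z ^+ _).
by rewrite mulnA; congr (_ * _)%N; rewrite mulnC divnK ?ec.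
Qed.

Definition prod_gen (G : nat -> algC -> Prop) (x : algC) : Prop :=
  exists2 f : nat -> algC, (forall p, p \in primes n -> G p (f p))
    & x = \prod_(p <- primes n) f p.

Variable G : nat -> algC -> Prop.
Hypothesis Gz : forall p x, p \in primes n -> G p x -> adj (pz p) x.

Lemma adj_Zspan p x : p \in primes n -> Zspan (G p) x -> adj (pz p) x.
Proof.
by move=> pn; elim=> [y /Gz||y w _ zy _ zw]; [exact|exact: adj0|exact: adjB].
Qed.

Lemma cz_fix p q x (h : Aut) : p \in primes n -> q \in primes n -> p != q ->
  adj (pz p) x -> h (cz q) = cz q -> h x = x.
Proof.
move=> pn qn pq zx hq; apply: zx; have [k ->] := pz_cz pn qn pq.
by rewrite rmorphXn /= hq.
Qed.

Lemma prod_gen_span p v f : p \in primes n -> Zspan (G p) v ->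
  (forall q, q \in primes n -> G q (f q)) ->
  Zspan (prod_gen G) (v * \prod_(q <- rem p (primes n)) f q).
Proof.
move=> pn Gv Gf; elim: Gv => [x Gx||x y _ IHx _ IHy].
- apply: Zspan_gen; exists (fun q => if q == p then x else f q).
    by move=> q qn; case: eqP => [->//|_]; apply: Gf.
  rewrite [RHS](big_rem p) //= eqxx; congr (_ * _); apply: eq_big_seq => q.
  by rewrite (mem_rem_uniq _ (primes_uniq n)) inE => /andP[/negPf ->].
- by rewrite mul0r; apply: Zspan0.
- by rewrite mulrBl; apply: ZspanB.
Qed.

Let Hp p h := H h /\ h (cz p) = cz p.

Lemma stable_prod_gen p T : p \in primes n -> isop (Hp p) S T ->
  (forall x, Zspan (G p) x -> Zspan (G p) (T x)) ->
  forall x, Zspan (prod_gen G) x -> Zspan (prod_gen G) (T x).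
Proof.
move=> pn oT TR; apply: (Zspan_stable oT) => _ [f Gf ->].
rewrite (big_rem p) //= mulrC (isop_linear _ oT); last first.
  move=> h [_ hp]; rewrite rmorph_prod big_seq [RHS]big_seq; apply: eq_bigr => q.
  rewrite (mem_rem_uniq _ (primes_uniq n)) inE => /andP[qp qn].
  exact: (cz_fix qn pn qp (Gz qn (Gf q qn)) hp).
by rewrite mulrC; apply: prod_gen_span => //; apply/TR/Zspan_gen/Gf.
Qed.

Hypothesis SQ : forall b : rat, S (ratr b).

(** Operators at p fix [cz p], hence are linear over the other parts. Applied one prime after
    another they change the product of the local generators factor by factor; the induction carries
    this linearity along. *)
Theorem op_cyclic_tensor :
  (forall p, p \in primes n -> op_cyclic (Hp p) S (G p)) ->
  exists alpha, (exists2 v : nat -> algC, alpha = \prod_(p <- primes n) v p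
                   & forall p, p \in primes n -> Zspan (G p) (v p)) /\
    forall y, prod_gen G y -> exists T, [/\ isop H S T,
      forall x, Zspan (prod_gen G) x -> Zspan (prod_gen G) (T x) & T alpha = y].
Proof.
move=> cyc.
have [v vE] : exists v : nat -> algC, forall p, p \in primes n -> Zspan (G p) (v p) /\
    forall y, G p y -> exists T, [/\ isop (Hp p) S T,
      forall x, Zspan (G p) x -> Zspan (G p) (T x) & T (v p) = y].
  have Hv p : exists vp, p \in primes n -> Zspan (G p) vp /\
    forall y, G p y -> exists T, [/\ isop (Hp p) S T,
      forall x, Zspan (G p) x -> Zspan (G p) (T x) & T vp = y].
    case: (boolP (p \in primes n)) => [pn|_]; last by exists 0.
    by have [vp Gvp vpE] := cyc p pn; exists vp.
  by have [v vE] := choice Hv; exists v.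
have Gv p : p \in primes n -> Zspan (G p) (v p) by case/vE.
exists (\prod_(p <- primes n) v p); split; first by exists v.
move=> _ [f Gf ->].
suff H0 s : uniq s -> {subset s <= primes n} -> exists T, [/\ isop H S T,
    forall x, Zspan (prod_gen G) x -> Zspan (prod_gen G) (T x),
    forall c, (forall p h, p \in s -> Hp p h -> h c = c) ->
      forall x, T (c * x) = c * T x
  & T (\prod_(p <- s) v p) = \prod_(p <- s) f p].
  by have [|T [oT RT _ TE]] := H0 _ (primes_uniq n); last exists T.
elim: s => [|p s IH].
  move=> _ _; exists (fun x => x); split=> //; first exact: isop_id.
  by rewrite !big_nil.
rewrite cons_uniq => /andP[ps us] sub; have pn : p \in primes n by apply: sub; rewrite mem_head.
have sn q : q \in s -> q \in primes n by move=> qs; apply: sub; rewrite inE qs orbT.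
have [Ts [oTs RTs lTs TsE]] := IH us sn.
have [_ /(_ _ (Gf p pn))[Tp [oTp RTp TpE]]] := vE p pn.
have ne q : q \in s -> q != p by move=> qs; apply: contraNneq ps => <-.
exists (fun x => Tp (Ts x)); split.
- apply: isop_comp oTs; apply: isop_sub_ops oTp => // h [] //.
- by move=> x Rx; apply: (stable_prod_gen pn oTp RTp); apply: RTs.
- move=> c cfix x; rewrite lTs => [|q h qs]; last by apply: (cfix q) => //; rewrite inE qs orbT.
  by rewrite (isop_linear _ oTp) // => h hh; apply: (cfix p h) => //; apply: mem_head.
rewrite !big_cons lTs => [|q h qs [_ hq]]; last first.
  have pq : p != q by rewrite eq_sym ne.
  exact: (cz_fix pn (sn q qs) pq (adj_Zspan pn (Gv p pn)) hq).
have cfix h : Hp p h -> h (\prod_(q <- s) f q) = \prod_(q <- s) f q.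
  move=> [_ hp]; rewrite rmorph_prod big_seq [RHS]big_seq; apply: eq_bigr => q qs.
  exact: (cz_fix (sn q qs) pn (ne q qs) (Gz (sn q qs) (Gf q (sn q qs))) hp).
by rewrite TsE mulrC (isop_linear cfix oTp) TpE mulrC.
Qed.

End Tensor.

Lemma isop_eq_Zspan H1 S1 H2 S2 G T U : isop H1 S1 T -> isop H2 S2 U ->
  (forall x, G x -> T x = U x) -> forall x, Zspan G x -> T x = U x.
Proof.
move=> oT oU TU x; elim=> [y /TU //||y w _ Ey _ Ew].
  by rewrite (isop0 oT) (isop0 oU).
by rewrite (isopB oT) (isopB oU) Ey Ew.
Qed.

Section PartAutomorphisms.
Variables (n : nat) (z : algC).
Hypothesis zn : n.-primitive_root z.
Let n_gt0 : (0 < n)%N := prim_order_gt0 zn.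

Lemma part_aut p : prime p -> exists sg : nat -> Aut, forall t, coprime t p ->
  sg t (pz n z p) = pz n z p ^+ t /\ sg t (cz n z p) = cz n z p.
Proof.
move=> pp.
have Hsg t : exists g : Aut, coprime t p -> g (pz n z p) = pz n z p ^+ t /\ g (cz n z p) = cz n z p.
  have [tp|] := boolP (coprime t p); last by exists idfun.
  have [c' pc' Ec] := pfactor_coprime pp n_gt0.
  have cop : coprime (p ^ logn p n) c' by apply: coprimeXl.
  pose e := chinese (p ^ logn p n) c' t 1.
  have ep : (e = t %[mod p ^ logn p n])%N by rewrite chinese_modl.
  have ec : (e = 1 %[mod c'])%N by rewrite chinese_modr.
  have en : coprime e n.
    rewrite Ec coprimeMr -coprime_modl ec coprime_modl coprime1n /=.
    by rewrite -coprime_modl ep coprime_modl coprimeXr.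
  have [g gE] := aut_exp en; exists g => _.
  have zk k : (z ^+ k) ^+ n = 1 by rewrite exprAC (prim_expr_order zn) expr1n.
  split; first by rewrite gE ?zk // -(prim_expr_mod (pz_prim zn p)) ep (prim_expr_mod (pz_prim zn p)).
  have czp : c'.-primitive_root (cz n z p).
    have c'n : (c' %| n)%N by rewrite Ec dvdn_mulr.
    have nc : (n %/ c' = p ^ logn p n)%N.
      by rewrite {1}Ec mulKn // (dvdn_gt0 n_gt0 c'n).
    by have := dvdn_prim_root zn c'n; rewrite nc.
  by rewrite gE ?zk // -(prim_expr_mod czp) ec (prim_expr_mod czp) expr1.
by have [sg sgE] := choice Hsg; exists sg.
Qed.

Lemma monom_prod_gen x : Zspan (monom z) x -> Zspan (prod_gen n (fun p => monom (pz n z p))) x.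
Proof.
have [k kE] := z_prod_pz zn.
elim=> [y [j ->]||y w _ IHy _ IHw]; [|exact: Zspan0|exact: ZspanB].
apply: Zspan_gen; exists (fun p => pz n z p ^+ (k p * j)); last exact: kE.
by move=> p _; exists (k p * j)%N.
Qed.

Section Twisted.
Variables (tau : nat) (h0 : Aut).
Local Notation a := (logn 2 n).
Local Notation xi := (pz n z 2).
Local Notation y := (cz n z 2).
Hypotheses (a3 : (3 <= a)%N) (tau4 : (tau = 3 %[mod 4])%N).
Hypothesis tauN : (tau.+1 = 0 %[mod 2 ^ (a - 1)])%N.
Hypotheses (h0xi : h0 xi = xi ^+ tau) (h0y : h0 y = y).

Let xia : (2 ^ a).-primitive_root xi := pz_prim zn 2.
Let prime2 : prime 2 := isT.
Let n2 : 2%N \in primes n.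
Proof.
have : (2 ^ 1 %| n)%N by rewrite pfactor_dvdn //; lia.
by rewrite mem_primes n_gt0 expn1.
Qed.

Let pow2a : (2 ^ a = 2 * 2 ^ (a - 1))%N.
Proof.
by rewrite -expnS; congr (2 ^ _)%N; lia.
Qed.

Definition twisted_gen p : algC -> Prop :=
  if p == 2%N then twisted tau xi else monom (pz n z p).

Lemma z_decomp m : exists i c, [/\ z ^+ m = c * xi ^+ i, Zadj y c &
  forall w, twisted tau xi w -> prod_gen n twisted_gen (c * w)].
Proof.
have [k kE] := z_prod_pz zn.
exists (k 2%N * m)%N, (\prod_(q <- rem 2%N (primes n)) pz n z q ^+ (k q * m)).
have inrem q : q \in rem 2%N (primes n) -> q != 2%N /\ q \in primes n.
  by rewrite (mem_rem_uniq _ (primes_uniq n)) inE => /andP[].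
split; first by rewrite kE (big_rem 2%N) //= mulrC.
  rewrite big_seq; apply: Zadj_prod => q /inrem[q2 qn]; apply: ZadjX.
  by have [j ->] := pz_cz z qn n2 q2; apply/ZadjX/Zadj_root.
move=> w tw; exists (fun q => if q == 2%N then w else pz n z q ^+ (k q * m)).
  by move=> q qn; rewrite /twisted_gen; case: eqP => // _; exists (k q * m)%N.
rewrite [RHS](big_rem 2%N) //= mulrC; congr (_ * _); rewrite big_seq [RHS]big_seq.
by apply: eq_bigr => q /inrem[/negPf -> _].
Qed.

Lemma Zadj_y_span c w : Zadj y c -> twisted tau xi w ->
  Zspan (prod_gen n twisted_gen) (c * w).
Proof.
move=> /Zadj_Zspan yc tw; elim: yc => [_ [k ->]||u v _ IHu _ IHv].
- have [i [c' [Ez _ /(_ w tw) Gw]]] := z_decomp (2 ^ a * k).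
  have [k' k'E] := z_prod_pz zn.
  have -> : y ^+ k = \prod_(q <- rem 2%N (primes n)) pz n z q ^+ (k' q * (2 ^ a * k)).
    rewrite /cz -exprM k'E (big_rem 2%N) //= mulnCA exprM (prim_expr_order xia) expr1n.
    by rewrite mul1r.
  apply: Zspan_gen; exists (fun q => if q == 2%N then w else pz n z q ^+ (k' q * (2 ^ a * k))).
    by move=> q qn; rewrite /twisted_gen; case: eqP => // _; eexists.
  rewrite [RHS](big_rem 2%N) //= mulrC; congr (_ * _); rewrite big_seq [RHS]big_seq.
  apply: eq_bigr => q; rewrite (mem_rem_uniq _ (primes_uniq n)) inE => /andP[/negPf ->] //.
- by rewrite mul0r; apply: Zspan0.
- by rewrite mulrBl; apply: ZspanB.
Qed.

Let HT (h : Aut) := h y = y.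
Let ST (_ : algC) := True.

Section Components.
Variable sg : nat -> Aut.
Hypothesis sgE : forall t, coprime t 2 -> sg t xi = xi ^+ t /\ sg t y = y.
Let sgxi t (t2 : coprime t 2) : sg t xi = xi ^+ t := proj1 (sgE t2).
Local Notation comp j := (proj 2 a xi sg 1 j).

Lemma isop_comp2 j : isop HT ST (comp j).
Proof.
apply: isop_avg => // u; rewrite /HT.
have t2 : coprime (1 + 2 ^ 1 * u) 2 by apply: coprime1pXM.
by case: (sgE t2).
Qed.

Let Zy_fix c : Zadj y c -> forall h, HT h -> h c = c.
Proof.
by move=> /Zadj_adj yc h hy; apply: yc.
Qed.

Lemma comp_mono j c i : Zadj y c -> comp j (c * xi ^+ i) =
  if i == j %[mod 2 ^ (a - 1)] then c * xi ^+ i else 0.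
Proof.
move=> yc; rewrite (isop_linear (Zy_fix yc) (isop_comp2 j)).
rewrite (proj_monom prime2 xia sgxi); last by rewrite /=; lia.
by case: ifP => _; rewrite ?mulr0.
Qed.

Let R := Zspan (monom z).

(** Powers of xi with exponents congruent to j modulo 2^(a-1) differ from xi^j at most by a sign,
    which the coefficient in Z[y] absorbs. *)
Lemma comp_coef j x : R x -> exists2 c, Zadj y c & comp j x = c * xi ^+ j.
Proof.
elim=> [_ [m ->]||u v _ [c yc Ec] _ [d yd Ed]].
- have [i [c [-> yc _]]] := z_decomp m; rewrite comp_mono //.
  case: eqP => [ij|_]; last by exists 0; rewrite ?mul0r //; apply: Zadj0.
  have xi0 := prim_root_neq0 xia.
  have e2 : (xi ^+ i / xi ^+ j) ^+ 2 == 1.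
    rewrite expr_div_n (_ : (xi ^+ i) ^+ 2 = (xi ^+ j) ^+ 2) ?mulfV ?(expf_neq0 _ (expf_neq0 _ xi0)) //.
    rewrite -(exprM xi i) -(exprM xi j); apply: (monom_mod xia).
    by rewrite pow2a mulnC (mulnC j) -!muln_modr ij.
  have Ei : xi ^+ i = (xi ^+ i / xi ^+ j) * xi ^+ j by rewrite (divfK (expf_neq0 j xi0)).
  move: e2 Ei; rewrite sqrf_eq1 => /orP[]/eqP-> ->.
    by exists c; rewrite ?mul1r.
  by exists (- c); [apply: ZadjN | rewrite mulN1r mulrN mulNr].
- by exists 0; [apply: Zadj0 | rewrite (isop0 (isop_comp2 j)) mul0r].
by exists (c - d); [apply: ZadjB | rewrite (isopB (isop_comp2 j)) Ec Ed mulrBl].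
Qed.

Lemma comp_sum x : R x -> \sum_(0 <= j < 2 ^ (a - 1)) comp j x = x.
Proof.
rewrite big_mkord; move: x; apply: (@isop_eq_Zspan HT ST HT ST _ _ (fun x => x)).
- by apply: isop_sum => // j _; apply: isop_comp2.
- exact: isop_id.
move=> _ [m ->]; have [i [c [-> yc _]]] := z_decomp m.
have iN : (i %% 2 ^ (a - 1) < 2 ^ (a - 1))%N by rewrite ltn_mod expn_gt0.
rewrite (bigD1 (Ordinal iN)) //= comp_mono // modn_mod eqxx big1 ?addr0 // => j ji.
rewrite comp_mono //; case: eqP => // ij; case/eqP: ji; apply: val_inj => /=.
by rewrite ij modn_small.
Qed.

Lemma comp_twist j x : R x -> h0 (comp j x) = comp (tau * j) (h0 x).
Proof.
have oh0 : isop HT ST h0 by apply: isop_aut.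
move: x; apply: (@isop_eq_Zspan HT ST HT ST _ (fun x => h0 (comp j x)) (fun x => comp (tau * j) (h0 x))).
- exact: (isop_comp oh0 (isop_comp2 j)).
- exact: (isop_comp (isop_comp2 _) oh0).
move=> _ [m ->]; have [i [c [-> yc _]]] := z_decomp m.
rewrite comp_mono // [in RHS]rmorphM (Zy_fix yc h0y) [in RHS]rmorphXn /= h0xi -(exprM xi) comp_mono //.
have tt : (tau * tau = 1 %[mod 2 ^ (a - 1)])%N.
  apply/eqP; rewrite -(eqn_modDr tau) -mulnSr add1n; apply/eqP.
  by rewrite tauN -modnMmr tauN mod0n muln0 mod0n.
have -> : (tau * i == tau * j %[mod 2 ^ (a - 1)]) = (i == j %[mod 2 ^ (a - 1)]).
  apply/eqP/eqP => ij; last by rewrite -modnMmr ij modnMmr.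
  by rewrite -[i]mul1n -[j]mul1n -[LHS]modnMml -[RHS]modnMml -tt !modnMml -!mulnA -[LHS]modnMmr ij modnMmr.
by case: ifP => _; rewrite ?rmorph0 // rmorphM (Zy_fix yc h0y) rmorphXn /= h0xi -(exprM xi).
Qed.

Lemma comp_mod i j x : (i = j %[mod 2 ^ (a - 1)])%N -> comp i x = comp j x.
Proof.
move=> ij; rewrite /proj /avg; congr (_ * _); apply: eq_bigr => u _; congr (_^-1 * _).
apply: (monom_mod xia); rewrite pow2a expn1 -!mulnA -!muln_modr.
by rewrite -modnMml ij modnMml.
Qed.

(** As tau = -1 modulo 2^(a-1), h0 exchanges the components j and 2^(a-1) - j, which for an
    invariant x combine into traces. The component 0 lies in Z[y]. The middle one, j = 2^(a-2), is
    both fixed and negated by h0, hence 0. *)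
Lemma twisted_fixed_span x : R x -> h0 x = x -> Zspan (prod_gen n twisted_gen) x.
Proof.
move=> Rx hx; pose h := (2 ^ (a - 2))%N; pose F j := comp j x.
have Fh : forall j, h0 (F j) = F (tau * j)%N by move=> j; rewrite /F comp_twist // hx.
have EN : (2 ^ (a - 1) = h + h)%N by rewrite addnn -mul2n -expnS; congr (2 ^ _)%N; lia.
have h_gt0 : (0 < h)%N by rewrite expn_gt0.
have Fneg j : (j <= h + h)%N -> F (h + h - j)%N = h0 (F j).
  move=> jh; rewrite Fh; apply: comp_mod; rewrite EN; apply/eqP.
  rewrite -(eqn_modDr j) subnK // modnn -mulSnr.
  by rewrite -modnMml -EN tauN mod0n mul0n mod0n.
have Ex : x = F 0%N + \sum_(1 <= j < h) (F j + h0 (F j)) + F h.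
  rewrite -[LHS](comp_sum Rx) EN (big_cat_nat (leq0n h) (leq_addr h h)) /=.
  have hlt : (h < h + h)%N by rewrite -{1}[h]addn0 ltn_add2l.
  rewrite big_ltn // [X in _ + X]big_ltn // -/(F 0%N) -/(F h).
  rewrite [X in _ + (_ + X)](_ : _ = \sum_(1 <= j < h) h0 (F j)).
    by rewrite big_split /= -!addrA; congr (_ + (_ + _)); rewrite addrC.
  rewrite big_nat_rev -[h.+1]add1n big_addn addnK big_nat [RHS]big_nat.
  apply: eq_bigr => j /andP[j1 jh]; rewrite -Fneg; last by rewrite ltnW // ltn_addr.
  congr F; lia.
have Fh0 : F h = 0.
  have hh : h0 (F h) = F h by rewrite -Fneg ?leq_addr // addnK.
  have [c yc Ec] := comp_coef h Rx; rewrite -/(F h) in Ec.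
  have w0 : xi ^+ h + xi ^+ (tau * h) = 0.
    apply: (w_eq0 a3 xia tau4); first exact: dvdnn.
    by rewrite EN gtnNdvd //; lia.
  have E2 : F h + h0 (F h) = 0.
    by rewrite Ec rmorphM (Zy_fix yc h0y) rmorphXn /= h0xi -(exprM xi) -mulrDr w0 mulr0.
  by move/eqP: E2; rewrite hh -mulr2n mulrn_eq0 => /eqP.
rewrite Ex Fh0 addr0; apply: ZspanD.
  have [c yc] := comp_coef 0 Rx; rewrite expr0 -/(F 0%N) => ->.
  by apply: Zadj_y_span => //; left.
rewrite big_nat; apply: Zspan_sum => j _; have [c yc Ec] := comp_coef j Rx.
rewrite -/(F j) in Ec; rewrite Ec rmorphM (Zy_fix yc h0y) rmorphXn /= h0xi -(exprM xi) -mulrDr.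
by apply: Zadj_y_span => //; right; exists j.
Qed.

End Components.
End Twisted.
End PartAutomorphisms.

(** * Minimal conductors and elements of trace one *)

Lemma pow_prime_mod q j u : prime q -> (u = 1 %[mod q ^ j.+1])%N ->
  (u ^ q = 1 %[mod q ^ j.+2])%N.
Proof.
move=> qp u1; have uq : (u = 1 %[mod q])%N.
  by rewrite -(modn_dvdm u (dvdn_exp (ltn0Sn j) (dvdnn q))) u1 modn_dvdm // dvdn_exp.
have u0 : (0 < u)%N.
  by case: u uq {u1} => //; rewrite mod0n modn_small ?prime_gt1.
apply/eqP; rewrite eqn_mod_dvd ?expn_gt0 ?u0 // subn1 predn_exp expnSr; apply: dvdn_mul.
  by rewrite -subn1 -eqn_mod_dvd //; apply/eqP.
rewrite /dvdn; have -> : (\sum_(i < q) u ^ i = \sum_(i < q) 1 %[mod q])%N.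
  rewrite -modn_summ -[in RHS]modn_summ; congr (_ %% _)%N; apply: eq_bigr => i _.
  by rewrite -modnXm uq modnXm exp1n.
by rewrite sum1_card card_ord modnn.
Qed.

Lemma pow_primeX_mod q j t : prime q -> (t = 1 %[mod q])%N -> (t ^ (q ^ j) = 1 %[mod q ^ j.+1])%N.
Proof.
move=> qp t1; elim: j => [|j IH]; first by rewrite expn0 !expn1.
by rewrite expnSr expnM; apply: pow_prime_mod.
Qed.

Lemma exp1_mod k t d : (t = 1 %[mod d])%N -> (t ^ k = 1 %[mod d])%N.
Proof.
by move=> t1; rewrite -modnXm t1 modnXm exp1n.
Qed.

Lemma mod_dvd_eq d e s t : (d %| e)%N -> (s = t %[mod e])%N -> (s = t %[mod d])%N.
Proof.
by move=> de st; rewrite -(modn_dvdm s de) st modn_dvdm.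
Qed.

Lemma pred_mod4 N : (4 %| N)%N -> (0 < N)%N -> (N.-1 = 3 %[mod 4])%N.
Proof.
by case/dvdnP=> [[|k]] -> // _; rewrite mulSn -[(_ + _).-1]/(3 + k * 4)%N addnC modnMDl.
Qed.

Lemma pred_sqr N : (1 < N)%N -> (N.-1 ^ 2 = (N - 2) * N + 1)%N.
Proof.
case: N => [|[|N]] // _; rewrite -addn2 addnK addn2 /= -mulnn; ring.
Qed.

Section MinimalConductor.
Variables (n m : nat) (z : algC) (J : Aut -> Prop).
Hypotheses (zn : n.-primitive_root z) (mn : (m %| n)%N).
Hypotheses (Jid : J idfun) (JM : forall g h : Aut, J g -> J h -> J (g \o h)).
Hypothesis Jmin : forall q (h : Aut) t, prime q -> (q * q %| n)%N -> J h -> h z = z ^+ t ->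
  (t = 1 %[mod n %/ q])%N -> (t <> 1 %[mod n])%N -> ~~ (m %| n %/ q)%N.
Hypothesis Jodd : forall q (h : Aut) t, prime q -> odd q -> (q %| n)%N ->
  logn q m = logn q n -> J h -> h z = z ^+ t -> (t = 1 %[mod q])%N ->
  (t = 1 %[mod q ^ logn q n])%N.
Hypothesis J2 : forall (h : Aut) t, (0 < logn 2 m)%N -> J h -> h z = z ^+ t ->
  (t = 1 %[mod 2 ^ logn 2 m])%N /\ (t = 1 %[mod 4])%N.
Let n_gt0 : (0 < n)%N := prim_order_gt0 zn.

Let Jiter (h : Aut) k t : J h -> h z = z ^+ t -> exists2 g : Aut, J g & g z = z ^+ (t ^ k).
Proof.
move=> Jh hz; elim: k => [|k [g Jg gz]]; first by exists idfun; rewrite // expn0 expr1.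
by exists (h \o g); [apply: JM | rewrite /= gz rmorphXn /= hz -exprM expnS].
Qed.

Let part q : prime q -> exists2 c, coprime q c & n = (c * q ^ logn q n)%N.
Proof.
by move=> qp; case: (pfactor_coprime qp n_gt0) => c; exists c.
Qed.

Let cofactor q : prime q -> coprime (q ^ logn q n) (n %/ q ^ logn q n).
Proof.
move=> qp; have [c qc En] := part qp; have -> : (n %/ q ^ logn q n = c)%N.
  by rewrite {1}En mulnK // expn_gt0 prime_gt0.
exact: coprimeXl.
Qed.

Let n_split q : n = (q ^ logn q n * (n %/ q ^ logn q n))%N.
Proof.
by rewrite mulnC divnK // pfactor_dvdnn.
Qed.

Lemma dvd_div_prime q : prime q -> (q %| n)%N -> (logn q m < logn q n)%N -> (m %| n %/ q)%N.
Proof.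
move=> qp qn lt; have m_gt0 : (0 < m)%N := dvdn_gt0 n_gt0 mn.
have [c qc Em] := pfactor_coprime qp m_gt0.
have qm : (m * q %| n)%N.
  rewrite Em -mulnA -expnSr Gauss_dvd; last by rewrite coprime_sym; apply: coprimeXl.
  apply/andP; split; last exact: dvdn_trans (dvdn_exp2l q lt) (pfactor_dvdnn q n).
  by apply: (dvdn_trans _ mn); apply/dvdnP; exists (q ^ logn q m)%N; rewrite [LHS]Em mulnC.
by rewrite dvdn_divRL.
Qed.

(** The last power t^(q^j) that is not 1 modulo q^a has q-th power 1, so by the geometric sum it is
    1 modulo q^(a-1), hence modulo n/q, and the minimality condition [Jmin] applies. For q = 2 that
    sum requires the start modulo 4. *)
Lemma climb q (h : Aut) t : prime q -> J h -> h z = z ^+ t ->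
  (t = 1 %[mod (if q == 2%N then 4 else q)])%N -> (t = 1 %[mod n %/ q ^ logn q n])%N ->
  (t <> 1 %[mod q ^ logn q n])%N -> ~~ (m %| n %/ q)%N.
Proof.
move=> qp Jh hz tq tc ta; set a := logn q n in ta tc *.
have q_q' : (q %| (if q == 2%N then 4 else q))%N by case: eqP => // ->.
have tq1 := mod_dvd_eq q_q' tq.
have t0 : (0 < t)%N by case: t tq1 {hz tq tc ta} => //; rewrite mod0n modn_small ?prime_gt1.
have exj : exists j, (t ^ (q ^ j) == 1 %[mod q ^ a])%N.
  by exists a; apply/eqP; apply: mod_dvd_eq (pow_primeX_mod a qp tq1); rewrite dvdn_exp2l.
case: (ex_minnP exj) => [[|j]] /eqP tj jmin.
  by case: ta; rewrite expn0 expn1 in tj.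
pose s := (t ^ (q ^ j))%N; have sa : (s <> 1 %[mod q ^ a])%N.
  by move/eqP => sj; have := jmin j sj; rewrite ltnn.
have sq : (s ^ q = 1 %[mod q ^ a])%N by rewrite -expnM -expnSr.
have s1 : (s = 1 %[mod (if q == 2%N then 4 else q)])%N by apply: exp1_mod.
have s0 : (0 < s)%N by rewrite expn_gt0 t0.
have a_gt0 : (0 < a)%N by case: a sa {tj jmin sq ta exj tc} => //; rewrite expn0 !modn1.
have sa1 : (s = 1 %[mod q ^ a.-1])%N.
  have [u [Eu cu]] : exists u, (\sum_(i < q) s ^ i = q * u)%N /\ coprime u q.
    have [q2|q2] := eqVneq q 2%N; rewrite ?q2 ?(negPf q2) /= in s1 *.
      by have [E c] := geometric_sum_two s1; eexists; split; [exact: E|].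
    have qodd : odd q by case: (even_prime qp) => // E; rewrite E in q2.
    by have [u Eu cu] := geometric_sum_odd qp qodd s1; exists u.
  by apply: (root_of_one_mod qp s0 Eu cu); rewrite prednK.
have a2 : (1 < a)%N.
  rewrite ltn_neqAle a_gt0 andbT; apply/eqP => a1; case: sa; rewrite -a1 expn1.
  exact: mod_dvd_eq q_q' s1.
have [g Jg gz] := Jiter (q ^ j) Jh hz.
have qn : (q * q %| n)%N.
  by rewrite mulnn; apply: dvdn_trans (dvdn_exp2l q a2) (pfactor_dvdnn q n).
have Enq : (n %/ q = q ^ a.-1 * (n %/ q ^ a))%N.
  by rewrite {1}(n_split q) -/a -{1}(prednK a_gt0) expnS -mulnA mulKn ?prime_gt0.
apply: (Jmin qp qn Jg gz).
  apply/eqP; rewrite Enq chinese_remainder; last first.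
    by have := cofactor qp; rewrite -/a -{1}(prednK a_gt0) expnS coprimeMl => /andP[].
  by rewrite -/s sa1 !eqxx /=; apply/eqP; apply: exp1_mod.
by move=> s1n; apply: sa; apply: mod_dvd_eq s1n; apply: pfactor_dvdnn.
Qed.

Hypothesis n1 : (1 < n)%N.

(** Raise h to a power N that is 1 modulo q^a and 0 modulo the cofactor of q^a. As t is 1 modulo
    each prime q', its order modulo a power of q' is a power of q', so the q-component is unchanged
    and the others become trivial. *)
Lemma isolate q (h : Aut) t : prime q -> J h -> h z = z ^+ t ->
  (forall q', prime q' -> (q' %| n)%N -> (t = 1 %[mod q'])%N) ->
  exists (g : Aut) s, [/\ J g, g z = z ^+ s, (s = t %[mod q ^ logn q n])%N
    & (s = 1 %[mod n %/ q ^ logn q n])%N].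
Proof.
move=> qp Jh hz tq'; set a := logn q n; set c := (n %/ q ^ a)%N.
have cc : coprime (q ^ a) c := cofactor qp.
have t_gt0 : (0 < t)%N.
  have pn := pdiv_prime n1.
  rewrite lt0n; apply/eqP => t0; have := tq' _ pn (pdiv_dvd n).
  by rewrite t0 mod0n modn_small ?prime_gt1.
pose N := chinese (q ^ a) c 1 0.
have [g Jg gz] := Jiter N Jh hz; exists g, (t ^ N)%N; split=> //.
  have [->|a0] := posnP a; first by rewrite expn0 !modn1.
  have tq : (t = 1 %[mod q])%N.
    apply: tq' => //; rewrite -[q]expn1; apply: dvdn_trans (dvdn_exp2l q a0) (pfactor_dvdnn q n).
  have tqa : (t ^ (q ^ a) = 1 %[mod q ^ a])%N.
    by apply: mod_dvd_eq (pow_primeX_mod a qp tq); rewrite dvdn_exp2l.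
  have N1 : (N %% q ^ a = 1)%N.
    rewrite chinese_modl // modn_small // -(expn0 q) ltn_exp2l ?prime_gt1 //.
  rewrite (divn_eq N (q ^ a)) N1 addn1 expnS (mulnC (N %/ _)%N) expnM.
  by rewrite -modnMmr (exp1_mod _ tqa) modnMmr muln1.
have c_gt0 : (0 < c)%N by rewrite divn_gt0 ?expn_gt0 ?prime_gt0 // dvdn_leq // pfactor_dvdnn.
apply: eqn_mod_prime_parts => // [|q' q'p]; first by rewrite expn_gt0 t_gt0.
have [b0|b0] := posnP (logn q' c); first by rewrite b0 expn0 !modn1.
have q'n : (q' %| n)%N.
  rewrite (n_split q) dvdn_mull //; rewrite -[q']expn1.
  by apply: dvdn_trans (dvdn_exp2l q' b0) (pfactor_dvdnn q' c).
have : (q' ^ logn q' c %| N)%N.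
  apply: dvdn_trans (pfactor_dvdnn q' c) _.
  by rewrite /dvdn chinese_modr // mod0n.
case/dvdnP=> k ->; rewrite mulnC expnM; apply: exp1_mod.
by apply: mod_dvd_eq (pow_primeX_mod _ q'p (tq' _ q'p q'n)); rewrite dvdn_exp2l.
Qed.

(** Where m has the full exponent of q, [Jodd] decides. Otherwise m divides n/q, and a nontrivial
    q-component would contradict [climb]. *)
Lemma conductor_odd (h : Aut) t q : J h -> h z = z ^+ t ->
  (forall q', prime q' -> (q' %| n)%N -> (t = 1 %[mod q'])%N) ->
  prime q -> odd q -> (t = 1 %[mod q ^ logn q n])%N.
Proof.
move=> Jh hz tq' qp qodd; have [qn|qn] := boolP (q %| n)%N; last first.
  by rewrite (_ : logn q n = 0)%N ?expn0 ?modn1 //; apply/eqP; rewrite lognE qp n_gt0 (negPf qn).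
have [lt|ge] := ltnP (logn q m) (logn q n); last first.
  apply: (Jodd qp qodd qn _ Jh hz (tq' q qp qn)).
  by apply/eqP; rewrite eqn_leq ge dvdn_leq_log.
apply/eqP/negP => /negP ta; have [g [s [Jg gz st s1]]] := isolate qp Jh hz tq'.
have q2 : (q == 2%N) = false by apply/negbTE; apply: contraTneq qodd => ->.
have H := climb qp Jg gz; rewrite q2 dvd_div_prime // in H; suff : ~~ true by [].
apply: H => //.
- have qa : (q %| q ^ logn q n)%N by rewrite dvdn_exp // -pfactor_dvdn ?expn1.
  by rewrite -(mod_dvd_eq qa (esym st)); apply: tq'.
- by rewrite st; apply/eqP.
Qed.

(** By [climb] a nontrivial 2-component is 3 modulo 4, and its square, being 1 modulo 4, is trivial.
    Then -t is 1 modulo 4 with trivial square, hence 1 modulo 2^(a-1). The case a = 2 contradicts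
    [Jmin], a nontrivial 2-part of m contradicts [J2]. *)
Lemma conductor_two (h : Aut) t : J h -> h z = z ^+ t ->
  (forall q', prime q' -> (q' %| n)%N -> (t = 1 %[mod q'])%N) ->
  (t <> 1 %[mod 2 ^ logn 2 n])%N ->
  [/\ logn 2 m = 0, 3 <= logn 2 n, t = 3 %[mod 4], t.+1 = 0 %[mod 2 ^ (logn 2 n - 1)]
    & t * t = 1 %[mod 2 ^ logn 2 n]]%N.
Proof.
move=> Jh hz tq' ta; set a := logn 2 n in ta *.
have pr2 : prime 2 by [].
have a_gt0 : (0 < a)%N by case: a ta => //; rewrite expn0 !modn1.
have n2 : (2 %| n)%N by rewrite -[2%N]expn1 pfactor_dvdn.
have t2 := tq' 2 pr2 n2.
have la : (logn 2 m < a)%N.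
  rewrite ltn_neqAle dvdn_leq_log // andbT; apply/eqP => E.
  by have [] := J2 (h := h) (t := t) _ Jh hz; rewrite E.
have mn2 := dvd_div_prime pr2 n2 la.
have [g [s [Jg gz st s1]]] := isolate pr2 Jh hz tq'; rewrite -/a in st s1.
have sa : (s <> 1 %[mod 2 ^ a])%N by rewrite st.
have a2 : (1 < a)%N.
  by rewrite ltn_neqAle a_gt0 andbT; apply/eqP => a1; apply: ta; rewrite -a1 expn1.
have d4 : (4 %| 2 ^ a)%N by rewrite (dvdn_exp2l 2 a2).
have st4 := mod_dvd_eq d4 st.
have t3 : (t = 3 %[mod 4])%N.
  have : ~ (t = 1 %[mod 4])%N.
    move=> t1; have := climb pr2 Jg gz; rewrite /= mn2 => H.
    by have := H (etrans st4 t1) s1 sa.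
  move: t2; rewrite -(modn_dvdm t (_ : 2 %| 4)%N) //.
  have := ltn_pmod t (isT : 0 < 4)%N; move: (t %% 4)%N => e.
  by case: e => [|[|[|[|e]]]] //= _ _ H; case: H.
have tt : (t * t = 1 %[mod 2 ^ a])%N.
  apply/eqP/negP => /negP ntt.
  have ggz : (g \o g) z = z ^+ (s * s) by rewrite /= gz rmorphXn /= gz -exprM.
  have := climb pr2 (JM Jg Jg) ggz; rewrite /= mn2 => H; suff : ~~ true by [].
  apply: H.
  - by rewrite -modnMm st4 t3.
  - by rewrite -modnMm s1 modnMm.
  - by rewrite -modnMm st modnMm; apply/eqP.
have tN : (t.+1 = 0 %[mod 2 ^ (a - 1)])%N.
  (* [u] stands for -t modulo 2^a. *)
  pose u := (t * (2 ^ a).-1)%N.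
  have N_gt0 : (0 < 2 ^ a)%N by rewrite expn_gt0.
  have u4 : (u = 1 %[mod 4])%N.
    have N3 := pred_mod4 d4 N_gt0.
    by rewrite /u -modnMm t3 N3.
  have u0 : (0 < u)%N by case: u u4.
  have uu : (u ^ 2 = 1 %[mod 2 ^ a])%N.
    rewrite /u expnMn -modnMm -(mulnn t) tt modnMm mul1n.
    rewrite pred_sqr; last by rewrite -{1}(expn0 2) ltn_exp2l.
    by rewrite modnMDl.
  have [Eu cu] := geometric_sum_two u4.
  have u1 : (u = 1 %[mod 2 ^ a.-1])%N.
    by apply: (root_of_one_mod pr2 u0 Eu cu); rewrite prednK.
  rewrite subn1 -addn1 addnC -modnDml -u1 modnDml /u -mulnSr prednK //.
  by rewrite mod0n; apply/eqP; apply: dvdn_mull; apply: dvdn_exp2l (leq_pred a).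
have a3 : (3 <= a)%N.
  rewrite ltn_neqAle a2 andbT; apply/eqP => a_2; have n4 : (2 * 2 %| n)%N.
    by apply: dvdn_trans (pfactor_dvdnn 2 n); rewrite -/a -a_2.
  have := Jmin pr2 n4 Jg gz; rewrite mn2 => H; suff : ~~ true by [].
  apply: H; last by move=> s1n; apply: sa; apply: mod_dvd_eq s1n; apply: pfactor_dvdnn.
  have En2 : (n %/ 2 = 2 ^ 1 * (n %/ 2 ^ a))%N.
    by rewrite {1}(n_split 2) -/a -a_2 (_ : 2 ^ 2 = 2 * 2)%N // -mulnA mulKn.
  apply/eqP; rewrite En2 chinese_remainder; last first.
    by have := cofactor pr2; rewrite -/a -a_2 (_ : 2 ^ 2 = 2 * 2)%N // coprimeMl => /andP[].
  rewrite s1 !eqxx andbT expn1; apply/eqP.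
  by rewrite (mod_dvd_eq (_ : 2 %| 2 ^ a)%N st) // dvdn_exp.
split=> //; apply/eqP; rewrite -leqn0 leqNgt; apply/negP => m2.
by have [_] := J2 m2 Jh hz; rewrite t3.
Qed.

Lemma conductor_eq (h h' : Aut) t t' : J h -> J h' -> h z = z ^+ t -> h' z = z ^+ t' ->
  (forall q', prime q' -> (q' %| n)%N -> (t = 1 %[mod q'])%N) ->
  (forall q', prime q' -> (q' %| n)%N -> (t' = 1 %[mod q'])%N) ->
  (t <> 1 %[mod 2 ^ logn 2 n])%N -> h' z = z \/ h' z = h z.
Proof.
move=> Jh Jh' hz h'z tq' tq'' ta.
have trivial (g : Aut) s : J g -> g z = z ^+ s -> (0 < s)%N ->
    (forall q', prime q' -> (q' %| n)%N -> (s = 1 %[mod q'])%N) ->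
    (s = 1 %[mod 2 ^ logn 2 n])%N -> g z = z.
  move=> Jg gz s0 sq s2; rewrite gz -[RHS]expr1; apply/eqP.
  rewrite (eq_prim_root_expr zn); apply/eqP; apply: eqn_mod_prime_parts => // q qp.
  case: (even_prime qp) => [->|qodd] //; exact: conductor_odd Jg gz sq qp qodd.
have gt0 s : (forall q', prime q' -> (q' %| n)%N -> (s = 1 %[mod q'])%N) -> (0 < s)%N.
  move=> sq; have pn := pdiv_prime n1.
  rewrite lt0n; apply/eqP => s0; have := sq _ pn (pdiv_dvd n).
  by rewrite s0 mod0n modn_small ?prime_gt1.
have [|t'a] := pselect (t' = 1 %[mod 2 ^ logn 2 n])%N.
  by left; apply: (trivial h' t') => //; apply: gt0.
have [_ _ t3 _ tt] := conductor_two Jh hz tq' ta.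
have [_ _ t'3 _ _] := conductor_two Jh' h'z tq'' t'a.
have hhz : (h \o h') z = z ^+ (t * t') by rewrite /= h'z rmorphXn /= hz -exprM.
have ttq q' : prime q' -> (q' %| n)%N -> (t * t' = 1 %[mod q'])%N.
  by move=> q'p q'n; rewrite -modnMm (tq' q') // (tq'' q') // modnMm.
have Jhh' := JM Jh Jh'; have Jhh := JM Jh Jh.
have hhz2 : (h \o h) z = z ^+ (t * t) by rewrite /= hz rmorphXn /= hz -exprM.
have ttq2 q' : prime q' -> (q' %| n)%N -> (t * t = 1 %[mod q'])%N.
  by move=> q'p q'n; rewrite -modnMm (tq' q') // modnMm.
have E1 : h (h' z) = z.
  apply: (trivial (h \o h') (t * t')%N) => //; first exact: gt0.
  have [//|tt1] := pselect (t * t' = 1 %[mod 2 ^ logn 2 n])%N.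
  have [_ _ + _ _] := conductor_two Jhh' hhz ttq tt1.
  by rewrite -modnMm t3 t'3.
have E2 : h (h z) = z by apply: (trivial (h \o h) (t * t)%N) => //; apply: gt0.
by right; apply: (fmorph_inj h); rewrite E1 E2.
Qed.

End MinimalConductor.

(** * Sums of primitive roots of unity and elements of trace one *)

Lemma sum_multiples (F : nat -> algC) p n : (0 < p)%N ->
  \sum_(0 <= i < p * n | (p %| i)%N) F i = \sum_(0 <= j < n) F (p * j)%N.
Proof.
move=> p0; elim: n => [|n IH]; first by rewrite muln0 !big_geq.
rewrite big_nat_recr // -IH mulnS addnC (big_cat_nat (leq0n _) (leq_addr p _)) /=.
congr (_ + _); rewrite big_ltn_cond ?dvdn_mulr //; last by rewrite -{1}[(p * n)%N]addn0 ltn_add2l.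
rewrite big_nat_cond big1 ?addr0 // => i /andP[/andP[li lt] pi]; exfalso.
move: pi => /dvdnP[k Ek]; move: li lt; rewrite Ek (mulnC k) -mulnSr !ltn_pmul2l // => li.
by rewrite ltnS leqNgt li.
Qed.

(** The Moebius function at a squarefree order, one prime p at a time: the sum over all i prime to
    the remaining factor n vanishes, because the shift by n multiplies it by z^n, and its terms with
    p dividing i are the sum for z^p. *)
Lemma sum_coprime_exp s z : uniq s -> all prime s ->
  (\prod_(p <- s) p)%N.-primitive_root z ->
  \sum_(0 <= i < \prod_(p <- s) p | coprime i (\prod_(p <- s) p)) z ^+ i =
    (-1) ^+ size s :> algC.
Proof.
elim: s z => [|p s IH] z; first by rewrite big_nil => _ _ _; rewrite big_mkcond big_nat1 expr0.
rewrite cons_uniq => /andP[ps us] /andP[pp sp]; rewrite big_cons; set n := (\prod_(q <- s) q)%N => zn.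
have n_gt0 : (0 < n)%N by rewrite /n big_seq prodn_cond_gt0 // => q qs; apply/prime_gt0/(allP sp).
have pn : coprime p n.
  rewrite /n big_seq; apply: (big_ind (coprime p)) => [|x y|q qs]; rewrite ?coprimen1 //.
    by rewrite coprimeMr => -> ->.
  have qp : prime q := allP sp q qs.
  by rewrite prime_coprime // dvdn_prime2 //; apply: contraNneq ps => ->.
have zpn : n.-primitive_root (z ^+ p).
  by have := dvdn_prim_root zn (dvdn_mull p (dvdnn n)); rewrite mulnK.
have all0 : \sum_(0 <= i < p * n | coprime i n) z ^+ i = 0.
  rewrite big_mkord; have N0 : (0 < p * n)%N := prim_order_gt0 zn.
  move: zn; rewrite -(prednK N0); set N := (p * n).-1 => zn.
  have nN : (n %| N.+1)%N by rewrite /N prednK // dvdn_mull.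
  set X := \sum_(i < _ | _) _; have EX : X = z ^+ n * X.
    rewrite {1}/X (reindex_inj (addrI (inZp n : 'I_N.+1))) /= mulr_sumr.
    apply: eq_big => [i|i _].
      by rewrite /= -coprime_modl (modn_dvdm _ nN) -modnDml modn_dvdm // modnn add0n coprime_modl.
    by rewrite (prim_expr_mod zn) exprD (prim_expr_mod zn).
  have zn1 : 1 - z ^+ n != 0.
    rewrite subr_eq0 eq_sym -(prim_order_dvd zn) /N prednK //.
    by rewrite -{2}[n]mul1n dvdn_pmul2r // dvdn1 gtn_eqF ?prime_gt1.
  by apply: (mulfI zn1); rewrite mulr0 mulrBl mul1r -EX subrr.
have mult : \sum_(0 <= i < p * n | coprime i n && (p %| i)%N) z ^+ i = (-1) ^+ size s.
  rewrite -(IH (z ^+ p)) // big_mkcondl (sum_multiples _ _ (prime_gt0 pp)) [RHS]big_mkcond /=.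
  by apply: eq_bigr => i _; rewrite coprimeMl [coprime p n]pn /= exprM.
move: all0; rewrite (bigID (fun i => (p %| i)%N)) /= mult => /eqP; rewrite addr_eq0 => /eqP E.
rewrite exprS mulN1r E opprK; apply: eq_bigl => i.
by rewrite coprimeMr (coprime_sym i p) prime_coprime // andbC.
Qed.

Section TraceOne.
Variable J : Aut -> Prop.
Hypotheses (Jid : J idfun) (JM : forall g h : Aut, J g -> J h -> J (g \o h)).

(** theta is e times the sum of z^u over representatives u of the cosets of J in the units modulo N.
    Their translates by J exhaust the units, so the trace of theta is e times the sum of all
    primitive roots of unity, that is e e = 1. *)
Lemma trace_one N z (e : algC) : N.-primitive_root z -> e * e = 1 -> Zadj z e ->
  \sum_(0 <= i < N | coprime i N) z ^+ i = e ->
  exists (s : seq Aut) (theta : algC), [/\ Zadj z theta, forall k : nat, J (@nth Aut idfun s k),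
    uniq [seq h z | h : Aut <- s],
    \sum_(h <- s) (h : Aut) theta = 1 &
    forall h : Aut, J h -> h z \in [seq g z | g : Aut <- s]].
Proof.
(* The case N = 1 is treated apart because ['Z_1] has two elements. *)
case: N => [|[|N]] zN ee ze sumz; first by case/andP: zN.
  have z1 : z = 1 by have := prim_expr_order zN; rewrite expr1.
  exists [:: (idfun : Aut)], 1; split.
  - exact: Zadj1.
  - by move=> k; case: k => [|[|k]].
  - by [].
  - by rewrite big_seq1.
  - by move=> h _; rewrite z1 rmorph1 mem_head.
pose ex (u : {unit 'Z_N.+2}) : nat := nat_of_ord (val u).
have exM u v : z ^+ ex (u * v)%g = z ^+ (ex u * ex v)%N.
  by rewrite /ex /= (prim_expr_mod zN).
have ex_inj u v : z ^+ ex u = z ^+ ex v -> u = v.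
  move/eqP; rewrite (eq_prim_root_expr zN) => /eqP; rewrite !modn_small ?ltn_ord // => E.
  exact/val_inj/val_inj.
have exh (h : Aut) : exists u, h z = z ^+ ex u.
  have [k ck hk] := aut_prim_root h zN.
  have uk : (k%:R : 'Z_N.+2) \is a GRing.unit by rewrite unitZpE // coprime_sym.
  by exists (FinRing.Unit uk); rewrite hk /ex /= val_Zp_nat // (prim_expr_mod zN).
pose J0 := [set u : {unit 'Z_N.+2} | `[< exists h : Aut, J h /\ h z = z ^+ ex u >]].
have J0g : group_set J0.
  apply/group_setP; split.
    by rewrite inE; apply/asboolP; exists idfun; split=> //; rewrite /ex /= expr1.
  move=> u v; rewrite !inE => /asboolP[g [Jg gz]] /asboolP[h [Jh hz]].
  apply/asboolP; exists (g \o h); split; first exact: JM.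
  by rewrite /= hz rmorphXn /= gz -exprM exM.
pose G0 := Group J0g.
have [hs hsE] : exists hs : {unit 'Z_N.+2} -> Aut, forall u, u \in J0 -> J (hs u) /\ hs u z = z ^+ ex u.
  have H u : exists g : Aut, u \in J0 -> J g /\ g z = z ^+ ex u.
    have [|] := boolP (u \in J0); last by exists idfun.
    by rewrite inE => /asboolP[g gE]; exists g.
  by have [hs hsE] := choice H; exists hs.
pose T := rcosets G0 [set: {unit 'Z_N.+2}].
pose theta := e * \sum_(B in T) z ^+ ex (repr B).
have full : \sum_(u : {unit 'Z_N.+2}) z ^+ ex u = e.
  rewrite -sumz big_mkord (reindex_omap (fun u : {unit 'Z_N.+2} => val u) insub) /=.
    apply: eq_bigl => u; rewrite valK eqxx andbT.
    by have := valP u; rewrite -{1}(natr_Zp (val u)) unitZpE // coprime_sym => ->.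
  move=> i ci; rewrite insubT //=.
  by rewrite -(natr_Zp (i : 'Z_N.+2)) unitZpE // coprime_sym.
exists [seq hs u | u <- enum J0], theta; split.
- apply: ZadjM => //; apply: Zadj_sum => B _; exact/ZadjX/Zadj_root.
- move=> k; have [kl|kl] := ltnP k (size (enum J0)); last by rewrite nth_default ?size_map.
  rewrite (nth_map 1%g) //; have : nth 1%g (enum J0) k \in J0 by rewrite -mem_enum mem_nth.
  by case/hsE.
- rewrite -map_comp map_inj_in_uniq ?enum_uniq // => u v; rewrite !mem_enum => uJ vJ /=.
  by rewrite (proj2 (hsE u uJ)) (proj2 (hsE v vJ)); apply: ex_inj.
- rewrite big_map big_enum /=.
  transitivity (\sum_(u in J0) e * \sum_(B in T) z ^+ ex (u * repr B)%g).
    apply: eq_bigr => u uJ; rewrite /theta rmorphM rmorph_sum.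
    have -> : hs u e = e.
      have : (e - 1) * (e + 1) = 0 by rewrite mulrDr mulr1 mulrBl mul1r ee; ring.
      move/eqP; rewrite mulf_eq0 subr_eq0 addr_eq0 => /orP[]/eqP->; rewrite ?rmorphN rmorph1 //.
    congr (_ * _); apply: eq_bigr => B _.
    by rewrite rmorphXn /= (proj2 (hsE u uJ)) -exprM exM.
  rewrite -mulr_sumr exchange_big /= -ee; congr (_ * _); rewrite -full.
  have part : partition T [set: {unit 'Z_N.+2}] by apply: rcosets_partition; apply: subsetT.
  transitivity (\sum_(x in [set: {unit 'Z_N.+2}]) z ^+ ex x); last by apply: eq_bigl => u; rewrite inE.
  rewrite (set_partition_big _ part) /=; apply: eq_bigr => B /rcosetsP[x _ EB].
  have EB' : B = (G0 :* repr B)%g by rewrite EB rcoset_repr.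
  rewrite [RHS](eq_bigl (fun u => u \in (G0 :* repr B)%g)) => [|u]; last by rewrite {1}EB'.
  rewrite [RHS](reindex_inj (mulIg (repr B))) /=; apply: eq_bigl => u.
  by rewrite mem_rcoset mulgK.
- move=> h Jh; have [u hu] := exh h; rewrite hu.
  have uJ : u \in J0 by rewrite inE; apply/asboolP; exists h.
  rewrite -map_comp; apply/mapP; exists u; first by rewrite mem_enum.
  by rewrite /= (proj2 (hsE u uJ)).
Qed.

(* [x] is fixed by the elements of [J] fixing [z], so [h x] depends only on   *)
(* [h z] for [h] in [J].                                                      *)
Lemma trace_fixed z x (s : seq Aut) (g : Aut) :
  (forall h : Aut, J h -> exists h' : Aut, J h' /\ forall y, h' (h y) = y) ->
  (forall h : Aut, J h -> h z = z -> h x = x) ->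
  (forall k : nat, J (@nth Aut idfun s k)) -> uniq [seq h z | h : Aut <- s] ->
  (forall h : Aut, J h -> h z \in [seq g z | g : Aut <- s]) -> J g ->
  g (\sum_(h <- s) (h : Aut) x) = \sum_(h <- s) (h : Aut) x.
Proof.
move=> JV fixx Js us sJ Jg.
have [F FE] : exists F : algC -> algC, forall h : Aut, J h -> F (h z) = h x.
  have H v : exists b, forall h : Aut, J h -> h z = v -> h x = b.
    have [[h [Jh hv]]|nex] := pselect (exists h : Aut, J h /\ h z = v); last first.
      by exists 0 => h Jh hv; case: nex; exists h.
    exists (h x) => h' Jh' h'v; have [hi [Jhi hiK]] := JV h Jh.
    apply: (fmorph_inj hi); rewrite hiK.
    by apply: (fixx (hi \o h')); [apply: JM | rewrite /= h'v -hv hiK].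
  by have [F FE] := choice H; exists F => h Jh; rewrite (FE (h z) h).
have sum_nth (K : Aut -> algC) : \sum_(h <- s) K h = \sum_(0 <= k < size s) K (@nth Aut idfun s k).
  exact: (big_nth (idfun : Aut)).
have E1 : \sum_(h <- s) (h : Aut) x = \sum_(v <- [seq h z | h : Aut <- s]) F v.
  by rewrite big_map !sum_nth; apply: eq_bigr => k _; rewrite FE.
have E2 : g (\sum_(h <- s) (h : Aut) x) = \sum_(v <- [seq g v | v <- [seq h z | h : Aut <- s]]) F v.
  rewrite rmorph_sum !big_map !sum_nth; apply: eq_bigr => k _.
  exact: esym (FE (g \o @nth Aut idfun s k) (JM Jg (Js k))).
rewrite E2 E1; apply: perm_big.
have ug : uniq [seq g v | v <- [seq h z | h : Aut <- s]] by rewrite map_inj_uniq //; apply: fmorph_inj.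
have sub : {subset [seq g v | v <- [seq h z | h : Aut <- s]] <= [seq h z | h : Aut <- s]}.
  move=> _ /mapP[_ /(nthP 0)[k] ks <- ->]; rewrite size_map in ks; rewrite (nth_map (idfun : Aut)) //.
  by apply: (sJ (g \o @nth Aut idfun s k)); apply: JM.
apply: uniq_perm => //; apply: (uniq_min_size ug sub _).2.
by rewrite !size_map.
Qed.

End TraceOne.

(** * Local generators over the given field K, and descent to L *)

Section Assemble.
Variables (k : nat) (p r : 'I_k.+1 -> nat) (zeta w : 'I_k.+1 -> algC).
Hypotheses (p_prime : forall i, prime (p i)) (p_inj : injective p).
Hypotheses (p0 : p ord0 = 2%N) (r0 : r ord0 <> 1%N).
Hypothesis r_gt0 : forall i, i != ord0 -> (0 < r i)%N.
Hypothesis zetaE : forall i, (p i ^ r i).-primitive_root (zeta i).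
Hypothesis wE : forall i, w i = zeta i \/ i != ord0 /\ w i = zeta i + (zeta i)^-1.

Definition fixw (h : Aut) := forall i, h (w i) = w i.
(** Polynomials in a single generator are enough: products over several i arise by composing
    operators. *)
Definition scalw (c : algC) := exists i (f : {poly rat}), c = (pQC f).[w i].

Lemma adj_w i : adj (zeta i) (w i).
Proof.
by case: (wE i) => [->|[_ ->]] //; apply: adjD => //; apply: adjV.
Qed.

Lemma scalw_rat (a : rat) : scalw (ratr a).
Proof.
by exists ord0, a%:P; rewrite map_polyC hornerC.
Qed.

Lemma chebyshev (x : algC) j : x != 0 -> exists f : {poly rat}, x ^+ j + x ^- j = (pQC f).[x + x^-1].
Proof.
move=> x0; suff [f [g [Ef _]]] : exists f g : {poly rat}, x ^+ j + x ^- j = (pQC f).[x + x^-1] /\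
    x ^+ j.+1 + x ^- j.+1 = (pQC g).[x + x^-1] by exists f.
elim: j => [|j [f [g [Ef Eg]]]].
  exists (1%:P + 1%:P), 'X; rewrite rmorphD /= !map_polyC hornerD !hornerC map_polyX hornerX.
  by rewrite expr0 invr1 expr1 /= rmorph1.
exists g, ('X * g - f); split=> //.
rewrite rmorphB rmorphM /= map_polyX hornerD hornerN hornerM hornerX -Ef -Eg.
by rewrite !exprS; field; rewrite x0 expf_neq0.
Qed.

Variables (n : nat) (z : algC).
Hypotheses (zn : n.-primitive_root z) (mn : (\prod_i p i ^ r i %| n)%N).
Let n_gt0 : (0 < n)%N := prim_order_gt0 zn.

Let pr_n i : (p i ^ r i %| n)%N.
Proof.
by apply: dvdn_trans mn; rewrite (bigD1 i) //= dvdn_mulr.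
Qed.

Let r_le i : (r i <= logn (p i) n)%N.
Proof.
by rewrite -pfactor_dvdn.
Qed.

Lemma zeta_cz q i : prime q -> (p i != q \/ r i = 0%N) -> exists j, zeta i = cz n z q ^+ j.
Proof.
move=> qp pq; have [c qc En] := pfactor_coprime qp n_gt0.
have pc : (p i ^ r i %| c)%N.
  case: pq => [pq|->]; last by rewrite expn0.
  have := pr_n i; rewrite {1}En Gauss_dvdl // coprimeXl // coprimeXr //.
  by rewrite prime_coprime // dvdn_prime2.
have czc : c.-primitive_root (cz n z q).
  have cn : (c %| n)%N by rewrite En dvdn_mulr.
  have := dvdn_prim_root zn cn; rewrite {1}En mulKn // (dvdn_gt0 n_gt0 cn) //.
have zc : zeta i ^+ c = 1.
  by case/dvdnP: pc => d ->; rewrite mulnC exprM (prim_expr_order (zetaE i)) expr1n.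
by have [j ->] := prim_rootP czc zc; exists j.
Qed.

Let Hq q h := fixw h /\ h (cz n z q) = cz n z q.

Section Local.
Variables (q : nat) (sg : nat -> Aut).
Hypothesis qp : prime q.
Hypothesis sgE : forall t, coprime t q ->
  sg t (pz n z q) = pz n z q ^+ t /\ sg t (cz n z q) = cz n z q.
Local Notation xi := (pz n z q).

Lemma sg_other i t : coprime t q -> (p i != q \/ r i = 0%N) -> sg t (w i) = w i.
Proof.
move=> tq pq; apply: adj_w; have [j ->] := zeta_cz qp pq.
by rewrite rmorphXn /= (sgE tq).2.
Qed.

Lemma zeta_xi i : p i = q -> exists j, zeta i = (xi ^+ (q ^ (logn q n - r i))) ^+ j.
Proof.
move=> pq; have om : (q ^ r i).-primitive_root (xi ^+ (q ^ (logn q n - r i))).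
  have := dvdn_prim_root (pz_prim zn q) (dvdn_exp2l q (_ : r i <= logn q n)%N).
  by rewrite -expnB ?prime_gt0 // -pq ?r_le //; apply.
have := prim_expr_order (zetaE i); rewrite {1}pq => E.
by have [j ->] := prim_rootP om E; exists j.
Qed.

Lemma xi_zeta i e : p i = q -> exists j, (xi ^+ (q ^ (logn q n - r i))) ^+ e = zeta i ^+ j.
Proof.
move=> pq; have E : ((xi ^+ (q ^ (logn q n - r i))) ^+ e) ^+ (p i ^ r i) = 1.
  have rl := r_le i; rewrite pq in rl *.
  by rewrite exprAC -(exprM xi) -expnD subnK // (prim_expr_order (pz_prim zn q)) expr1n.
by have [j ->] := prim_rootP (zetaE i) E; exists j.
Qed.

Lemma sg_zeta i t : coprime t q -> p i = q -> sg t (zeta i) = zeta i ^+ t.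
Proof.
move=> tq pq; have [j ->] := zeta_xi pq.
rewrite (rmorphXn (sg t) j) (rmorphXn (sg t) (q ^ (logn q n - r i))) (sgE tq).1.
by rewrite (exprAC xi t) [LHS]exprAC.
Qed.

(** The part of K at q is trivial, cyclotomic or real. Automorphisms acting only on the q-part fix
    the [w j] of all other primes, so only the index belonging to q has to be tested. *)
Lemma op_cyclic_local : op_cyclic (Hq q) scalw (monom xi).
Proof.
have sgx t (tq : coprime t q) := (sgE tq).1.
have sgc t (tq : coprime t q) := (sgE tq).2.
have [[i [pq ri]]|none] := pselect (exists i, p i = q /\ (0 < r i)%N); last first.
  apply: (op_cyclic_rational qp (pz_prim zn q) sgx scalw_rat) => t tq; split; last exact: sgc.
  move=> i; apply: sg_other => //; have [pq|] := eqVneq (p i) q; last by left.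
  by right; apply/eqP; rewrite -leqn0 leqNgt; apply/negP => ri; apply: none; exists i.
have rl := r_le i; rewrite pq in rl.
have other t : coprime t q -> sg t (w i) = w i -> Hq q (sg t).
  move=> tq ti; split; last exact: sgc.
  move=> j; have [->//|ji] := eqVneq j i; apply: sg_other => //; left.
  by apply: contraNneq ji => pj; apply/eqP/p_inj; rewrite pj pq.
have one t : (t = 1 %[mod q ^ r i])%N -> Hq q (sg t).
  move=> t1; have tq := coprime_1mod ri t1; apply: other => //; apply: adj_w.
  rewrite sg_zeta // -(prim_expr_mod (zetaE i)) pq t1 -{1}pq (prim_expr_mod (zetaE i)) expr1 //.
case: (wE i) => [wz|[i0 wz]].
  apply: (op_cyclic_cyclotomic qp (pz_prim zn q) sgx scalw_rat ri rl one) => e.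
    have [j ->] := xi_zeta e pq; exists i, 'X^j.
    by rewrite map_polyXn hornerXn wz.
  have [j Ej] := xi_zeta e pq; have [d Ed] := zetaV (zetaE i) j.
  by exists i, 'X^d; rewrite map_polyXn hornerXn wz Ej Ed.
have q_odd : odd q.
  case: (even_prime qp) => // q2; case/eqP: i0; apply: p_inj.
  by rewrite pq q2 p0.
have z0 : zeta i != 0 := prim_root_neq0 (zetaE i).
apply: (op_cyclic_real qp q_odd (pz_prim zn q) ri rl sgx scalw_rat one) => [|e].
  have pa_gt0 : (0 < q ^ logn q n)%N by rewrite expn_gt0 prime_gt0.
  have tq : coprime (q ^ logn q n).-1 q.
    rewrite -(coprime_pexpr _ _ (leq_trans ri rl)) coprime_sym -{1}(prednK pa_gt0).
    exact: coprimeSn.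
  apply: other => //; rewrite wz rmorphD fmorphV /= sg_zeta //.
  have -> : zeta i ^+ (q ^ logn q n).-1 = (zeta i)^-1.
    apply: (mulfI z0); rewrite mulfV // -exprS prednK // -(subnK rl) expnD mulnC exprM.
    by rewrite -{1}pq (prim_expr_order (zetaE i)) expr1n.
  by rewrite invrK addrC.
have [j Ej] := xi_zeta e pq; rewrite Ej; have [f Ef] := chebyshev j z0.
by exists i, f; rewrite wz Ef.
Qed.

End Local.

Lemma op_cyclic_twisted_local tau : r ord0 = 0%N -> (3 <= logn 2 n)%N ->
  (tau = 3 %[mod 4])%N -> op_cyclic (Hq 2) scalw (twisted tau (pz n z 2)).
Proof.
move=> r00 a3 tau3; have [sg sgE] := part_aut zn (isT : prime 2).
have sgx t (tq : coprime t 2) := (sgE t tq).1.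
apply: (op_cyclic_twisted a3 (pz_prim zn 2) tau3 sgx scalw_rat) => t tq.
split; last exact: (sgE t tq).2.
move=> i; apply: (sg_other (isT : prime 2) sgE tq).
have [->|i0] := eqVneq i ord0; first by right.
by left; apply: contraNneq i0 => pi; apply/eqP/p_inj; rewrite pi p0.
Qed.

End Assemble.

Section Descent.
Variables (n n0 : nat) (z e : algC) (L : splittingFieldType rat) (iota : {rmorphism L -> algC}).
Variables (H : Aut -> Prop) (S : algC -> Prop) (G : nat -> algC -> Prop).
Hypotheses (zn : n.-primitive_root z) (n0n : (n0 %| n)%N) (zL : forall x, adj z (iota x)).
Local Notation z0 := (z ^+ (n %/ n0)).
Let J (h : Aut) := forall x, h (iota x) = iota x.
Hypotheses (e2 : e * e = 1) (Ze : Zadj z0 e).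
Hypothesis sum0 : \sum_(0 <= i < n0 | coprime i n0) z0 ^+ i = e.
Hypothesis SQ : forall b : rat, S (ratr b).
Hypothesis Sz : forall c, S c -> adj z c /\ forall h, J h -> h c = c.
Hypothesis GZ : forall p x, p \in primes n -> G p x -> Zadj (pz n z p) x.
Hypothesis Gloc : forall p, p \in primes n ->
  op_cyclic (fun h => H h /\ h (cz n z p) = cz n z p) S (G p).
Hypothesis Gspan : forall x, Zadj z x ->
  (forall h, J h -> h z0 = z0 -> h x = x) -> Zspan (prod_gen n G) x.
Hypothesis Gfix : forall p x h, p \in primes n -> G p x -> J h -> h z0 = z0 -> h x = x.

(** Let T carry the generator of the lattice to [iota y * theta]. Operators commute with J on the
    abelian field Q(z), so T carries the trace of the generator to the trace of [iota y * theta],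
    which is [iota y] because theta has trace 1. *)
Lemma op_cyclic_descent : exists2 alpha, iota alpha \in Aint &
  forall y, iota y \in Aint -> exists T,
    [/\ isop H S T, forall x, iota x \in Aint -> T (iota x) \in Aint & T (iota alpha) = iota y].
Proof.
have zn0 : n0.-primitive_root z0 := dvdn_prim_root zn n0n.
have Jid : J idfun by [].
have JM (g h : Aut) : J g -> J h -> J (g \o h) by move=> Jg Jh x /=; rewrite Jh Jg.
have JV (h : Aut) : J h -> exists h' : Aut, J h' /\ forall y, h' (h y) = y.
  move=> Jh; have [h' [hK _]] := aut_inv h; exists h'; split=> // x.
  by rewrite -[in LHS](Jh x) hK.
have [s [theta [Zt Js us tr1 sJ]]] := trace_one Jid JM zn0 e2 Ze sum0.
have Gz p x : p \in primes n -> G p x -> adj (pz n z p) x by move=> pn /(GZ pn)/Zadj_adj.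
have [alpha [[v Ea Gv] gen]] := op_cyclic_tensor Gz SQ Gloc.
have zpz p : Zadj z (pz n z p) by apply/ZadjX/Zadj_root.
have Zpz p x : Zadj (pz n z p) x -> Zadj z x by case=> f ->; apply: Zadj_horner.
have ZG p x : p \in primes n -> Zspan (G p) x -> Zadj z x.
  move=> pn; elim=> [y /(GZ pn)/Zpz //||y w _ IHy _ IHw]; [exact: Zadj0 | exact: ZadjB].
have ZP x : Zspan (prod_gen n G) x -> Zadj z x.
  elim=> [_ [f Gf ->]||y w _ IHy _ IHw]; [|exact: Zadj0 | exact: ZadjB].
  by rewrite big_seq; apply: Zadj_prod => p pn; apply: (ZG p) => //; apply/Zspan_gen/Gf.
have Zalpha : Zadj z alpha.
  by rewrite Ea big_seq; apply: Zadj_prod => p pn; apply: (ZG p) => //; apply: Gv.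
have fixalpha (h : Aut) : J h -> h z0 = z0 -> h alpha = alpha.
  move=> Jh hz; rewrite Ea rmorph_prod big_seq [RHS]big_seq; apply: eq_bigr => p pn.
  elim: (Gv p pn) => [y Gy||y w _ IHy _ IHw]; rewrite ?rmorph0 ?rmorphB ?IHy ?IHw //.
  exact: (Gfix pn Gy).
have zadj0 x : Zadj z0 x -> Zadj z x.
  by case=> f ->; apply: Zadj_horner; apply/ZadjX/Zadj_root.
have comm T : isop H S T -> (forall x, adj z x -> adj z (T x)) /\
    forall h x, J h -> adj z x -> h (T x) = T (h x).
  elim=> [g _|c Sc|U V _ [IU IU'] _ [IV IV']|U V _ [IU IU'] _ [IV IV']]; split=> [x zx|h x Jh zx].
  - exact: adj_aut zn zx.
  - exact: (abelianC_adj zn zx).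
  - by apply: adjM => //; case: (Sz Sc).
  - by rewrite rmorphM; case: (Sz Sc) => _ ->.
  - by apply: adjD; [apply: IU | apply: IV].
  - by rewrite rmorphD IU' ?IV'.
  - by apply/IU/IV.
  - by rewrite IU' ?IV' //; apply: IV.
pose tr x := \sum_(h <- s) (h : Aut) x.
have ztr x : adj z x -> adj z (tr x).
  by move=> zx; apply: adj_sum => h _; apply: adj_aut zn zx.
have trfix (g : Aut) x : (forall h : Aut, J h -> h z0 = z0 -> h x = x) -> J g -> g (tr x) = tr x.
  by move=> fx Jg; apply: (trace_fixed JM JV fx Js us sJ Jg).
have inL x : (forall g, J g -> g x = x) -> exists a, iota a = x.
  move=> fx; pose u := separable_generator 1 {:L}.
  have genu : <<1; u>>%VS = fullv.
    by rewrite -eq_adjoin_separable_generator ?sub1v ?separable_number_field.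
  have /adj_poly[f ->] : adj (iota u) x.
    move=> g gu; apply: fx => b.
    have /Fadjoin1_polyP[q ->] : b \in <<1; u>>%VS by rewrite genu memvf.
    rewrite -horner_map -map_poly_comp -horner_map gu; congr (_.[_]).
    rewrite -map_poly_comp; apply: eq_map_poly => c /=.
    exact: etrans (fmorph_eq_rat (g \o (iota \o in_alg L)) c) (esym (fmorph_eq_rat (iota \o in_alg L) c)).
  exists (map_poly (in_alg L) f).[u]; rewrite -horner_map -map_poly_comp; congr (_.[_]).
  by apply: eq_map_poly => c; rewrite -(fmorph_eq_rat (iota \o in_alg L)).
have zalpha := Zadj_adj Zalpha.
have [al Eal] : exists al, iota al = tr alpha.
  by apply: inL => g Jg; apply: trfix.
have itr x : Zadj z x -> tr x \in Aint.
  move=> zx; apply: rpred_sum => h _; rewrite Aint_aut; exact: Zadj_Aint zn zx.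
have span x : Zspan (prod_gen n G) x -> exists T, [/\ isop H S T,
    forall x, Zspan (prod_gen n G) x -> Zspan (prod_gen n G) (T x) & T alpha = x].
  elim=> [y /gen //||y w _ [T [oT TR TE]] _ [U [oU UR UE]]].
    exists (fun x => 0%:~R * x); split; [exact: isop_int | | by rewrite mul0r].
    by move=> y _; rewrite mul0r; apply: Zspan0.
  exists (fun x => T x - U x); split; [exact: isop_sub | | by rewrite TE UE].
  by move=> b Rb; apply: ZspanB; [apply: TR | apply: UR].
exists al; first by rewrite Eal; apply: itr.
move=> y iy; have zy := zL y; have Zy := Zadj_integral zn zy iy.
have Zth := zadj0 _ Zt.
have Syt : Zspan (prod_gen n G) (iota y * theta).
  apply: Gspan; first exact: ZadjM.
  by move=> h Jh hz; rewrite rmorphM Jh (Zadj_adj Zt hz).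
have [T [oT TR TE]] := span _ Syt; have [zT hT] := comm T oT.
exists T; split=> //.
  move=> x ix; apply: (Zadj_Aint zn); apply/ZP/TR/Gspan; first exact: Zadj_integral zn (zL x) ix.
  by move=> h Jh _; apply: Jh.
rewrite Eal /tr (isop_raddf_sum _ _ _ oT).
have Esum (F1 F2 : Aut -> algC) : (forall h, J h -> F1 h = F2 h) ->
    \sum_(h <- s) F1 h = \sum_(h <- s) F2 h.
  by move=> F12; rewrite !(big_nth (idfun : Aut)); apply: eq_bigr => k _; apply: F12.
rewrite (Esum _ (fun h => iota y * h theta)) => [|h Jh]; last first.
  by rewrite -hT // TE rmorphM Jh.
by rewrite -mulr_sumr tr1 mulr1.
Qed.

End Descent.

Lemma prod_primes_dvd (s : seq nat) n : uniq s -> (forall q, q \in s -> prime q /\ (q %| n)%N) ->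
  (\prod_(q <- s) q %| n)%N.
Proof.
elim: s => [|q s IH]; first by rewrite big_nil dvd1n.
rewrite cons_uniq => /andP[qs us] sP; have [qp qn] := sP q (mem_head q s).
have sP' t : t \in s -> prime t /\ (t %| n)%N by move=> ts; apply: sP; rewrite inE ts orbT.
rewrite big_cons Gauss_dvd ?qn ?IH // big_seq; apply: (big_ind (coprime q)) => [|x y|t ts].
- exact: coprimen1.
- by rewrite coprimeMr => -> ->.
have [tp _] := sP' t ts; rewrite prime_coprime // dvdn_prime2 //.
by apply: contraNneq qs => ->.
Qed.

Lemma logn_prime_prod (I : finType) (p r : I -> nat) i : (forall j, prime (p j)) -> injective p ->
  logn (p i) (\prod_j p j ^ r j) = r i.
Proof.
move=> p_prime p_inj; rewrite (bigD1 i) //=.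
have rest_gt0 : (0 < \prod_(j | j != i) p j ^ r j)%N.
  by rewrite prodn_cond_gt0 // => j _; rewrite expn_gt0 prime_gt0.
have pi_gt0 : (0 < p i ^ r i)%N by rewrite expn_gt0 prime_gt0.
rewrite lognM //.
rewrite pfactorK // logn_coprime ?addn0 //.
apply: (big_ind (coprime (p i))) => [|x y|j ji]; rewrite ?coprimen1 ?coprimeMr //; first by move=> -> ->.
by rewrite coprimeXr // prime_coprime // dvdn_prime2 // inj_eq // eq_sym.
Qed.

Theorem cyclotomic_op_cyclic (k : nat) (p r : 'I_k.+1 -> nat) (zeta w : 'I_k.+1 -> algC)
    (L : splittingFieldType rat) (iota : {rmorphism L -> algC}) :
  (forall i, prime (p i)) -> injective p -> p ord0 = 2%N -> r ord0 <> 1%N ->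
  (forall i, i != ord0 -> (0 < r i)%N) ->
  (forall i, (p i ^ r i).-primitive_root (zeta i)) ->
  (forall i, w i = zeta i \/ i != ord0 /\ w i = zeta i + (zeta i)^-1) ->
  (forall i, exists x, iota x = w i) -> abelian 'Gal({:L} / 1) ->
  exists2 alpha, iota alpha \in Aint & forall y, iota y \in Aint -> exists T,
    [/\ isop (fun h => forall i, h (w i) = w i)
          (fun c => exists i (f : {poly rat}), c = (pQC f).[w i]) T,
        forall x, iota x \in Aint -> T (iota x) \in Aint & T (iota alpha) = iota y].
Proof.
move=> p_prime p_inj p0 r0 r_gt0 zetaE wE wL abL.
pose m := (\prod_i p i ^ r i)%N.
have m_gt0 : (0 < m)%N by apply: prodn_gt0 => i; rewrite expn_gt0 prime_gt0.
pose good n := `[< [/\ (m %| n)%N, (0 < n)%N & forall z, n.-primitive_root z -> forall x, adj z (iota x)] >].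
have exgood : exists n, good n.
  have [N N0 NL] := abelian_field_cyclotomic iota abL.
  exists (m * N)%N; apply/asboolP; split; rewrite ?dvdn_mulr ?muln_gt0 ?m_gt0 //.
  move=> z zn x; have zN : N.-primitive_root (z ^+ m).
    by have := dvdn_prim_root zn (dvdn_mull m (dvdnn N)); rewrite mulnK.
  exact: adj_exp (NL _ zN x).
case: (ex_minnP exgood) => n /asboolP[mn n_gt0 nL] nmin {exgood}.
have [z zn] := C_prim_root_exists n_gt0; have zL := nL z zn.
pose J (h : Aut) := forall x, h (iota x) = iota x.
have Jid : J idfun by [].
have JM (g h : Aut) : J g -> J h -> J (g \o h) by move=> Jg Jh x /=; rewrite Jh Jg.
have Jw (h : Aut) i : J h -> h (w i) = w i by move=> Jh; have [x <-] := wL i; apply: Jh.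
have pn i : (p i ^ r i %| n)%N.
  by apply: dvdn_trans mn; rewrite /m (bigD1 i) //= dvdn_mulr.
have zetaz i : exists j, zeta i = z ^+ j.
  have E : zeta i ^+ n = 1.
    by case/dvdnP: (pn i) => d ->; rewrite mulnC exprM (prim_expr_order (zetaE i)) expr1n.
  by have [j ->] := prim_rootP zn E; exists j.
have hzeta (h : Aut) t i : h z = z ^+ t -> h (zeta i) = zeta i ^+ t.
  by move=> hz; have [j ->] := zetaz i; rewrite rmorphXn /= hz exprAC.
have Jmin q (h : Aut) t : prime q -> (q * q %| n)%N -> J h -> h z = z ^+ t ->
    (t = 1 %[mod n %/ q])%N -> (t <> 1 %[mod n])%N -> ~~ (m %| n %/ q)%N.
  move=> qp qqn Jh hz t1 tn; apply/negP => mq.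
  have qn : (q %| n)%N := dvdn_trans (dvdn_mulr q (dvdnn q)) qqn.
  pose b := (n %/ q)%N; have En : n = (b * q)%N by rewrite divnK.
  have b0 : (0 < b)%N by rewrite divn_gt0 ?prime_gt0 // dvdn_leq.
  have qb : (q %| b)%N by rewrite dvdn_divRL.
  (* As q divides b, the Galois group of Q(zeta_n) over Q(zeta_b) has prime order q. It is generated
     by h, which fixes L, so L already lies in Q(zeta_b), contrary to the choice of n. *)
  have : good b.
    apply/asboolP; split=> // z' z'b x g gz'.
    have zqb : b.-primitive_root (z ^+ q).
      have bn' : (b %| n)%N by rewrite En dvdn_mulr.
      have := dvdn_prim_root zn bn'; have -> // : (n %/ b = q)%N by rewrite {1}En mulKn.
    have gzq : g (z ^+ q) = z ^+ q.
      by have [j ->] := prim_rootP z'b (prim_expr_order zqb); rewrite rmorphXn /= gz'.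
    have [e _ ge] := aut_prim_root g zn.
    have eb : (e = 1 %[mod b])%N.
      apply/eqP; rewrite -(eq_prim_root_expr zqb) expr1; apply/eqP.
      by rewrite -[RHS]gzq rmorphXn /= ge exprAC.
    have t0 : (1 <= t + n)%N by rewrite addn_gt0 n_gt0 orbT.
    have e0 : (1 <= e + n)%N by rewrite addn_gt0 n_gt0 orbT.
    have bn : (b %| n)%N by rewrite En dvdn_mulr.
    have redn u : (u = 1 %[mod b])%N -> exists u', (u + n = 1 + b * u')%N.
      move=> u1; have : (b %| u + n - 1)%N.
        rewrite -eqn_mod_dvd ?addn_gt0 ?n_gt0 ?orbT //; apply/eqP.
        by rewrite -modnDmr (eqP (bn : _ == 0)%N) addn0.
      by case/dvdnP=> u' Eu; exists u'; rewrite mulnC -Eu subnKC // addn_gt0 n_gt0 orbT.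
    have [t' Et] := redn t t1; have [e' Ee] := redn e eb.
    have zaddn u : z ^+ (u + n) = z ^+ u by rewrite exprD (prim_expr_order zn) mulr1.
    have qt' : coprime t' q.
      rewrite coprime_sym prime_coprime //; apply/negP => /dvdnP[d Ed]; apply: tn.
      have Edn : (b * (d * q) = d * n)%N by rewrite En; ring.
      by rewrite -[LHS]modnDr Et Ed Edn addnC modnMDl.
    have qt2 : ~~ (q %| t')%N by rewrite -prime_coprime // coprime_sym.
    have [i it] := inverse_mod_prime qp qt2.
    (* b^2 is a multiple of n, so modulo n the powers of 1 + b t' are linear in the exponent. *)
    have pw c : ((1 + b * t') ^ c = 1 + c * (b * t') %[mod n])%N.
      elim: c => [|c IH]; first by rewrite expn0 mul0n addn0.
      rewrite expnS -modnMmr IH modnMmr.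
      have -> : ((1 + b * t') * (1 + c * (b * t')) = 1 + c.+1 * (b * t') + b * b * (c * t' * t'))%N by ring.
      case/dvdnP: qb => d Ed; have Ebb : (b * b = d * n)%N by rewrite {2}Ed En; ring.
      rewrite Ebb (_ : d * n * (c * t' * t') = c * t' * t' * d * n)%N; last by ring.
      by rewrite addnC modnMDl.
    have hi : iter (i * e') h z = g z.
      rewrite ge (aut_iter_exp _ (etrans hz (esym (zaddn t)))) -(zaddn e) Et Ee.
      apply/eqP; rewrite (eq_prim_root_expr zn) pw eqn_modDl.
      have -> : (i * e' * (b * t') = b * (t' * i * e'))%N by ring.
      by rewrite En -!muln_modr -modnMml it modnMml mul1n.
    have [hh hhE] := aut_iter h (i * e').
    rewrite -(adj_aut_eq (g := hh) (h := g) zn (zL x)) ?hhE //.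
    by elim: (i * e')%N => //= c ->; apply: Jh.
  by move/nmin; rewrite leqNgt ltn_Pdiv ?prime_gt1.
have [mi lm] : (forall q, prime q -> (q %| m)%N -> exists i, p i = q) /\ forall i, logn (p i) m = r i.
  split=> [q qp qm|i]; last exact: logn_prime_prod.
  apply: contrapT => none; have : coprime q m.
    apply: (big_ind (coprime q)) => [|x y|i _]; rewrite ?coprimen1 ?coprimeMr //; first by move=> -> ->.
    rewrite coprimeXr // prime_coprime // dvdn_prime2 //; apply/eqP => qi; apply: none.
    by exists i.
  by rewrite prime_coprime // qm.
have Jodd q (h : Aut) t : prime q -> odd q -> (q %| n)%N -> logn q m = logn q n -> J h ->
    h z = z ^+ t -> (t = 1 %[mod q])%N -> (t = 1 %[mod q ^ logn q n])%N.
  move=> qp qodd qn Elog Jh hz tq; rewrite -Elog.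
  have qm : (q %| m)%N by rewrite -[q]expn1 pfactor_dvdn // Elog -pfactor_dvdn // expn1.
  have [i pi] := mi q qp qm; have := Jw h i Jh; have hzt := hzeta h t i hz.
  have lr : logn q m = r i by rewrite -pi lm.
  have z0 : zeta i != 0 := prim_root_neq0 (zetaE i).
  have done1 : zeta i ^+ t = zeta i -> (t = 1 %[mod q ^ logn q m])%N.
    by rewrite lr -pi -{2}[zeta i]expr1 => /eqP; rewrite (eq_prim_root_expr (zetaE i)) => /eqP.
  case: (wE i) => [->|[i0 ->]]; first by rewrite hzt.
  rewrite rmorphD fmorphV /= hzt => E.
  have zt0 : zeta i ^+ t != 0 by rewrite expf_neq0.
  (* An automorphism fixing zeta + 1/zeta sends zeta to itself or to its inverse. The second would
     make t = -1 modulo q, contrary to t = 1 modulo the odd prime q. *)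
  have : (zeta i ^+ t - zeta i) * (zeta i ^+ t - (zeta i)^-1) = 0.
    have -> : (zeta i ^+ t - zeta i) * (zeta i ^+ t - (zeta i)^-1) =
        zeta i ^+ t * (zeta i ^+ t + (zeta i ^+ t)^-1 - (zeta i + (zeta i)^-1)).
      by field; rewrite z0 zt0.
    by rewrite E subrr mulr0.
  move/eqP; rewrite mulf_eq0 !subr_eq0 => /orP[/eqP//|/eqP zt].
  have : zeta i ^+ t.+1 = 1 by rewrite exprS zt mulfV.
  move/eqP; rewrite -(prim_order_dvd (zetaE i)) => dt.
  have qd : (q %| t.+1)%N.
    by apply: dvdn_trans dt; rewrite pi dvdn_exp // lt0n; apply/eqP => ri; have := r_gt0 i i0; rewrite ri.
  have : (q %| 2)%N by move: qd; rewrite /dvdn -addn1 -modnDml tq modnDml.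
  by rewrite dvdn_prime2 // => /eqP q2; rewrite q2 in qodd.
(* Since [r ord0] is not 1, a nontrivial 2-part of m is divisible by 4, so fixing K forces t = 1
   modulo 4. *)
have J2 (h : Aut) t : (0 < logn 2 m)%N -> J h -> h z = z ^+ t ->
    (t = 1 %[mod 2 ^ logn 2 m])%N /\ (t = 1 %[mod 4])%N.
  move=> m2 Jh hz; have lr : logn 2 m = r ord0 by rewrite -p0 lm.
  have := Jw h ord0 Jh; case: (wE ord0) => [->|[/eqP //]]; rewrite (hzeta h t _ hz).
  rewrite -{2}[zeta ord0]expr1 => /eqP; rewrite (eq_prim_root_expr (zetaE ord0)) p0 => /eqP t1.
  rewrite lr; split=> //; apply: mod_dvd_eq t1; apply: (@dvdn_exp2l 2 2).
  by move: m2 r0; rewrite lr; case: (r ord0) => [|[|]].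
(* n0 is squarefree, so its primitive roots of unity sum to a sign, as [trace_one] requires.
   Doubling this odd order would not enlarge the field. *)
pose s := [seq q <- primes n | odd q]; pose n0 := (\prod_(q <- s) q)%N.
have sP q : q \in s -> prime q /\ (q %| n)%N.
  by rewrite mem_filter mem_primes => /and4P[_ qp _ qn].
have us : uniq s by rewrite filter_uniq ?primes_uniq.
have n0n : (n0 %| n)%N by apply: prod_primes_dvd.
set z0 := z ^+ (n %/ n0); have zn0 : n0.-primitive_root z0 := dvdn_prim_root zn n0n.
have ps : all prime s by apply/allP => q /sP[].
have sum0 := sum_coprime_exp us ps zn0.
have e2 : (-1) ^+ size s * (-1) ^+ size s = 1 :> algC by rewrite -expr2 sqrr_sign.
have Ze : Zadj z0 ((-1) ^+ size s).
  by apply: ZadjX; apply: ZadjN; apply: Zadj1.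
have Vt (h : Aut) t : coprime t n -> h z = z ^+ t -> h z0 = z0 ->
    forall q, prime q -> (q %| n)%N -> (t = 1 %[mod q])%N.
  move=> tn hz hz0 q qp qn; case: (even_prime qp) => [q2|qodd].
    have : coprime t 2 by rewrite -q2; apply: coprime_dvdr tn.
    by rewrite q2 coprimen2 => todd; rewrite modn2 todd.
  have qs : q \in s by rewrite mem_filter qodd mem_primes qp n_gt0.
  have t1 : (t = 1 %[mod n0])%N.
    apply/eqP; rewrite -(eq_prim_root_expr zn0) expr1; apply/eqP.
    by rewrite -[RHS]hz0 /z0 rmorphXn /= hz exprAC.
  by apply: mod_dvd_eq t1; rewrite /n0 (big_rem q) //= dvdn_mulr.
have SQ := scalw_rat w.
have Sz c : scalw w c -> adj z c /\ forall h, J h -> h c = c.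
  move=> [i [f ->]]; have zw : adj z (w i).
    apply: (@adj_trans (zeta i)); last first.
      by case: (wE i) => [->|[_ ->]] //; apply: adjD => //; apply: adjV.
    by have [j ->] := zetaz i; apply/adjX/adj_root.
  split=> [|h Jh].
    rewrite horner_coef; apply: adj_sum => j _; apply: adjM (adjX _ zw).
    by rewrite coef_map; apply: adj_rat.
  rewrite -horner_map Jw //; congr (_.[_]); rewrite -map_poly_comp.
  by apply: eq_map_poly => a /=; rewrite fmorph_rat.
have loc q : q \in primes n -> op_cyclic (fun h => fixw w h /\ h (cz n z q) = cz n z q)
    (scalw w) (monom (pz n z q)).
  rewrite mem_primes => /and3P[qp _ _]; have [sg sgE] := part_aut zn qp.
  by apply: op_cyclic_local; try exact: sgE; try eassumption.
(* If only trivial elements of J fix z0, the lattice is Z[z]; otherwise h0 is the exceptional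
   involution at 2, and [r ord0] is 0. *)
have [triv|] := pselect (forall h, J h -> h z0 = z0 -> h z = z).
  apply: (op_cyclic_descent (G := fun q => monom (pz n z q)) zn n0n zL e2 Ze sum0 SQ Sz) => //.
  - by move=> q x _ [i ->]; apply/ZadjX/Zadj_root.
  - by move=> x zx _; apply: (monom_prod_gen zn); apply: Zadj_Zspan.
  - by move=> q x h _ [i ->] Jh hz; rewrite /pz !rmorphXn /= (triv h Jh hz).
move=> nt; have [h0 [Jh0 h0z0 h0z]] : exists h0 : Aut, [/\ J h0, h0 z0 = z0 & h0 z <> z].
  apply: contrapT => H; apply: nt => h Jh hz; apply: contrapT => hz'.
  by apply: H; exists h.
have n1 : (1 < n)%N.
  rewrite ltn_neqAle n_gt0 andbT; apply/eqP => n1; apply: h0z.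
  by have := prim_expr_order zn; rewrite -n1 expr1 => ->; rewrite rmorph1.
have [t tn h0t] := aut_prim_root h0 zn; have tq := Vt h0 t tn h0t h0z0.
have oddp := conductor_odd zn mn Jid JM Jmin Jodd n1 Jh0 h0t tq.
have t_gt0 : (0 < t)%N.
  by rewrite lt0n; apply: contraTneq tn => ->; rewrite /coprime gcd0n gtn_eqF.
have ta : (t <> 1 %[mod 2 ^ logn 2 n])%N.
  move=> t2; apply: h0z; rewrite h0t -[RHS]expr1; apply/eqP; rewrite (eq_prim_root_expr zn).
  apply/eqP; apply: eqn_mod_prime_parts => // q qp.
  by case: (even_prime qp) => [->|/(oddp _ qp)].
have [m2 a3 t3 tN tt] := conductor_two zn mn Jid JM Jmin J2 n1 Jh0 h0t tq ta.
have r00 : r ord0 = 0%N by rewrite -lm p0.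
have h0y : h0 (cz n z 2) = cz n z 2.
  have [c c2 En] := pfactor_coprime (isT : prime 2) n_gt0.
  have cn : (c %| n)%N by rewrite En dvdn_mulr.
  have czc : c.-primitive_root (cz n z 2).
    by have := dvdn_prim_root zn cn; rewrite {1}En mulKn // (dvdn_gt0 n_gt0 cn).
  rewrite {1}/cz rmorphXn /= h0t exprAC -/(cz n z 2) -[RHS]expr1; apply/eqP.
  rewrite (eq_prim_root_expr czc); apply/eqP.
  apply: eqn_mod_prime_parts => // [|q qp]; first exact: dvdn_gt0 n_gt0 cn.
  case: (even_prime qp) => [->|qodd]; first by rewrite logn_coprime // expn0 !modn1.
  apply: mod_dvd_eq (oddp q qp qodd); apply: dvdn_exp2l; exact: dvdn_leq_log.
have h0x : h0 (pz n z 2) = pz n z 2 ^+ t by rewrite /pz rmorphXn /= h0t exprAC.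
have n2 : 2%N \in primes n.
  have : (2 ^ 1 %| n)%N by rewrite pfactor_dvdn // (ltn_trans _ a3).
  by rewrite mem_primes n_gt0 expn1.
have Jeq (h : Aut) : J h -> h z0 = z0 -> h z = z \/ h z = h0 z.
  move=> Jh hz0; have [u un hu] := aut_prim_root h zn.
  exact: (conductor_eq zn mn Jid JM Jmin Jodd J2 n1 Jh0 Jh h0t hu tq (Vt h u un hu hz0) ta).
apply: (op_cyclic_descent (G := twisted_gen n z t) zn n0n zL e2 Ze sum0 SQ Sz) => //.
- move=> q x _; rewrite /twisted_gen; case: eqP => [->|_].
    by case=> [->|[i ->]]; [exact: Zadj1 | apply: ZadjD; apply/ZadjX/Zadj_root].
  by case=> i ->; apply/ZadjX/Zadj_root.
- move=> q qn; rewrite /twisted_gen; case: eqP => [->|_]; last exact: loc.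
  by apply: op_cyclic_twisted_local; try eassumption.
- move=> x zx fx; have [sg sgE] := part_aut zn (isT : prime 2).
  apply: (twisted_fixed_span zn a3 t3 tN h0x h0y sgE); first exact: Zadj_Zspan.
  exact: fx.
(* On z, h is the identity or h0. The latter moves the 2-part only, where the traces are invariant
   because t^2 = 1 modulo 2^a. *)
move=> q x h qn Gx Jh hz0; case: (Jeq h Jh hz0) => hz.
  have zx : adj z x; last exact: zx.
  move: Gx; rewrite /twisted_gen; case: eqP => [_|_].
    by case=> [->|[i ->]]; [exact: adj1 | apply: adjD; do 2!apply: adjX].
  by case=> i ->; do 2!apply: adjX.
have hy : h (cz n z 2) = cz n z 2 by rewrite -[RHS]h0y /cz !rmorphXn /= hz.
have hx : h (pz n z 2) = pz n z 2 ^+ t by rewrite -h0x /pz !rmorphXn /= hz.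
move: Gx; rewrite /twisted_gen; case: eqP => [_|/eqP q2].
  case=> [->|[i ->]]; first exact: rmorph1.
  rewrite rmorphD (rmorphXn h i) (rmorphXn h (t * i)) /= hx -!(exprM (pz n z 2)) addrC.
  congr (_ + _); apply: (monom_mod (pz_prim zn 2)).
  by rewrite mulnA -modnMml tt modnMml mul1n.
case=> i ->; have [j Ej] := pz_cz z qn n2 q2.
by rewrite rmorphXn /= Ej rmorphXn /= hy.
Qed.

(** * Passage to the associated order *)

Lemma algint_Aint (L : splittingFieldType rat) (iota : {rmorphism L -> algC}) a :
  (a \in @algint_pred L) = (iota a \in Aint).
Proof.
apply/idP/idP => [/asboolP[q qm qa]|ia].
  have : root (map_poly intr q) (iota a).
    have -> : map_poly intr q = map_poly iota (map_poly intr q) :> {poly algC}.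
      by rewrite -map_poly_comp; apply: eq_map_poly => c /=; rewrite rmorph_int.
    by rewrite fmorph_root.
  move/root_monic_Aint; apply; first by rewrite monic_map.
  by apply/polyOverP => i; rewrite coef_map; apply: intr_int.
apply/asboolP; have /floorpP[q Eq] : minCpoly (iota a) \is a polyOver Num.int by [].
have qm := minCpoly_monic (iota a).
exists q.
  move: qm; rewrite Eq !monicE (lead_coef_map_inj (@intr_inj algC)) ?rmorph0 //.
  by rewrite -(eqr_int algC).
have := root_minCpoly (iota a); rewrite Eq.
have -> : map_poly intr q = map_poly iota (map_poly intr q) :> {poly algC}.
  by rewrite -map_poly_comp; apply: eq_map_poly => c /=; rewrite rmorph_int.
by rewrite fmorph_root.
Qed.

(** In a normal number field containing c and d, d is a root of the minimal polynomial of c, so an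
    automorphism of that field carries c to d; it extends to [algC]. *)
Lemma conjugate_aut (c d : algC) : (forall q : {poly rat}, root (pQC q) c -> root (pQC q) d) ->
  exists h : Aut, h c = d.
Proof.
move=> cd; have [M [j [t Et]]] := normal_number_field [:: c; d].
case: t Et => [|c' [|d' [|]]] //= [Ec Ed].
have /polyOver1P[q Eq] := minPolyOver 1 c'.
have rd : root (minPoly 1 c') d'.
  have inj (q' : {poly rat}) x : root (map_poly (in_alg M) q') x = root (pQC q') (j x).
    rewrite -(fmorph_root j) -map_poly_comp; congr (root _ _); apply: eq_map_poly => b.
    exact: (fmorph_eq_rat (j \o in_alg M)).
  rewrite Eq inj Ed; apply: cd; rewrite -Ec -inj -Eq; exact: root_minPoly.
have [g _ gE] := normalField_root_minPoly (sub1v {:M}%AS) (normalFieldf _) (memvf c') rd.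
by have [h hE] := gal_to_aut j g; exists h; rewrite -Ec hE gE Ed.
Qed.

Section CompositumFix.
Variables (E : splittingFieldType rat) (iota : {rmorphism E -> algC}).
Variables (I : finType) (K_ : I -> {subfield E}).

Lemma compositum_fix (h : Aut) : (forall i a, a \in K_ i -> h (iota a) = iota a) ->
  forall a, a \in compositum K_ -> h (iota a) = iota a.
Proof.
move=> hK a aK; have [g gE] := aut_to_gal iota h.
set F := fixedField [set g].
have UF : (\sum_i K_ i <= F)%VS.
  apply/subv_sumP => i _; apply/subvP => b bK; apply/fixedFieldP; rewrite ?memvf // => x.
  by rewrite inE => /eqP->; apply: (fmorph_inj iota); rewrite gE (hK i).
have KF : (compositum K_ <= F)%VS.
  apply: agenv_sub_modl; first exact: sub1v.
  exact: subv_trans (prodvSl F UF) (asubv F).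
have [_ /(_ g (set11 g)) ga] := mem_fixedFieldP (subvP KF a aK).
by rewrite -gE ga.
Qed.

End CompositumFix.

Section Generators.
Variables (E : splittingFieldType rat) (iota : {rmorphism E -> algC}).

Lemma adj_Fadjoin u a : a \in <<1; u>>%VS -> adj (iota u) (iota a).
Proof.
move=> /Fadjoin1_polyP[f ->]; rewrite -horner_map -map_poly_comp horner_coef.
apply: adj_sum => i _; apply: adjM; last exact/adjX/adj_root.
rewrite coef_map.
by rewrite [X in adj _ X](fmorph_eq_rat (iota \o in_alg E) f`_i); apply: adj_rat.
Qed.

(** Complex conjugation inverts u, so u + 1/u is real and lies in K by maximality. An automorphism
    fixing it sends u to u or 1/u, hence acts on the cyclotomic field as the identity or as complex
    conjugation, and both are trivial on K. *)
Lemma real_generator N (K : {subfield E}) : (0 < N)%N -> is_real_cyclotomic_field iota N K ->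
  exists2 u, N.-primitive_root u & u + u^-1 \in K /\
    forall h : Aut, h (iota (u + u^-1)) = iota (u + u^-1) ->
      forall a, a \in K -> h (iota a) = iota a.
Proof.
move=> N_gt0 [C [u uN EC] [KC Kreal Kmax]]; exists u => //.
have uC : u \in C by rewrite EC memv_adjoin.
have zN : N.-primitive_root (iota u) by rewrite fmorph_primitive_root.
have z0 := prim_root_neq0 zN; set x := iota u in zN z0.
have conjx : x^* = x^-1.
  by apply: (mulfI z0); rewrite mulfV // (conj_unity N_gt0 (prim_expr_order zN)).
have wr : x + x^-1 \is Num.real by rewrite -conjx CrealE rmorphD /= conjCK addrC.
split.
  have wC : (<<1; u + u^-1>> <= C)%VS.
    by apply/FadjoinP; rewrite sub1v rpredD // rpredV.
  apply: (subvP (Kmax <<1; u + u^-1>>%AS wC _)); last exact: memv_adjoin.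
  move=> a /Fadjoin1_polyP[f ->]; rewrite -horner_map -map_poly_comp horner_coef.
  apply: rpred_sum => i _; apply: rpredM; last first.
    by apply: rpredX; rewrite rmorphD fmorphV.
  have E1 : (iota \o in_alg E) f`_i = ratr f`_i by exact: fmorph_eq_rat.
  have : (ratr f`_i : algC) \is Num.real by exact: rpred_rat.
  by rewrite coef_map -E1.
move=> h hw a aK; have za : adj x (iota a).
  by apply: adj_Fadjoin; have := subvP KC a aK; rewrite EC.
have : (h x - x) * (h x - x^-1) = 0.
  have hx0 : h x != 0 by rewrite fmorph_eq0.
  have E1 : h x + (h x)^-1 = x + x^-1.
    by move: hw; rewrite !rmorphD !fmorphV.
  have -> : (h x - x) * (h x - x^-1) = h x * (h x + (h x)^-1 - (x + x^-1)).
    by field; rewrite z0 hx0.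
  by rewrite E1 subrr mulr0.
move/eqP; rewrite mulf_eq0 !subr_eq0 => /orP[]/eqP hx; first exact: za.
have -> : h (iota a) = (iota a)^*.
  by apply: (adj_aut_eq (h := Num.conj) zN za); rewrite hx; apply: esym conjx.
by apply/eqP; rewrite -CrealE; apply: Kreal.
Qed.

End Generators.

Section FreeRank1.
Variables (L : splittingFieldType rat) (iota : {rmorphism L -> algC}) (K : {subfield L}).
Variables (H : Aut -> Prop) (S : algC -> Prop).
Hypothesis HK : forall h : Aut, H h -> forall a, a \in K -> h (iota a) = iota a.
Hypothesis SK : forall c, S c -> exists2 a, a \in K & c = iota a.

Lemma isop_galg T : isop H S T -> exists c : galois_galg K, forall x,
  iota (galg_act c x) = T (iota x).
Proof.
elim=> [h Hh|k Sk|U V _ [c cE] _ [d dE]|U V _ [c cE] _ [d dE]].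
- have [g gE] := aut_to_gal iota h.
  have gK : g \in 'Gal({:L} / K)%g.
    rewrite gal_kHom ?subvf //; apply/kHomP; split=> [x y _ _|x xK]; first exact: rmorphM.
    by apply: (fmorph_inj iota); rewrite gE HK.
  exists [ffun s => (s == subg _ g)%:R] => x; rewrite /galg_act (bigD1 (subg _ g)) //=.
  rewrite ffunE eqxx rmorph1 mul1r big1 ?addr0; first by rewrite subgK // gE.
  by move=> s /negPf sg; rewrite ffunE sg raddf0 mul0r.
- have [a aK ->] := SK Sk; exists [ffun s => if s == 1%g then vsproj K a else 0] => x.
  rewrite /galg_act (bigD1 1%g) //= ffunE eqxx vsprojK // gal_id big1 ?addr0 ?rmorphM //.
  by move=> s /negPf sg; rewrite ffunE sg raddf0 mul0r.
- by exists (c + d) => x; rewrite galg_actDl rmorphD cE dE.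
- by exists (c * d) => x; rewrite galg_actM cE dE.
Qed.

Hypothesis abL : abelian 'Gal({:L} / 1)%g.
Hypothesis intL : forall x : L, exists2 d : nat, (0 < d)%N & d%:R * iota x \in Aint.

Lemma galg_act_comm (c d : galois_galg K) x :
  galg_act c (galg_act d x) = galg_act d (galg_act c x).
Proof.
rewrite -!galg_actM; congr (galg_act _ x); apply/ffunP => g.
rewrite -[(c * d) g]/(galg_mul c d g) -[(d * c) g]/(galg_mul d c g) !ffunE.
have cG (s t : [subg 'Gal({:L} / K)]) : (s * t = t * s)%g.
  apply: val_inj => /=; apply: (centsP abL).
    by apply: (subsetP (galS _ (sub1v K))); apply: subgP.
  by apply: (subsetP (galS _ (sub1v K))); apply: subgP.
rewrite (reindex_inj (inj_comp (mulgI g) invg_inj)) /=; apply: eq_bigr => h _.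
rewrite mulrC; congr (d _ * _).
by rewrite invMg invgK mulgA (cG g h) mulgK.
Qed.

(** The coefficient of T in K[G] lies in the associated order because T preserves integers, so alpha
    generates. For uniqueness, let c alpha = 0: K[G] is commutative, so c kills every integer, hence
    L, and linear independence of automorphisms gives c = 0. *)
Lemma free_of_isop alpha : iota alpha \in Aint ->
  (forall y, iota y \in Aint -> exists T, [/\ isop H S T,
     forall x, iota x \in Aint -> T (iota x) \in Aint & T (iota alpha) = iota y]) ->
  ringint_is_free K.
Proof.
move=> ia gen.
have reach y : iota y \in Aint -> exists c : assoc_order K, galg_act (val c) alpha = y.
  move=> iy; have [T [oT TA TE]] := gen y iy; have [c cE] := isop_galg oT.
  have cA : assoc_order_pred c.
    by apply/asboolP => x; rewrite !(algint_Aint iota) cE; apply: TA.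
  exists (Sub c cA : assoc_order K); rewrite SubK.
  by apply: (fmorph_inj iota); rewrite cE.
have inj (c : galois_galg K) : galg_act c alpha = 0 -> c = 0.
  move=> c0; have act0 x : galg_act c x = 0.
    have [d d0 idx] := intL x; have [|e Ee] := reach (d%:R * x).
      by rewrite rmorphM rmorph_nat.
    have : galg_act c (d%:R * x) = 0.
      rewrite -Ee galg_act_comm c0; apply: (addrI (galg_act (val e) 0)).
      by rewrite -galg_actDr !addr0.
    have -> : d%:R * x = x *+ d by rewrite mulr_natl.
    rewrite /galg_act; under eq_bigr => s _ do rewrite rmorphMn /= mulrnAr.
    rewrite sumrMnl -mulr_natl => /eqP; rewrite mulf_eq0 => /orP[|/eqP //].
    have -> : (d%:R : L) = in_alg L d%:R by rewrite rmorph_nat.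
    by rewrite fmorph_eq0 pnatr_eq0 gtn_eqF.
  apply/ffunP => s; rewrite ffunE; apply: val_inj; apply: etrans (_ : 0 = _); last by rewrite /= ?raddf0.
  pose cc (g : gal_of {:L}) : L := if g \in 'Gal({:L} / K)%g then vsval (c (subg _ g)) else 0.
  have : cc (sgval s) = 0.
    apply: (gal_independent (P := mem 'Gal({:L} / K)%g)); last exact: subgP.
    move=> a _; rewrite -[RHS](act0 a) /galg_act [LHS](reindex_onto
      (fun t : [subg 'Gal({:L} / K)] => sgval t) (fun g => subg _ g)) /=; last first.
      by move=> g gK; rewrite subgK.
    apply: eq_big => [t|t _]; first by rewrite subgP sgvalK eqxx.
    by rewrite /cc subgP sgvalK.
  by rewrite /cc subgP sgvalK.
exists 1%N; have ia' : algint_pred alpha by rewrite -[algint_pred _]/(alpha \in @algint_pred L) (algint_Aint iota).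
exists (fun _ => Sub alpha ia' : ringint K) => v.
have iv : iota (val v) \in Aint by rewrite -(algint_Aint iota); apply: (valP v).
have [c cE] := reach _ iv; exists [ffun _ => c]; split.
  by apply: val_inj; rewrite big_ord1 ffunE; apply: esym cE.
move=> c' Ec'; apply/ffunP => i; rewrite ffunE ord1; apply: val_inj; apply/eqP.
rewrite -subr_eq0; apply/eqP/inj; rewrite galg_actDl galg_actNl cE.
have -> : val v = galg_act (val (c' ord0)) alpha by rewrite {1}Ec' big_ord1.
by rewrite subrr.
Qed.

End FreeRank1.

Lemma morph_horner (R : fieldExtType rat) (g : {rmorphism R -> algC}) (q : {poly rat}) x :
  g (map_poly (in_alg R) q).[x] = (pQC q).[g x].
Proof.
rewrite -horner_map -map_poly_comp; congr (_.[_]); apply: eq_map_poly => b.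
exact: (fmorph_eq_rat (g \o in_alg R)).
Qed.

Section AbelianSubfield.
Variables (E : splittingFieldType rat) (iota : {rmorphism E -> algC}) (K : {subfield E}).
Hypothesis abK : forall b, b \in K -> abelianC (iota b).

Let ab_gal (g h : gal_of {:E}) b : b \in K -> g (h b) = h (g b).
Proof.
move=> bK; have [g' g'E] := gal_to_aut iota g; have [h' h'E] := gal_to_aut iota h.
by apply: (fmorph_inj iota); rewrite -g'E -h'E -h'E -g'E (abK bK g' h').
Qed.

(** Automorphisms of E commute on K, so g(K) is fixed by all that fixes K; by the Galois
    correspondence g(K) lies in K, which is therefore normal over Q. *)
Lemma abelian_number_fieldC : abelian_number_field K.
Proof.
have galK : galois K {:E}%AS by rewrite /galois subvf separable_number_field normalFieldf.
have gK (g : gal_of {:E}) b : b \in K -> g b \in K.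
  move=> bK; rewrite -(galois_fixedField galK); apply/fixedFieldP; first exact: memvf.
  by move=> h hG; rewrite ab_gal // (fixed_gal (subvf K) hG bK).
split.
  rewrite /galois sub1v separable_number_field /=; apply/normalFieldP => b bK.
  have /normalFieldP/(_ b (memvf b))[rs _ Ers] := normalFieldf (1%AS : {subfield E}).
  exists rs => //; apply/allP => d drs.
  have rd : root (minPoly 1 b) d by rewrite Ers root_prod_XsubC.
  have [g _ <-] := normalField_root_minPoly (sub1v {:E}%AS) (normalFieldf _) (memvf b) rd.
  exact: gK.
have ext (x : gal_of K) : x \in 'Gal(K / 1)%g -> exists g : gal_of {:E}, {in K, x =1 g}.
  rewrite gal_kHom ?sub1v // => hx.
  have [g _ gE] := kHom_to_gal (K := 1%AS) (E := {:E}%AS) (M := K)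
    (introT andP (conj (sub1v K) (subvf K))) (normalFieldf _) hx.
  by exists g.
apply/centsP => x xG y yG; have [g gE] := ext x xG; have [h hE] := ext y yG.
apply/eqP/gal_eqP => b bK; rewrite !galM //.
by rewrite gE // hE ?gK // hE // gE ?gK // ab_gal.
Qed.

End AbelianSubfield.

Theorem theorem1p4
  (m k : nat) (p r : 'I_k.+1 -> nat)
  (p_prime : forall i, prime (p i)) (p_inj : injective p)
  (p0 : p ord0 = 2%N) (r0 : r ord0 <> 1%N)
  (r_gt0 : forall i, i != ord0 -> (0 < r i)%N)
  (m_factorization : m = (\prod_i p i ^ r i)%N)
  (E : splittingFieldType rat) (iota : {rmorphism E -> algC})
  (K_ : 'I_k.+1 -> {subfield E})
  (K0 : is_cyclotomic_field (2 ^ r ord0) (K_ ord0))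
  (K_i : forall i, i != ord0 ->
     is_cyclotomic_field (p i ^ r i) (K_ i) \/
     is_real_cyclotomic_field iota (p i ^ r i) (K_ i)) :
  Leopoldt (compositum K_).
Proof.
(* [ua.1] is a root of unity and [ua.2] the generator of [K_ i] built from it. *)
have gen i : exists ua : E * E, [/\ (p i ^ r i).-primitive_root ua.1,
    ua.2 = ua.1 \/ i != ord0 /\ ua.2 = ua.1 + ua.1^-1, ua.2 \in K_ i &
    forall h : Aut, h (iota ua.2) = iota ua.2 -> forall b, b \in K_ i -> h (iota b) = iota b].
  have cyc : is_cyclotomic_field (p i ^ r i) (K_ i) -> exists ua : E * E,
      [/\ (p i ^ r i).-primitive_root ua.1,
      ua.2 = ua.1 \/ i != ord0 /\ ua.2 = ua.1 + ua.1^-1, ua.2 \in K_ i &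
      forall h : Aut, h (iota ua.2) = iota ua.2 -> forall b, b \in K_ i -> h (iota b) = iota b].
    move=> [u uN EK]; exists (u, u); split=> //=; first by left.
      by rewrite EK memv_adjoin.
    move=> h hu b bK; have zb : adj (iota u) (iota b); last exact: zb.
    by apply: adj_Fadjoin; move: bK; rewrite EK.
  have [Ei|/eqP i0] : i = ord0 \/ i <> ord0 by case: (i =P ord0); [left | right].
    by apply: cyc; rewrite Ei p0.
  case: (K_i i i0) => [|Kr]; first exact: cyc.
  have N_gt0 : (0 < p i ^ r i)%N by rewrite expn_gt0 prime_gt0.
  have [u uN [uK uh]] := real_generator N_gt0 Kr.
  by exists (u, u + u^-1); split=> //=; right.
have {gen}[ua uaE] := choice gen.
pose u i := (ua i).1; pose a i := (ua i).2; pose K := compositum K_.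
have uP i : (p i ^ r i).-primitive_root (u i) by case: (uaE i).
have aP i : a i = u i \/ i != ord0 /\ a i = u i + (u i)^-1 by case: (uaE i).
have fixK (h : Aut) : (forall i, h (iota (a i)) = iota (a i)) ->
    forall b, b \in K -> h (iota b) = iota b.
  move=> ha; apply: compositum_fix => i b bK; case: (uaE i) => _ _ _; apply => //.
  exact: ha.
have KK i : (K_ i <= K)%VS.
  by apply: subv_trans (sub_agenv _); apply: (sumv_sup i).
have aK i : a i \in K by apply: (subvP (KK i)); case: (uaE i).
have N_gt0 : (0 < \prod_i p i ^ r i)%N by apply: prodn_gt0 => i; rewrite expn_gt0 prime_gt0.
have abK b : b \in K -> abelianC (iota b).
  have [z zn] := C_prim_root_exists N_gt0.
  move=> bK; apply: (abelianC_adj zn) => h hz; apply: fixK bK => i.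
  have [j Ej] : exists j, iota (u i) = z ^+ j.
    have E1 : iota (u i) ^+ (\prod_i p i ^ r i) = 1.
      rewrite -rmorphXn /= (bigD1 i) //= exprM (prim_expr_order (uP i)) expr1n rmorph1 //.
    by have [j ->] := prim_rootP zn E1; exists j.
  have hu : h (iota (u i)) = iota (u i) by rewrite Ej rmorphXn /= hz.
  by case: (aP i) => [->//|[_ ->]]; rewrite !rmorphD !fmorphV /= hu.
split; first exact: abelian_number_fieldC abK.
move=> L f [_ abL]; have [iotaL _] := number_field_embedding L.
pose phi := iotaL \o f.
pose c0 := separable_generator 1 K.
have genK : K = <<1; c0>>%VS :> {vspace E}.
  by rewrite [LHS](eq_adjoin_separable_generator (separable_number_field 1 K) (sub1v K)).
have c0K : c0 \in K.
  by apply: (subvP (_ : (<<1; c0>> <= K)%VS)); [rewrite -genK subvv | apply: memv_adjoin].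
pose c : subvs_of K := vsproj K c0.
have vc : vsval c = c0 by rewrite vsprojK.
have rootE (q : {poly rat}) : root (pQC q) (iota c0) -> root (pQC q) (phi c).
  have inj1 (x : subvs_of K) : root (map_poly (in_alg (subvs_of K)) q) x = root (pQC q) (iota (vsval x)).
    rewrite -(fmorph_root (iota \o vsval)) -map_poly_comp; congr (root _ _).
    by apply: eq_map_poly => b; apply: (fmorph_eq_rat ((iota \o vsval) \o in_alg (subvs_of K))).
  have inj2 (x : subvs_of K) : root (map_poly (in_alg (subvs_of K)) q) x = root (pQC q) (phi x).
    rewrite -(fmorph_root phi) -map_poly_comp; congr (root _ _).
    by apply: eq_map_poly => b; apply: (fmorph_eq_rat (phi \o in_alg (subvs_of K))).
  by rewrite -{1}vc -inj1 inj2.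
(* K lies in E and, through f, in L; its two embeddings in [algC] are conjugate, and [h0] transports
   the generators from the first to the second. *)
have [h0 h0c] := conjugate_aut rootE.
have h0E (x : subvs_of K) : phi x = h0 (iota (vsval x)).
  have /Fadjoin1_polyP[q Eq] : vsval x \in <<1; c0>>%VS by rewrite -genK subvsP.
  have Ex : x = (map_poly (in_alg (subvs_of K)) q).[c].
    have E2 : vsval (map_poly (in_alg (subvs_of K)) q).[c] =
        (map_poly vsval (map_poly (in_alg (subvs_of K)) q)).[vsval c] by rewrite horner_map.
    apply: val_inj; apply: etrans Eq _; apply: esym; apply: etrans E2 _.
    rewrite vc -map_poly_comp; congr (_.[_]).
    apply: eq_map_poly => b; apply: (fmorph_inj iota).
    apply: etrans (fmorph_eq_rat (iota \o (vsval \o in_alg (subvs_of K))) b) (esym _).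
    exact: (fmorph_eq_rat (iota \o in_alg E)).
  have S1 : phi x = (map_poly phi (map_poly (in_alg (subvs_of K)) q)).[phi c].
    by rewrite {1}Ex horner_map.
  have S2 : h0 (iota (vsval x)) =
      (map_poly (h0 \o iota) (map_poly (in_alg E) q)).[h0 (iota c0)].
    by rewrite Eq; apply: esym; apply: (horner_map (h0 \o iota)).
  apply: etrans S1 (esym (etrans S2 _)); rewrite h0c -!map_poly_comp.
  apply: (congr1 (fun r : {poly algC} => r.[phi c])); apply: eq_map_poly => b; apply: esym.
  apply: etrans (fmorph_eq_rat (phi \o in_alg (subvs_of K)) b) (esym _).
  exact: (fmorph_eq_rat (h0 \o (iota \o in_alg E))).
pose zeta i := h0 (iota (u i)); pose w i := h0 (iota (a i)).
have zetaE i : (p i ^ r i).-primitive_root (zeta i) by rewrite !fmorph_primitive_root.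
have wE i : w i = zeta i \/ i != ord0 /\ w i = zeta i + (zeta i)^-1.
  by rewrite /w /zeta; case: (aP i) => [->|[i0 ->]]; [left | right; rewrite !rmorphD !fmorphV].
pose aL i := f (vsproj K (a i)).
have aLE i : iotaL (aL i) = w i by rewrite -[LHS]/(phi _) h0E vsprojK.
have wL i : exists x, iotaL x = w i by exists (aL i).
have [alpha ia gen] := cyclotomic_op_cyclic p_prime p_inj p0 r0 r_gt0 zetaE wE wL abL.
apply: (free_of_isop _ _ abL _ ia gen).
(* Conjugation by h0 turns h into an automorphism that fixes the generators of K as embedded through
   E. *)
- move=> h hw b /memv_imgP[x _ ->]; rewrite -[iotaL _]/(phi x) h0E.
  have [h1 [h1K Kh1]] := aut_inv h0.
  apply: (fmorph_inj h1); rewrite h1K; apply: (fixK (h1 \o (h \o h0))); last exact: subvsP.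
  by move=> i /=; rewrite -/(w i) hw h1K.
- move=> _ [i [q ->]]; exists (f (map_poly (in_alg (subvs_of K)) q).[vsproj K (a i)]).
    exact: memv_img (memvf _).
  by rewrite -aLE; apply: esym (morph_horner (iotaL \o f) q _).
move=> x; have [N NP NL] := abelian_field_cyclotomic iotaL abL.
have [z zn] := C_prim_root_exists NP; have [d d0 zd] := adj_Zadj (NL z zn x).
by exists d => //; apply: Zadj_Aint zn zd.
Qed.
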